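(* Let $\tilde M^{n+1}$, $n\geq2$, be an oriented Riemannian manifold of nonnegative Ricci curvature, let $\xi$ and $\eta$ be respectively a parallel vector field and a homothetic nonparallel vector field on $\tilde M$, and let $x:M^n\to\tilde M^{n+1}$ be a connected, complete, oriented hypersurface transversal to $\xi$ at every point, with unit normal vector field $N$, second fundamental form $A$ and mean curvature $H$ with respect to $N$. If $|A|$ is bounded on $M$, $|\xi^\top|$ is integrable on $M$ and $H$ does not change sign on $M$, then: (a) $M$ is totally geodesic and the Ricci curvature of $\tilde M$ in the direction of $N$ vanishes identically. (b) If $M$ is noncompact and $\mathrm{Ric}_M$ is also nonnegative, then $x(M)$ is contained in a leaf of $\xi^\bot$.
   Context: Let $\tilde\nabla$ be the Levi-Civita connection of $\tilde M$. A smooth vector field $\xi$ is closed conformal with conformal factor the smooth function $\psi_\xi$ if $\tilde\nabla_X\xi=\psi_\xi X$ for all vector fields $X$. ''Homothetic'' means closed conformal with $\psi_\xi$ constant; ''parallel'' means closed conformal with $\psi_\xi\equiv0$. $\xi^\bot$ is the distribution of vectors orthogonal to $\xi$ (where $\xi\neq0$); it is integrable, and its leaves are its maximal connected integral hypersurfaces. $M$ carries the metric induced by the immersion $x$; $\xi^\top$ is the orthogonal projection of $\xi$ onto the tangent spaces of $M$; integrable means in $\mathcal L^1(M)$ for the Riemannian volume measure. $A X=-\tilde\nabla_XN$ and $nH=\mathrm{tr}\,A$. ''$H$ does not change sign'' means $H\geq0$ on $M$ or $H\leq0$ on $M$. *)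

(* Defs.v *)
(* Smooth manifolds and Riemannian geometry over [R : realType].

   Tangent spaces: every point [p] of a manifold has a preferred chart
   [chart_at p], and T_pM is ['rV[R]_n], a row vector being read as the
   coordinates of a tangent vector in the coordinate basis of [chart_at p].
   Vector fields, metrics, etc. are thus plain functions on the manifold, and
   smoothness is always tested after transport to an arbitrary fixed chart
   of the atlas ([tcoord], [gram]).  *)
From HB Require Import structures.
From mathcomp Require Import all_boot all_order all_algebra.
From mathcomp Require Import all_classical all_reals all_analysis.
Set Implicit Arguments.
Unset Strict Implicit.
Unset Printing Implicit Defensive.
Import Order.TTheory GRing.Theory Num.Theory.
Import numFieldNormedType.Exports.
Local Open Scope classical_set_scope.
Local Open Scope ring_scope.

Section Smooth.
Context {R : realType} {V W : normedModType R}.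

(* Used with [U] open and [V] finite-dimensional, where existence and
   continuity of all iterated directional derivatives is being C^k. *)
Fixpoint Ck (k : nat) (U : set V) (f : V -> W) : Prop :=
  (forall y, U y -> {for y, continuous f}) /\
  if k is k'.+1 then
    (forall y v, U y -> derivable f y v) /\ (forall v, Ck k' U ('D_v f))
  else True.

Definition Cinfty (U : set V) (f : V -> W) := forall k, Ck k U f.

End Smooth.

Record chart (R : realType) (n : nat) (T : topologicalType) := Chart {
  chart_dom : set T;
  chart_map :> T -> 'rV[R]_n;
  chart_inv : 'rV[R]_n -> T;
  chart_dom_open : open chart_dom;
  chart_img_open : open (chart_map @` chart_dom);
  chartK : forall p, chart_dom p -> chart_inv (chart_map p) = p;
  chart_continuous : forall p, chart_dom p -> {for p, continuous chart_map};
  chart_inv_continuous : forall p, chart_dom p ->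
    {for chart_map p, continuous chart_inv} }.

(* The atlas need not be maximal.  Carriers are nonempty (pointed) because the
   library's measurable spaces are. *)
Record manifold (R : realType) (n : nat) := Manifold {
  carrier :> ptopologicalType;
  manifold_hausdorff : hausdorff_space carrier;
  manifold_second_countable : @second_countable carrier;
  atlas : set (chart R n carrier);
  chart_at : carrier -> chart R n carrier;
  chart_at_atlas : forall p, atlas (chart_at p);
  chart_at_dom : forall p, chart_dom (chart_at p) p;
  atlas_compatible : forall c c', atlas c -> atlas c' ->
    Cinfty (c @` (chart_dom c `&` chart_dom c')) (c' \o chart_inv c) }.

Section Maps.
Context {R : realType} {n m : nat} {M : manifold R n} {N : manifold R m}.

Definition smooth_map (F : M -> N) :=
  continuous F /\
  forall c d, atlas c -> atlas d ->
    Cinfty (c @` (chart_dom c `&` F @^-1` chart_dom d)) (d \o F \o chart_inv c).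

(* The differential T_pM -> T_{F p}N; its matrix acts on row vectors from the
   right. *)
Definition dmx (F : M -> N) (p : M) : 'M[R]_(n, m) :=
  'J (chart_at (F p) \o F \o chart_inv (chart_at p)) (chart_at p p).

Definition dmap (F : M -> N) (p : M) (v : 'rV[R]_n) : 'rV[R]_m := v *m dmx F p.

Definition immersion (F : M -> N) :=
  smooth_map F /\ forall p, injective (dmap F p).

End Maps.

Section Fields.
Context {R : realType} {m : nat} {N : manifold R m}.

(* The components of [v] in T_qN with respect to the chart [c] around [q]. *)
Definition tcoord (c : chart R m N) (q : N) (v : 'rV[R]_m) : 'rV[R]_m :=
  'd (c \o chart_inv (chart_at q)) (chart_at q q) v.

(* Locally constant sign: [o] tells whether the coordinate basis of [chart_at p]
   is negatively oriented. *)
Definition orientation (o : N -> bool) :=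
  forall c, atlas c -> forall p, chart_dom c p -> \forall q \near p,
    0 < ((-1) ^+ o p * \det (lin1_mx (tcoord c p))) *
        ((-1) ^+ o q * \det (lin1_mx (tcoord c q))).

(* A vector field along [F : M -> N] is [V] with [V p] in T_{F p}N; vector
   fields on [N] are the case [F := idfun]. *)
Definition smooth_along {n : nat} {M : manifold R n} (F : M -> N)
    (V : M -> 'rV[R]_m) :=
  forall c d, atlas c -> atlas d ->
    Cinfty (c @` (chart_dom c `&` F @^-1` chart_dom d))
      (fun y => tcoord d (F (chart_inv c y)) (V (chart_inv c y))).

Definition smooth_field (X : N -> 'rV[R]_m) := smooth_along idfun X.

(* [V] read in the preferred charts at [p] and [F p]. *)
Definition local_rep {n : nat} {M : manifold R n} (F : M -> N)
    (V : M -> 'rV[R]_m) (p : M) (y : 'rV[R]_n) : 'rV[R]_m :=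
  let q := chart_inv (chart_at p) y in tcoord (chart_at (F p)) (F q) (V q).

Definition lie_bracket (X Y : N -> 'rV[R]_m) (p : N) : 'rV[R]_m :=
  'd (local_rep idfun Y p) (chart_at p p) (X p)
  - 'd (local_rep idfun X p) (chart_at p p) (Y p).

(* The field with constant components [v] in [chart_at p], near [p]. *)
Definition coord_field (p : N) (v : 'rV[R]_m) (q : N) : 'rV[R]_m :=
  'd (chart_at q \o chart_inv (chart_at p)) (chart_at p q) v.

End Fields.

Section Riemannian.
Context {R : realType} {m : nat} {N : manifold R m}.
Variable g : N -> 'M[R]_m.

Definition inner (p : N) (u v : 'rV[R]_m) : R := (u *m g p *m v^T) ord0 ord0.

Definition riem_norm (p : N) (v : 'rV[R]_m) : R := Num.sqrt (inner p v v).

(* The matrix (g_ij) of the metric in the coordinates of [c], as a function of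
   these coordinates. *)
Definition gram (c : chart R m N) (y : 'rV[R]_m) : 'M[R]_m :=
  let q := chart_inv c y in
  let B := 'J (chart_at q \o chart_inv c) y in B *m g q *m B^T.

Definition riemannian_metric :=
  [/\ forall p, (g p)^T = g p,
      forall p v, v != 0 -> 0 < inner p v v
    & forall c i j, atlas c ->
        Cinfty (c @` chart_dom c) (fun y => gram c y i j)].

(* Gamma(u, v) = u^i v^j Gamma_ij^k e_k, with
   Gamma_ij^k = g^kl (d_i g_jl + d_j g_il - d_l g_ij) / 2. *)
Definition christoffel (c : chart R m N) (y u v : 'rV[R]_m) : 'rV[R]_m :=
  let G (a b : 'rV[R]_m) z : R := (a *m gram c z *m b^T) ord0 ord0 in
  (\row_l (2^-1 * ('d (G v (delta_mx 0 l)) y u + 'd (G u (delta_mx 0 l)) y v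
                   - 'd (G u v) y (delta_mx 0 l))))
  *m invmx (gram c y).

(* The Levi-Civita connection of [N] pulled back by [F]: the covariant
   derivative, in the direction [v] of T_pM, of the field [V] along [F]. *)
Definition cov_along {n : nat} {M : manifold R n} (F : M -> N)
    (V : M -> 'rV[R]_m) (p : M) (v : 'rV[R]_n) : 'rV[R]_m :=
  'd (local_rep F V p) (chart_at p p) v
  + christoffel (chart_at (F p)) (chart_at (F p) (F p)) (dmap F p v) (V p).

Definition levi_civita (X Y : N -> 'rV[R]_m) (p : N) : 'rV[R]_m :=
  cov_along idfun Y p (X p).

Definition curvature (X Y Z : N -> 'rV[R]_m) (p : N) : 'rV[R]_m :=
  levi_civita X (levi_civita Y Z) p - levi_civita Y (levi_civita X Z) p
  - levi_civita (lie_bracket X Y) Z p.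

(* Ric(v, w) is the trace of u |-> R(u, v)w. *)
Definition ricci (p : N) (v w : 'rV[R]_m) : R :=
  \tr (lin1_mx (fun u =>
    curvature (coord_field p u) (coord_field p v) (coord_field p w) p)).

Definition ricci_nonneg := forall p v, 0 <= ricci p v v.

Definition closed_conformal (X : N -> 'rV[R]_m) (psi : N -> R) :=
  [/\ smooth_field X,
      forall c, atlas c -> Cinfty (c @` chart_dom c) (psi \o chart_inv c)
    & forall Y, smooth_field Y -> forall p, levi_civita Y X p = psi p *: Y p].

Definition homothetic (X : N -> 'rV[R]_m) :=
  exists a : R, closed_conformal X (fun=> a).

Definition parallel (X : N -> 'rV[R]_m) := closed_conformal X (fun=> 0).

Definition smooth_curve (c : R -> N) :=
  continuous c /\
  forall d, atlas d -> Cinfty (c @^-1` chart_dom d) (d \o c : R -> 'rV[R]_m).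

Definition curve_length (c : R -> N) : \bar R :=
  (\int[@lebesgue_measure R]_(t in `[0%R, 1%R])
     (riem_norm (c t) (derive1 (chart_at (c t) \o c : R -> 'rV[R]_m) t))%:E)%E.

(* [l] is the length of some piecewise smooth curve from [p] to [q]. *)
Inductive joined : N -> N -> \bar R -> Prop :=
| joined_refl p : joined p p 0%E
| joined_cons c q l : smooth_curve c -> joined (c 1) q l ->
    joined (c 0) q (curve_length c + l)%E.

Definition rdist (p q : N) : \bar R := ereal_inf [set l | joined p q l].

Definition complete_metric :=
  forall u : nat -> N,
    (forall e : R, 0 < e -> exists K : nat, forall i j : nat,
       (K <= i)%N -> (K <= j)%N -> (rdist (u i) (u j) < e%:E)%E) ->
    exists p : N, u @ \oo --> p.

End Riemannian.

(* Integration on R^k of nonnegative Borel functions, as an iterated integral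
   (the library has no Lebesgue measure on ['rV[R]_k]). *)
Fixpoint lebesgue_int {R : realType} (k : nat) :
    ('rV[R]_k -> \bar R) -> \bar R :=
  match k return ('rV[R]_k -> \bar R) -> \bar R with
  | 0 => fun f => f 0
  | k'.+1 => fun f => (\int[@lebesgue_measure R]_t
      lebesgue_int (fun y : 'rV[R]_k' => f (row_mx (t%:M : 'rV[R]_1) y)))%E
  end.

Definition borel (T : ptopologicalType) := g_sigma_algebraType (@open T).

(* These equations determine [mu], since countably many charts cover [M]. *)
Definition riemannian_volume {R : realType} {n : nat} {M : manifold R n}
    (g : M -> 'M[R]_n) (mu : {measure set (borel M) -> \bar R}) :=
  forall c (B : set (borel M)), atlas c -> measurable B -> B `<=` chart_dom c ->
    mu B = lebesgue_int (fun y =>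
      (\1_(c @` B) y * Num.sqrt (\det (gram g c y)))%:E).

Section Hypersurface.
Context {R : realType} {n : nat} {Mt : manifold R n.+1} {M : manifold R n}.
Variables (g : Mt -> 'M[R]_n.+1) (x : M -> Mt).

Definition induced_metric (p : M) : 'M[R]_n :=
  dmx x p *m g (x p) *m (dmx x p)^T.

(* The vector t of T_pM such that dx(t) is the orthogonal projection of [w] onto
   dx(T_pM): <dx t, dx u> = <w, dx u> for all u. *)
Definition tangent_part (p : M) (w : 'rV[R]_n.+1) : 'rV[R]_n :=
  w *m g (x p) *m (dmx x p)^T *m invmx (induced_metric p).

Definition transversal_to (xi : Mt -> 'rV[R]_n.+1) :=
  forall p v, dmap x p v != xi (x p).

Variable N : M -> 'rV[R]_n.+1.

Definition unit_normal :=
  [/\ smooth_along x N,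
      forall p, inner g (x p) (N p) (N p) = 1
    & forall p v, inner g (x p) (N p) (dmap x p v) = 0].

Definition shape_operator (p : M) (v : 'rV[R]_n) : 'rV[R]_n :=
  tangent_part p (- cov_along g x N p v).

(* |A|^2 = tr(A A^* ), the adjoint being taken with respect to the induced
   metric. *)
Definition shape_norm (p : M) : R :=
  let S := lin1_mx (shape_operator p) in
  Num.sqrt (\tr (S *m induced_metric p *m S^T *m invmx (induced_metric p))).

Definition mean_curvature (p : M) : R :=
  \tr (lin1_mx (shape_operator p)) / n%:R.

Definition totally_geodesic := forall p v, shape_operator p v = 0.

End Hypersurface.

Section Leaves.
Context {R : realType} {n : nat} {Mt : manifold R n.+1}.
Variables (g : Mt -> 'M[R]_n.+1) (xi : Mt -> 'rV[R]_n.+1).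

Definition integral_hypersurface (S : set Mt) :=
  exists (L : manifold R n) (i : L -> Mt),
    [/\ connected [set: L], immersion i, injective i, range i = S
      & forall p, xi (i p) != 0 /\
          forall v, inner g (i p) (xi (i p)) (dmap i p v) = 0].

Definition leaf_orth (S : set Mt) :=
  integral_hypersurface S /\
  forall S', integral_hypersurface S' -> S `<=` S' -> S' = S.

End Leaves.

(* Main.v *)
(* Let xi^T be the tangential part of xi along M, and f = <xi, N>, which has no
   zero and hence a constant sign, as M is connected and transversal to xi.
   Since xi is parallel, div xi^T = n f H, and the Codazzi equation gives
   div (A xi^T) = f (|A|^2 + Ric(N, N)) when H = 0.  On a complete manifold an
   integrable field whose divergence has a sign is divergence free: integrate
   against Lipschitz cutoffs of the distance, compactly supported because
   bounded balls are relatively compact (Hopf-Rinow).  This gives H = 0, then,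
   |A| being bounded, A = 0 and Ric(N, N) = 0.

   If A = 0, then |xi^T| is constant.  Were it nonzero, M would have finite
   volume, so that the field eta^T / (1 + |eta^T|^2), of norm at most 1/2, would
   be integrable.  With psi the nonzero constant conformal factor of eta, its
   divergence is psi (n + (n - 2) |eta^T|^2) / (1 + |eta^T|^2)^2, which would
   have to vanish.  Hence xi^T = 0, that is, x is tangent to the orthogonal of
   xi.  Integral hypersurfaces are locally unique, so x(M), with the quotient
   topology of M, is an injectively immersed one.  It is maximal because M is
   complete: a segment of a larger one lifts to M at the same speed. *)
From mathcomp Require Import finmap.
From HB Require Import structures.
Require Import Defs.
From mathcomp Require Import all_boot all_order all_algebra.
From mathcomp Require Import all_classical all_reals all_analysis.
From mathcomp Require Import perm measurable_realfun ring lra.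
Set Implicit Arguments.
Unset Strict Implicit.
Unset Printing Implicit Defensive.
Import Order.TTheory GRing.Theory Num.Theory.
Import numFieldNormedType.Exports.
Local Open Scope classical_set_scope.
Local Open Scope ring_scope.

(** * Smooth functions and symmetry of second derivatives *)

(** The tensor calculus is done once in coordinates, for a matrix-valued metric [G] and a map [z]
    into its domain ([chr], [nabla], [Rm]). It reaches manifolds because [cov_along] has the same
    expression in every pair of charts. Codazzi is then the exchange of two covariant derivatives of
    the normal; its curvature term reduces to Ric(N, N) because the curvature vanishes on a parallel
    field.

    What shapes the integration is that the cutoffs are only Lipschitz, for a distance defined as an
    infimum of lengths, so that their gradient cannot appear. In a chart the divergence is a limit
    of difference quotients, which translation invariance moves onto the cutoff. Local pieces are
    peeled off as [b *: X] with [0 <= b <= 1]. The norms of [b *: X] and of the remainder add up to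
    that of [X], so the final estimate is a fixed constant times the slope of the cutoff times the
    integral of the norm, whatever the number of pieces. Charts enter through boxes on which the
    metric is within a fixed factor of a Euclidean one, which makes the constant uniform.

    In (b) the leaf is built on the image of [x] itself, as a quotient manifold. *)

Lemma near_openP (T : topologicalType) (y : T) (P : set T) :
  (\forall z \near y, P z) -> exists A, [/\ open A, A y & A `<=` P].
Proof. by move=> h; have : nbhs y P by []; rewrite nbhsE => -[A [? ?] ?]; exists A. Qed.

Lemma near_forall (T : topologicalType) (I : finType) (x : T) (P : I -> set T) :
  (forall i, \forall z \near x, P i z) -> \forall z \near x, forall i, P i z.
Proof. by move=> h; exact: (@filter_forall T I P (nbhs x) _). Qed.

Section CkBasics.
Context {R : realType} {V W : normedModType R}.
Implicit Types (U : set V) (f g : V -> W).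

Lemma Ck_continuous k U f y : Ck k U f -> U y -> {for y, continuous f}.
Proof. by case: k => [|k] [+ _]; apply. Qed.

Lemma Ck_derivable k U f y v : Ck k.+1 U f -> U y -> derivable f y v.
Proof. by move=> [_ [+ _]] Uy; exact. Qed.

Lemma CkSP k U f : Ck k.+1 U f <->
  [/\ forall y, U y -> {for y, continuous f},
      forall y v, U y -> derivable f y v & forall v, Ck k U ('D_v f)].
Proof. by split=> [[? [? ?]]|[]]. Qed.

Lemma Ck_derive k U f v : Ck k.+1 U f -> Ck k U ('D_v f).
Proof. by move=> /CkSP[_ _]. Qed.

Lemma CkW k U f : Ck k.+1 U f -> Ck k U f.
Proof.
elim: k f => [|k IH] f /CkSP[cf df Df]; first by split.
by apply/CkSP; split => // v; exact/IH.
Qed.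

Lemma sub_Ck k U U' f : U' `<=` U -> Ck k U f -> Ck k U' f.
Proof.
move=> UU'; elim: k f => [|k IH] f.
  by move=> [cf _]; split => // y /UU'; exact: cf.
move=> /CkSP[cf df Df]; apply/CkSP; split=> [y /UU'|y v /UU'|v].
- exact: cf.
- exact: df.
- exact: IH.
Qed.

Lemma eq_Ck k U f g : open U -> (forall y, U y -> f y = g y) ->
  Ck k U f -> Ck k U g.
Proof.
move=> oU.
have nfg f1 g1 y : (forall y, U y -> f1 y = g1 y) -> U y ->
    \forall z \near y, f1 z = g1 z.
  by move=> fg Uy; near=> z; apply: fg; near: z; exact: open_nbhs_nbhs.
have ceq f1 g1 y : (forall y, U y -> f1 y = g1 y) -> U y ->
    {for y, continuous f1} -> {for y, continuous g1}.
  move=> fg Uy cf; rewrite /prop_for /continuous_at -(fg _ Uy).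
  by apply: cvg_trans cf; apply: near_eq_cvg; apply: filterS (nfg _ _ _ fg Uy).
elim: k f g => [|k IH] f g fg.
  by move=> [cf _]; split=> // y Uy; apply: ceq (cf y Uy).
move=> /CkSP[cf df Df]; apply/CkSP; split=> [y Uy|y v Uy|v].
- exact: ceq (cf y Uy).
- exact: (near_eq_derivable (nfg _ _ y fg Uy) (df y v Uy)).
- by apply: IH (Df v) => y Uy; apply: near_eq_derive; exact: nfg.
Unshelve. all: by end_near. Qed.

Lemma Ck_local k U f :
  (forall y, U y -> exists2 U', open_nbhs y U' & Ck k U' f) -> Ck k U f.
Proof.
elim: k f => [|k IH] f loc.
  by split => // y /loc[U' [oU' U'y] /Ck_continuous]; exact.
apply/CkSP; split; first by move=> y /loc[U' [oU' U'y] /Ck_continuous]; exact.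
  by move=> y v /loc[U' [oU' U'y] /Ck_derivable]; exact.
by move=> v; apply: IH => y /loc[U' oU' /Ck_derive]; exists U'.
Qed.

Lemma Ck_cst k U (a : W) : Ck k U (fun=> a).
Proof.
elim: k a => [|k IH] a.
  by split => // y _; exact: cst_continuous.
apply/CkSP; split=> [y _|y v _|v].
- exact: cst_continuous.
- exact: derivable_cst.
- by rewrite (_ : 'D_v _ = fun=> 0)//; apply/funext => y; rewrite derive_cst.
Qed.

Lemma CkD k U f g : open U -> Ck k U f -> Ck k U g ->
  Ck k U (fun y => f y + g y).
Proof.
move=> oU; elim: k f g => [|k IH] f g.
  by move=> [cf _] [cg _]; split => // y Uy; apply: cvgD; [exact: cf|exact: cg].
move=> /CkSP[cf df Df] /CkSP[cg dg Dg]; apply/CkSP.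
split=> [y Uy|y v Uy|v]; first by apply: cvgD; [exact: cf|exact: cg].
  by apply: derivableD; [exact: df|exact: dg].
apply: (eq_Ck (f := fun y => 'D_v f y + 'D_v g y)) => //; last exact: IH.
by move=> y Uy; rewrite (deriveD (f:=f) (g:=g))//; [exact: df|exact: dg].
Qed.

Lemma CkN k U f : open U -> Ck k U f -> Ck k U (fun y => - f y).
Proof.
move=> oU; elim: k f => [|k IH] f.
  by move=> [cf _]; split => // y Uy; apply: cvgN; exact: cf.
move=> /CkSP[cf df Df]; apply/CkSP.
split=> [y Uy|y v Uy|v]; first by apply: cvgN; exact: cf.
  by apply: derivableN; exact: df.
apply: (eq_Ck (f := fun y => - 'D_v f y)) => //; last exact: IH.
by move=> y Uy; rewrite (deriveN (f:=f))//; exact: df.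
Qed.

End CkBasics.

(** One neighbourhood serves all orders of differentiability. Working with germs spares later
    statements an open set to carry along; [CinftyP] converts back. *)
Definition smooth_near {R : realType} {V W : normedModType R} (f : V -> W) (y : V) :=
  exists2 U, open_nbhs y U & Cinfty U f.

Section SmoothNear.
Context {R : realType} {V W : normedModType R}.
Implicit Types (U : set V) (f g : V -> W).

Lemma Cinfty_near U f y : open U -> U y -> Cinfty U f -> smooth_near f y.
Proof. by move=> oU Uy Cf; exists U. Qed.

Lemma CinftyP U f : open U ->
  Cinfty U f <-> (forall y, U y -> smooth_near f y).
Proof.
move=> oU; split=> [Cf y Uy|sf k]; first exact: (Cinfty_near oU).
apply: Ck_local => y /sf[U' oU' Cf]; exists U' => //; exact: Cf.
Qed.

Lemma near_smooth f y : smooth_near f y -> \forall z \near y, smooth_near f z.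
Proof.
move=> [U [oU Uy] Cf]; near=> z; apply: (Cinfty_near oU) => //.
by near: z; exact: open_nbhs_nbhs.
Unshelve. all: by end_near. Qed.

Lemma smooth_continuous f y : smooth_near f y -> {for y, continuous f}.
Proof. by move=> [U [oU Uy] /(_ 0)/Ck_continuous]; exact. Qed.

Lemma smooth_derivable f y v : smooth_near f y -> derivable f y v.
Proof. by move=> [U [oU Uy] /(_ 1)/Ck_derivable]; exact. Qed.

Lemma smooth_derive f y v : smooth_near f y -> smooth_near ('D_v f) y.
Proof. by move=> [U oU Cf]; exists U => // k; have /Ck_derive := Cf k.+1. Qed.

Lemma eq_smooth f g y : (\forall z \near y, f z = g z) ->
  smooth_near f y -> smooth_near g y.
Proof.
move=> /near_openP[A [oA Ay fg]] [U [oU Uy] Cf].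
exists (U `&` A); first by split; [exact: openI|].
move=> k; apply: (eq_Ck (f := f)); first exact: openI.
  by move=> z [_ /fg].
by apply: sub_Ck (Cf k) => z [].
Qed.

Lemma smooth_ext f g y : (forall z, f z = g z) ->
  smooth_near f y -> smooth_near g y.
Proof. by move=> /funext ->. Qed.

Lemma smooth_cst (a : W) (y : V) : smooth_near (fun=> a) y.
Proof. by exists setT => [|k]; [split => //; exact: openT|exact: Ck_cst]. Qed.

Lemma smoothD f g y : smooth_near f y -> smooth_near g y ->
  smooth_near (fun y => f y + g y) y.
Proof.
move=> [U [oU Uy] Cf] [U' [oU' U'y] Cg]; exists (U `&` U').
  by split; [exact: openI|].
by move=> k; apply: CkD; [exact: openI|exact: sub_Ck (Cf k)|exact: sub_Ck (Cg k)].
Qed.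

Lemma smoothN f y : smooth_near f y -> smooth_near (fun y => - f y) y.
Proof.
move=> [U [oU Uy] Cf]; exists U; first by split.
by move=> k; apply: CkN => //; exact: Cf.
Qed.

Lemma smoothB f g y : smooth_near f y -> smooth_near g y ->
  smooth_near (fun y => f y - g y) y.
Proof. by move=> sf sg; apply: smoothD => //; exact: smoothN. Qed.

Lemma smooth_sum (I : Type) (r : seq I) (P : pred I) (F : I -> V -> W) y :
  (forall i, P i -> smooth_near (F i) y) ->
  smooth_near (fun y => \sum_(i <- r | P i) F i y) y.
Proof.
move=> sF; elim: r => [|i r IH].
  by apply: smooth_ext (smooth_cst _ y) => z; rewrite big_nil.
case Pi: (P i).
  by apply: smooth_ext (smoothD (sF i Pi) IH) => z; rewrite big_cons Pi.
by apply: smooth_ext IH => z; rewrite big_cons Pi.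
Qed.

Lemma smooth_lin (f : {linear V -> W}) y : continuous f -> smooth_near f y.
Proof.
move=> cf; exists setT; first by split => //; exact: openT.
case=> [|k]; first by split => // ? _; exact: cf.
have df z : differentiable f z by exact: linear_differentiable.
apply/CkSP; split=> [? _|z v _|v]; [exact: cf|exact: diff_derivable|].
rewrite (_ : 'D_v f = fun=> f v); first exact: Ck_cst.
by apply/funext => z; rewrite deriveE// diff_lin.
Qed.

End SmoothNear.

Section SmoothScalar.
Context {R : realType} {V : normedModType R}.
Implicit Types (U : set V) (f g : V -> R).

Lemma CkM k U f g : open U -> Ck k U f -> Ck k U g ->
  Ck k U (fun y => f y * g y).
Proof.
move=> oU; elim: k f g => [|k IH] f g.
  by move=> [cf _] [cg _]; split => // y Uy; apply: cvgM; [exact: cf|exact: cg].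
move=> Cf Cg; have Cf' := CkW Cf; have Cg' := CkW Cg.
move: Cf Cg => /CkSP[cf df Df] /CkSP[cg dg Dg]; apply/CkSP.
split=> [y Uy|y v Uy|v]; first by apply: cvgM; [exact: cf|exact: cg].
  by apply: derivableM; [exact: df|exact: dg].
apply: (eq_Ck (f := fun y => f y * 'D_v g y + g y * 'D_v f y)) => //.
  by move=> y Uy; rewrite (deriveM (f:=f) (g:=g))//; [exact: df|exact: dg].
by apply: CkD => //; exact: IH.
Qed.

Lemma derive_ext (W : normedModType R) (f g : V -> W) (y v : V) :
  (forall z, f z = g z) -> 'D_v f y = 'D_v g y.
Proof. by move=> /funext ->. Qed.

Lemma derivable_ext (W : normedModType R) (f g : V -> W) (y v : V) :
  (forall z, f z = g z) -> derivable f y v -> derivable g y v.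
Proof. by move=> /funext ->. Qed.

Lemma is_derive_ext (W : normedModType R) (f g : V -> W) (y v : V) (d : W) :
  (forall z, f z = g z) -> is_derive y v f d -> is_derive y v g d.
Proof. by move=> /funext ->. Qed.

Lemma is_derive_lineP (W : normedModType R) (f : V -> W) (y v : V) (df : W) :
  is_derive y v f df <-> is_derive (0 : R) 1 (fun t : R => f (t *: v + y)) df.
Proof.
have E : 'D_v f y = 'D_1 (fun t : R => f (t *: v + y)) 0.
  rewrite /derive; set d := fun h => h^-1 *: _; set d' := fun h => h^-1 *: _.
  suff -> : d = d' by []; rewrite funeqE => t; rewrite /d /d'/=.
  by rewrite addr0 scale0r add0r (_ : t%:A = t)//; exact: mulr1.
split=> -[dv <-]; apply: DeriveDef; [exact: (derivable1P f y v).1|exact/esym/E|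
  exact: (derivable1P f y v).2|exact: E].
Qed.

(** The outer function comes with its whole tower of derivatives, [h i] differentiating into
    [h i.+1] on [A]. The chain rule sends [h j] to [h j.+1], so the induction on [k] runs over all
    [j] at once. The inverse, the square root and the flat function are the instances. *)
Lemma Ck_compR k U (A : set R) (h : nat -> R -> R) j f : open U ->
  (forall y, U y -> A (f y)) ->
  (forall i t, A t -> is_derive t 1 (h i) (h i.+1 t)) ->
  Ck k U f -> Ck k U (fun y => h j (f y)).
Proof.
move=> oU UA hd; elim: k j f UA => [|k IH] j f UA Cf.
  split => // y Uy; apply: (@continuous_comp _ _ _ f (h j)).
    exact: (Ck_continuous Cf).
  by apply/differentiable_continuous/derivable1_diffP; apply: ex_derive; exact/hd/UA.
have Cf' := CkW Cf; move: Cf => /CkSP[cf df Df].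
have chain y v : U y -> is_derive y v (h j \o f) (h j.+1 (f y) * 'D_v f y).
  move=> Uy; apply/is_derive_lineP.
  apply: (is_derive1_comp (g := fun t : R => f (t *: v + y))).
    by rewrite scale0r add0r; exact/hd/UA.
  by apply/is_derive_lineP; exact/derivableP/df.
apply/CkSP; split=> [y Uy|y v Uy|v].
- apply: (@continuous_comp _ _ _ f (h j)); first exact: cf.
  by apply/differentiable_continuous/derivable1_diffP; apply: ex_derive; exact/hd/UA.
- by have [] := chain y v Uy.
- apply: (eq_Ck (f := fun y => h j.+1 (f y) * 'D_v f y)) => //.
    by move=> y Uy; have [_ <-] := chain y v Uy.
  by apply: CkM => //; exact: IH.
Qed.

Lemma smoothM f g y : smooth_near f y -> smooth_near g y ->
  smooth_near (fun y => f y * g y) y.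
Proof.
move=> [U [oU Uy] Cf] [U' [oU' U'y] Cg]; exists (U `&` U').
  by split; [exact: openI|].
by move=> k; apply: CkM; [exact: openI|exact: sub_Ck (Cf k)|exact: sub_Ck (Cg k)].
Qed.

Lemma smooth_prod (I : Type) (r : seq I) (P : pred I) (F : I -> V -> R) y :
  (forall i, P i -> smooth_near (F i) y) ->
  smooth_near (fun y => \prod_(i <- r | P i) F i y) y.
Proof.
move=> sF; elim: r => [|i r IH].
  by apply: smooth_ext (smooth_cst _ y) => z; rewrite big_nil.
case Pi: (P i).
  by apply: smooth_ext (smoothM (sF i Pi) IH) => z; rewrite big_cons Pi.
by apply: smooth_ext IH => z; rewrite big_cons Pi.
Qed.

Lemma smooth_compR (A : set R) (h : nat -> R -> R) j f y : open A ->
  (forall i t, A t -> is_derive t 1 (h i) (h i.+1 t)) ->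
  A (f y) -> smooth_near f y -> smooth_near (fun y => h j (f y)) y.
Proof.
move=> oA hd Ay sf; have cf := smooth_continuous sf.
have : \forall z \near y, A (f z) by apply: cf; exact: open_nbhs_nbhs.
move=> /near_openP[B [oB By BA]].
move: sf => [U [oU Uy] Cf]; exists (U `&` B).
  by split; [exact: openI|].
move=> k; apply: (Ck_compR (A := A)) => //; first exact: openI.
  by move=> z [_ /BA].
exact: sub_Ck (Cf k).
Qed.

Lemma smoothV f y : f y != 0 -> smooth_near f y ->
  smooth_near (fun y => (f y)^-1) y.
Proof.
move=> fy0 sf.
(* The [i]-th derivative of [t^-1]. *)
pose h (i : nat) (t : R) : R := (-1) ^+ i * (i`!)%:R * (t^-1) ^+ i.+1.
suff : smooth_near (fun y => h 0%N (f y)) y.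
  by apply: smooth_ext => z; rewrite /h expr0 fact0 !mul1r expr1.
apply: (@smooth_compR (~` [set 0])) => //; last 1 first.
- exact/eqP.
- by apply: closed_openC; exact: (accessible_closed_set1 (hausdorff_accessible (@norm_hausdorff _ _))).
move=> i t/= /eqP t0; rewrite /h.
have dV : is_derive t 1 (fun s : R => s^-1) (- t^-1 ^+ 2).
  apply: DeriveDef; first by apply: derivableV.
  by rewrite (deriveV (f := id))// derive_id -[_ *: _]/(_ * _) mulr1 exprVn.
have dX := @is_deriveX _ _ (fun s : R => s^-1) i.+1 t 1 _ dV.
have dZ := @is_deriveZ _ _ _ _ ((-1) ^+ i * (i`!)%:R) _ _ _ dX.
have -> : (fun s : R => (-1) ^+ i * (i`!)%:R * s^-1 ^+ i.+1) =
   ((-1) ^+ i * (i`!)%:R) *: (fun s : R => s^-1) ^+ i.+1.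
  apply/funext => s; rewrite [RHS]/(_ *: _)/=; congr (_ * _).
  elim: (i.+1) => [|k IH]; first by rewrite !expr0.
  by rewrite !exprS IH.
move: dZ => /(@is_derive_eq _ _ _ _ _ _ _ _); apply.
rewrite /= -[LHS]/(_ * (_ * _)) factS natrM !exprS.
rewrite -[_ *+ _]mulr_natr; ring.
Qed.

End SmoothScalar.

Section Chain.
Context {R : realType} {V W W' : normedModType R}.

Lemma derivable_diff1 (W0 : normedModType R) (f : R -> W0) (t : R) :
  derivable f t 1 -> differentiable f t.
Proof. by move=> df; apply/derivable1_diffP. Qed.

Lemma is_derive_comp (g : V -> W) (f : W -> W') (y v : V) :
  derivable g y v -> differentiable f (g y) ->
  is_derive y v (f \o g) ('d f (g y) ('D_v g y)).
Proof.
move=> dg df; apply/is_derive_lineP.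
have dg1 : is_derive (0:R) 1 (fun t : R => g (t *: v + y)) ('D_v g y).
  by apply: (is_derive_lineP g y v _).1; exact: derivableP.
have dg2 : differentiable (fun t : R => g (t *: v + y)) 0.
  exact: derivable_diff1 (@ex_derive _ _ _ _ _ _ _ dg1).
have df2 : differentiable f ((fun t : R => g (t *: v + y)) 0).
  by rewrite scale0r add0r.
apply: DeriveDef.
  apply: diff_derivable; exact: (differentiable_comp dg2 df2).
rewrite deriveE; last exact: (differentiable_comp dg2 df2).
have -> := diff_comp dg2 df2.
rewrite /= scale0r add0r; congr ('d f (g y) _).
by rewrite -deriveE//; exact: (@derive_val _ _ _ _ _ _ _ dg1).
Qed.

Lemma is_derive_line_at (f : V -> W) (z v : V) (t : R) :
  derivable f (t *: v + z) v ->
  is_derive t 1 (fun s : R => f (s *: v + z)) ('D_v f (t *: v + z)).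
Proof.
move=> df; apply/is_derive_lineP.
have /is_derive_lineP := derivableP df; congr (is_derive _ _ _ _).
by apply/funext => s; rewrite addrA -scalerDl (_ : s%:A = s)//; exact: mulr1.
Qed.

End Chain.

Section MeanValue.
Context {R : realType} {V : normedModType R}.
Implicit Types (f : V -> R).

(** The intermediate parameter is located by its absolute value only, which treats both signs of [s]
    together: for negative [s] the line is run backwards. Applications must in return control the
    line on both sides of [z]. *)
Lemma MVT_line f (z v : V) (s : R) :
  (forall t, `|t| <= `|s| -> derivable f (t *: v + z) v) ->
  exists2 t, `|t| <= `|s| & f (s *: v + z) - f z = s * 'D_v f (t *: v + z).
Proof.
move=> df.
have key (g : R -> R) (dg : R -> R) (s0 : R) : 0 <= s0 ->
    (forall t, 0 <= t <= s0 -> is_derive t 1 g (dg t)) ->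
    exists2 t, 0 <= t <= s0 & g s0 - g 0 = s0 * dg t.
  move=> s00 gd; have [t|t|t + E] := @MVT_segment R g dg 0 s0 s00.
  - by rewrite in_itv/= => /andP[/ltW t0 /ltW ts]; apply: gd; rewrite t0.
  - apply: continuous_in_subspaceT => x; rewrite inE/= in_itv/= => x0.
    by apply/differentiable_continuous/derivable_diff1/ex_derive; exact: gd.
  - by rewrite in_itv/= => t0; exists t => //; rewrite E subr0 mulrC.
case: (leP 0 s) => s0.
  have [t t0|t /andP[t0 ts] E] :=
      key (fun t => f (t *: v + z)) (fun t => 'D_v f (t *: v + z)) s s0.
    apply: is_derive_line_at; apply: df.
    by case/andP: t0 => t0 ts; rewrite !ger0_norm.
  exists t; first by rewrite !ger0_norm.
  by rewrite -E scale0r add0r.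
have Ns0 : 0 <= - s by rewrite oppr_ge0 ltW.
have [t t0|t /andP[t0 ts] E] :=
    key (fun t => f ((- t) *: v + z)) (fun t => - 'D_v f ((- t) *: v + z)) (- s) Ns0.
  have h : is_derive (- t) 1 (fun s : R => f (s *: v + z)) ('D_v f ((- t) *: v + z)).
    apply: is_derive_line_at; apply: df.
    by case/andP: t0 => t0 ts; rewrite normrN ger0_norm// ltr0_norm.
  have hn : is_derive t 1 (fun t : R => - t) (- 1).
    by have := @is_deriveN _ _ _ id t 1 1 (is_derive_id _ _).
  have := @is_derive1_comp R (fun s : R => f (s *: v + z)) (fun t : R => - t) t _ _ h hn.
  by rewrite mulrN1.
exists (- t); first by rewrite normrN ger0_norm// ltr0_norm.
by move: E; rewrite opprK oppr0 scale0r add0r mulrNN.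
Qed.

(** The second difference of [f] over a small parallelogram is symmetric in its two sides, and
    equals the square of [s] times either mixed derivative at some point nearby. Continuity of the
    mixed derivatives brings these points back to [y]. *)
Lemma smooth_schwarz f (y u v : V) : smooth_near f y ->
  'D_u ('D_v f) y = 'D_v ('D_u f) y.
Proof.
move=> sf; apply/eqP; rewrite -subr_eq0 -normr_le0; apply/ler_addgt0Pl => e e0.
have e20 : 0 < e / 2 by rewrite divr_gt0.
have cA := smooth_continuous (smooth_derive u (smooth_derive v sf)).
have cB := smooth_continuous (smooth_derive v (smooth_derive u sf)).
have nA : \forall z \near y, `|'D_u ('D_v f) y - 'D_u ('D_v f) z| < e / 2.
  by move/cvgrPdist_lt : cA => /(_ _ e20).
have nB : \forall z \near y, `|'D_v ('D_u f) y - 'D_v ('D_u f) z| < e / 2.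
  by move/cvgrPdist_lt : cB => /(_ _ e20).
have := near_smooth sf.
move: nA nB => /[swap]/filterI/[apply]/filterI/[apply].
move=> /nbhs_ballP[r/= r0 rP].
(* With this size every [a *: u + (b *: v + y)] with [|a|] and [|b|] at most [s] stays in the ball
   of radius [r]; the summand 1 keeps the denominator positive when [u] and [v] vanish. *)
pose s := r / (1 + `|u| + `|v|) / 2.
have d0 : 0 < 1 + `|u| + `|v| by rewrite -addrA ltr_wpDr// addr_ge0.
have s0 : 0 < s by rewrite !divr_gt0.
have inb a b : `|a| <= s -> `|b| <= s -> ball y r (a *: u + (b *: v + y)).
  move=> ha hb; rewrite -ball_normE/= distrC addrA addrK.
  rewrite (le_lt_trans (ler_normD _ _))// !normrZ.
  apply: (@le_lt_trans _ _ (s * `|u| + s * `|v|)).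
    by rewrite lerD// ler_wpM2r.
  have sr : s * (1 + `|u| + `|v|) = r / 2 by rewrite /s; field; rewrite gt_eqF.
  rewrite -mulrDr; apply: (@le_lt_trans _ _ (r / 2)); last by lra.
  by rewrite -sr ler_wpM2l ?(ltW s0)//; lra.
have sE : `|s| = s by rewrite gtr0_norm.
(* Both mixed derivatives are attained near [y] by the second difference. *)
pose D := f (s *: u + (s *: v + y)) - f (s *: u + y) - f (s *: v + y) + f y.
have half (a b : V) : (forall p q, `|p| <= s -> `|q| <= s ->
      smooth_near f (p *: a + (q *: b + y))) ->
    exists p q, [/\ `|p| <= s, `|q| <= s &
      f (s *: a + (s *: b + y)) - f (s *: a + y) - f (s *: b + y) + f y
      = s * (s * 'D_b ('D_a f) (p *: a + (q *: b + y)))].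
  move=> sm.
  have sm0 p : `|p| <= s -> smooth_near f (p *: a + y).
    by move=> ps; have := sm p 0 ps; rewrite normr0 ltW// scale0r add0r; exact.
  pose G z := f (z + s *: b) - f z.
  have dfs z : smooth_near f (z + s *: b) ->
      is_derive z a (fun z => f (z + s *: b)) ('D_a f (z + s *: b)).
    move=> sz; apply: (is_derive_lineP _ _ _ _).2.
    have := (is_derive_lineP _ _ _ _).1 (derivableP (smooth_derivable (v:=a) sz)).
    by apply: is_derive_ext => t; rewrite addrA.
  have dG t : `|t| <= `|s| -> is_derive (t *: a + y) a G
     ('D_a f (t *: a + y + s *: b) - 'D_a f (t *: a + y)).
    rewrite sE => ts; apply: is_deriveB.
      by apply: dfs; rewrite -addrA (addrC y); apply: sm => //; rewrite sE.
    by apply: derivableP; apply: smooth_derivable; exact: sm0.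
  have [p|p ps E] := @MVT_line G y a s.
    by move=> ps; have [] := dG p ps.
  have [_ dGE] := dG p ps; rewrite sE in ps.
  have [q|q qs E2] := @MVT_line ('D_a f) (p *: a + y) b s.
    rewrite sE => qs; apply: smooth_derivable; apply: smooth_derive.
    by rewrite addrCA; exact: sm.
  exists p, q; split => //; first by rewrite sE in qs.
  have -> : p *: a + (q *: b + y) = q *: b + (p *: a + y) by rewrite addrCA.
  rewrite -E2; have -> : s *: b + (p *: a + y) = p *: a + y + s *: b by rewrite addrC.
  rewrite -dGE -E /G.
  have -> : s *: a + (s *: b + y) = s *: a + y + s *: b.
    by rewrite -addrA (addrC y).
  by rewrite (addrC y); ring.
have [p1 [q1 [p1s q1s E1]]] := half u v (fun p q hp hq =>
  let: conj _ h := rP _ (inb p q hp hq) in h).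
have [|p2 [q2 [p2s q2s E2]]] := half v u.
  by move=> p q hp hq; rewrite addrCA; have [] := rP _ (inb q p hq hp).
have EE : 'D_v ('D_u f) (p1 *: u + (q1 *: v + y)) =
          'D_u ('D_v f) (p2 *: v + (q2 *: u + y)).
  have s1 : s != 0 by rewrite gt_eqF.
  move: E1 E2; rewrite (addrCA (s *: v)).
  move: ('D_v ('D_u f) _) ('D_u ('D_v f) _) (f _) (f _) (f _) (f _) => A B a b c d.
  move=> E1 E2; apply: (mulfI s1); apply: (mulfI s1); rewrite -E1 -E2.
  by rewrite (addrAC d).
have [[h1 _] _] := rP _ (inb p1 q1 p1s q1s).
have [[_ h2] _] := rP _ (inb q2 p2 q2s p2s).
move: h1 h2; rewrite (addrCA (q2 *: u)) EE addr0.
move: ('D_v ('D_u f) y) ('D_u ('D_v f) y) ('D_u ('D_v f) _) => A B C.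
move=> h1 h2; rewrite (_ : B - A = (B - C) - (A - C)); last by ring.
by rewrite (le_trans (ler_normB _ _))//; lra.
Qed.

End MeanValue.

Section MatrixValued.
Context {R : realType} {V : normedModType R}.

Lemma mx_norm_entry p q (A : 'M[R]_(p, q)) i j : `|A i j| <= `|A|.
Proof.
rewrite [leRHS]/Num.Def.normr/= mx_normrE.
exact: (le_bigmax _ (fun ij : 'I_p * 'I_q => `|A ij.1 ij.2|) (i, j)).
Qed.

Lemma mx_norm_le p q (A : 'M[R]_(p, q)) (e : R) : 0 <= e ->
  (forall i j, `|A i j| <= e) -> `|A| <= e.
Proof.
by move=> e0 Ae; rewrite [leLHS]/Num.Def.normr/= mx_normrE; apply: bigmax_le.
Qed.

Lemma cvg_mxP (T : Type) (F : set_system T) (FF : Filter F) p q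
    (f : T -> 'M[R]_(p, q)) (A : 'M[R]_(p, q)) :
  f x @[x --> F] --> A <-> forall i j, f x i j @[x --> F] --> A i j.
Proof.
split=> [fA i j|fA].
  by apply: (@cvg_comp _ _ _ f (fun M : 'M[R]_(p, q) => M i j) _ _ _ fA);
     exact: coord_continuous.
apply/cvgrPdist_le => e e0.
near=> x; apply: mx_norm_le; first exact: ltW.
move=> i j; rewrite !mxE; move: i j; near: x.
apply: filter_forall => i; apply: filter_forall => j.
by move/cvgrPdist_le : (fA i j) => /(_ _ e0).
Unshelve. all: by end_near. Qed.

Lemma Ck_mxP k (U : set V) p q (f : V -> 'M[R]_(p, q)) : open U ->
  Ck k U f <-> forall i j, Ck k U (fun y => f y i j).
Proof.
move=> oU; elim: k f => [|k IH] f.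
  split=> [[cf _] i j|cf]; split => // y Uy.
    by have /cvg_mxP := cf y Uy; exact.
  by apply/cvg_mxP => i j; have [+ _] := cf i j; exact.
split=> [/CkSP[cf df Df] i j|Cf]; apply/CkSP; split.
- by move=> y Uy; have /cvg_mxP := cf y Uy; exact.
- by move=> y v Uy; have /derivable_mxP := df y v Uy; exact.
- move=> v; have /IH/(_ i j) := Df v; apply: eq_Ck => // y Uy.
  by rewrite derive_mx ?mxE//; exact: df.
- by move=> y Uy; apply/cvg_mxP => i j; have /CkSP[+ _ _] := Cf i j; exact.
- by move=> y v Uy; apply/derivable_mxP => i j; have /CkSP[_ + _] := Cf i j; exact.
- move=> v; apply/IH => i j; have /CkSP[_ _ /(_ v)] := Cf i j.
  apply: eq_Ck => // y Uy; rewrite derive_mx ?mxE//.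
  by apply/derivable_mxP => i' j'; have /CkSP[_ + _] := Cf i' j'; exact.
Qed.

Lemma smooth_mxP p q (f : V -> 'M[R]_(p, q)) y :
  smooth_near f y <-> forall i j, smooth_near (fun y => f y i j) y.
Proof.
split=> [[U [oU Uy] Cf] i j|sf].
  by exists U => // k; move: i j; apply/Ck_mxP => //; exact: Cf.
have /choice[U HU] (ij : 'I_p * 'I_q) : exists U, open_nbhs y U /\
    Cinfty U (fun y => f y ij.1 ij.2).
  by have [U oU Cf] := sf ij.1 ij.2; exists U.
have : \forall z \near y, forall ij, U ij z.
  by apply: near_forall => ij; apply: open_nbhs_nbhs; have [] := HU ij.
move=> /near_openP[A [oA Ay AU]]; exists A => // k.
apply/Ck_mxP => // i j; have [_ Cf] := HU (i, j).
by apply: sub_Ck (Cf k) => z /AU; exact.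
Qed.

Lemma smooth_mx p q (f : V -> 'M[R]_(p, q)) y :
  (forall i j, smooth_near (fun y => f y i j) y) -> smooth_near f y.
Proof. by move=> ?; apply/smooth_mxP. Qed.

Lemma smooth_entry p q (f : V -> 'M[R]_(p, q)) y i j :
  smooth_near f y -> smooth_near (fun y => f y i j) y.
Proof. by move/smooth_mxP; exact. Qed.

Lemma smooth_mulmx p q r (f : V -> 'M[R]_(p, q)) (g : V -> 'M[R]_(q, r)) y :
  smooth_near f y -> smooth_near g y -> smooth_near (fun y => f y *m g y) y.
Proof.
move=> sf sg; apply: smooth_mx => i j.
apply: (smooth_ext (f := fun y => \sum_k f y i k * g y k j)).
  by move=> z; rewrite mxE.
by apply: smooth_sum => k _; apply: smoothM; exact: smooth_entry.
Qed.

Lemma smooth_trmx p q (f : V -> 'M[R]_(p, q)) y :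
  smooth_near f y -> smooth_near (fun y => (f y)^T) y.
Proof.
move=> sf; apply: smooth_mx => i j.
by apply: (smooth_ext (f := fun y => f y j i)) (smooth_entry _ _ sf) => z; rewrite mxE.
Qed.

Lemma smooth_scale p q (a : V -> R) (f : V -> 'M[R]_(p, q)) y :
  smooth_near a y -> smooth_near f y -> smooth_near (fun y => a y *: f y) y.
Proof.
move=> sa sf; apply: smooth_mx => i j.
apply: (smooth_ext (f := fun y => a y * f y i j)) => [z|]; first by rewrite mxE.
by apply: smoothM => //; exact: smooth_entry.
Qed.

Lemma smooth_det n (f : V -> 'M[R]_n) y :
  smooth_near f y -> smooth_near (fun y => \det (f y)) y.
Proof.
move=> sf; apply: smooth_sum => s _; apply: smoothM; first exact: smooth_cst.
by apply: smooth_prod => i _; exact: smooth_entry.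
Qed.

Lemma smooth_invmx n (f : V -> 'M[R]_n) y :
  f y \in unitmx -> smooth_near f y -> smooth_near (fun y => invmx (f y)) y.
Proof.
move=> fu sf; have sd := smooth_det sf.
have d0 : \det (f y) != 0 by move: fu; rewrite unitmxE unitfE.
have nd : \forall z \near y, \det (f z) != 0.
  have /smooth_continuous/cvgrPdist_lt/(_ `|\det (f y)|) := sd.
  rewrite normr_gt0 => /(_ d0); apply: filterS => z.
  by apply: contraTneq => ->; rewrite subr0 ltxx.
apply: (eq_smooth (f := fun y => (\det (f y))^-1 *: \adj (f y))).
  apply: filterS nd => z dz.
  by rewrite /invmx unitmxE unitfE dz.
apply: smooth_scale; first exact: smoothV.
apply: smooth_mx => i j.
apply: (smooth_ext (f := fun z => cofactor (f z) j i)) => [z|].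
  by rewrite mxE.
rewrite /cofactor; apply: smoothM; first exact: smooth_cst.
apply: smooth_det; apply: smooth_mx => a b.
apply: (smooth_ext (f := fun z => f z (lift j a) (lift i b))) => [z|].
  by rewrite !mxE.
exact: smooth_entry.
Qed.

Lemma derive_entry p q (f : V -> 'M[R]_(p, q)) (y v : V) i j :
  derivable f y v -> ('D_v f y) i j = 'D_v (fun z => f z i j) y.
Proof. by move=> df; rewrite derive_mx// mxE. Qed.

Lemma smooth_schwarz_mx p q (f : V -> 'M[R]_(p, q)) (y u v : V) :
  smooth_near f y -> 'D_u ('D_v f) y = 'D_v ('D_u f) y.
Proof.
move=> sf; apply/matrixP => i j.
have E a b : ('D_a ('D_b f) y) i j = 'D_a ('D_b (fun z => f z i j)) y.
  rewrite derive_entry; last by apply/smooth_derivable/smooth_derive.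
  apply: near_eq_derive; have := near_smooth sf; apply: filterS => z sz.
  by rewrite derive_entry//; exact: smooth_derivable.
exact: etrans (E u v) (etrans (smooth_schwarz u v (smooth_entry i j sf)) (esym (E v u))).
Qed.

Lemma derive_mulmx p q r (f : V -> 'M[R]_(p, q)) (g : V -> 'M[R]_(q, r)) y v :
  derivable f y v -> derivable g y v ->
  is_derive y v (fun y => f y *m g y) ('D_v f y *m g y + f y *m 'D_v g y).
Proof.
move=> df dg.
have dfe i k : derivable (fun z => f z i k) y v by move/derivable_mxP : df; exact.
have dge k j : derivable (fun z => g z k j) y v by move/derivable_mxP : dg; exact.
have E i j : (fun z => (f z *m g z) i j) =
    \sum_k ((fun z => f z i k) * (fun z => g z k j)).
  by apply/funext => z; rewrite mxE fct_sumE.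
have dE i j : derivable (fun z => (f z *m g z) i j) y v.
  by rewrite E; apply: derivable_sum => k; exact: derivableM.
have d : derivable (fun z => f z *m g z) y v by apply/derivable_mxP.
apply: DeriveDef => //; apply/matrixP => i j.
rewrite derive_entry// E derive_sum; last by move=> k; exact: derivableM.
rewrite !mxE -big_split/=; apply: eq_bigr => k _.
by rewrite deriveM// !derive_entry// addrC; congr (_ + _); rewrite -[LHS]/(_ * _) mulrC.
Qed.

Lemma derive_trmx p q (f : V -> 'M[R]_(p, q)) y v : derivable f y v ->
  is_derive y v (fun y => (f y)^T) ('D_v f y)^T.
Proof.
move=> df; have dt : derivable (fun y => (f y)^T) y v.
  apply/derivable_mxP => i j; move/derivable_mxP : df => /(_ j i).
  by apply: derivable_ext => z; rewrite mxE.
apply: DeriveDef => //; apply/matrixP => i j.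
rewrite derive_entry// mxE derive_entry//.
by apply: derive_ext => z; rewrite mxE.
Qed.

End MatrixValued.

Section FiniteDimensionalDomain.
Context {R : realType}.

Definition ebase {n} (i : 'I_n) : 'rV[R]_n := delta_mx 0 i.

Lemma row_ebase n (v : 'rV[R]_n) : v = \sum_i v 0 i *: ebase i.
Proof. exact: row_sum_delta. Qed.

Lemma rV_linear_continuous n (W : normedModType R) (f : {linear 'rV[R]_n -> W}) :
  continuous f.
Proof.
rewrite (_ : (f : _ -> _) = fun v => \sum_i v 0 i *: f (ebase i)); last first.
  by apply/funext => v; rewrite {1}(row_ebase v) linear_sum; under eq_bigr do rewrite linearZ.
elim: (index_enum _) => [|i r IH].
  by under eq_fun do rewrite big_nil; move=> v; exact: cst_continuous.
under eq_fun do rewrite big_cons.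
move=> v; apply: (@continuousD _ _ _ (fun v : 'rV[R]_n => v 0 i *: f (ebase i))); last exact: IH.
by apply: continuousZr_tmp; exact: coord_continuous.
Qed.

Lemma smooth_linear n (W : normedModType R) (f : {linear 'rV[R]_n -> W}) y :
  smooth_near f y.
Proof. by apply: smooth_lin; exact: rV_linear_continuous. Qed.

Lemma is_diff_crit (V W : normedModType R) (f : V -> W) (L : {linear V -> W}) x :
  continuous L ->
  (forall e, 0 < e -> \forall h \near 0, `|f (h + x) - f x - L h| <= e * `|h|) ->
  is_diff x f L.
Proof.
move=> cL fL.
have E : f \o shift x = cst (f x) + L +o_ 0 id.
  apply/eqaddoP => _/posnumP[e]; have := fL e%:num [gt0 of e%:num].
  by move=> {}fL; near do rewrite /= opprD addrA; exact: fL.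
have D := diff_unique cL E.
by apply: DiffDef => //; apply/diff_locallyP; split; rewrite D.
Unshelve. all: by end_near.
Qed.

(** The coordinates of [h] are switched on one at a time, each increment being handled by the mean
    value theorem; continuity of the partial derivatives replaces the intermediate points by [x]. *)
Lemma partial_increment n (f : 'rV[R]_n -> R) (x : 'rV[R]_n) (e : R) :
  0 < e -> (\forall z \near x, forall i, derivable f z (ebase i)) ->
  (forall i, {for x, continuous ('D_(ebase i) f)}) ->
  \forall h \near (0 : 'rV[R]_n),
    `|f (h + x) - f x - \sum_i h 0 i * 'D_(ebase i) f x| <= e * `|h|.
Proof.
move=> e0 df cf.
(* The share of the error given to each of the [n] increments; [n.+1] keeps the division meaningful
   for [n = 0]. *)
pose e' := e / n.+1%:R.
have e'0 : 0 < e' by rewrite divr_gt0.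
have nD : \forall z \near x, forall i, `|'D_(ebase i) f x - 'D_(ebase i) f z| < e'.
  by apply: near_forall => i; move/cvgrPdist_lt : (cf i) => /(_ _ e'0).
move: df nD => /[swap]/filterI/[apply] /nbhs_ballP[r/= r0 rP].
apply/nbhs_ballP; exists r => //= h; rewrite -ball_normE/= sub0r normrN => hr.
pose t k : 'rV[R]_n := \row_i if (i < k)%N then h 0 i else 0.
have t0 : t 0%N = 0 by apply/rowP => i; rewrite !mxE.
have tn : t n = h by apply/rowP => i; rewrite !mxE ltn_ord.
have tS (k : 'I_n) : t k.+1 = h 0 k *: ebase k + t k.
  apply/rowP => i; rewrite !mxE eqxx/= ltnS leq_eqVlt (inj_eq val_inj).
  have [->|ik] /= := eqVneq i k; first by rewrite mulr1 ltnn addr0.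
  by rewrite mulr0 add0r.
have step (k : 'I_n) :
    `|f (t k.+1 + x) - f (t k + x) - h 0 k * 'D_(ebase k) f x| <= `|h| * e'.
  have inb s : `|s| <= `|h 0 k| -> ball x r (s *: ebase k + (t k + x)).
    move=> sh; rewrite -ball_normE/= distrC addrA addrK.
    apply: le_lt_trans hr; apply: mx_norm_le => // i j.
    rewrite !mxE ord1 eqxx/=; have [->|ik] := eqVneq j k.
      by rewrite ltnn addr0 mulr1 (le_trans sh)// mx_norm_entry.
    by rewrite mulr0 add0r; case: ifP => _; rewrite ?normr0// mx_norm_entry.
  have [s sh E] := @MVT_line R _ f (t k + x) (ebase k) (h 0 k)
    (fun s sh => (rP _ (inb s sh)).2 k).
  have -> : t k.+1 + x = h 0 k *: ebase k + (t k + x) by rewrite tS addrA.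
  rewrite E -mulrBr normrM ler_pM// ?mx_norm_entry//.
  by rewrite distrC ltW//; have [/(_ k)] := rP _ (inb s sh).
have -> : f (h + x) - f x - \sum_i h 0 i * 'D_(ebase i) f x =
    \sum_(i < n) (f (t i.+1 + x) - f (t i + x) - h 0 i * 'D_(ebase i) f x).
  rewrite sumrB; congr (_ - _).
  rewrite -(big_mkord xpredT (fun i => f (t i.+1 + x) - f (t i + x))).
  by rewrite telescope_sumr// t0 tn add0r.
rewrite (le_trans (ler_norm_sum _ _ _))//.
apply: (@le_trans _ _ (\sum_(i < n) `|h| * e')); first by apply: ler_sum => i _.
rewrite sumr_const card_ord -mulr_natr -mulrA mulrC ler_wpM2r//.
rewrite /e' mulrAC ler_pdivrMr// ler_wpM2l ?(ltW e0)//.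
by rewrite ler_nat.
Qed.

(** [Ck] speaks of directional derivatives only. In finite dimension their continuity yields Frechet
    differentiability, on which the chain rule and the linearity of a derivative in its direction
    depend. *)
Lemma smooth_differentiable_mx n p q (f : 'rV[R]_n -> 'M[R]_(p, q)) x :
  smooth_near f x -> differentiable f x.
Proof.
move=> sf.
pose L (h : 'rV[R]_n) : 'M[R]_(p, q) := \sum_i h 0 i *: 'D_(ebase i) f x.
have linL : linear L.
  move=> a u v; rewrite /L scaler_sumr -big_split; apply: eq_bigr => i _ /=.
  by rewrite !mxE scalerDl scalerA.
pose L' : {linear _ -> _} := HB.pack L (GRing.isLinear.Build _ _ _ _ _ linL).
suff [] : is_diff x f L' by [].
apply: is_diff_crit; first exact: rV_linear_continuous.
move=> e e0; have fij i j := smooth_entry i j sf.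
have : \forall h \near (0 : 'rV[R]_n), forall ij : 'I_p * 'I_q,
    `|f (h + x) ij.1 ij.2 - f x ij.1 ij.2 -
      \sum_i h 0 i * 'D_(ebase i) (fun z => f z ij.1 ij.2) x| <= e * `|h|.
  apply: near_forall => ij.
  apply: (partial_increment (f := fun z => f z ij.1 ij.2)) => //.
    have := near_smooth (fij ij.1 ij.2); apply: filterS => z sz i.
    exact: smooth_derivable.
  by move=> i; apply/smooth_continuous/smooth_derive.
apply: filterS => h hP; apply: mx_norm_le; first by rewrite mulr_ge0// ltW.
move=> i j; have := hP (i, j); rewrite /= /L !mxE summxE.
rewrite (eq_bigr (fun k => (h 0 k *: 'D_(ebase k) f x) i j))// => k _.
by rewrite mxE derive_entry//; exact: smooth_derivable.
Qed.

Lemma smooth_differentiable n (f : 'rV[R]_n -> R) x :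
  smooth_near f x -> differentiable f x.
Proof.
move=> sf; pose F z : 'rV[R]_1 := \row__ f z.
have sF : smooth_near F x.
  by apply: smooth_mx => i j; apply: smooth_ext sf => z; rewrite mxE.
have -> : f = (fun M : 'rV[R]_1 => M 0 0) \o F.
  by apply/funext => z /=; rewrite mxE.
apply: differentiable_comp; first exact: smooth_differentiable_mx.
exact: differentiable_coord.
Qed.

(** The inner map is allowed to be merely of class [k], which lets the regularity of a local inverse
    be bootstrapped later. The outer one is smooth because the induction passes to its partial
    derivatives. *)
Lemma Ck_comp_rV (V : normedModType R) k n (U : set V) (U' : set 'rV[R]_n)
    (g : V -> 'rV[R]_n) (f : 'rV[R]_n -> R) : open U -> open U' ->
  (forall y, U y -> U' (g y)) -> Ck k U g -> Cinfty U' f ->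
  Ck k U (f \o g).
Proof.
move=> oU oU' UU'; elim: k f => [|k IH] f Cg Cf.
  split=> // y Uy; apply: continuous_comp.
    exact: (Ck_continuous Cg).
  by apply: (Ck_continuous (Cf 0%N)); exact: UU'.
have dfg y : U y -> differentiable f (g y).
  by move=> Uy; apply: smooth_differentiable; apply: Cinfty_near Cf => //; exact: UU'.
have dg y v : U y -> derivable g y v by move=> Uy; exact: (Ck_derivable Cg).
apply/CkSP; split.
- move=> y Uy; apply: continuous_comp; first exact: (Ck_continuous Cg).
  exact/differentiable_continuous/dfg.
- by move=> y v Uy; have [] := is_derive_comp (dg y v Uy) (dfg y Uy).
- move=> v; apply: (eq_Ck (f := fun y => \sum_i ('D_v g y) 0 i * 'D_(ebase i) f (g y))) => //.
    move=> y Uy; have [_ ->] := is_derive_comp (dg y v Uy) (dfg y Uy).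
    rewrite [in RHS](row_ebase ('D_v g y)) linear_sum; apply: eq_bigr => i _.
    by rewrite (deriveE _ (dfg y Uy)) linearZ.
  have Csum (r : seq 'I_n) (F : 'I_n -> V -> R) : (forall i, Ck k U (F i)) ->
      Ck k U (fun y => \sum_(i <- r) F i y).
    move=> CF; elim: r => [|i r IHr].
      by apply: eq_Ck (Ck_cst k U (0 : R)) => // y _; rewrite big_nil.
    by apply: eq_Ck (CkD oU (CF i) IHr) => // y _; rewrite big_cons.
  apply: Csum => i; apply: CkM => //.
    by have /(Ck_mxP _ _ oU) := Ck_derive v Cg; exact.
  apply: (IH ('D_(ebase i) f)); first exact: CkW.
  by move=> k'; have /Ck_derive := Cf k'.+1.
Qed.

Lemma smooth_comp1 (V : normedModType R) n (g : V -> 'rV[R]_n) (f : 'rV[R]_n -> R) y :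
  smooth_near g y -> smooth_near f (g y) -> smooth_near (f \o g) y.
Proof.
move=> sg [U' [oU' U'y] Cf].
have : \forall z \near y, U' (g z).
  by apply: (smooth_continuous sg); exact: open_nbhs_nbhs.
move=> /near_openP[B [oB By BU]]; move: sg => [U [oU Uy] Cg].
exists (U `&` B); first by split; [exact: openI|].
move=> k; apply: (@Ck_comp_rV _ _ _ (U `&` B) U') => //; first exact: openI.
  by move=> z [_ /BU].
by apply: sub_Ck (Cg k) => z [].
Qed.

Lemma smooth_comp (V : normedModType R) n p q (g : V -> 'rV[R]_n)
    (f : 'rV[R]_n -> 'M[R]_(p, q)) y :
  smooth_near g y -> smooth_near f (g y) -> smooth_near (f \o g) y.
Proof.
move=> sg sf; apply: smooth_mx => i j.
exact: (smooth_comp1 (f := fun z => f z i j) sg (smooth_entry i j sf)).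
Qed.

End FiniteDimensionalDomain.

(** * A smooth step function, and positive definite matrices *)

Section Flat.
Context {R : realType}.

(** Each factor [X] is paid for with half of the rate, since [x] is at most
    [2 / a * expR (a / 2 * x)]. This growth bound makes all derivatives of the flat function vanish
    at 0. *)
Lemma poly_le_expR (p : {poly R}) (a : R) : 0 < a ->
  exists2 C, 0 <= C & forall x, 0 <= x -> `|p.[x]| <= C * expR (a * x).
Proof.
elim/poly_ind: p a => [|p c IH] a a0.
  by exists 0 => // x _; rewrite horner0 normr0 mul0r.
have a20 : 0 < a / 2 by rewrite divr_gt0.
have [C C0 HC] := IH _ a20.
exists (C * (2 / a) + `|c|).
  by rewrite addr_ge0// mulr_ge0// divr_ge0// ltW.
move=> x x0; rewrite hornerMXaddC mulrDl.
have ax0 : 0 <= a * x by rewrite mulr_ge0// ltW.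
rewrite (le_trans (ler_normD _ _))// lerD//; last first.
  by rewrite ler_peMr// (le_trans _ (expR_ge1Dx _))// lerDl.
rewrite normrM (ger0_norm x0) mulrC.
have xE : x <= 2 / a * expR (a / 2 * x).
  have := expR_ge1Dx (a / 2 * x); move: (expR _) => E hE.
  rewrite mulrAC ler_pdivlMr//; nra.
have -> : C * (2 / a) * expR (a * x) =
    (2 / a * expR (a / 2 * x)) * (C * expR (a / 2 * x)).
  rewrite (_ : a * x = a / 2 * x + a / 2 * x); last by field.
  by rewrite expRD; ring.
by rewrite ler_pM//; exact: HC.
Qed.

(* The derivatives of [t |-> exp (- 1 / t)] are [P (1 / t) exp (- 1 / t)] with
   [P] running through these polynomials. *)
Fixpoint flat_poly (k : nat) : {poly R} :=
  if k is k'.+1 then 'X^2 * (flat_poly k' - (flat_poly k')^`()) else 1.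

Definition flatn (k : nat) (t : R) : R :=
  if 0 < t then (flat_poly k).[t^-1] * expR (- t^-1) else 0.

Lemma is_derive_flatn k (t : R) : is_derive t 1 (flatn k) (flatn k.+1 t).
Proof.
case: (ltrgtP t 0) => t0.
- have h0 : \forall s \near t, cst 0 s = flatn k s.
    near=> s; rewrite /flatn ltNge ltW//=.
    by near: s; exact: lt_nbhsl.
  rewrite {2}/flatn ltNge ltW//=.
  exact: (near_eq_is_derive h0 (is_derive_cst _ _ _)).
- have h0 : \forall s \near t,
      ((horner (flat_poly k) \o (fun s => s^-1)) * (expR \o (fun s => - s^-1))) s = flatn k s.
    by near=> s; rewrite /flatn ifT//; near: s; apply: open_nbhs_nbhs; split => //; exact: open_gt.
  apply: (near_eq_is_derive h0).
  have tn0 : t != 0 by rewrite gt_eqF.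
  have dV : is_derive t 1 (fun s : R => s^-1) (- t^-1 ^+ 2).
    apply: DeriveDef; first by apply: derivableV.
    by rewrite (deriveV (f := id))// derive_id -[_ *: _]/(_ * _) mulr1 exprVn.
  have dP := @is_derive1_comp R (horner (flat_poly k)) (fun s => s^-1) t _ _
    (is_derive_poly _ _) dV.
  have dE := @is_derive1_comp R expR (fun s => - s^-1) t _ _
    (is_derive_expR _) (@is_deriveN _ _ _ _ _ _ _ dV).
  have dM := @is_deriveM _ _ _ _ _ _ _ _ dP dE.
  apply: (is_derive_eq dM).
  rewrite /flatn t0/= -![_ *: _]/(_ * _) !hornerE/= ; ring.
- rewrite t0 {2}/flatn ltxx.
  (* Evaluated at the inverse of [h], the extra factor ['X^2] bounds [flatn k h] by [C * h ^+ 2],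
     hence the difference quotient at 0 by [C * h]. *)
  have [C C0 HC] := poly_le_expR ('X^2 * flat_poly k) (@ltr01 R).
  have lim0 : (fun h => h^-1 *: ((flatn k \o shift 0) (h *: 1) - flatn k 0)) @ 0^' --> (0:R).
    apply/cvgrPdist_le => e e0; near=> h.
    rewrite sub0r normrN /= addr0 /flatn ltxx subr0 [h%:A]mulr1.
    case: ifPn => [h0|_]; last by rewrite scaler0 normr0 ltW.
    have hV : 0 <= h^-1 by rewrite invr_ge0 ltW.
    have := HC _ hV; rewrite hornerM hornerXn mul1r normrM.
    rewrite (@ger0_norm _ (h^-1 ^+ 2)) ?exprn_ge0// => hh.
    rewrite normrZ normrM (ger0_norm hV) (ger0_norm (expR_ge0 _)).
    apply: (@le_trans _ _ (C * h)).
      rewrite -(@ler_pM2r _ (h^-1)) ?invr_gt0// -(@ler_pM2r _ (expR h^-1)) ?expR_gt0//.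
      rewrite mulfK ?gt_eqF// (le_trans _ hh)// expr2 le_eqVlt; apply/orP; left.
      have EE : expR (- h^-1) * expR h^-1 = 1 by rewrite -expRD addNr expR0.
      move: (expR (- h^-1)) (expR h^-1) EE `|_| => E1 E2 EE P.
      apply/eqP; transitivity (h^-1 / h * P * (E1 * E2)); first by ring.
      by rewrite EE mulr1.
    have : `|h| <= e / (C + 1).
      by near: h; apply: dnbhs0_le; rewrite divr_gt0// ltr_wpDl.
    rewrite (gtr0_norm h0) ler_pdivlMr ?ltr_wpDl//; nra.
  by apply: DeriveDef; [apply/cvg_ex; exists 0|exact/cvg_lim].
Unshelve. all: by end_near. Qed.

Definition flat : R -> R := flatn 0.

Lemma flat_le0 t : t <= 0 -> flat t = 0.
Proof. by move=> t0; rewrite /flat /flatn ltNge t0. Qed.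

Lemma flat_gt0 t : 0 < t -> 0 < flat t.
Proof. by move=> t0; rewrite /flat /flatn t0/= hornerE mul1r expR_gt0. Qed.

Lemma flat_ge0 t : 0 <= flat t.
Proof. by case: (leP t 0) => [/flat_le0 ->|/flat_gt0/ltW]. Qed.

Definition step (t : R) : R := flat t / (flat t + flat (1 - t)).

Lemma step_den_gt0 t : 0 < flat t + flat (1 - t).
Proof.
have [t0|t0] := leP t 0.
  by rewrite ltr_wpDl ?flat_ge0// flat_gt0//; lra.
by rewrite ltr_pwDl ?flat_ge0// flat_gt0.
Qed.

Lemma step_ge0 t : 0 <= step t.
Proof. by rewrite divr_ge0 ?flat_ge0// ltW// step_den_gt0. Qed.

Lemma step_le1 t : step t <= 1.
Proof. by rewrite ler_pdivrMr ?step_den_gt0// mul1r lerDl flat_ge0. Qed.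

Lemma step_le0 t : t <= 0 -> step t = 0.
Proof. by move=> t0; rewrite /step flat_le0// mul0r. Qed.

Lemma step_ge1 t : 1 <= t -> step t = 1.
Proof.
move=> t1; rewrite /step (@flat_le0 (1 - t)) ?addr0 ?divff//; last by lra.
by rewrite gt_eqF// flat_gt0//; lra.
Qed.

Lemma smooth_flat (V : normedModType R) (f : V -> R) y :
  smooth_near f y -> smooth_near (fun z => flat (f z)) y.
Proof.
move=> sf; apply: (@smooth_compR _ _ setT flatn 0%N) => //; first exact: openT.
by move=> i t _; exact: is_derive_flatn.
Qed.

Lemma smooth_step (V : normedModType R) (f : V -> R) y :
  smooth_near f y -> smooth_near (fun z => step (f z)) y.
Proof.
move=> sf; have s1 : smooth_near (fun z => flat (1 - f z)) y.
  by apply: smooth_flat; apply: smoothB => //; exact: smooth_cst.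
apply: smoothM; first exact: smooth_flat.
apply: smoothV; first by rewrite gt_eqF// step_den_gt0.
by apply: smoothD => //; exact: smooth_flat.
Qed.

Lemma smooth_sqrt (V : normedModType R) (f : V -> R) y : 0 < f y ->
  smooth_near f y -> smooth_near (fun z => Num.sqrt (f z)) y.
Proof.
move=> fy sf.
(* Falling factorials of 1/2: the [i]-th derivative of the square root is [c i] times [Num.sqrt t]
   divided by the [i]-th power of [t]. *)
pose c := fix c (i : nat) : R := if i is i'.+1 then c i' * (2^-1 - i'%:R) else 1.
pose h (i : nat) (t : R) : R := c i * (Num.sqrt t * t^-1 ^+ i).
suff : smooth_near (fun y => h 0%N (f y)) y.
  by apply: smooth_ext => z; rewrite /h/= expr0 mul1r mulr1.
apply: (@smooth_compR _ _ `]0, +oo[%classic); first exact: itv_open_ends_open.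
- move=> i t/=; rewrite in_itv/= andbT => t0.
rewrite /h.
have tn0 : t != 0 by rewrite gt_eqF.
have st0 : Num.sqrt t != 0 by rewrite gt_eqF// sqrtr_gt0.
have dV : is_derive t 1 (fun s : R => s^-1) (- t^-1 ^+ 2).
  apply: DeriveDef; first by apply: derivableV.
  by rewrite (deriveV (f := id))// derive_id -[_ *: _]/(_ * _) mulr1 exprVn.
have dS : is_derive t 1 Num.sqrt (2 * Num.sqrt t)^-1 by exact: is_derive1_sqrt.
have dI : is_derive t 1 (fun s : R => s^-1 ^+ i) (- i%:R * t^-1 ^+ i.+1).
  case: i => [|i].
    rewrite oppr0 mul0r; apply: is_derive_ext (is_derive_cst (1:R) _ _) => z.
    by rewrite expr0.
  have := @is_deriveX _ _ (fun s : R => s^-1) i.+1 t 1 _ dV.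
  move=> /(@is_derive_eq _ _ _ _ _ _ _ _) dX.
  have {dX} := dX (- i.+1%:R * t^-1 ^+ i.+2).
  rewrite -[_ *: _]/(_ * _)/= => dX.
  apply: is_derive_ext (dX _).
    by move=> z; elim: (i.+1) => [|k IH]; rewrite ?expr0// !exprS -IH.
  by rewrite !exprS; ring.
have dM := @is_deriveZ _ _ _ _ (c i) _ _ _ (@is_deriveM _ _ _ _ _ _ _ _ dS dI).
apply: is_derive_ext (is_derive_eq dM _) => [z //|].
rewrite -![_ *: _]/(_ * _) /= exprS.
have t2 : t = Num.sqrt t ^+ 2 by rewrite sqr_sqrtr// ltW.
have -> : Num.sqrt t * (t^-1 * t^-1 ^+ i) = (Num.sqrt t)^-1 * t^-1 ^+ i.
  by rewrite {2}t2 expr2 mulrA; congr (_ * _); field.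
have -> : Num.sqrt t * (- i%:R * (t^-1 * t^-1 ^+ i)) = - i%:R * ((Num.sqrt t)^-1 * t^-1 ^+ i).
  by rewrite {2}t2 expr2; field.
by rewrite invfM; field.
- by rewrite /= in_itv/= fy.
- by [].
Qed.

End Flat.

Section DeterminantDerivative.
Context {R : realType} {V : normedModType R}.

Lemma is_derive_prod (I : eqType) (r : seq I) (F : I -> V -> R) (dF : I -> R) y v :
  uniq r -> (forall i, is_derive y v (F i) (dF i)) ->
  is_derive y v (fun z => \prod_(i <- r) F i z)
    (\sum_(i <- r) dF i * \prod_(j <- r | j != i) F j y).
Proof.
elim: r => [_ _|a r IH /= /andP[ar ur] dFi].
  rewrite big_nil; apply: is_derive_ext (is_derive_cst (1 : R) y v) => z.
  by rewrite big_nil.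
have {}IH := IH ur dFi.
have dM := @is_deriveM _ _ _ _ _ _ _ _ (dFi a) IH.
apply: is_derive_ext (is_derive_eq dM _) => [z|]; first by rewrite big_cons.
rewrite -![_ *: _]/(_ * _) big_cons addrC; congr (_ + _).
  rewrite big_cons eqxx/= mulrC; congr (_ * _); rewrite big_seq [RHS]big_seq_cond.
  by apply: eq_bigl => j; case jr: (j \in r) => //=; symmetry; apply: contraNneq ar => <-.
rewrite mulr_sumr !big_seq; apply: eq_bigr => i ir.
rewrite big_cons (_ : a != i); last by apply: contraNneq ar => ->.
by rewrite mulrCA.
Qed.

(** Jacobi's formula. The product rule in the Leibniz expansion gives, for each row, the determinant
    in which that row is differentiated; expansion along this row brings out the cofactors. *)
Lemma is_derive_det n (f : V -> 'M[R]_n) y v : derivable f y v ->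
  is_derive y v (fun z => \det (f z)) (\tr (\adj (f y) *m 'D_v f y)).
Proof.
move=> df.
have de i j : is_derive y v (fun z => f z i j) (('D_v f y) i j).
  by rewrite derive_entry//; apply: derivableP; move/derivable_mxP : df; exact.
have ds (s : {perm 'I_n}) : is_derive y v (fun z => (-1) ^+ s * \prod_i f z i (s i))
    ((-1) ^+ s * \sum_i ('D_v f y) i (s i) * \prod_(j | j != i) f y j (s j)).
  have dp := @is_derive_prod _ (index_enum 'I_n) (fun i z => f z i (s i))
     (fun i => ('D_v f y) i (s i)) y v (index_enum_uniq _) (fun i => de i (s i)).
  exact: (@is_deriveZ _ _ _ _ ((-1) ^+ s) _ _ _ dp).
have dsum (r : seq {perm 'I_n}) : is_derive y v
    (fun z => \sum_(s <- r) (-1) ^+ s * \prod_i f z i (s i))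
    (\sum_(s <- r) (-1) ^+ s * \sum_i ('D_v f y) i (s i) * \prod_(j | j != i) f y j (s j)).
  elim: r => [|s r IH].
    by rewrite big_nil; apply: is_derive_ext (is_derive_cst (0 : R) y v) => z; rewrite big_nil.
  rewrite big_cons; apply: is_derive_ext (@is_deriveD _ _ _ _ _ _ _ _ _ (ds s) IH) => z.
  by rewrite big_cons.
apply: (is_derive_eq (dsum _)).
under eq_bigr do rewrite mulr_sumr.
rewrite exchange_big/=.
transitivity (\sum_i \det (\matrix_(a, b) if a == i then ('D_v f y) a b else f y a b)).
  apply: eq_bigr => i _; apply: eq_bigr => s _; congr (_ * _).
  rewrite [RHS](bigD1 i)//= mxE eqxx; congr (_ * _).
  by apply: eq_bigr => j ji; rewrite mxE (negPf ji).
rewrite mxtrace_mulC /mxtrace; apply: eq_bigr => i _.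
rewrite (expand_det_row _ i) mxE; apply: eq_bigr => j _.
rewrite !mxE eqxx; congr (_ * _); rewrite /cofactor; congr (_ * \det _).
by apply/matrixP => a b; rewrite !mxE eq_sym (negPf (neq_lift i a)).
Qed.

End DeterminantDerivative.

Section Orthonormalization.
Context {R : realType}.

Definition posdef n (G : 'M[R]_n) :=
  G^T = G /\ forall v : 'rV[R]_n, v != 0 -> 0 < (v *m G *m v^T) 0 0.

(** One step of Gaussian elimination: [L] clears the first column, and the Schur complement [S] of
    the corner entry is again positive definite. The rows of [B] are an orthonormal basis for [G];
    invertibility, the sign of the determinant, tame coordinates and operator norms all rest on
    it. *)
Lemma posdef_orthonormal n (G : 'M[R]_n) : posdef G ->
  exists B : 'M[R]_n, B *m G *m B^T = 1%:M.
Proof.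
elim: n G => [G _|n IH G [GT Gpos]].
  by exists 1%:M; apply/matrixP => -[].
pose G' : 'M[R]_(1 + n) := G; rewrite -[G]/G'.
pose a := G' 0 0; pose r := ursubmx G'; pose D := drsubmx G'.
have ulE : ulsubmx G' = a%:M.
  by apply/matrixP => i j; rewrite !ord1 !mxE/= mulr1n /a; congr (G' _ _); exact: val_inj.
have dlE : dlsubmx G' = r^T.
  by rewrite /r trmx_ursub [G'^T]GT.
have GE : G' = block_mx a%:M r r^T D by rewrite -ulE -dlE submxK.
have DT : D^T = D by rewrite /D trmx_drsub [G'^T]GT.
have a0 : 0 < a.
  have := Gpos (delta_mx 0 0); rewrite -rowE trmx_delta -colE !mxE; apply.
  by apply/eqP => /rowP/(_ 0); rewrite !mxE !eqxx => /eqP; rewrite oner_eq0.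
pose L : 'M[R]_(1 + n) := block_mx 1%:M 0 (- a^-1 *: r^T) 1%:M.
pose S := D - a^-1 *: (r^T *m r).
have LGL : L *m G' *m L^T = block_mx a%:M 0 0 S.
  rewrite /L GE tr_block_mx !mulmx_block !trmx1 trmx0 linearZ/= trmxK.
  rewrite !(mul1mx, mulmx1, mul0mx, mulmx0, addr0, add0r).
  rewrite -!scalemxAl -!scalemxAr mul_mx_scalar mul_scalar_mx scalerA.
  rewrite !scalerA mulNr mulVf ?gt_eqF// !scaleN1r !addNr mul0mx scaler0 add0r.
  by congr block_mx; rewrite /S scaleNr addrC.
have Lu : L \in unitmx by rewrite unitmxE /L det_lblock !det1 mulr1 unitr1.
have [|C CS] := IH S.
  split.
    by rewrite /S linearB/= linearZ/= trmx_mul trmxK DT.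
  move=> w w0.
  have := Gpos (row_mx 0 w *m L).
  have -> : row_mx 0 w *m L != 0.
    apply: contraNneq w0 => /(congr1 (mulmx^~ (invmx L))).
    rewrite mulmxK// mul0mx => /(congr1 (@rsubmx _ 1 1 n)).
    by rewrite row_mxKr linear0 => ->.
  move=> /(_ isT); rewrite trmx_mul -[G]/G' !mulmxA -(mulmxA _ L) -(mulmxA _ _ L^T) LGL.
  by rewrite mul_row_block tr_row_mx mul_row_col !(mul0mx, mulmx0, add0r, trmx0, addr0).
pose b := (Num.sqrt a)^-1.
pose E : 'M[R]_(1 + n) := block_mx b%:M 0 0 C.
suff EE : E *m (L *m G' *m L^T) *m E^T = 1%:M.
  by exists (E *m L); rewrite trmx_mul !mulmxA in EE *.
rewrite LGL /E tr_block_mx.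
rewrite !mulmx_block !trmx0 !(mul0mx, mulmx0, add0r, addr0) CS.
rewrite tr_scalar_mx -!scalar_mxM.
rewrite (_ : b * a * b = 1) -?scalar_mx_block//.
rewrite /b -[X in _ * X * _](@sqr_sqrtr _ a) ?(ltW a0)//; field.
by rewrite gt_eqF// sqrtr_gt0.
Qed.

End Orthonormalization.

Section Posdef.
Context {R : realType}.

Lemma posdef_unit n (G : 'M[R]_n) : posdef G -> G \in unitmx.
Proof.
move=> /posdef_orthonormal[B /(congr1 determinant)].
rewrite !det_mulmx det_tr det1 unitmxE unitfE => E; apply/eqP => G0.
by move: E; rewrite G0 mulr0 mul0r => /eqP; rewrite eq_sym oner_eq0.
Qed.

Lemma posdef_det_gt0 n (G : 'M[R]_n) : posdef G -> 0 < \det G.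
Proof.
move=> /posdef_orthonormal[B /(congr1 determinant)].
rewrite !det_mulmx det_tr det1 => E.
have B0 : \det B != 0.
  by apply/eqP => B0; move: E; rewrite B0 !mul0r => /eqP; rewrite eq_sym oner_eq0.
have : 0 < \det B ^+ 2 by rewrite lt0r sqrf_eq0 B0/= sqr_ge0.
by move=> h; rewrite -(@pmulr_rgt0 _ (\det B ^+ 2))// (_ : _ * _ = 1) ?ltr01// -E; ring.
Qed.

Lemma posdef_ge0 n (G : 'M[R]_n) (v : 'rV[R]_n) : posdef G -> 0 <= (v *m G *m v^T) 0 0.
Proof.
move=> [_ Gp]; have [->|/Gp/ltW//] := eqVneq v 0.
by rewrite !mul0mx mxE.
Qed.

End Posdef.

(** * Directional derivatives of matrix-valued maps *)

(* Locked, so that unification never unfolds the limit defining ['D_v f y]. *)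
HB.lock Definition Dv {R : realType} {V W : normedModType R} (v : V) (f : V -> W) (y : V) : W :=
  'D_v f y.

HB.lock Definition bil {R : realType} {m : nat} (A : 'M[R]_m) (a b : 'rV[R]_m) : R :=
  (a *m A *m b^T) ord0 ord0.

Section DvTheory.
Context {R : realType} {V W : normedModType R}.
Implicit Types (f g : V -> W) (u v y : V).

Lemma DvE v f y : Dv v f y = 'D_v f y. Proof. by rewrite unlock. Qed.
Lemma DvEfun v f : Dv v f = 'D_v f. Proof. by rewrite unlock. Qed.

Lemma Dv_is_derive v f y : smooth_near f y -> is_derive y v f (Dv v f y).
Proof. by move=> sf; rewrite DvE; exact/derivableP/smooth_derivable. Qed.

Lemma Dv_val v f y d : is_derive y v f d -> Dv v f y = d.
Proof. by move=> [_ <-]; exact: DvE. Qed.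

Lemma smooth_Dv v f y : smooth_near f y -> smooth_near (Dv v f) y.
Proof. by rewrite DvEfun; exact: smooth_derive. Qed.

Lemma Dv_near v f g y : (\forall z \near y, f z = g z) -> Dv v f y = Dv v g y.
Proof. by rewrite !DvE; exact: near_eq_derive. Qed.

Lemma Dv_cst v (c : W) y : Dv v (fun=> c) y = 0.
Proof. by rewrite DvE derive_cst. Qed.

Lemma DvD v f g y : smooth_near f y -> smooth_near g y ->
  Dv v (fun z => f z + g z) y = Dv v f y + Dv v g y.
Proof. move=> sf sg; apply: Dv_val.
by apply: is_deriveD; exact: Dv_is_derive. Qed.

Lemma DvN v f y : smooth_near f y -> Dv v (fun z => - f z) y = - Dv v f y.
Proof. by move=> sf; apply: Dv_val; apply: is_deriveN; exact: Dv_is_derive. Qed.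

Lemma DvB v f g y : smooth_near f y -> smooth_near g y ->
  Dv v (fun z => f z - g z) y = Dv v f y - Dv v g y.
Proof. by move=> sf sg; rewrite DvD ?DvN//; exact: smoothN. Qed.

Lemma Dv_sum v (I : Type) (r : seq I) (F : I -> V -> W) y :
  (forall i, smooth_near (F i) y) ->
  Dv v (fun z => \sum_(i <- r) F i z) y = \sum_(i <- r) Dv v (F i) y.
Proof.
move=> sF; elim: r => [|i r IH].
  rewrite big_nil -[RHS](Dv_cst v 0 y); congr (Dv v _ y); apply/funext => z.
  by rewrite big_nil.
rewrite big_cons -IH -DvD//; last exact: smooth_sum.
by congr (Dv v _ y); apply/funext => z; rewrite big_cons.
Qed.

End DvTheory.

Section DvScalar.
Context {R : realType} {V : normedModType R}.
Implicit Types (u v y : V).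

Lemma DvM v (f g : V -> R) y : smooth_near f y -> smooth_near g y ->
  Dv v (fun z => f z * g z) y = Dv v f y * g y + f y * Dv v g y.
Proof.
move=> sf sg; apply: Dv_val.
apply: (is_derive_eq (is_deriveM (Dv_is_derive v sf) (Dv_is_derive v sg))).
by rewrite -![_ *: _]/(_ * _) addrC; congr (_ + _); rewrite mulrC.
Qed.

Lemma DvV v (f : V -> R) y : f y != 0 -> smooth_near f y ->
  Dv v (fun z => (f z)^-1) y = - Dv v f y / (f y) ^+ 2.
Proof.
move=> f0 sf; have sV := smoothV f0 sf.
have nf : \forall z \near y, f z != 0.
  have /smooth_continuous/cvgrPdist_lt/(_ `|f y|) := sf.
  rewrite normr_gt0 => /(_ f0); apply: filterS => z.
  by apply: contraTneq => ->; rewrite subr0 ltxx.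
have : Dv v (fun z => f z * (f z)^-1) y = 0.
  rewrite -(Dv_cst v (1 : R) y); apply: Dv_near; apply: filterS nf => z fz.
  by rewrite mulfV.
rewrite DvM// => E; apply: (mulfI f0); move: E.
by move: (Dv _ _ _) (Dv _ _ _) => a b E; have -> : f y * a = - (b / f y); [lra|field].
Qed.

Lemma Dv_sqrt v (f : V -> R) y : 0 < f y -> smooth_near f y ->
  Dv v (fun z => Num.sqrt (f z)) y = Dv v f y / (2 * Num.sqrt (f y)).
Proof.
move=> f0 sf; have ss := smooth_sqrt f0 sf.
have nf : \forall z \near y, 0 < f z.
  have /smooth_continuous/cvgrPdist_lt/(_ (f y) f0) := sf.
  apply: filterS => z; rewrite ltr_norml => /andP[_]; lra.
have : Dv v (fun z => Num.sqrt (f z) * Num.sqrt (f z)) y = Dv v f y.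
  by apply: Dv_near; apply: filterS nf => z fz; rewrite -expr2 sqr_sqrtr// ltW.
have s0 : Num.sqrt (f y) != 0 by rewrite gt_eqF// sqrtr_gt0.
rewrite DvM// => <-; move: (Dv _ _ _) => a; by field.
Qed.

End DvScalar.

Section DvMatrix.
Context {R : realType} {V : normedModType R}.
Implicit Types (u v y : V).

Lemma Dv_entry v p q (f : V -> 'M[R]_(p, q)) y i j : smooth_near f y ->
  (Dv v f y) i j = Dv v (fun z => f z i j) y.
Proof. by move=> sf; rewrite !DvE derive_entry//; exact: smooth_derivable. Qed.

Lemma Dv_mulmx v p q r (f : V -> 'M[R]_(p, q)) (g : V -> 'M[R]_(q, r)) y :
  smooth_near f y -> smooth_near g y ->
  Dv v (fun y => f y *m g y) y = Dv v f y *m g y + f y *m Dv v g y.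
Proof.
move=> sf sg; apply: Dv_val; rewrite !DvE; apply: derive_mulmx; exact: smooth_derivable.
Qed.

Lemma Dv_trmx v p q (f : V -> 'M[R]_(p, q)) y : smooth_near f y ->
  Dv v (fun y => (f y)^T) y = (Dv v f y)^T.
Proof.
by move=> sf; apply: Dv_val; rewrite !DvE; apply: derive_trmx; exact: smooth_derivable.
Qed.

Lemma Dv_scale v p q (a : V -> R) (f : V -> 'M[R]_(p, q)) y :
  smooth_near a y -> smooth_near f y ->
  Dv v (fun y => a y *: f y) y = Dv v a y *: f y + a y *: Dv v f y.
Proof.
move=> sa sf; have ss := smooth_scale sa sf; apply/matrixP => i j.
rewrite (Dv_entry _ _ _ ss) [RHS]mxE [X in X + _]mxE [X in _ + X]mxE (Dv_entry _ _ _ sf).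
rewrite -DvM//; last exact: smooth_entry.
by congr (Dv v _ y); apply/funext => z; rewrite mxE.
Qed.

Lemma Dv_det v n (f : V -> 'M[R]_n) y : smooth_near f y ->
  Dv v (fun z => \det (f z)) y = \tr (\adj (f y) *m Dv v f y).
Proof.
by move=> sf; apply: Dv_val; rewrite !DvE; apply: is_derive_det; exact: smooth_derivable.
Qed.

Lemma Dv_schwarz u v p q (f : V -> 'M[R]_(p, q)) y : smooth_near f y ->
  Dv u (Dv v f) y = Dv v (Dv u f) y.
Proof. by move=> sf; rewrite !DvEfun smooth_schwarz_mx. Qed.

Lemma Dv_schwarz1 u v (f : V -> R) y : smooth_near f y ->
  Dv u (Dv v f) y = Dv v (Dv u f) y.
Proof. by move=> sf; rewrite !DvEfun smooth_schwarz. Qed.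

Lemma smooth_bil m (A : V -> 'M[R]_m) (a b : V -> 'rV[R]_m) y :
  smooth_near A y -> smooth_near a y -> smooth_near b y ->
  smooth_near (fun y => bil (A y) (a y) (b y)) y.
Proof.
move=> sA sa sb; rewrite unlock; apply: smooth_entry; apply: smooth_mulmx; last exact: smooth_trmx.
exact: smooth_mulmx.
Qed.

End DvMatrix.

Section Bilinear.
Context {R : realType} {m : nat}.
Implicit Types (A : 'M[R]_m) (a b c : 'rV[R]_m).

Lemma bilE A a b : bil A a b = (a *m A *m b^T) ord0 ord0.
Proof. by rewrite unlock. Qed.
Lemma bilDl A a b c : bil A (a + b) c = bil A a c + bil A b c.
Proof. by rewrite !bilE !mulmxDl mxE. Qed.
Lemma bilDr A a b c : bil A a (b + c) = bil A a b + bil A a c.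
Proof. by rewrite !bilE linearD mulmxDr mxE. Qed.
Lemma bilZl A k a c : bil A (k *: a) c = k * bil A a c.
Proof. by rewrite !bilE -!scalemxAl mxE. Qed.
Lemma bilZr A k a c : bil A a (k *: c) = k * bil A a c.
Proof. by rewrite !bilE linearZ -scalemxAr mxE. Qed.
Lemma bilNl A a c : bil A (- a) c = - bil A a c.
Proof. by rewrite -scaleN1r bilZl mulN1r. Qed.
Lemma bilNr A a c : bil A a (- c) = - bil A a c.
Proof. by rewrite -scaleN1r bilZr mulN1r. Qed.
Lemma bilBl A a b c : bil A (a - b) c = bil A a c - bil A b c.
Proof. by rewrite bilDl bilNl. Qed.
Lemma bilBr A a b c : bil A a (b - c) = bil A a b - bil A a c.
Proof. by rewrite bilDr bilNr. Qed.
Lemma bil0l A c : bil A 0 c = 0.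
Proof. by rewrite bilE !mul0mx mxE. Qed.
Lemma bil0r A c : bil A c 0 = 0.
Proof. by rewrite bilE trmx0 mulmx0 mxE. Qed.
Lemma bil_suml A (I : Type) (r : seq I) (F : I -> 'rV[R]_m) c :
  bil A (\sum_(i <- r) F i) c = \sum_(i <- r) bil A (F i) c.
Proof.
elim: r => [|i r IH]; first by rewrite !big_nil bil0l.
by rewrite !big_cons bilDl IH.
Qed.
Lemma bil_sumr A (I : Type) (r : seq I) (F : I -> 'rV[R]_m) c :
  bil A c (\sum_(i <- r) F i) = \sum_(i <- r) bil A c (F i).
Proof.
elim: r => [|i r IH]; first by rewrite !big_nil bil0r.
by rewrite !big_cons bilDr IH.
Qed.
Lemma bilMD A B a b : bil (A + B) a b = bil A a b + bil B a b.
Proof. by rewrite !bilE mulmxDr mulmxDl mxE. Qed.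
Lemma bilMZ k A a b : bil (k *: A) a b = k * bil A a b.
Proof. by rewrite !bilE -scalemxAr -scalemxAl mxE. Qed.
Lemma bilM_sum (I : Type) (r : seq I) (F : I -> 'M[R]_m) a b :
  bil (\sum_(i <- r) F i) a b = \sum_(i <- r) bil (F i) a b.
Proof.
elim: r => [|i r IH]; first by rewrite !big_nil bilE mulmx0 mul0mx mxE.
by rewrite !big_cons bilMD IH.
Qed.
Lemma bil_tr A a b : bil A^T a b = bil A b a.
Proof.
rewrite !bilE; transitivity ((b *m A *m a^T)^T ord0 ord0); last by rewrite mxE.
by rewrite !trmx_mul trmxK mulmxA.
Qed.
Lemma bilC A a b : A^T = A -> bil A a b = bil A b a.
Proof. by move=> AT; rewrite -{1}AT bil_tr. Qed.

Lemma bil_inj A a b : A \in unitmx -> (forall w, bil A a w = bil A b w) -> a = b.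
Proof.
move=> uA ab; apply: (can_inj (mulmxK uA)); apply/rowP => j.
by have := ab (ebase j); rewrite !bilE /ebase trmx_delta -!colE !mxE.
Qed.

Lemma posdef_bil_gt0 A a : posdef A -> a != 0 -> 0 < bil A a a.
Proof. by rewrite bilE => -[_]; exact. Qed.

Lemma posdef_bil_ge0 A a : posdef A -> 0 <= bil A a a.
Proof. by move=> pA; rewrite bilE; exact: posdef_ge0. Qed.

End Bilinear.

Lemma bil_mulmx {R : realType} m n (A : 'M[R]_m) (E : 'M[R]_(n, m)) (a b : 'rV[R]_n) :
  bil A (a *m E) (b *m E) = bil (E *m A *m E^T) a b.
Proof. by rewrite !bilE; rewrite trmx_mul !mulmxA. Qed.


Lemma Dv_bil {R : realType} {V : normedModType R} v m (A : V -> 'M[R]_m)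
    (a b : V -> 'rV[R]_m) (y : V) :
  smooth_near A y -> smooth_near a y -> smooth_near b y ->
  Dv v (fun y => bil (A y) (a y) (b y)) y =
    bil (Dv v A y) (a y) (b y) + bil (A y) (Dv v a y) (b y)
     + bil (A y) (a y) (Dv v b y).
Proof.
move=> sA sa sb; have sm := smooth_mulmx (smooth_mulmx sa sA) (smooth_trmx sb).
transitivity ((Dv v (fun y => a y *m A y *m (b y)^T) y) ord0 ord0).
  by rewrite (Dv_entry _ _ _ sm); congr (Dv v _ y); apply/funext => z; rewrite bilE.
rewrite (Dv_mulmx _ (smooth_mulmx sa sA) (smooth_trmx sb)) (Dv_mulmx _ sa sA) (Dv_trmx _ sb).
rewrite !bilE; move: (Dv v A y) (Dv v a y) (Dv v b y) => A' a' b'.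
rewrite mulmxDl [LHS]mxE [X in X + _ = _]mxE; ring.
Qed.

Section DirectionLinear.
Context {R : realType}.

Lemma Dv_diff n (W : normedModType R) (f : 'rV[R]_n -> W) y v :
  differentiable f y -> Dv v f y = 'd f y v.
Proof. by move=> df; rewrite DvE deriveE. Qed.

Lemma DvDdir n (W : normedModType R) (f : 'rV[R]_n -> W) y u v :
  differentiable f y -> Dv (u + v) f y = Dv u f y + Dv v f y.
Proof. by move=> df; rewrite !(Dv_diff _ df) linearD. Qed.

Lemma DvZdir n (W : normedModType R) (f : 'rV[R]_n -> W) y k v :
  differentiable f y -> Dv (k *: v) f y = k *: Dv v f y.
Proof. by move=> df; rewrite !(Dv_diff _ df) linearZ. Qed.

Lemma Dv0dir n (W : normedModType R) (f : 'rV[R]_n -> W) y :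
  differentiable f y -> Dv 0 f y = 0.
Proof. by move=> df; rewrite !(Dv_diff _ df) linear0. Qed.

Lemma Dv_dir_sum n (W : normedModType R) (f : 'rV[R]_n -> W) y v :
  differentiable f y -> Dv v f y = \sum_i v 0 i *: Dv (ebase i) f y.
Proof.
move=> df; rewrite (Dv_diff _ df) {1}(row_ebase v) linear_sum.
by apply: eq_bigr => i _; rewrite linearZ/= (Dv_diff _ df).
Qed.

Lemma Dv_comp (V : normedModType R) n (W : normedModType R)
    (g : V -> 'rV[R]_n) (f : 'rV[R]_n -> W) y v :
  smooth_near g y -> differentiable f (g y) ->
  Dv v (fun y => f (g y)) y = Dv (Dv v g y) f (g y).
Proof.
move=> sg df; rewrite (Dv_diff _ df) !DvE.
by have [_ ->] := is_derive_comp (smooth_derivable (v:=v) sg) df.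
Qed.

Lemma Dv_jacobian n m (f : 'rV[R]_n -> 'rV[R]_m) y v :
  differentiable f y -> v *m 'J f y = Dv v f y.
Proof. by move=> df; rewrite DvE deriveEjacobian. Qed.

Lemma smooth_jacobian n m (f : 'rV[R]_n -> 'rV[R]_m) y :
  smooth_near f y -> smooth_near (fun z => 'J f z) y.
Proof.
move=> sf; apply: smooth_mx => i j.
apply: (eq_smooth (f := fun z => (Dv (ebase i) f z) 0 j)); last first.
  exact/smooth_entry/smooth_Dv.
apply: filterS (near_smooth sf) => z sz.
by rewrite -Dv_jacobian ?/ebase -?rowE ?mxE//; exact: smooth_differentiable_mx.
Qed.

Lemma Dv_id n (u y : 'rV[R]_n) : Dv u (fun z => z) y = u.
Proof. by rewrite DvE derive_id. Qed.

Lemma smooth_id n (y : 'rV[R]_n) : smooth_near (fun z => z) y.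
Proof. exact: (@smooth_linear _ _ _ idfun). Qed.

End DirectionLinear.

(** * Christoffel symbols and curvature in coordinates *)

Ltac vring := apply/rowP => ?; rewrite !mxE; ring.

(** The contracted Christoffel symbols of a metric known only as a function of coordinates;
    [christoffelE] identifies them with [christoffel] in a chart of a manifold. *)
HB.lock Definition chr {R : realType} {m : nat} (G : 'rV[R]_m -> 'M[R]_m)
    (z u v : 'rV[R]_m) : 'rV[R]_m :=
  (\row_l (2^-1 * (bil (Dv u G z) v (ebase l) + bil (Dv v G z) u (ebase l)
                   - bil (Dv (ebase l) G z) u v))) *m invmx (G z).

(** Positivity is asked around [z] and not only at [z], so that the symmetry of [G] passes to its
    derivatives. *)
Definition metric_near {R : realType} {m : nat} (G : 'rV[R]_m -> 'M[R]_m) z :=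
  smooth_near G z /\ \forall z' \near z, posdef (G z').

Section Christoffel.
Context {R : realType} {m : nat}.
Implicit Types (G : 'rV[R]_m -> 'M[R]_m) (z u v w a b : 'rV[R]_m).

Lemma metric_nearW G z : metric_near G z -> posdef (G z).
Proof. by move=> [_ /nbhs_singleton]. Qed.

Lemma near_metric G z : metric_near G z -> \forall z' \near z, metric_near G z'.
Proof.
move=> [/near_smooth sG /near_openP[A [oA Az Ap]]].
near=> z'; split; first by near: z'.
have Az' : A z' by near: z'; exact: open_nbhs_nbhs.
by apply: filterS (open_nbhs_nbhs (conj oA Az')).
Unshelve. all: by end_near. Qed.

Lemma metric_diff G z : metric_near G z -> differentiable G z.
Proof. by move=> [sG _]; exact: smooth_differentiable_mx. Qed.

Lemma metric_Dv_sym G z u : metric_near G z -> (Dv u G z)^T = Dv u G z.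
Proof.
move=> [sG pG]; rewrite -(Dv_trmx u sG); apply: Dv_near.
by apply: filterS pG => z' [].
Qed.

(** Pairing with [w] removes the inverse matrix from [chr]. As the form is nondegenerate, the
    identity characterizes [chr] (this is [chr_uniq]); symmetry, bilinearity, metric compatibility
    and the behaviour under a change of coordinates are all read off from it. *)
Lemma koszul G z u v w : metric_near G z ->
  2 * bil (G z) (chr G z u v) w =
  bil (Dv u G z) v w + bil (Dv v G z) u w - bil (Dv w G z) u v.
Proof.
move=> mG; have dG := metric_diff mG.
have uG := posdef_unit (metric_nearW mG).
have bilDw : bil (Dv w G z) u v = \sum_l w 0 l * bil (Dv (ebase l) G z) u v.
  by rewrite (Dv_dir_sum w dG) bilM_sum; apply: eq_bigr => l _; rewrite bilMZ.
have -> : bil (G z) (chr G z u v) w = \sum_l (2^-1 * (bil (Dv u G z) v (ebase l)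
    + bil (Dv v G z) u (ebase l) - bil (Dv (ebase l) G z) u v)) * w 0 l.
  rewrite bilE unlock (mulmxKV uG) mxE; apply: eq_bigr => l _.
  by rewrite [w^T l ord0]mxE [X in X * _]mxE.
rewrite bilDw (_ : bil (Dv u G z) v w = \sum_l w 0 l * bil (Dv u G z) v (ebase l)).
  rewrite (_ : bil (Dv v G z) u w = \sum_l w 0 l * bil (Dv v G z) u (ebase l)).
    rewrite mulr_sumr -big_split -sumrB/=; apply: eq_bigr => l _; by field.
  by rewrite {1}(row_ebase w) bil_sumr; apply: eq_bigr => l _; rewrite bilZr.
by rewrite {1}(row_ebase w) bil_sumr; apply: eq_bigr => l _; rewrite bilZr.
Qed.

Lemma chr_uniq G z u v x : metric_near G z ->
  (forall w, 2 * bil (G z) x w =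
     bil (Dv u G z) v w + bil (Dv v G z) u w - bil (Dv w G z) u v) ->
  chr G z u v = x.
Proof.
move=> mG xP; apply: (bil_inj (posdef_unit (metric_nearW mG))) => w.
by have := koszul u v w mG; rewrite -xP; lra.
Qed.

Lemma chrC G z u v : metric_near G z -> chr G z u v = chr G z v u.
Proof.
move=> mG; apply: chr_uniq => // w; rewrite koszul//.
rewrite (bilC u v (metric_Dv_sym w mG)); ring.
Qed.

Lemma chrDl G z u u' v : metric_near G z ->
  chr G z (u + u') v = chr G z u v + chr G z u' v.
Proof.
move=> mG; apply: chr_uniq => // w; rewrite bilDl mulrDr !koszul//.
by rewrite (DvDdir u u' (metric_diff mG)) bilMD !bilDl; ring.
Qed.

Lemma chrZl G z k u v : metric_near G z -> chr G z (k *: u) v = k *: chr G z u v.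
Proof.
move=> mG; apply: chr_uniq => // w; rewrite bilZl mulrCA koszul//.
by rewrite (DvZdir k u (metric_diff mG)) bilMZ !bilZl; ring.
Qed.

Lemma chrDr G z u v v' : metric_near G z ->
  chr G z u (v + v') = chr G z u v + chr G z u v'.
Proof. by move=> mG; rewrite !(chrC u)// chrDl. Qed.

Lemma chrZr G z k u v : metric_near G z -> chr G z u (k *: v) = k *: chr G z u v.
Proof. by move=> mG; rewrite !(chrC u)// chrZl. Qed.

Lemma chr0l G z v : metric_near G z -> chr G z 0 v = 0.
Proof. by move=> mG; have := chrZl 0 0 v mG; rewrite !scale0r. Qed.

Lemma chr0r G z v : metric_near G z -> chr G z v 0 = 0.
Proof. by move=> mG; rewrite chrC// chr0l. Qed.

Lemma chr_compat G z u v w : metric_near G z ->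
  bil (Dv u G z) v w = bil (G z) (chr G z u v) w + bil (G z) v (chr G z u w).
Proof.
move=> mG; have GT : (G z)^T = G z by have [] := metric_nearW mG.
have := koszul u v w mG; have := koszul u w v mG.
rewrite (bilC v (chr G z u w) GT) (bilC w v (metric_Dv_sym u mG)); lra.
Qed.

Lemma chr_suml G z (I : Type) (r : seq I) (F : I -> 'rV[R]_m) w :
  metric_near G z ->
  chr G z (\sum_(i <- r) F i) w = \sum_(i <- r) chr G z (F i) w.
Proof.
move=> mG; elim: r => [|i r IH]; first by rewrite !big_nil chr0l.
by rewrite !big_cons chrDl// IH.
Qed.

(** Through this expansion, smoothness and derivatives of [chr] with moving arguments reduce to
    those with constant basis vectors. *)
Lemma chr_sumE G z u v : metric_near G z ->
  chr G z u v = \sum_i \sum_j (u 0 i * v 0 j) *: chr G z (ebase i) (ebase j).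
Proof.
move=> mG; rewrite {1}(row_ebase u) chr_suml//; apply: eq_bigr => i _.
rewrite chrZl// chrC// {1}(row_ebase v) chr_suml// scaler_sumr.
by apply: eq_bigr => j _; rewrite chrZl// scalerA chrC.
Qed.

Lemma smooth_chr_const G z u v : metric_near G z ->
  smooth_near (fun z => chr G z u v) z.
Proof.
move=> mG; have [sG _] := mG.
have sD a : smooth_near (Dv a G) z by exact: smooth_Dv.
rewrite unlock; apply: smooth_mulmx; last first.
  by apply: smooth_invmx => //; exact/posdef_unit/metric_nearW.
apply: smooth_mx => i l.
pose h z := 2^-1 * (bil (Dv u G z) v (ebase l) + bil (Dv v G z) u (ebase l)
                   - bil (Dv (ebase l) G z) u v).
apply: (smooth_ext (f := h)) => [z'|]; first by rewrite mxE.
apply: smoothM; first exact: smooth_cst.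
by apply: smoothB; [apply: smoothD|]; apply: smooth_bil => //; exact: smooth_cst.
Qed.

End Christoffel.

HB.lock Definition dchr {R : realType} {m : nat} (G : 'rV[R]_m -> 'M[R]_m)
  (z a u v : 'rV[R]_m) : 'rV[R]_m := Dv a (fun z => chr G z u v) z.

(* The Riemann tensor [R(a, b)w] of the metric [G] at [z]. *)
HB.lock Definition Rm {R : realType} {m : nat} (G : 'rV[R]_m -> 'M[R]_m)
  (z a b w : 'rV[R]_m) : 'rV[R]_m :=
  dchr G z a b w - dchr G z b a w + chr G z a (chr G z b w) - chr G z b (chr G z a w).

Section Riemann.
Context {R : realType} {m : nat}.
Implicit Types (G : 'rV[R]_m -> 'M[R]_m) (z u v w a b : 'rV[R]_m).

Lemma dchrE G z a u v : dchr G z a u v = Dv a (fun z => chr G z u v) z.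
Proof. by rewrite unlock. Qed.

Lemma RmE G z a b w : Rm G z a b w =
  dchr G z a b w - dchr G z b a w + chr G z a (chr G z b w) - chr G z b (chr G z a w).
Proof. by rewrite Rm.unlock. Qed.

Lemma chr_const_diff G z u v : metric_near G z ->
  differentiable (fun z => chr G z u v) z.
Proof. by move=> mG; apply: smooth_differentiable_mx; exact: smooth_chr_const. Qed.

Lemma dchrDa G z a a' u v : metric_near G z ->
  dchr G z (a + a') u v = dchr G z a u v + dchr G z a' u v.
Proof. by move=> mG; rewrite !dchrE (DvDdir _ _ (chr_const_diff u v mG)). Qed.

Lemma dchrZa G z k a u v : metric_near G z ->
  dchr G z (k *: a) u v = k *: dchr G z a u v.
Proof. by move=> mG; rewrite !dchrE (DvZdir _ _ (chr_const_diff u v mG)). Qed.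

Lemma dchrC G z a u v : metric_near G z -> dchr G z a u v = dchr G z a v u.
Proof.
move=> /near_metric mG; rewrite !dchrE; apply: Dv_near; apply: filterS mG => z' mG.
exact: chrC.
Qed.

Lemma dchrDl G z a u u' v : metric_near G z ->
  dchr G z a (u + u') v = dchr G z a u v + dchr G z a u' v.
Proof.
move=> mG; rewrite !dchrE -(DvD a (smooth_chr_const u v mG) (smooth_chr_const u' v mG)).
by apply: Dv_near; apply: filterS (near_metric mG) => z' mG'; rewrite chrDl.
Qed.

Lemma dchrZl G z a k u v : metric_near G z ->
  dchr G z a (k *: u) v = k *: dchr G z a u v.
Proof.
move=> mG; have := Dv_scale a (smooth_cst k z) (smooth_chr_const u v mG).
rewrite Dv_cst scale0r add0r !dchrE => <-.
by apply: Dv_near; apply: filterS (near_metric mG) => z' mG'; rewrite chrZl.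
Qed.

Lemma RmC G z a b w : Rm G z a b w = - Rm G z b a w.
Proof. by rewrite !RmE; vring. Qed.

Lemma RmDa G z a a' b w : metric_near G z ->
  Rm G z (a + a') b w = Rm G z a b w + Rm G z a' b w.
Proof. by move=> mG; rewrite !RmE dchrDa// dchrDl// !chrDl// chrDr//; vring. Qed.

Lemma RmZa G z k a b w : metric_near G z -> Rm G z (k *: a) b w = k *: Rm G z a b w.
Proof. by move=> mG; rewrite !RmE dchrZa// dchrZl// !chrZl// chrZr//; vring. Qed.

Lemma RmDb G z a b b' w : metric_near G z ->
  Rm G z a (b + b') w = Rm G z a b w + Rm G z a b' w.
Proof. by move=> mG; rewrite !(RmC _ _ a) RmDa// opprD. Qed.

Lemma RmZb G z k a b w : metric_near G z -> Rm G z a (k *: b) w = k *: Rm G z a b w.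
Proof. by move=> mG; rewrite !(RmC _ _ a) RmZa// scalerN. Qed.

Lemma Rm_bianchi G z a b w : metric_near G z ->
  Rm G z a b w + Rm G z b w a + Rm G z w a b = 0.
Proof.
move=> mG; rewrite !RmE (dchrC a w b)// (dchrC b w a)// (dchrC w b a)//.
by rewrite (chrC w b mG) (chrC w a mG) (chrC b a mG); vring.
Qed.

End Riemann.

(** The connection pulled back by an arbitrary map [z]: with [z] the identity it is the ambient
    connection, with [z] an immersion the connection along the hypersurface. One calculus serves
    both. *)
HB.lock Definition nabla {R : realType} {n m : nat} (G : 'rV[R]_m -> 'M[R]_m)
    (z V : 'rV[R]_n -> 'rV[R]_m) (y v : 'rV[R]_n) : 'rV[R]_m :=
  Dv v V y + chr G (z y) (Dv v z y) (V y).

Section Nabla.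
Context {R : realType} {n m : nat}.
Variables (G : 'rV[R]_m -> 'M[R]_m) (z : 'rV[R]_n -> 'rV[R]_m).
Implicit Types (y u v : 'rV[R]_n) (V W : 'rV[R]_n -> 'rV[R]_m).
Local Notation nabla := (nabla G z).

Lemma nablaE V y v : nabla V y v = Dv v V y + chr G (z y) (Dv v z y) (V y).
Proof. by rewrite unlock. Qed.

Lemma near_metric_along y : smooth_near z y -> metric_near G (z y) ->
  \forall y' \near y, metric_near G (z y').
Proof. by move=> sz mG; exact: (smooth_continuous sz) (near_metric mG). Qed.

Lemma smooth_metric_along y : smooth_near z y -> metric_near G (z y) ->
  smooth_near (fun y => G (z y)) y.
Proof. by move=> sz [sG _]; exact: (smooth_comp sz sG). Qed.

Lemma chr_sum_near y (U V : 'rV[R]_n -> 'rV[R]_m) :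
  smooth_near z y -> metric_near G (z y) ->
  \forall y' \near y, chr G (z y') (U y') (V y') =
    \sum_i \sum_j (U y' 0 i * V y' 0 j) *: chr G (z y') (ebase i) (ebase j).
Proof.
move=> sz mG; have := near_metric_along sz mG.
by apply: filterS => y' mG'; exact: chr_sumE.
Qed.

Lemma smooth_chr_term y (U V : 'rV[R]_n -> 'rV[R]_m) i j :
  smooth_near z y -> metric_near G (z y) -> smooth_near U y -> smooth_near V y ->
  smooth_near (fun y => (U y 0 i * V y 0 j) *: chr G (z y) (ebase i) (ebase j)) y.
Proof.
move=> sz mG sU sV; apply: smooth_scale.
  by apply: smoothM; exact: smooth_entry.
by apply: (smooth_comp (f := fun z => chr G z (ebase i) (ebase j)) sz); exact: smooth_chr_const.
Qed.

Lemma smooth_chr y (U V : 'rV[R]_n -> 'rV[R]_m) :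
  smooth_near z y -> metric_near G (z y) -> smooth_near U y -> smooth_near V y ->
  smooth_near (fun y => chr G (z y) (U y) (V y)) y.
Proof.
move=> sz mG sU sV.
apply: (eq_smooth (f := fun y => \sum_i \sum_j (U y 0 i * V y 0 j) *:
                          chr G (z y) (ebase i) (ebase j))).
  by apply: filterS (chr_sum_near U V sz mG) => y' ->.
apply: smooth_sum => i _; apply: smooth_sum => j _; exact: smooth_chr_term.
Qed.

Lemma Dv_chr y v (U V : 'rV[R]_n -> 'rV[R]_m) :
  smooth_near z y -> metric_near G (z y) -> smooth_near U y -> smooth_near V y ->
  Dv v (fun y => chr G (z y) (U y) (V y)) y =
  dchr G (z y) (Dv v z y) (U y) (V y) + chr G (z y) (Dv v U y) (V y)
  + chr G (z y) (U y) (Dv v V y).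
Proof.
move=> sz mG sU sV.
have sg i j : smooth_near (fun z => chr G z (ebase i) (ebase j)) (z y).
  exact: smooth_chr_const.
have st i j := smooth_chr_term i j sz mG sU sV.
have dchr_sum : dchr G (z y) (Dv v z y) (U y) (V y) =
    \sum_i \sum_j (U y 0 i * V y 0 j) *: dchr G (z y) (Dv v z y) (ebase i) (ebase j).
  rewrite dchrE (Dv_near _ (_ : \forall z' \near z y, chr G z' (U y) (V y) =
    \sum_i \sum_j (U y 0 i * V y 0 j) *: chr G z' (ebase i) (ebase j))); last first.
    by apply: filterS (near_metric mG) => z' mG'; exact: chr_sumE.
  have sc i j : smooth_near (fun z' => (U y 0 i * V y 0 j) *: chr G z' (ebase i) (ebase j)) (z y).
    by apply: smooth_scale; [exact: smooth_cst|exact: sg].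
  rewrite Dv_sum => [|i]; last by apply: smooth_sum => j _; exact: sc.
  apply: eq_bigr => i _; rewrite Dv_sum => [|j]; last exact: sc.
  apply: eq_bigr => j _.
  by rewrite (Dv_scale _ (smooth_cst _ _) (sg i j)) Dv_cst scale0r add0r dchrE.
rewrite (Dv_near _ (chr_sum_near U V sz mG)).
rewrite dchr_sum (chr_sumE (Dv v U y) _ mG) (chr_sumE _ (Dv v V y) mG) -!big_split/=.
rewrite Dv_sum => [|i]; last by apply: smooth_sum => j _; exact: st.
apply: eq_bigr => i _; rewrite Dv_sum => [|j]; last exact: st.
rewrite -!big_split/=; apply: eq_bigr => j _.
have sUi := smooth_entry 0 i sU; have sVj := smooth_entry 0 j sV.
rewrite (Dv_scale v (smoothM sUi sVj) (smooth_comp sz (sg i j))) (DvM v sUi sVj).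
have -> : Dv v (fun y => chr G (z y) (ebase i) (ebase j)) y =
   dchr G (z y) (Dv v z y) (ebase i) (ebase j).
  by rewrite (Dv_comp v sz (chr_const_diff (ebase i) (ebase j) mG)) dchrE.
rewrite (Dv_entry v 0 i sU) (Dv_entry v 0 j sV) /=; vring.
Qed.

Lemma nabla_compat y v V W :
  smooth_near z y -> metric_near G (z y) -> smooth_near V y -> smooth_near W y ->
  Dv v (fun y => bil (G (z y)) (V y) (W y)) y =
  bil (G (z y)) (nabla V y v) (W y) + bil (G (z y)) (V y) (nabla W y v).
Proof.
move=> sz mG sV sW.
rewrite (Dv_bil v (smooth_metric_along sz mG) sV sW) (Dv_comp v sz (metric_diff mG)).
by rewrite chr_compat// !nablaE bilDl bilDr; ring.
Qed.

Lemma nabla_torsion y u v : smooth_near z y -> metric_near G (z y) ->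
  nabla (Dv v z) y u = nabla (Dv u z) y v.
Proof. by move=> sz mG; rewrite !nablaE Dv_schwarz// chrC. Qed.

Lemma smooth_nabla y v V : smooth_near z y -> metric_near G (z y) ->
  smooth_near V y -> smooth_near (fun y => nabla V y v) y.
Proof.
move=> sz mG sV; rewrite unlock; apply: smoothD; first exact: smooth_Dv.
by apply: smooth_chr => //; exact: smooth_Dv.
Qed.

(** The directions [u] and [v] are constant in the source and commute, hence no bracket term. Second
    derivatives of [V] and of [z] cancel by symmetry; what is left are the derivatives and products
    of Christoffel symbols. Applied to a unit normal, this is the source of the Codazzi equation. *)
Lemma nabla_curvature y u v V : smooth_near z y -> metric_near G (z y) ->
  smooth_near V y ->
  nabla (fun y => nabla V y v) y u - nabla (fun y => nabla V y u) y v =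
  Rm G (z y) (Dv u z y) (Dv v z y) (V y).
Proof.
move=> sz mG sV.
have E a b : nabla (fun y => nabla V y b) y a =
    Dv a (Dv b V) y + (dchr G (z y) (Dv a z y) (Dv b z y) (V y)
      + chr G (z y) (Dv a (Dv b z) y) (V y) + chr G (z y) (Dv b z y) (Dv a V y))
    + chr G (z y) (Dv a z y) (Dv b V y)
    + chr G (z y) (Dv a z y) (chr G (z y) (Dv b z y) (V y)).
  rewrite [LHS]nablaE nablaE chrDr// addrA; congr (_ + _ + _).
  rewrite -(Dv_chr a sz mG (smooth_Dv b sz) sV).
  rewrite -DvD; first by congr (Dv _ _ _); apply/funext => y'; rewrite nablaE.
    exact: smooth_Dv.
  by apply: smooth_chr => //; exact: smooth_Dv.
by rewrite !E (Dv_schwarz u v sV) (Dv_schwarz u v sz) RmE; vring.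
Qed.

Lemma nablaD y v V W : metric_near G (z y) -> smooth_near V y -> smooth_near W y ->
  nabla (fun y => V y + W y) y v = nabla V y v + nabla W y v.
Proof. by move=> mG sV sW; rewrite !nablaE chrDr// DvD//; vring. Qed.

Lemma nablaZ y v (a : 'rV[R]_n -> R) V : metric_near G (z y) ->
  smooth_near a y -> smooth_near V y ->
  nabla (fun y => a y *: V y) y v = Dv v a y *: V y + a y *: nabla V y v.
Proof. by move=> mG sa sV; rewrite !nablaE chrZr// scalerDr addrA Dv_scale. Qed.

Lemma nablaN y v V : metric_near G (z y) -> smooth_near V y ->
  nabla (fun y => - V y) y v = - nabla V y v.
Proof.
move=> mG sV; rewrite !nablaE DvN// -(scaleN1r (V y)) chrZr//; vring.
Qed.

Lemma nabla_sum y v (I : Type) (r : seq I) (F : I -> 'rV[R]_n -> 'rV[R]_m) :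
  metric_near G (z y) -> (forall i, smooth_near (F i) y) ->
  nabla (fun y => \sum_(i <- r) F i y) y v = \sum_(i <- r) nabla (F i) y v.
Proof.
move=> mG sF; elim: r => [|i r IH].
  rewrite big_nil (_ : (fun _ => _) = fun=> 0); last by apply/funext => ?; rewrite big_nil.
  by rewrite nablaE Dv_cst chr0r// addr0.
rewrite big_cons -IH -nablaD//; last exact: smooth_sum.
by congr nabla; apply/funext => ?; rewrite big_cons.
Qed.

Lemma nabla_near y v V W : (\forall y' \near y, V y' = W y') ->
  nabla V y v = nabla W y v.
Proof. by move=> VW; rewrite !nablaE (Dv_near _ VW) (nbhs_singleton VW). Qed.

Lemma nabla_dirD y u v V : smooth_near z y -> metric_near G (z y) -> smooth_near V y ->
  nabla V y (u + v) = nabla V y u + nabla V y v.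
Proof.
move=> sz mG sV; rewrite !nablaE (DvDdir u v (smooth_differentiable_mx sV)).
by rewrite (DvDdir u v (smooth_differentiable_mx sz)) chrDl//; vring.
Qed.

Lemma nabla_dirZ y k v V : smooth_near z y -> metric_near G (z y) -> smooth_near V y ->
  nabla V y (k *: v) = k *: nabla V y v.
Proof.
move=> sz mG sV; rewrite !nablaE (DvZdir k v (smooth_differentiable_mx sV)).
by rewrite (DvZdir k v (smooth_differentiable_mx sz)) chrZl//; vring.
Qed.

Lemma nabla_dir_sum y v V : smooth_near z y -> metric_near G (z y) -> smooth_near V y ->
  nabla V y v = \sum_i v 0 i *: nabla V y (ebase i).
Proof.
move=> sz mG sV; rewrite {1}(row_ebase v).
elim: (index_enum _) => [|i r IH]; last by rewrite !big_cons nabla_dirD// nabla_dirZ// IH.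
by rewrite !big_nil; have := nabla_dirZ 0 0 sz mG sV; rewrite !scale0r.
Qed.

End Nabla.

Section RmSymmetries.
Context {R : realType} {m : nat}.
Variables (G : 'rV[R]_m -> 'M[R]_m).
Implicit Types (z u v w a b : 'rV[R]_m).

(** For constant [v] and [w] the function [bil (G z) v w] has symmetric second derivatives. Metric
    compatibility turns their difference into the two curvature terms, the mixed products
    cancelling. *)
Lemma Rm_metric z a b v w : metric_near G z ->
  bil (G z) (Rm G z a b v) w = - bil (G z) v (Rm G z a b w).
Proof.
move=> mG; pose i := fun z : 'rV[R]_m => z; have si y : smooth_near i y := smooth_id y.
have nc c u z' : nabla G i (fun=> u) z' c = chr G z' c u.
  by rewrite nablaE Dv_cst add0r Dv_id.
have nn c u d : nabla G i (fun z => nabla G i (fun=> u) z c) z d =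
    nabla G i (fun z => chr G z c u) z d.
  by congr nabla; apply/funext => z'; exact: nc.
pose g z := bil (G z) v w.
have sg : smooth_near g z.
  by apply: smooth_bil; [case: mG|exact: smooth_cst|exact: smooth_cst].
have Dg c : \forall z' \near z, Dv c g z' =
    bil (G z') (chr G z' c v) w + bil (G z') v (chr G z' c w).
  apply: filterS (near_metric mG) => z' mG'.
  have := nabla_compat c (si z') mG' (smooth_cst v z') (smooth_cst w z').
  by rewrite !nc.
have sX c u : smooth_near (fun z => chr G z c u) z by exact: smooth_chr_const.
have DDg c d : Dv d (Dv c g) z =
  bil (G z) (nabla G i (fun z => nabla G i (fun=> v) z c) z d) w
  + bil (G z) (chr G z c v) (chr G z d w)
  + (bil (G z) (chr G z d v) (chr G z c w)
  + bil (G z) v (nabla G i (fun z => nabla G i (fun=> w) z c) z d)).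
  rewrite (Dv_near _ (Dg c)) DvD; last 2 first.
  - by apply: smooth_bil => //; [case: mG|exact: smooth_cst].
  - by apply: smooth_bil => //; [case: mG|exact: smooth_cst].
  have := nabla_compat d (si z) mG (sX c v) (smooth_cst w z).
  have := nabla_compat d (si z) mG (smooth_cst v z) (sX c w).
  by rewrite !nc /i => -> ->; rewrite !nn.
have := Dv_schwarz1 a b sg; rewrite !DDg.
have := nabla_curvature a b (si z) mG (smooth_cst v z).
have := nabla_curvature a b (si z) mG (smooth_cst w z).
by rewrite !Dv_id => <- <-; rewrite bilBl bilBr; lra.
Qed.

(* Ric(xi, .) = 0 for parallel xi: the trilinear form <R(u, xi)w, x> is then
   symmetric in [(u, w)] and skew in [(w, x)]. *)
Lemma Rm_parallel z xi u w : metric_near G z ->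
  (forall a b, Rm G z a b xi = 0) -> Rm G z u xi w = 0.
Proof.
move=> mG Rxi; pose T a b c := bil (G z) (Rm G z a xi b) c.
have Tsym a b c : T a b c = T b a c.
  have := Rm_bianchi a xi b mG; rewrite Rxi addr0 => /eqP; rewrite addr_eq0 => /eqP E.
  by rewrite /T E -RmC.
have GT : (G z)^T = G z by have [] := metric_nearW mG.
have Tskew a b c : T a b c = - T a c b.
  by rewrite /T Rm_metric// (bilC b _ GT).
apply: (bil_inj (posdef_unit (metric_nearW mG))) => x; rewrite bil0l -/(T u w x).
have := Tskew u w x; have := Tsym u x w; have := Tskew x u w.
by have := Tsym x w u; have := Tskew w x u; have := Tsym w u x; lra.
Qed.

End RmSymmetries.

Section ChristoffelTransform.
Context {R : realType} {m : nat}.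
Variables (G G0 : 'rV[R]_m -> 'M[R]_m) (phi : 'rV[R]_m -> 'rV[R]_m).

(** Christoffel symbols fail to be tensorial by the second derivative of the coordinate change. The
    Koszul formulas of the two metrics agree against every [Dv w phi z], and these vectors fill the
    space because the Jacobian is invertible. *)
Lemma chr_transform (z u v : 'rV[R]_m) :
  smooth_near phi z -> metric_near G (phi z) -> metric_near G0 z ->
  'J phi z \in unitmx ->
  (\forall z' \near z, forall a b,
     bil (G0 z') a b = bil (G (phi z')) (Dv a phi z') (Dv b phi z')) ->
  Dv (chr G0 z u v) phi z =
  chr G (phi z) (Dv u phi z) (Dv v phi z) + Dv u (Dv v phi) z.
Proof.
move=> sphi mG mG0 uJ GE.
have dphi := smooth_differentiable_mx sphi.
have GT : (G (phi z))^T = G (phi z) by have [] := metric_nearW mG.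
have DG0 c a b : bil (Dv c G0 z) a b =
    bil (Dv (Dv c phi z) G (phi z)) (Dv a phi z) (Dv b phi z)
    + bil (G (phi z)) (Dv c (Dv a phi) z) (Dv b phi z)
    + bil (G (phi z)) (Dv a phi z) (Dv c (Dv b phi) z).
  have := Dv_bil c mG0.1 (smooth_cst a z) (smooth_cst b z).
  rewrite !Dv_cst bil0l bil0r !addr0 => <-.
  have nE : \forall z' \near z, bil (G0 z') a b =
      bil (G (phi z')) (Dv a phi z') (Dv b phi z') by apply: filterS GE => z' ->.
  rewrite (Dv_near _ nE).
  rewrite (Dv_bil c (smooth_metric_along sphi mG) (smooth_Dv a sphi) (smooth_Dv b sphi)).
  by rewrite (Dv_comp c sphi (metric_diff mG)).
have key w : bil (G (phi z)) (Dv (chr G0 z u v) phi z) (Dv w phi z) =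
    bil (G (phi z)) (chr G (phi z) (Dv u phi z) (Dv v phi z) + Dv u (Dv v phi) z)
      (Dv w phi z).
  have := koszul u v w mG0; have := koszul (Dv u phi z) (Dv v phi z) (Dv w phi z) mG.
  rewrite (nbhs_singleton GE) !DG0 bilDl.
  rewrite (Dv_schwarz v u sphi) (Dv_schwarz w u sphi) (Dv_schwarz w v sphi).
  rewrite (bilC (Dv u phi z) (Dv v (Dv w phi) z) GT).
  rewrite (bilC (Dv v phi z) (Dv u (Dv w phi) z) GT).
  rewrite (bilC (Dv u (Dv w phi) z) _ GT) (bilC (Dv v (Dv w phi) z) _ GT); lra.
apply: (bil_inj (posdef_unit (metric_nearW mG))) => w.
have := key (w *m invmx ('J phi z)).
by rewrite -[Dv (w *m _) phi z](Dv_jacobian _ dphi) mulmxKV.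
Qed.

End ChristoffelTransform.

(** * Immersions in coordinates *)

Section Pullback.
Context {R : realType} {n m : nat}.
Variables (G : 'rV[R]_m -> 'M[R]_m) (z : 'rV[R]_n -> 'rV[R]_m).
Implicit Types (y u v : 'rV[R]_n) (W : 'rV[R]_n -> 'rV[R]_n).

Definition pullback y : 'M[R]_n := 'J z y *m G (z y) *m ('J z y)^T.

Definition immersed_at y :=
  [/\ smooth_near z y, metric_near G (z y) & forall v, Dv v z y = 0 -> v = 0].

Definition immersed y := \forall y' \near y, immersed_at y'.

Lemma immersedW y : immersed y -> immersed_at y.
Proof. exact: nbhs_singleton. Qed.

Lemma bil_pullback y u v : smooth_near z y ->
  bil (pullback y) u v = bil (G (z y)) (Dv u z y) (Dv v z y).
Proof.
move=> /smooth_differentiable_mx dz.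
by rewrite -bil_mulmx !(Dv_jacobian _ dz).
Qed.

Lemma smooth_pullback y : immersed_at y -> smooth_near pullback y.
Proof.
move=> [sz mG _]; have sJ := smooth_jacobian sz.
apply: smooth_mulmx; last exact: smooth_trmx.
by apply: smooth_mulmx => //; exact: smooth_metric_along.
Qed.

Lemma posdef_pullback y : immersed_at y -> posdef (pullback y).
Proof.
move=> [sz mG inj]; have [GT Gp] := metric_nearW mG; split.
  by rewrite /pullback !trmx_mul trmxK GT mulmxA.
move=> v v0; rewrite -bilE bil_pullback//; apply: posdef_bil_gt0 => //.
by apply: contra_neq v0; exact: inj.
Qed.

Definition push (W : 'rV[R]_n -> 'rV[R]_n) y := Dv (W y) z y.

Definition Qmx (V : 'rV[R]_n -> 'rV[R]_m) y : 'M[R]_n :=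
  \matrix_(i, j) bil (G (z y)) (nabla G z V y (ebase i)) (Dv (ebase j) z y).

(* The divergence of [W]: the trace of [u |-> nabla_u (dz W)] over the tangent
   spaces of the immersed manifold. *)
Definition tau (W : 'rV[R]_n -> 'rV[R]_n) y := \tr (invmx (pullback y) *m Qmx (push W) y).

(** The Christoffel symbols of the first kind of the induced metric, that is, the tangential
    components of the second covariant derivatives of [z]. Adding the transpose gives the derivative
    of [pullback] in the direction [k], by metric compatibility and symmetry in the lower
    indices. *)
Definition Tmx k y : 'M[R]_n := Qmx (Dv (ebase k) z) y.

Lemma pushE W y : smooth_near z y ->
  push W y = \sum_k W y 0 k *: Dv (ebase k) z y.
Proof. by move=> sz; rewrite /push (Dv_dir_sum _ (smooth_differentiable_mx sz)). Qed.

Lemma push_near W y : immersed y ->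
  \forall y' \near y, push W y' = \sum_k W y' 0 k *: Dv (ebase k) z y'.
Proof. by apply: filterS => y' [sz _ _]; exact: pushE. Qed.

Lemma Tmx_torsion k y i j : smooth_near z y -> metric_near G (z y) ->
  Tmx k y i j = bil (G (z y)) (nabla G z (Dv (ebase i) z) y (ebase k)) (Dv (ebase j) z y).
Proof. by move=> sz mG; rewrite mxE nabla_torsion. Qed.

Lemma pullback_entry y i j : smooth_near z y ->
  pullback y i j = bil (G (z y)) (Dv (ebase i) z y) (Dv (ebase j) z y).
Proof. by move=> sz; rewrite -bil_pullback// bilE /ebase trmx_delta -colE -rowE !mxE. Qed.

Lemma Dv_pullback k y : immersed y ->
  Dv (ebase k) pullback y = Tmx k y + (Tmx k y)^T.
Proof.
move=> iy; have [sz mG inj] := immersedW iy.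
have GT : (G (z y))^T = G (z y) by have [] := metric_nearW mG.
apply/matrixP => i j; rewrite (Dv_entry _ _ _ (smooth_pullback (immersedW iy))).
rewrite (@Dv_near _ _ _ _ _ (fun y => bil (G (z y)) (Dv (ebase i) z y) (Dv (ebase j) z y))).
  rewrite (nabla_compat _ sz mG (smooth_Dv _ sz) (smooth_Dv _ sz)).
  by rewrite [RHS]mxE [(Tmx k y)^T i j]mxE !Tmx_torsion// (bilC (Dv (ebase i) z y) _ GT).
by apply: filterS iy => y' [sz' _ _]; exact: pullback_entry.
Qed.

(** The first term differentiates the components of [W], the second the coordinate frame. *)
Lemma Qmx_push W y : immersed y -> smooth_near W y ->
  Qmx (push W) y =
  (\matrix_(i, k) Dv (ebase i) (fun y => W y 0 k) y) *m pullback y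
  + \sum_k W y 0 k *: Tmx k y.
Proof.
move=> iy sW; have [sz mG inj] := immersedW iy.
apply/matrixP => i j; rewrite mxE.
rewrite (nabla_near _ _ _ (push_near W iy)).
have sk k := smooth_entry 0 k sW.
rewrite nabla_sum => [|//|k]; last by apply: smooth_scale => //; exact: smooth_Dv.
rewrite bil_suml [RHS]mxE [X in X + _]mxE [X in _ + X]summxE -big_split/=.
apply: eq_bigr => k _.
rewrite (nablaZ _ mG (sk k) (smooth_Dv _ sz)) bilDl !bilZl.
by rewrite [X in _ = X * _ + _]mxE pullback_entry// [X in _ = _ + X]mxE [Tmx k y i j]mxE.
Qed.

Lemma tr_mul_sum (B : 'M[R]_n) (c : 'I_n -> R) (F : 'I_n -> 'M[R]_n) :
  \tr (B *m \sum_k c k *: F k) = \sum_k c k * \tr (B *m F k).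
Proof.
rewrite mulmx_sumr raddf_sum; apply: eq_bigr => k _ /=.
by rewrite -scalemxAr mxtraceZ.
Qed.

Lemma Dv_mxtrace (F : 'rV[R]_n -> 'M[R]_m) y v : smooth_near F y ->
  Dv v (fun y => \tr (F y)) y = \tr (Dv v F y).
Proof.
move=> sF; rewrite /mxtrace Dv_sum => [|i]; last exact: smooth_entry.
by apply: eq_bigr => i _; rewrite (Dv_entry _ _ _ sF).
Qed.

Lemma mulr_sum_add (s : R) (a b c : 'I_n -> R) :
  (forall k, c k = s * (a k + b k)) -> \sum_k c k = s * (\sum_k a k + \sum_k b k).
Proof. by move=> E; rewrite -big_split mulr_sumr; apply: eq_bigr. Qed.

Lemma adj_invmx (B : 'M[R]_n) : B \in unitmx -> \adj B = \det B *: invmx B.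
Proof.
move=> uB; rewrite /invmx uB scalerA mulfV ?scale1r//.
by rewrite -unitfE -unitmxE.
Qed.

(** By Jacobi's formula the trace of [invmx (pullback y) *m Tmx k y] is the logarithmic derivative
    of the volume density in the direction [k], and these same traces multiply the components of [W]
    in [tau]. So the divergence in coordinates is a trace of ambient covariant derivatives. *)
Lemma divergence_formula W y : immersed y -> smooth_near W y ->
  \sum_k Dv (ebase k) (fun y => Num.sqrt (\det (pullback y)) * W y 0 k) y =
  Num.sqrt (\det (pullback y)) * tau W y.
Proof.
move=> iy sW; have i0 := immersedW iy; have pP := posdef_pullback i0.
have uP := posdef_unit pP; have dP := posdef_det_gt0 pP.
have sP := smooth_pullback i0; have sd := smooth_det sP.
have ss := @smooth_sqrt _ _ (fun y => \det (pullback y)) y dP sd.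
have PT : (pullback y)^T = pullback y by case: pP.
have s0 : Num.sqrt (\det (pullback y)) != 0 by rewrite gt_eqF// sqrtr_gt0.
have trT k : \tr (invmx (pullback y) *m (Tmx k y)^T) = \tr (invmx (pullback y) *m Tmx k y).
  by rewrite -[RHS]mxtrace_tr trmx_mul trmx_inv PT mxtrace_mulC.
have Dsq k : Dv (ebase k) (fun y => Num.sqrt (\det (pullback y))) y =
    Num.sqrt (\det (pullback y)) * \tr (invmx (pullback y) *m Tmx k y).
  rewrite (@Dv_sqrt _ _ (ebase k) (fun y => \det (pullback y)) y dP sd) (Dv_det _ sP) (adj_invmx uP) (Dv_pullback _ iy).
  rewrite -scalemxAl mxtraceZ mulmxDr mxtraceD trT.
  rewrite -[X in X * _ / _](@sqr_sqrtr _ (\det (pullback y))) ?(ltW dP)//.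
  by move: (\tr _) => t; field.
rewrite /tau (Qmx_push iy sW) mulmxDr mxtraceD mulmxA mxtrace_mulC mulKVmx//.
rewrite tr_mul_sum.
have -> : \tr (\matrix_(i, k) Dv (ebase i) (fun y => W y 0 k) y) =
    \sum_k Dv (ebase k) (fun y => W y 0 k) y.
  by apply: eq_bigr => k _; rewrite mxE.
apply: mulr_sum_add => k.
rewrite (DvM _ ss (smooth_entry 0 k sW)) Dsq /=.
by move: (Dv _ _ _) (\tr _) (Num.sqrt _) => a b c; ring.
Qed.

End Pullback.

(** The trace is computed in the frame made of the unit normal [nu] and the rows of [E]. Stacked
    into [F], this frame has a block diagonal Gram matrix with blocks 1 and [P], whence the explicit
    inverse [A *m F^T *m D]. *)
Lemma trace_frame {R : realType} n (L A : 'M[R]_n.+1) (E : 'M[R]_(n, n.+1)) (nu : 'rV[R]_n.+1) :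
  posdef A -> E *m A *m E^T \in unitmx -> nu *m A *m nu^T = 1%:M ->
  nu *m A *m E^T = 0 ->
  \tr L = \tr (invmx (E *m A *m E^T) *m (E *m L *m A *m E^T)) + bil A (nu *m L) nu.
Proof.
move=> [AT _] uP nn nE; set P := E *m A *m E^T in uP *.
pose F : 'M[R]_(1 + n, n.+1) := col_mx nu E.
have En : E *m A *m nu^T = 0.
  by apply: (can_inj trmxK); rewrite !trmx_mul trmxK AT trmx0 mulmxA.
pose D : 'M[R]_(1 + n) := block_mx 1%:M 0 0 (invmx P).
have FAF : F *m A *m F^T = block_mx 1%:M 0 0 P.
  by rewrite /F tr_col_mx mul_col_mx mul_col_row nn nE En.
have FI : F *m (A *m F^T *m D) = 1%:M.
  rewrite !mulmxA FAF /D mulmx_block !(mul1mx, mulmx0, mul0mx, addr0, add0r) mulmxV//.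
  by rewrite -scalar_mx_block.
have IF : (A *m F^T *m D) *m F = 1%:M by exact: mulmx1C.
have -> : \tr L = \tr (F *m L *m (A *m F^T *m D)).
  by rewrite mxtrace_mulC mulmxA IF mul1mx.
rewrite !mulmxA mxtrace_mulC /F tr_col_mx (mul_col_mx _ _ L) (mul_col_mx _ _ A).
rewrite mul_col_row /D mulmx_block.
rewrite !(mul1mx, mulmx0, mul0mx, addr0, add0r) mxtrace_block addrC; congr (_ + _).
  by rewrite !mulmxA.
by rewrite bilE /mxtrace big_ord1.
Qed.

(** * Hypersurfaces in coordinates: the unit normal and the two divergences *)

Section LocalHypersurface.
Context {R : realType} {n : nat}.
Local Notation m := n.+1.
Variables (G : 'rV[R]_m -> 'M[R]_m) (z nu : 'rV[R]_n -> 'rV[R]_m).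
Implicit Types (y u v : 'rV[R]_n).
Local Notation P := (pullback G z).
Local Notation nabla := (nabla G z).

Definition normal_at y := [/\ smooth_near nu y, bil (G (z y)) (nu y) (nu y) = 1
  & forall v, bil (G (z y)) (nu y) (Dv v z y) = 0].

Definition hyper y := immersed G z y /\ \forall y' \near y, normal_at y'.

(** Since the shape operator is minus the derivative of the normal, this matrix is the negative of
    the second fundamental form, which accounts for the signs below. *)
Definition Smx y := Qmx G z nu y.

Section At.
Variable y : 'rV[R]_n.
Hypothesis hy : hyper y.

Let iy : immersed G z y := hy.1.
Let i0 : immersed_at G z y := immersedW iy.
Let sz : smooth_near z y. Proof. by case: i0. Qed.
Let mG : metric_near G (z y). Proof. by case: i0. Qed.
Let GT : (G (z y))^T = G (z y). Proof. by have [] := metric_nearW mG. Qed.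
Let sn : smooth_near nu y. Proof. by have [] := nbhs_singleton hy.2. Qed.
Let nn : bil (G (z y)) (nu y) (nu y) = 1. Proof. by have [] := nbhs_singleton hy.2. Qed.
Let nt v : bil (G (z y)) (nu y) (Dv v z y) = 0. Proof. by have [] := nbhs_singleton hy.2. Qed.
Let PT : (P y)^T = P y. Proof. by have [] := posdef_pullback i0. Qed.
Let uP : P y \in unitmx. Proof. exact/posdef_unit/posdef_pullback. Qed.

(** Differentiating the orthogonality of [nu] and the coordinate tangent vectors moves the
    derivative onto the second derivatives of [z], which are symmetric. *)
Lemma Smx_sym : (Smx y)^T = Smx y.
Proof.
have key i j : bil (G (z y)) (nabla nu y (ebase i)) (Dv (ebase j) z y) =
    - bil (G (z y)) (nu y) (nabla (Dv (ebase j) z) y (ebase i)).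
  have := nabla_compat (ebase i) sz mG sn (smooth_Dv (ebase j) sz).
  rewrite (@Dv_near _ _ _ _ _ (fun=> (0 : R)) y); first by rewrite Dv_cst; lra.
  by apply: filterS hy.2 => y' [_ _ ->].
apply/matrixP => i j; rewrite mxE [LHS]mxE [RHS]mxE !key.
by rewrite (nabla_torsion (ebase i) (ebase j) sz mG).
Qed.

Lemma nabla_nu_normal v : bil (G (z y)) (nabla nu y v) (nu y) = 0.
Proof.
have := nabla_compat v sz mG sn sn.
rewrite (@Dv_near _ _ _ _ _ (fun=> (1 : R)) y); last by apply: filterS hy.2 => y' [_ ->].
by rewrite Dv_cst (bilC (nu y) _ GT); lra.
Qed.

Lemma bil_basis_inj a b :
  (forall j, bil (G (z y)) a (Dv (ebase j) z y) = bil (G (z y)) b (Dv (ebase j) z y)) ->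
  bil (G (z y)) a (nu y) = bil (G (z y)) b (nu y) -> a = b.
Proof.
move=> ht hn; apply: subr0_eq.
set c := a - b.
have ct j : bil (G (z y)) c (Dv (ebase j) z y) = 0 by rewrite bilBl ht subrr.
have cn : bil (G (z y)) c (nu y) = 0 by rewrite bilBl hn subrr.
have cE : c *m G (z y) *m ('J z y)^T = 0.
  apply/rowP => j; rewrite [RHS]mxE -(ct j) bilE -(Dv_jacobian _ (smooth_differentiable_mx sz)).
  by rewrite trmx_mul /ebase trmx_delta mulmxA -colE [RHS]mxE.
(* The trace of the rank one matrix [c^T *m c] is the sum of the squares of the coordinates of [c].
   In the frame of the hypersurface both contributions to it vanish, so [c] does. *)
have := @trace_frame _ _ (c^T *m c) _ _ (nu y) (metric_nearW mG) uP.
rewrite (_ : nu y *m _ *m _ = 1%:M); last first.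
  by apply/rowP => j; rewrite !ord1 -bilE nn mxE eqxx.
rewrite (_ : nu y *m _ *m _ = 0); last first.
  apply/rowP => j; rewrite [RHS]mxE -(nt (ebase j)) bilE -(Dv_jacobian _ (smooth_differentiable_mx sz)).
  by rewrite trmx_mul /ebase trmx_delta mulmxA -colE [RHS]mxE.
move=> /(_ erefl erefl).
have -> : 'J z y *m (c^T *m c) *m G (z y) *m ('J z y)^T = 0.
  by rewrite -!mulmxA [c *m (_ *m _)]mulmxA cE !mulmx0.
have -> : bil (G (z y)) (nu y *m (c^T *m c)) (nu y) = 0.
  rewrite bilE -!mulmxA [c *m (_ *m _)]mulmxA.
  rewrite (_ : c *m G (z y) *m (nu y)^T = 0) ?mulmx0 ?mxE//.
  by apply/rowP => j; rewrite !ord1 [RHS]mxE -cn bilE.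
rewrite mulmx0 mxtrace0 addr0 mxtrace_mulC /mxtrace big_ord1 mxE => c2.
apply/rowP => j; rewrite [RHS]mxE; apply/eqP; rewrite -sqrf_eq0.
have /allP : all (fun j => true ==> (c 0 j * c^T j 0 == 0)) (index_enum 'I_m).
  rewrite -psumr_eq0; first by apply/eqP; exact: c2.
  by move=> i _; rewrite [c^T i 0]mxE -expr2 sqr_ge0.
by move=> /(_ j (mem_index_enum _)) /=; rewrite [c^T j 0]mxE -expr2.
Qed.

(** Weingarten's equation: a unit field has derivatives orthogonal to itself, so those of the normal
    are tangent, and their components are found by pairing with the tangent basis. *)
Lemma nabla_nuE i : nabla nu y (ebase i) =
  \sum_k (Smx y *m invmx (P y)) i k *: Dv (ebase k) z y.
Proof.
apply: bil_basis_inj => [j|]; last first.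
  rewrite nabla_nu_normal bil_suml big1// => k _.
  by rewrite bilZl (bilC (Dv _ _ _) _ GT) nt mulr0.
rewrite bil_suml.
transitivity ((Smx y *m invmx (P y) *m P y) i j).
  by rewrite mulmxKV// [RHS]mxE.
by rewrite mxE; apply: eq_bigr => k _; rewrite bilZl pullback_entry.
Qed.

Section Tangential.
Variables (xi : 'rV[R]_n -> 'rV[R]_m) (a : R).
Hypothesis sxi : smooth_near xi y.
Hypothesis nxi : forall v, nabla xi y v = a *: Dv v z y.

Definition support_fun y' := bil (G (z y')) (xi y') (nu y').

Lemma smooth_support_fun : smooth_near support_fun y.
Proof. by apply: smooth_bil => //; exact: smooth_metric_along. Qed.

Lemma Dv_support_fun v : Dv v support_fun y = bil (G (z y)) (xi y) (nabla nu y v).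
Proof.
rewrite /support_fun (nabla_compat v sz mG sxi sn) nxi bilZl.
by rewrite (bilC (Dv _ _ _) _ GT) nt mulr0 add0r.
Qed.

Variable X : 'rV[R]_n -> 'rV[R]_n.
Hypothesis sX : smooth_near X y.
Hypothesis pX : \forall y' \near y, push z X y' = xi y' - support_fun y' *: nu y'.

(** The covariant derivative of [xi - f nu] is [a dz - df nu - f nabla nu], where [f] is the support
    function; pairing with tangent vectors kills the middle term. *)
Lemma Qmx_tangential : Qmx G z (push z X) y = a *: P y - support_fun y *: Smx y.
Proof.
apply/matrixP => i j; rewrite [LHS]mxE (nabla_near _ _ _ pX).
rewrite (@nablaD _ _ _ G z y _ xi (fun y => - (support_fun y *: nu y))) => //; last first.
  by apply: smoothN; apply: smooth_scale => //; exact: smooth_support_fun.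
rewrite (nablaN _ mG); last by apply: smooth_scale => //; exact: smooth_support_fun.
rewrite (nablaZ _ mG smooth_support_fun sn) nxi bilDl bilNl bilDl !bilZl nt mulr0 add0r.
transitivity (a * P y i j - support_fun y * Smx y i j).
  by rewrite pullback_entry// [Smx y i j]mxE.
by move: (P y) (Smx y) (support_fun y) => A B f; rewrite !mxE.
Qed.

Lemma tau_tangential : tau G z X y =
  a * n%:R - support_fun y * \tr (invmx (P y) *m Smx y).
Proof.
rewrite /tau Qmx_tangential mulmxBr -!scalemxAr mulVmx// mxtraceD mxtraceZ mxtrace1.
by rewrite raddfN/= mxtraceZ.
Qed.

End Tangential.

Section ShapeOfTangential.
Variables (xi : 'rV[R]_n -> 'rV[R]_m).
Hypothesis sxi : smooth_near xi y.
Hypothesis nxi : forall v, nabla xi y v = 0.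
Hypothesis Rxi : forall u w : 'rV[R]_m, Rm G (z y) u (xi y) w = 0.
Variable X : 'rV[R]_n -> 'rV[R]_n.
Hypothesis sX : smooth_near X y.
Hypothesis pX : \forall y' \near y, push z X y' = xi y' - support_fun xi y' *: nu y'.
Hypothesis minimal : \forall y' \near y, \tr (invmx (P y') *m Smx y') = 0.
Variable X2 : 'rV[R]_n -> 'rV[R]_n.
Hypothesis pX2 : \forall y' \near y, push z X2 y' = - nabla nu y' (X y').

Definition ricci_at := \tr (lin1_mx (fun u : 'rV[R]_m => Rm G (z y) u (nu y) (nu y))).

Let f := support_fun xi y.
Let Gi := invmx (P y).

Lemma smooth_Smx : smooth_near Smx y.
Proof.
apply: smooth_mx => i j.
apply: (smooth_ext (f := fun y => bil (G (z y)) (nabla nu y (ebase i)) (Dv (ebase j) z y))).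
  by move=> y'; rewrite mxE.
apply: smooth_bil; [exact: smooth_metric_along|exact: smooth_nabla|exact: smooth_Dv].
Qed.

Lemma Dv_invmx k : Dv (ebase k) (fun y => invmx (P y)) y = - (Gi *m Dv (ebase k) P y *m Gi).
Proof.
have sP := smooth_pullback i0; have sI := smooth_invmx uP sP.
have E : Dv (ebase k) (fun y => P y *m invmx (P y)) y = 0.
  rewrite -[RHS](Dv_cst (ebase k) (1%:M : 'M[R]_n) y); apply: Dv_near.
  by apply: filterS iy => y' /posdef_pullback/posdef_unit uP'; rewrite mulmxV.
move: E; rewrite (Dv_mulmx _ sP sI) /Gi.
move: (Dv _ _ _) (Dv _ _ _) => DP DI E.
have : invmx (P y) *m (DI *m invmx (P y) + P y *m DP) = 0 by rewrite E mulmx0.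
rewrite mulmxDr (mulmxA _ (P y)) (mulVmx uP) mul1mx.
by rewrite mulmxA => /eqP; rewrite addrC addr_eq0 => /eqP.
Qed.

Let Pk k : 'M[R]_n := \matrix_(i, j)
  bil (G (z y)) (nabla (fun y => nabla nu y (ebase i)) y (ebase k)) (Dv (ebase j) z y).

(** Minimality enters here: the trace of [invmx (P y) *m Smx y] vanishes near [y], hence so does its
    derivative in the direction [k]. The symmetry of [Smx] and [P] makes the terms from the
    derivative of the inverse metric equal to one another. *)
Lemma trace_Pk k : \tr (Gi *m Pk k) = \tr (Gi *m (Tmx G z k y)^T *m Gi *m Smx y).
Proof.
have sP := smooth_pullback i0; have sI := smooth_invmx uP sP.
have DS : Dv (ebase k) Smx y = Pk k + Smx y *m Gi *m (Tmx G z k y)^T.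
  apply/matrixP => i j; rewrite (Dv_entry _ _ _ smooth_Smx).
  rewrite (_ : (fun _ => _) = fun y => bil (G (z y)) (nabla nu y (ebase i)) (Dv (ebase j) z y)); last first.
    by apply/funext => y'; rewrite mxE.
  rewrite (nabla_compat _ sz mG (smooth_nabla _ sz mG sn) (smooth_Dv _ sz)).
  rewrite [RHS]mxE [Pk k i j]mxE; congr (_ + _).
  rewrite nabla_nuE bil_suml [RHS]mxE; apply: eq_bigr => l _.
  by rewrite bilZl [(Tmx G z k y)^T l j]mxE Tmx_torsion// (bilC (Dv (ebase l) z y) _ GT).
have : Dv (ebase k) (fun y => \tr (invmx (P y) *m Smx y)) y = 0.
  by rewrite -[RHS](Dv_cst (ebase k) 0 y); exact: Dv_near.
have sIS := smooth_mulmx sI smooth_Smx.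
rewrite (Dv_mxtrace _ sIS) (Dv_mulmx _ sI smooth_Smx) Dv_invmx (Dv_pullback _ iy) DS.
set T := Tmx G z k y; set S := Smx y.
have ST : S^T = S := Smx_sym.
have GiT : Gi^T = Gi by rewrite trmx_inv PT.
have cyc : \tr (Gi *m T *m Gi *m S) = \tr (Gi *m T^T *m Gi *m S).
  rewrite -mxtrace_tr !trmx_mul GiT ST mxtrace_mulC.
  by rewrite -!mulmxA mxtrace_mulC !mulmxA.
have cyc2 : \tr (Gi *m (S *m Gi *m T^T)) = \tr (Gi *m T^T *m Gi *m S).
  by rewrite mxtrace_mulC -!mulmxA mxtrace_mulC !mulmxA.
rewrite mulNmx mulmxDr mulmxDl mulmxDl mulmxDr !mxtraceD raddfN/= mxtraceD cyc cyc2.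
lra.
Qed.

(** Exchanging two covariant derivatives of [nu] costs a curvature term, which is Codazzi. Of the
    resulting sums, the one with the derivatives of the components of [X] yields [f] times the trace
    of the squared shape operator, plus traces with [Tmx] that [trace_Pk] cancels; the curvature sum
    yields [f] times the Ricci term. *)
Lemma tau_shape : tau G z X2 y =
  f * (\tr (Gi *m Smx y *m Gi *m Smx y) + ricci_at).
Proof.
have GiT : Gi^T = Gi by rewrite trmx_inv PT.
pose DX : 'M[R]_n := \matrix_(i, k) Dv (ebase i) (fun y => X y 0 k) y.
pose Rk k : 'M[R]_n := \matrix_(i, j) bil (G (z y))
  (Rm G (z y) (Dv (ebase i) z y) (Dv (ebase k) z y) (nu y)) (Dv (ebase j) z y).
have sXk k := smooth_entry 0 k sX.
have snk k := smooth_nabla (ebase k) sz mG sn.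
(* The product rule gives the [DX] term; swapping the directions [i] and [k] in the second
   derivatives of [nu] splits the rest into [Pk] and the curvature [Rk]. *)
have Q2 : Qmx G z (push z X2) y =
    - (DX *m Smx y) - \sum_k X y 0 k *: Pk k - \sum_k X y 0 k *: Rk k.
  have pX2' : \forall y' \near y, push z X2 y' = - \sum_k X y' 0 k *: nabla nu y' (ebase k).
    apply: filterS (filterI pX2 (filterI iy hy.2)) => y' [-> [[sz' mG' _] [sn' _ _]]].
    by rewrite (nabla_dir_sum _ sz' mG' sn').
  have st k : smooth_near (fun y => X y 0 k *: nabla nu y (ebase k)) y.
    exact: smooth_scale.
  apply/matrixP => i j; rewrite [LHS]mxE (nabla_near _ _ _ pX2').
  rewrite (nablaN _ mG); last by apply: smooth_sum => k _; exact: st.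
  rewrite nabla_sum// bilNl bil_suml.
  have -> : (- (DX *m Smx y) - \sum_k X y 0 k *: Pk k - \sum_k X y 0 k *: Rk k) i j =
      - (\sum_k (DX i k * Smx y k j + X y 0 k * Pk k i j + X y 0 k * Rk k i j)).
    rewrite !big_split/= [LHS]mxE [X in X + _]mxE [X in X + _ + _]mxE [X in - X + _ + _]mxE.
    rewrite [X in _ + X + _]mxE [X in _ + X]mxE !summxE !opprD.
    by congr (_ - _ - _); apply: eq_bigr => k _; rewrite mxE.
  congr (- _); apply: eq_bigr => k _.
  rewrite (nablaZ _ mG (sXk k) (snk k)) bilDl !bilZl.
  have := nabla_curvature (ebase i) (ebase k) sz mG sn.
  move=> /eqP; rewrite subr_eq => /eqP ->.
  by rewrite bilDl mulrDr [DX i k]mxE [Smx y k j]mxE [Pk k i j]mxE [Rk k i j]mxE; ring.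
(* The derivatives of the components of [X] are found by comparing two expressions for the
   derivative of [push z X], one in components, the other as [xi - f nu]. *)
have DXE : DX *m P y = - f *: Smx y - \sum_k X y 0 k *: Tmx G z k y.
  have nxi0 v : nabla xi y v = 0 *: Dv v z y by rewrite nxi scale0r.
  have := Qmx_tangential sxi nxi0 pX; rewrite (Qmx_push iy sX) scale0r add0r -scaleNr => <-.
  by rewrite addrK.
have DXS : DX *m Smx y = - f *: (Smx y *m Gi *m Smx y)
    - \sum_k X y 0 k *: (Tmx G z k y *m Gi *m Smx y).
  rewrite -[DX](mulmxK uP) DXE -/Gi !mulmxBl -!scalemxAl; congr (_ - _).
  by rewrite !mulmx_suml; apply: eq_bigr => k _; rewrite -!scalemxAl.
have cyc k : \tr (Gi *m (Tmx G z k y *m Gi *m Smx y)) =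
    \tr (Gi *m (Tmx G z k y)^T *m Gi *m Smx y).
  by rewrite !mulmxA -mxtrace_tr !trmx_mul GiT Smx_sym mxtrace_mulC !mulmxA.
have trsum (F : 'I_n -> 'M[R]_n) := tr_mul_sum Gi (fun k => X y 0 k) F.
(* By linearity the sum over [k] inserts [xi - f nu] in the second slot of the curvature, where [xi]
   contributes nothing. The trace over tangent vectors is then the full one, because the curvature
   of [nu] with itself is 0. *)
have ric : \sum_k X y 0 k * \tr (Gi *m Rk k) = - f * ricci_at.
  rewrite -trsum.
  pose L : 'M[R]_m := lin1_mx (fun u : 'rV[R]_m => Rm G (z y) u (nu y) (nu y)).
  have linR : linear (fun u : 'rV[R]_m => Rm G (z y) u (nu y) (nu y)).
    by move=> k u v; rewrite RmDa// RmZa.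
  pose Rl : {linear 'rV[R]_m -> 'rV[R]_m} := HB.pack
    (fun u : 'rV[R]_m => Rm G (z y) u (nu y) (nu y)) (GRing.isLinear.Build _ _ _ _ _ linR).
  have LE (u : 'rV[R]_m) : u *m L = Rm G (z y) u (nu y) (nu y) by exact: (mul_rV_lin1 Rl).
  have sumRk : \sum_k X y 0 k *: Rk k = - f *: ('J z y *m L *m G (z y) *m ('J z y)^T).
    have dz := smooth_differentiable_mx sz.
    apply/matrixP => i j; rewrite summxE.
    have -> : (- f *: ('J z y *m L *m G (z y) *m ('J z y)^T)) i j =
       - f * bil (G (z y)) (Rm G (z y) (Dv (ebase i) z y) (nu y) (nu y)) (Dv (ebase j) z y).
      rewrite [LHS]mxE; congr (_ * _); rewrite -LE -!(Dv_jacobian _ dz) bilE trmx_mul.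
      rewrite /ebase trmx_delta !mulmxA -colE -!mulmxA -rowE !mulmxA.
      by rewrite !mxE; apply: eq_bigr => k _; rewrite !mxE; congr (_ * _);
         apply: eq_bigr => l _; rewrite !mxE; congr (_ * _); apply: eq_bigr => p _; rewrite !mxE.
    transitivity (bil (G (z y)) (Rm G (z y) (Dv (ebase i) z y) (push z X y) (nu y)) (Dv (ebase j) z y)).
      rewrite pushE//.
      elim: (index_enum _) => [|k r IH].
        rewrite !big_nil (_ : Rm _ _ _ 0 _ = 0) ?bil0l//.
        by have := RmZb 0 (Dv (ebase i) z y) 0 (nu y) mG; rewrite !scale0r.
      by rewrite !big_cons RmDb// RmZb// bilDl bilZl -IH [in LHS]mxE [X in _ * X]mxE.
    rewrite (nbhs_singleton pX) RmDb// Rxi add0r -scaleNr RmZb// bilZl.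
    by [].
  rewrite sumRk -scalemxAr mxtraceZ /ricci_at -/L; congr (_ * _).
  have nJ : nu y *m G (z y) *m ('J z y)^T = 0.
    apply/rowP => j; rewrite [RHS]mxE -(nt (ebase j)) bilE -(Dv_jacobian _ (smooth_differentiable_mx sz)).
    by rewrite trmx_mul /ebase trmx_delta mulmxA -colE [RHS]mxE.
  have n1 : nu y *m G (z y) *m (nu y)^T = 1%:M.
    by apply/rowP => j; rewrite !ord1 -bilE nn mxE eqxx.
  rewrite (trace_frame L (metric_nearW mG) uP n1 nJ) LE.
  have -> : Rm G (z y) (nu y) (nu y) (nu y) = 0.
    by have /eqP := RmC G (z y) (nu y) (nu y) (nu y); rewrite -subr_eq0 opprK -mulr2n -scaler_nat scaler_eq0 pnatr_eq0 => /eqP.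
  by rewrite bil0l addr0.
rewrite /tau -/Gi Q2 !mulmxBr mulmxN !mxtraceD !raddfN/= !trsum ric DXS mulmxBr -scalemxAr.
rewrite mxtraceD mxtraceZ raddfN/= trsum.
under [X in _ - X - _]eq_bigr do rewrite trace_Pk.
have -> : \sum_k X y 0 k * \tr (Gi *m (Tmx G z k y *m Gi *m Smx y)) =
    \sum_k X y 0 k * \tr (Gi *m (Tmx G z k y)^T *m Gi *m Smx y).
  by apply: eq_bigr => k _; rewrite cyc.
rewrite !mulmxA; move: (\sum_k _) (\tr _) ricci_at => s t r; ring.
Qed.

End ShapeOfTangential.

End At.

End LocalHypersurface.

(** * Charts and metrics on manifolds *)

Section Charts.
Context {R : realType} {n : nat} {T : topologicalType}.
Implicit Types (c : chart R n T) (p : T).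

Lemma chart_near c p : chart_dom c p -> \forall q \near p, chart_dom c q.
Proof. by move=> cp; apply: open_nbhs_nbhs; split => //; exact: chart_dom_open. Qed.

Lemma chart_near_inv c p (Q : set 'rV[R]_n) : chart_dom c p ->
  (\forall y \near c p, Q y) -> \forall q \near p, Q (c q).
Proof. by move=> cp; exact: chart_continuous. Qed.

Lemma near_chart c p (P : set T) : chart_dom c p ->
  (\forall q \near p, P q) -> \forall y \near c p, P (chart_inv c y).
Proof.
by move=> cp Pp; apply: (chart_inv_continuous cp); rewrite /= chartK.
Qed.

Lemma chart_invK_near c p : chart_dom c p ->
  \forall y \near c p, chart_dom c (chart_inv c y) /\ c (chart_inv c y) = y.
Proof.
move=> cp; have : \forall y \near c p, (c @` chart_dom c) y.
  by apply: open_nbhs_nbhs; split; [exact: chart_img_open|exists p].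
by apply: filterS => _ [q cq <-]; rewrite chartK.
Qed.

Lemma near_chart_inv c p (P : set T) : chart_dom c p ->
  (\forall y \near c p, P (chart_inv c y)) -> \forall q \near p, P q.
Proof.
move=> cp Pc; have := chart_near_inv cp Pc.
by apply: filterS2 (chart_near cp) => q cq; rewrite chartK.
Qed.

Lemma near_chartP c p (P : 'rV[R]_n -> Prop) : chart_dom c p ->
  (\forall q \near p, chart_dom c q -> P (c q)) -> \forall y \near c p, P y.
Proof.
move=> cp /(near_chart cp); apply: filterS2 (chart_invK_near cp) => y [dy cy].
by rewrite cy => /(_ dy).
Qed.

Lemma open_chart_image c (A : set T) : open A -> A `<=` chart_dom c -> open (c @` A).
Proof.
move=> oA Ac; rewrite openE => _ [p Ap <-]; have cp := Ac _ Ap.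
have : \forall q \near p, A q by apply: open_nbhs_nbhs.
move=> /(near_chart cp); rewrite /interior.
by apply: filterS2 (chart_invK_near cp) => y [dy cy] Ay; exists (chart_inv c y).
Qed.

End Charts.

Section Transitions.
Context {R : realType} {n : nat} {M : manifold R n}.
Implicit Types (c d e : chart R n M) (p q : M).

Lemma smooth_transition c d p : atlas c -> atlas d -> chart_dom c p -> chart_dom d p ->
  smooth_near (fun y => d (chart_inv c y)) (c p).
Proof.
move=> ac ad cp dp; apply: Cinfty_near (atlas_compatible ac ad).
  by apply: open_chart_image => [|q []//]; apply: openI; exact: chart_dom_open.
by exists p.
Qed.

End Transitions.

HB.lock Definition trans {R : realType} {n : nat} {T : topologicalType} (c d : chart R n T) (q : T) : 'M[R]_n :=
  'J (fun y => d (chart_inv c y)) (c q).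

Section TransitionMatrices.
Context {R : realType} {n : nat} {M : manifold R n}.
Implicit Types (c d e : chart R n M) (p q : M).

Lemma transE c d q : trans c d q = 'J (fun y => d (chart_inv c y)) (c q).
Proof. by rewrite unlock. Qed.

Lemma Dv_trans c d q v : atlas c -> atlas d -> chart_dom c q -> chart_dom d q ->
  Dv v (fun y => d (chart_inv c y)) (c q) = v *m trans c d q.
Proof.
move=> ac ad cq dq; rewrite transE Dv_jacobian//.
exact/smooth_differentiable_mx/smooth_transition.
Qed.

Lemma Dv_chart_change c d q (W : normedModType R) (f : M -> W) v :
  atlas c -> atlas d -> chart_dom c q -> chart_dom d q ->
  differentiable (fun y => f (chart_inv d y)) (d q) ->
  Dv v (fun y => f (chart_inv c y)) (c q) =
  Dv (v *m trans c d q) (fun y => f (chart_inv d y)) (d q).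
Proof.
move=> ac ad cq dq df; rewrite -Dv_trans//.
have := @Dv_comp _ _ _ _ _ _ (c q) v (smooth_transition ac ad cq dq).
rewrite /= chartK// => <-//; apply: Dv_near.
by apply: filterS (near_chart cq (chart_near dq)) => y dy; rewrite chartK.
Qed.

Lemma smooth_chart_change c d q (k l : nat) (f : M -> 'M[R]_(k, l)) :
  atlas c -> atlas d -> chart_dom c q -> chart_dom d q ->
  smooth_near (fun y => f (chart_inv d y)) (d q) ->
  smooth_near (fun y => f (chart_inv c y)) (c q).
Proof.
move=> ac ad cq dq sf.
apply: (eq_smooth (f := (fun y => f (chart_inv d y)) \o (fun y => d (chart_inv c y)))).
  by apply: filterS (near_chart cq (chart_near dq)) => y dy /=; rewrite chartK.
by apply: smooth_comp; [exact: smooth_transition|rewrite chartK].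
Qed.

Lemma trans_comp c d e q : atlas c -> atlas d -> atlas e ->
  chart_dom c q -> chart_dom d q -> chart_dom e q ->
  trans c d q *m trans d e q = trans c e q.
Proof.
move=> ac ad ae cq dq eq; apply/row_matrixP => i.
rewrite !rowE mulmxA -(Dv_trans _ ac ae cq eq).
rewrite -(Dv_trans _ ad ae dq eq) (@Dv_chart_change c d q _ e)//.
exact/smooth_differentiable_mx/smooth_transition.
Qed.

Lemma trans_id c q : chart_dom c q -> trans c c q = 1%:M.
Proof.
move=> cq; have E (v : 'rV[R]_n) : Dv v (fun y => c (chart_inv c y)) (c q) = v.
  rewrite -[RHS](Dv_id v (c q)); apply: Dv_near.
  by apply: filterS (chart_invK_near cq) => y [].
have sm : smooth_near (fun y => c (chart_inv c y)) (c q).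
  by apply: eq_smooth (smooth_id (c q)); apply: filterS (chart_invK_near cq) => y [].
apply/row_matrixP => i; rewrite !rowE mulmx1 transE Dv_jacobian ?E//.
exact: smooth_differentiable_mx.
Qed.

Lemma trans_unit c d q : atlas c -> atlas d -> chart_dom c q -> chart_dom d q ->
  trans c d q \in unitmx.
Proof.
move=> ac ad cq dq; have := trans_comp ac ad ac cq dq cq.
by rewrite trans_id// => /mulmx1_unit[].
Qed.

Lemma transK c d q (v : 'rV[R]_n) : atlas c -> atlas d -> chart_dom c q -> chart_dom d q ->
  v *m trans c d q *m trans d c q = v.
Proof. by move=> ac ad cq dq; rewrite -mulmxA trans_comp// trans_id// mulmx1. Qed.

Lemma tcoordE c q v : tcoord c q v = v *m trans (chart_at q) c q.
Proof. by rewrite transE /jacobian mul_rV_lin1. Qed.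

Lemma tcoord_at q v : tcoord (chart_at q) q v = v.
Proof. by rewrite tcoordE trans_id ?mulmx1//; exact: chart_at_dom. Qed.

Lemma tcoord_trans c d q v : atlas c -> atlas d -> chart_dom c q -> chart_dom d q ->
  tcoord c q v *m trans c d q = tcoord d q v.
Proof.
move=> ac ad cq dq; rewrite !tcoordE -mulmxA trans_comp//.
  exact: chart_at_atlas.
exact: chart_at_dom.
Qed.

Lemma tcoord_inj c q : atlas c -> chart_dom c q -> injective (tcoord c q).
Proof.
move=> ac cq u v; rewrite !tcoordE; apply: row_free_inj; rewrite row_free_unit.
by apply: trans_unit => //; [exact: chart_at_atlas|exact: chart_at_dom].
Qed.

Lemma tcoordZ c q k u : tcoord c q (k *: u) = k *: tcoord c q u.
Proof. by rewrite !tcoordE scalemxAl. Qed.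

Lemma tcoordD c q u v : tcoord c q (u + v) = tcoord c q u + tcoord c q v.
Proof. by rewrite !tcoordE mulmxDl. Qed.

Lemma tcoordN c q u : tcoord c q (- u) = - tcoord c q u.
Proof. by rewrite !tcoordE mulNmx. Qed.

Lemma tcoord0 c q : tcoord c q 0 = 0 :> 'rV[R]_n.
Proof. by rewrite !tcoordE mul0mx. Qed.

Lemma coord_fieldE p v q : coord_field p v q = v *m trans (chart_at p) (chart_at q) q.
Proof. by rewrite transE /jacobian mul_rV_lin1. Qed.

Lemma smooth_trans c d p : atlas c -> atlas d -> chart_dom c p -> chart_dom d p ->
  smooth_near (fun y => trans c d (chart_inv c y)) (c p).
Proof.
move=> ac ad cp dp.
apply: (eq_smooth (f := fun y => 'J (fun y => d (chart_inv c y)) y)).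
  by apply: filterS (chart_invK_near cp) => y [_ yK]; rewrite transE yK.
exact/smooth_jacobian/smooth_transition.
Qed.

Lemma tcoord_surj c q (w : 'rV[R]_n) : atlas c -> chart_dom c q ->
  tcoord c q (w *m trans c (chart_at q) q) = w.
Proof.
by move=> ac cq; rewrite tcoordE transK//; [exact: chart_at_atlas|exact: chart_at_dom].
Qed.

End TransitionMatrices.

HB.lock Definition gmx {R : realType} {m : nat} {N : manifold R m} (g : N -> 'M[R]_m)
  (c : chart R m N) (y : 'rV[R]_m) : 'M[R]_m := gram g c y.

Section Metrics.
Context {R : realType} {m : nat} {N : manifold R m}.
Variable g : N -> 'M[R]_m.
Implicit Types (c d : chart R m N) (q : N).

Lemma gmx_def c : gmx g c = gram g c.
Proof. by rewrite gmx.unlock. Qed.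

Lemma gramE c q : chart_dom c q ->
  gmx g c (c q) = trans c (chart_at q) q *m g q *m (trans c (chart_at q) q)^T.
Proof. by move=> cq; rewrite gmx_def /gram /= chartK// transE. Qed.

Lemma gram_trans c d q : atlas c -> atlas d -> chart_dom c q -> chart_dom d q ->
  gmx g c (c q) = trans c d q *m gmx g d (d q) *m (trans c d q)^T.
Proof.
move=> ac ad cq dq; rewrite !gramE// !mulmxA trans_comp//; last first.
- exact: chart_at_dom.
- exact: chart_at_atlas.
rewrite -!mulmxA -trmx_mul trans_comp//; first exact: chart_at_atlas.
exact: chart_at_dom.
Qed.

Lemma innerE q u v : inner g q u v = bil (g q) u v.
Proof. by rewrite bilE. Qed.

Lemma bil_gram_trans c d q u v : atlas c -> atlas d -> chart_dom c q -> chart_dom d q ->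
  bil (gmx g c (c q)) u v = bil (gmx g d (d q)) (u *m trans c d q) (v *m trans c d q).
Proof. by move=> ac ad cq dq; rewrite (gram_trans ac ad)// bil_mulmx. Qed.

Lemma gram_at q : gmx g (chart_at q) (chart_at q q) = g q.
Proof.
by rewrite gramE ?trans_id ?mul1mx ?trmx1 ?mulmx1//; exact: chart_at_dom.
Qed.

Lemma bil_gram c q u v : atlas c -> chart_dom c q ->
  bil (gmx g c (c q)) (tcoord c q u) (tcoord c q v) = inner g q u v.
Proof.
move=> ac cq; rewrite innerE !tcoordE -(bil_gram_trans _ _ (chart_at_atlas q)) ?gram_at//.
exact: chart_at_dom.
Qed.

Hypothesis gm : riemannian_metric g.

Lemma posdef_metric q : posdef (g q).
Proof. by case: gm => gT gp _; split => // v v0; exact: gp. Qed.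

Lemma smooth_gram c q : atlas c -> chart_dom c q -> smooth_near (gmx g c) (c q).
Proof.
move=> ac cq; rewrite gmx_def; apply: smooth_mx => i j; case: gm => _ _ /(_ c i j ac).
by apply: Cinfty_near; [exact: chart_img_open|exists q].
Qed.

Lemma posdef_congr k (B : 'M[R]_(k, m)) (A : 'M[R]_m) : row_free B -> posdef A -> posdef (B *m A *m B^T).
Proof.
move=> fB [AT Ap]; split; first by rewrite !trmx_mul trmxK AT mulmxA.
move=> v v0; have vB : v *m B != 0.
  by apply: contra_neq v0 => v0; apply: (row_free_inj fB); rewrite v0 mul0mx.
by have := Ap _ vB; rewrite trmx_mul !mulmxA.
Qed.

Lemma posdef_gram c q : atlas c -> chart_dom c q -> posdef (gmx g c (c q)).
Proof.
move=> ac cq; rewrite gramE//; apply: posdef_congr (posdef_metric q).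
rewrite row_free_unit; apply: trans_unit => //; first exact: chart_at_atlas.
exact: chart_at_dom.
Qed.

Lemma gram_metric c q : atlas c -> chart_dom c q -> metric_near (gmx g c) (c q).
Proof.
move=> ac cq; split; first exact: smooth_gram.
by apply: near_chartP => //; near=> q' => cq'; exact: posdef_gram.
Unshelve. all: by end_near.
Qed.

End Metrics.

Section Maps.
Context {R : realType} {n m : nat} {M : manifold R n} {N : manifold R m}.
Variable F : M -> N.
Hypothesis sF : smooth_map F.
Implicit Types (c : chart R n M) (d : chart R m N) (p : M).

Lemma smooth_map_near c d p : atlas c -> atlas d -> chart_dom c p -> chart_dom d (F p) ->
  smooth_near (fun y => d (F (chart_inv c y))) (c p).
Proof.
move=> ac ad cp dp; case: sF => cF /(_ c d ac ad); apply: Cinfty_near; last by exists p.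
apply: open_chart_image => [|q []//]; apply: openI; first exact: chart_dom_open.
by apply: open_comp; [move=> q _; exact: cF|exact: chart_dom_open].
Qed.

Lemma smooth_along_near (V : M -> 'rV[R]_m) c d p : smooth_along F V ->
  atlas c -> atlas d -> chart_dom c p -> chart_dom d (F p) ->
  smooth_near (fun y => tcoord d (F (chart_inv c y)) (V (chart_inv c y))) (c p).
Proof.
move=> sV ac ad cp dp; apply: Cinfty_near (sV c d ac ad); last by exists p.
case: sF => cF _.
apply: open_chart_image => [|q []//]; apply: openI; first exact: chart_dom_open.
by apply: open_comp; [move=> q _; exact: cF|exact: chart_dom_open].
Qed.

Lemma map_chart_near d p : chart_dom d (F p) -> \forall q \near p, chart_dom d (F q).
Proof. by case: sF => cF _ dp; apply: (cF p); exact: chart_near. Qed.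

(** [dmap] is defined in the preferred charts only; the chain rule gives it in arbitrary ones. *)
Lemma dmap_tcoord c d p v : atlas c -> atlas d -> chart_dom c p -> chart_dom d (F p) ->
  tcoord d (F p) (dmap F p v) = Dv (tcoord c p v) (fun y => d (F (chart_inv c y))) (c p).
Proof.
move=> ac ad cp dp; have ap := chart_at_atlas p; have app := chart_at_dom p.
have aF := chart_at_atlas (F p); have aFF := chart_at_dom (F p).
have s1 := smooth_map_near ap aF app aFF.
have s2 := smooth_map_near ac ad cp dp.
rewrite tcoordE (tcoordE c) -(@Dv_chart_change _ _ _ _ _ _ _ (fun q => d (F q)) _ ap ac app cp (smooth_differentiable_mx s2)).
have -> : dmap F p v = Dv v (fun y => chart_at (F p) (F (chart_inv (chart_at p) y))) (chart_at p p).
  by rewrite -Dv_jacobian//; exact: smooth_differentiable_mx.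
rewrite -(Dv_trans _ aF ad aFF dp).
have := @Dv_comp _ _ _ _ _ _ (chart_at p p) v s1.
rewrite chartK// => <-; last exact/smooth_differentiable_mx/smooth_transition.
apply: Dv_near; apply: filterS (near_chart app (map_chart_near aFF)) => y dy.
by rewrite chartK.
Qed.

End Maps.

Lemma bil_ext {R : realType} m (A B : 'M[R]_m) :
  (forall u v, bil A u v = bil B u v) -> A = B.
Proof.
move=> E; apply/matrixP => i j; have := E (ebase i) (ebase j).
by rewrite !bilE /ebase trmx_delta -!colE -!rowE !mxE.
Qed.

HB.lock Definition mrep {R : realType} {n m : nat} {M : manifold R n} {N : manifold R m}
  (c : chart R n M) (d : chart R m N) (F : M -> N) (y : 'rV[R]_n) : 'rV[R]_m :=
  d (F (chart_inv c y)).

HB.lock Definition frep {R : realType} {n m : nat} {M : manifold R n} {N : manifold R m}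
  (c : chart R n M) (d : chart R m N) (F : M -> N) (V : M -> 'rV[R]_m) (y : 'rV[R]_n) : 'rV[R]_m :=
  tcoord d (F (chart_inv c y)) (V (chart_inv c y)).

Section Representatives.
Context {R : realType} {n m : nat} {M : manifold R n} {N : manifold R m}.
Implicit Types (c : chart R n M) (d : chart R m N) (p : M) (F : M -> N) (V : M -> 'rV[R]_m).

Lemma mrep_def c d F : mrep c d F = (fun y => d (F (chart_inv c y))).
Proof. by rewrite mrep.unlock. Qed.

Lemma frep_def c d F V :
  frep c d F V = (fun y => tcoord d (F (chart_inv c y)) (V (chart_inv c y))).
Proof. by rewrite frep.unlock. Qed.

Definition smooth_along_at F V p := forall c d, atlas c -> atlas d ->
  chart_dom c p -> chart_dom d (F p) -> smooth_near (frep c d F V) (c p).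

Lemma mrepE c d F p : chart_dom c p -> mrep c d F (c p) = d (F p).
Proof. by move=> cp; rewrite mrep_def chartK. Qed.

Lemma frepE c d F V p : chart_dom c p -> frep c d F V (c p) = tcoord d (F p) (V p).
Proof. by move=> cp; rewrite frep_def chartK. Qed.

Lemma smooth_alongP F V p : smooth_map F -> smooth_along F V -> smooth_along_at F V p.
Proof. by move=> sF sV c d ac ad cp dp; rewrite frep_def; exact: smooth_along_near. Qed.

(** A single pair of charts suffices: a change of chart composes with a transition map in the source
    and multiplies by a Jacobian in the target, both smooth. *)
Lemma smooth_along_at1 F V p c0 d0 : smooth_map F -> atlas c0 -> atlas d0 ->
  chart_dom c0 p -> chart_dom d0 (F p) -> smooth_near (frep c0 d0 F V) (c0 p) ->
  smooth_along_at F V p.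
Proof.
move=> sF ac0 ad0 cp0 dp0 s0 c d ac ad cp dp.
have s1 : smooth_near (frep c d0 F V) (c p).
  move: s0; rewrite !frep_def; exact: (@smooth_chart_change _ _ _ c c0 p 1 m (fun q => tcoord d0 (F q) (V q))).
apply: (eq_smooth (f := fun y => frep c d0 F V y *m trans d0 d (F (chart_inv c y)))).
  near=> y; rewrite !frep_def tcoord_trans//; near: y.
    exact: near_chart cp (map_chart_near sF dp0).
  exact: near_chart cp (map_chart_near sF dp).
apply: smooth_mulmx => //.
have := smooth_comp (smooth_map_near sF ac ad0 cp dp0).
move=> /(_ _ _ (fun y => trans d0 d (chart_inv d0 y))); rewrite chartK// => /(_ (smooth_trans ad0 ad dp0 dp)).
apply: eq_smooth; near=> y => /=; rewrite chartK//; near: y.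
exact: near_chart cp (map_chart_near sF dp0).
Unshelve. all: by end_near.
Qed.

End Representatives.

Section CovariantDerivative.
Context {R : realType} {n m : nat} {M : manifold R n} {N : manifold R m}.
Variables (g : N -> 'M[R]_m) (gm : riemannian_metric g).
Implicit Types (c : chart R n M) (d : chart R m N) (p : M).

Lemma christoffelE d q u v : atlas d -> chart_dom d q ->
  christoffel g d (d q) u v = chr (gmx g d) (d q) u v.
Proof.
move=> ad dq; have sg := smooth_gram gm ad dq.
rewrite gmx_def in sg *; have key a b w : 'd (fun z => (a *m gram g d z *m b^T) ord0 ord0) (d q) w =
    bil (Dv w (gram g d) (d q)) a b.
  have sA : smooth_near (fun z => bil (gram g d z) a b) (d q).
    by apply: smooth_bil => //; exact: smooth_cst.
  have E : (fun z => (a *m gram g d z *m b^T) ord0 ord0) = fun z => bil (gram g d z) a b.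
    by apply/funext => z; rewrite bilE.
  rewrite E -Dv_diff; last exact: smooth_differentiable.
  by rewrite Dv_bil ?Dv_cst ?bil0l ?bil0r ?addr0//; exact: smooth_cst.
rewrite chr.unlock /christoffel; congr (_ *m _).
apply/rowP => l; rewrite [LHS]mxE [RHS]mxE; congr (_ * (_ + _ - _)); exact: key.
Qed.

Section Along.
Variable F : M -> N.
Hypothesis sF : smooth_map F.
Variable V : M -> 'rV[R]_m.

Lemma nabla_chart_dom c c0 d p v : atlas c -> atlas c0 -> atlas d ->
  chart_dom c p -> chart_dom c0 p -> chart_dom d (F p) -> smooth_along_at F V p ->
  nabla (gmx g d) (mrep c d F) (frep c d F V) (c p) v =
  nabla (gmx g d) (mrep c0 d F) (frep c0 d F V) (c0 p) (v *m trans c c0 p).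
Proof.
move=> ac ac0 ad cp cp0 dp sV.
rewrite !nablaE !mrepE// !frepE//.
have E1 := @Dv_chart_change _ _ _ c c0 p _ (fun q => tcoord d (F q) (V q)) v ac ac0 cp cp0.
have E2 := @Dv_chart_change _ _ _ c c0 p _ (fun q => d (F q)) v ac ac0 cp cp0.
rewrite [frep c d F V]frep_def E1; last by rewrite -frep_def; exact/smooth_differentiable_mx/sV.
rewrite [mrep c d F]mrep_def E2 -?mrep_def -?frep_def //.
by rewrite mrep_def; exact/smooth_differentiable_mx/smooth_map_near.
Qed.

(** The components of [V] are multiplied by the Jacobian of the transition map, whose derivative
    produces a second derivative; [chr_transform] produces the same one, and the two expressions
    match. *)
Lemma nabla_chart_codom c d0 d p v : atlas c -> atlas d0 -> atlas d ->
  chart_dom c p -> chart_dom d0 (F p) -> chart_dom d (F p) -> smooth_along_at F V p ->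
  nabla (gmx g d0) (mrep c d0 F) (frep c d0 F V) (c p) v *m trans d0 d (F p) =
  nabla (gmx g d) (mrep c d F) (frep c d F V) (c p) v.
Proof.
move=> ac ad0 ad cp dp0 dp sV.
pose phi y := d (chart_inv d0 y).
have sphi : smooth_near phi (d0 (F p)) := smooth_transition ad0 ad dp0 dp.
have dphi := smooth_differentiable_mx sphi.
have sz0 : smooth_near (mrep c d0 F) (c p) by rewrite mrep_def; exact: smooth_map_near.
have sV0 : smooth_near (frep c d0 F V) (c p) by exact: sV.
have zE : Dv v (mrep c d F) (c p) = Dv (Dv v (mrep c d0 F) (c p)) phi (d0 (F p)).
  have := @Dv_comp _ _ _ _ (mrep c d0 F) phi (c p) v sz0.
  rewrite mrepE// => <-//; apply: Dv_near.
  apply: filterS (near_chart cp (map_chart_near sF dp0)) => y dy.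
  by rewrite /phi !mrep_def chartK.
have sT : smooth_near (fun y => trans d0 d (F (chart_inv c y))) (c p).
  have := smooth_comp sz0.
  move=> /(_ _ _ (fun y => trans d0 d (chart_inv d0 y))); rewrite mrepE// => /(_ (smooth_trans ad0 ad dp0 dp)).
  apply: eq_smooth; apply: filterS (near_chart cp (map_chart_near sF dp0)) => y dy /=.
  by rewrite mrep_def chartK.
have VE : Dv v (frep c d F V) (c p) = Dv v (frep c d0 F V) (c p) *m trans d0 d (F p)
    + Dv (Dv v (mrep c d0 F) (c p)) (Dv (frep c d0 F V (c p)) phi) (d0 (F p)).
  transitivity (Dv v (fun y => frep c d0 F V y *m trans d0 d (F (chart_inv c y))) (c p)).
    apply: Dv_near; near=> y; rewrite !frep_def tcoord_trans//; near: y.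
      exact: near_chart cp (map_chart_near sF dp0).
    exact: near_chart cp (map_chart_near sF dp).
  rewrite (Dv_mulmx _ sV0 sT) chartK//; congr (_ + _).
  set a := frep c d0 F V (c p).
  have sJ := smooth_Dv a sphi.
  have := @Dv_comp _ _ _ _ (mrep c d0 F) (Dv a phi) (c p) v sz0.
  rewrite mrepE// => <-; last exact: smooth_differentiable_mx.
  transitivity (Dv v (fun y => a *m trans d0 d (F (chart_inv c y))) (c p)).
    by rewrite (Dv_mulmx _ (smooth_cst a _) sT) Dv_cst mul0mx add0r.
  apply: Dv_near; apply: filterS2 (near_chart cp (map_chart_near sF dp0)) (near_chart cp (map_chart_near sF dp)) => y dy0 dy.
  by rewrite mrep_def -(Dv_trans _ ad0 ad dy0 dy).
have mG0 := gram_metric gm ad0 dp0; have mG := gram_metric gm ad dp.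
have phiE : phi (d0 (F p)) = d (F p) by rewrite /phi chartK.
have gen (A B C D : 'rV[R]_m) : B = C + D -> A + B = A + C + D by move=> ->; rewrite addrA.
rewrite [X in X *m _ = _]nablaE [RHS]nablaE mulmxDl VE; apply: gen.
rewrite zE !mrepE//.
set u := Dv v (mrep c d0 F) (c p).
have -> : frep c d F V (c p) = Dv (frep c d0 F V (c p)) phi (d0 (F p)).
  by rewrite Dv_trans// !frepE// tcoord_trans.
set w := frep c d0 F V (c p).
rewrite -(Dv_trans _ ad0 ad dp0 dp) -/phi addrC.
have := @chr_transform _ _ (gmx g d) (gmx g d0) phi (d0 (F p)) u w sphi.
rewrite phiE => -> //.
  by rewrite -transE; exact: trans_unit.
apply: near_chartP => //; apply: filterS (chart_near dp) => q dq d0q a b.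
rewrite (bil_gram_trans g a b ad0 ad d0q dq).
rewrite (Dv_trans a ad0 ad d0q dq) (Dv_trans b ad0 ad d0q dq).
by rewrite (_ : phi (d0 q) = d q) // /phi chartK.
Unshelve. all: by end_near.
Qed.

(** The bridge to coordinates. [cov_along] is tied to the preferred charts, which vary with the
    point, whereas differentiating it again requires one chart on a whole neighbourhood. *)
Lemma cov_along_nabla c d p v : atlas c -> atlas d -> chart_dom c p -> chart_dom d (F p) ->
  smooth_along_at F V p ->
  tcoord d (F p) (cov_along g F V p v) =
  nabla (gmx g d) (mrep c d F) (frep c d F V) (c p) (tcoord c p v).
Proof.
move=> ac ad cp dp sV; have a0 := chart_at_atlas p; have p0 := chart_at_dom p.
have b0 := chart_at_atlas (F p); have q0 := chart_at_dom (F p).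
apply: (etrans _ (esym (nabla_chart_dom _ ac a0 ad cp p0 dp sV))).
rewrite tcoordE [tcoord c p v]tcoordE (transK _ a0 ac p0 cp).
apply: (etrans _ (nabla_chart_codom _ a0 b0 ad p0 q0 dp sV)); congr (_ *m _).
rewrite nablaE (mrepE _ _ p0) (frepE _ _ _ p0) tcoord_at -(christoffelE _ _ b0 q0) /cov_along.
have s1 : smooth_near (mrep (chart_at p) (chart_at (F p)) F) (chart_at p p).
  by rewrite mrep_def; exact: smooth_map_near.
have s2 := sV _ _ a0 b0 p0 q0.
rewrite (_ : local_rep F V p = frep (chart_at p) (chart_at (F p)) F V); last by rewrite frep_def.
rewrite -(Dv_diff _ (smooth_differentiable_mx s2)).
suff -> : dmap F p v = Dv v (mrep (chart_at p) (chart_at (F p)) F) (chart_at p p) by [].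
rewrite mrep_def in s1 *.
by rewrite -[RHS](Dv_jacobian _ (smooth_differentiable_mx s1)).
Qed.

End Along.

End CovariantDerivative.

Section Identity.
Context {R : realType} {m : nat} {N : manifold R m}.
Implicit Types (d : chart R m N) (q : N).

Lemma smooth_map_id : smooth_map (idfun : N -> N).
Proof.
split; first by move=> q.
by move=> c d ac ad; exact: (atlas_compatible ac ad).
Qed.

Lemma mrep_id d q : chart_dom d q -> \forall y \near d q, mrep d d idfun y = y.
Proof. by move=> dq; rewrite mrep_def; apply: filterS (chart_invK_near dq) => y []. Qed.

Lemma Dv_mrep_id d q v : chart_dom d q -> Dv v (mrep d d idfun) (d q) = v.
Proof.
by move=> dq; rewrite -[RHS](Dv_id v (d q)); apply: Dv_near; exact: mrep_id.
Qed.

End Identity.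

Section Restriction.
Context {R : realType} {n m : nat} {M : manifold R n} {N : manifold R m}.
Variables (g : N -> 'M[R]_m) (gm : riemannian_metric g).
Variables (F : M -> N) (sF : smooth_map F).
Variable X : N -> 'rV[R]_m.
Hypothesis sX : smooth_field X.

Lemma smooth_along_comp : smooth_along F (X \o F).
Proof.
move=> c d ac ad; apply/CinftyP.
  apply: open_chart_image => [|q []//]; apply: openI; first exact: chart_dom_open.
  by apply: open_comp; [move=> q _; case: sF|exact: chart_dom_open].
move=> _ [p [cp dp] <-].
have s1 := smooth_map_near sF ac ad cp dp; rewrite -mrep_def in s1.
have s2 := smooth_alongP smooth_map_id sX ad ad dp dp.
apply: (eq_smooth (f := frep d d idfun X \o mrep c d F)).
  apply: filterS (near_chart cp (map_chart_near sF dp)) => y dy.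
  by rewrite !frep_def mrep_def /= chartK.
by apply: smooth_comp => //; rewrite mrepE.
Qed.

Lemma cov_along_comp p v :
  cov_along g F (X \o F) p v = cov_along g idfun X (F p) (dmap F p v).
Proof.
have ac := chart_at_atlas p; have cp := chart_at_dom p.
have ad := chart_at_atlas (F p); have dp := chart_at_dom (F p).
set c := chart_at p in ac cp *; set d := chart_at (F p) in ad dp *.
have s1 := smooth_map_near sF ac ad cp dp; rewrite -mrep_def in s1.
have s2 := smooth_alongP smooth_map_id sX ad ad dp dp.
apply: (tcoord_inj ad dp).
have E1 := cov_along_nabla gm sF v ac ad cp dp (smooth_alongP sF smooth_along_comp).
have E2 := cov_along_nabla gm smooth_map_id (dmap F p v) ad ad dp dp (smooth_alongP smooth_map_id sX).
apply: (etrans E1); apply: (etrans _ (esym E2)).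
rewrite !nablaE (mrepE _ _ cp) (mrepE _ _ dp) (frepE _ _ _ cp) (frepE _ _ _ dp) (Dv_mrep_id _ dp) (dmap_tcoord sF _ ac ad cp dp) -mrep_def.
congr (_ + _).
have := @Dv_comp _ _ _ _ (mrep c d F) (frep d d idfun X) (c p) (tcoord c p v) s1.
rewrite mrepE// => <-; last exact: smooth_differentiable_mx.
apply: Dv_near; apply: filterS (near_chart cp (map_chart_near sF dp)) => y dy.
by rewrite !frep_def mrep_def /= chartK.
Qed.

End Restriction.

(** * Boxes, bump functions and extension by zero *)

Section Boxes.
Context {R : realType} {n : nat}.
Implicit Types (y z : 'rV[R]_n) (e : R).

Definition box y e : set 'rV[R]_n := [set z | `|z - y| <= e].

Lemma closed_box y e : closed (box y e).
Proof.
have -> : box y e = (fun z => `|z - y|) @^-1` [set t | t <= e] by [].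
apply: closed_comp; last exact: closed_le.
by move=> z _; apply: (@cvg_norm _ _ _ _ (nbhs_filter z)); apply: cvgB; [exact: cvg_id|exact: cvg_cst].
Qed.

Lemma compact_box y e : compact (box y e).
Proof.
apply: bounded_closed_compact; last exact: closed_box.
exists (`|y| + e); split; first by rewrite num_real.
move=> r er z /= ze; apply: le_trans (ltW er).
by rewrite -[z](subrK y) addrC (le_trans (ler_normD _ _))// lerD2l.
Qed.

Lemma near_box y (P : set 'rV[R]_n) : (\forall z \near y, P z) ->
  exists2 e, 0 < e & box y e `<=` P.
Proof.
move=> /nbhs_ballP[e /= e0 eP]; exists (e / 2); first by rewrite divr_gt0.
move=> z /= ze; apply: eP; rewrite -ball_normE /= distrC (le_lt_trans ze)//.
by rewrite ltr_pdivrMr// mulr2n mulrDr mulr1 ltrDl.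
Qed.

Lemma box_near y e : 0 < e -> \forall z \near y, box y e z.
Proof.
move=> e0; apply/nbhs_ballP; exists e => //= z.
by rewrite -ball_normE /= distrC => /ltW.
Qed.

Lemma smooth_coord y i : smooth_near (fun z => z 0 i) y.
Proof. exact: smooth_entry (smooth_id y). Qed.

(* [step] has to reach 0 inside the box, where the sum of squares is >= e^2. *)
Definition bump y e z : R := step (2 - 2 / e ^+ 2 * \sum_i (z 0 i - y 0 i) ^+ 2).

Lemma bump_ge0 y e z : 0 <= bump y e z. Proof. exact: step_ge0. Qed.

Lemma bump_le1 y e z : bump y e z <= 1. Proof. exact: step_le1. Qed.

Lemma smooth_bump y e z : smooth_near (bump y e) z.
Proof.
apply: smooth_step; apply: smoothB; first exact: smooth_cst.
apply: smoothM; first exact: smooth_cst.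
apply: smooth_sum => i _; apply: smoothM;
  by apply: smoothB; [exact: smooth_coord|exact: smooth_cst].
Qed.

Lemma bump_near1 y e : 0 < e -> \forall z \near y, bump y e z = 1.
Proof.
move=> e0; pose f (z : 'rV[R]_n) : R := 2 - 2 / e ^+ 2 * \sum_i (z 0 i - y 0 i) ^+ 2.
have sf : smooth_near f y.
  apply: smoothB; first exact: smooth_cst.
  apply: smoothM; first exact: smooth_cst.
  apply: smooth_sum => i _; apply: smoothM;
    by apply: smoothB; [exact: smooth_coord|exact: smooth_cst].
have : \forall z \near y, 1 < f z.
  have fy : \forall t \near f y, 1 < t.
    apply: lt_nbhsr; rewrite /f big1; last by move=> i _; rewrite subrr expr0n.
    by rewrite mulr0 subr0 ltr1n.
  exact: (smooth_continuous sf) fy.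
by apply: filterS => z /ltW f1; rewrite /bump step_ge1.
Qed.

Lemma bump_center y e : bump y e y = 1.
Proof.
rewrite /bump big1; last by move=> i _; rewrite subrr expr0n.
by rewrite mulr0 subr0 step_ge1// ler1n.
Qed.

Lemma bump_eq0 y e z : 0 < e -> e <= `|z - y| -> bump y e z = 0.
Proof.
move=> e0 ez; apply: step_le0; rewrite subr_le0 -mulrA -{1}[2]mulr1 ler_pM2l//.
rewrite mulrC ler_pdivlMr ?exprn_gt0// mul1r leNgt; apply/negP => se.
suff : `|z - y| < e by rewrite ltNge ez.
have e2 : Num.sqrt (\sum_i (z 0 i - y 0 i) ^+ 2) < e.
  by rewrite -[ltRHS]gtr0_norm// -sqrtr_sqr ltr_sqrt// exprn_gt0.
apply: le_lt_trans e2; apply: mx_norm_le => [|i j]; first exact: sqrtr_ge0.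
rewrite -sqrtr_sqr ler_sqrt; last by rewrite sumr_ge0// => k _; exact: sqr_ge0.
rewrite (bigD1 j)//= ord1 !mxE lerDl sumr_ge0// => k _; exact: sqr_ge0.
Qed.

End Boxes.

Section ChartBoxes.
Context {R : realType} {n : nat} {M : manifold R n}.
Implicit Types (c : chart R n M) (p q : M).

Definition chart_box c y e : set M := chart_inv c @` box y e.

(* [b] transported to the manifold by [c] and extended by 0. *)
Definition extend0 {W : nmodType} c (b : 'rV[R]_n -> W) (q : M) : W :=
  if `[< chart_dom c q >] then b (c q) else 0.

Lemma extend0_in (W : nmodType) c (b : 'rV[R]_n -> W) q : chart_dom c q ->
  extend0 c b q = b (c q).
Proof. by move=> cq; rewrite /extend0; case: asboolP. Qed.

Definition boxed c y e := box y e `<=` [set z | chart_dom c (chart_inv c z) /\ c (chart_inv c z) = z].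

Lemma boxed_chart c p : chart_dom c p -> exists2 e, 0 < e & boxed c (c p) e.
Proof. by move=> cp; exact/near_box/chart_invK_near. Qed.

Lemma compact_chart_box c y e : boxed c y e -> compact (chart_box c y e).
Proof.
move=> bx; apply: continuous_compact; last exact: compact_box.
apply: continuous_in_subspaceT => z; rewrite inE => /bx[dz cz].
by rewrite -cz; apply: chart_inv_continuous.
Qed.

Lemma closed_chart_box c y e : boxed c y e -> closed (chart_box c y e).
Proof. by move=> /compact_chart_box; apply: compact_closed; exact: manifold_hausdorff. Qed.

Lemma extend0_out (W : nmodType) c y e (b : 'rV[R]_n -> W) q : boxed c y e ->
  (forall z, ~ box y e z -> b z = 0) -> ~ chart_box c y e q -> extend0 c b q = 0.
Proof.
move=> bx b0 nq; rewrite /extend0; case: asboolP => // cq; apply: b0 => bq.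
by apply: nq; exists (c q) => //; rewrite chartK.
Qed.

Lemma extend0_near0 (W : nmodType) c y e (b : 'rV[R]_n -> W) q : boxed c y e ->
  (forall z, ~ box y e z -> b z = 0) -> ~ chart_box c y e q ->
  \forall q' \near q, extend0 c b q' = 0.
Proof.
move=> bx b0 nq; have : \forall q' \near q, (~` chart_box c y e) q'.
  by apply: open_nbhs_nbhs; split => //; exact/closed_openC/closed_chart_box.
by apply: filterS => q' nq'; exact: extend0_out b0 nq'.
Qed.

Definition smooth_fun (b : M -> R) := forall d q, atlas d -> chart_dom d q ->
  smooth_near (fun z => b (chart_inv d z)) (d q).

Lemma smooth_fun_chart_change c d q (f : M -> R) :
  atlas c -> atlas d -> chart_dom c q -> chart_dom d q ->
  smooth_near (fun y => f (chart_inv d y)) (d q) ->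
  smooth_near (fun y => f (chart_inv c y)) (c q).
Proof.
move=> ac ad cq dq sf.
apply: (eq_smooth (f := (fun y => f (chart_inv d y)) \o (fun y => d (chart_inv c y)))).
  by apply: filterS (near_chart cq (chart_near dq)) => y dy /=; rewrite chartK.
by apply: smooth_comp1; [exact: smooth_transition|rewrite chartK].
Qed.

(** At points outside the chart domain the extension vanishes on a neighbourhood, because the box is
    compact and therefore closed in a Hausdorff space. *)
Lemma smooth_extend0 c y e (b : 'rV[R]_n -> R) : atlas c -> boxed c y e ->
  (forall z, smooth_near b z) -> (forall z, ~ box y e z -> b z = 0) ->
  smooth_fun (extend0 c b).
Proof.
move=> ac bx sb b0 d q ad dq; have [cq|nq] := pselect (chart_dom c q).
  apply: (smooth_fun_chart_change ad ac dq cq).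
  apply: (eq_smooth (f := b)) (sb _).
  by apply: filterS (chart_invK_near cq) => z [dz cz]; rewrite extend0_in// cz.
apply: (eq_smooth (f := fun=> 0)); last exact: smooth_cst.
have /(near_chart dq) : \forall q' \near q, extend0 c b q' = 0.
  by apply: extend0_near0 b0 _ => // -[z /bx[dz _] zq]; apply: nq; rewrite -zq.
by apply: filterS => z ->.
Qed.

End ChartBoxes.

Section FieldExtension.
Context {R : realType} {m : nat} {N : manifold R m}.

(** The condition in [closed_conformal] is tested on global smooth fields. Extending a single
    vector, as a bump function times a coordinate field, makes it available at each point and for
    each vector. *)
Lemma exists_smooth_field (p : N) (v : 'rV[R]_m) :
  exists2 Y : N -> 'rV[R]_m, smooth_field Y & Y p = v.
Proof.
have ac := chart_at_atlas p; have cp := chart_at_dom p.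
set c := chart_at p in ac cp; have [e e0 bx] := boxed_chart cp.
pose b : N -> R := extend0 c (bump (c p) e).
have b0 z : ~ box (c p) e z -> bump (c p) e z = 0.
  by move=> /negP; rewrite -ltNge => /ltW; exact: bump_eq0.
have sb : smooth_fun b by apply: smooth_extend0 b0 => //; exact: smooth_bump.
exists (fun q => b q *: coord_field p v q); last first.
  by rewrite /b extend0_in// bump_center scale1r coord_fieldE trans_id ?mulmx1.
move=> d' d ad' ad; apply/CinftyP.
  by apply: open_chart_image => [|q []//]; apply: openI; exact: chart_dom_open.
move=> _ [q [d'q dq] <-].
have [cq|nq] := pselect (chart_dom c q).
  apply: (eq_smooth (f := fun z => b (chart_inv d' z) *: (v *m trans c d (chart_inv d' z)))).
    apply: filterS2 (near_chart d'q (chart_near cq)) (near_chart d'q (chart_near dq)) => z cz dz.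
    rewrite tcoordE coord_fieldE -scalemxAl -mulmxA trans_comp//.
      exact: chart_at_atlas.
    exact: chart_at_dom.
  apply: smooth_scale; first exact: sb.
  apply: smooth_mulmx; first exact: smooth_cst.
  apply: (smooth_chart_change ad' ac d'q cq).
  exact: smooth_trans.
apply: (eq_smooth (f := fun=> 0)); last exact: smooth_cst.
have /(near_chart d'q) : \forall q' \near q, b q' = 0.
  by apply: extend0_near0 b0 _ => // -[z /bx[dz _] zq]; apply: nq; rewrite -zq.
by apply: filterS => z ->; rewrite scale0r tcoord0.
Qed.

Variables (g : N -> 'M[R]_m) (gm : riemannian_metric g).

Lemma closed_conformal_cov X psi p v : closed_conformal g X psi ->
  cov_along g idfun X p v = psi p *: v.
Proof.
move=> [_ _ cX]; have [Y sY <-] := exists_smooth_field p v.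
exact: (cX Y sY p).
Qed.

End FieldExtension.

(** * Curvature and divergence in charts *)

Section CurvatureInCharts.
Context {R : realType} {m : nat} {N : manifold R m}.
Variables (g : N -> 'M[R]_m) (gm : riemannian_metric g).
Implicit Types (p q : N).

Lemma cov_along0 n (M : manifold R n) (F : M -> N) V (p : M) : smooth_map F -> smooth_along_at F V p ->
  cov_along g F V p 0 = 0.
Proof.
move=> sF sV; have ac := chart_at_atlas p; have cp := chart_at_dom p.
have ad := chart_at_atlas (F p); have dp := chart_at_dom (F p).
apply: (tcoord_inj ad dp); rewrite (cov_along_nabla gm sF 0 ac ad cp dp sV) !tcoord0.
have s1 := smooth_map_near sF ac ad cp dp; rewrite -mrep_def in s1.
have mG := gram_metric gm ad dp; rewrite -(mrepE (chart_at (F p)) F cp) in mG.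
by have := nabla_dirZ 0 0 s1 mG (sV _ _ ac ad cp dp); rewrite !scale0r.
Qed.

Lemma frep_coord_field p v q : chart_dom (chart_at p) q ->
  \forall y \near chart_at p q, frep (chart_at p) (chart_at p) idfun (coord_field p v) y = v.
Proof.
move=> cq; apply: near_chartP => //; apply: filterS (chart_near cq) => q' cq' _.
rewrite frepE// coord_fieldE tcoord_surj//; exact: chart_at_atlas.
Qed.

Lemma smooth_coord_field p v q : chart_dom (chart_at p) q ->
  smooth_along_at idfun (coord_field p v) q.
Proof.
move=> cq; have ac := chart_at_atlas p.
apply: (smooth_along_at1 smooth_map_id ac ac cq cq).
apply: (eq_smooth (f := fun=> v)); last exact: smooth_cst.
by apply: filterS (frep_coord_field v cq) => y ->.
Qed.

Lemma levi_civita_coord p v w q : chart_dom (chart_at p) q ->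
  tcoord (chart_at p) q (levi_civita g (coord_field p v) (coord_field p w) q) =
  chr (gmx g (chart_at p)) (chart_at p q) v w.
Proof.
move=> cq; have ac := chart_at_atlas p.
apply: (etrans (cov_along_nabla gm smooth_map_id _ ac ac cq cq (smooth_coord_field w cq))).
rewrite nablaE (Dv_near _ (frep_coord_field w cq)) Dv_cst add0r (mrepE _ _ cq).
rewrite (Dv_mrep_id _ cq) (nbhs_singleton (frep_coord_field w cq)).
by rewrite coord_fieldE tcoord_surj.
Qed.

(** The inner covariant derivative is known on the whole domain of the chart at [p], as a
    contraction of Christoffel symbols with constants, and can thus be differentiated again in that
    chart. *)
Lemma levi_civita2_coord p u v w :
  levi_civita g (coord_field p u) (levi_civita g (coord_field p v) (coord_field p w)) p =
  dchr (gmx g (chart_at p)) (chart_at p p) u v w +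
  chr (gmx g (chart_at p)) (chart_at p p) u (chr (gmx g (chart_at p)) (chart_at p p) v w).
Proof.
have ac := chart_at_atlas p; have cp := chart_at_dom p.
set c := chart_at p in ac cp *.
set Z := levi_civita g (coord_field p v) (coord_field p w).
have ZE : \forall y \near c p, frep c c idfun Z y = chr (gmx g c) y v w.
  apply: near_chartP => //; apply: filterS (chart_near cp) => q cq _.
  by rewrite frepE//; exact: levi_civita_coord.
have mG := gram_metric gm ac cp.
have sZ : smooth_along_at idfun Z p.
  apply: (smooth_along_at1 smooth_map_id ac ac cp cp).
  apply: (eq_smooth (f := fun y => chr (gmx g c) y v w)); last exact: smooth_chr_const.
  by apply: filterS ZE => y ->.
rewrite -[LHS](tcoord_at p) -/c.
apply: (etrans (cov_along_nabla gm smooth_map_id _ ac ac cp cp sZ)).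
rewrite nablaE (Dv_near _ ZE) (mrepE _ _ cp) (Dv_mrep_id _ cp) (nbhs_singleton ZE) dchrE.
by rewrite coord_fieldE tcoord_surj.
Qed.

Lemma lie_bracket_coord p u v : lie_bracket (coord_field p u) (coord_field p v) p = 0.
Proof.
have cp := chart_at_dom p; have ac := chart_at_atlas p.
have key w w' : 'd (local_rep idfun (coord_field p w) p) (chart_at p p) w' = 0.
  have E : local_rep idfun (coord_field p w) p = frep (chart_at p) (chart_at p) idfun (coord_field p w).
    by rewrite frep_def.
  have s : smooth_near (frep (chart_at p) (chart_at p) idfun (coord_field p w)) (chart_at p p).
    by apply: smooth_coord_field.
  by rewrite E -(Dv_diff _ (smooth_differentiable_mx s)) (Dv_near _ (frep_coord_field w cp)) Dv_cst.
by apply: (etrans (congr2 (fun a b : 'rV[R]_m => a - b) (key _ _) (key _ _))); rewrite subr0.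
Qed.

(** Coordinate fields commute, so the bracket term of the curvature is a derivative in the direction
    0. *)
Lemma ricciE p v w : ricci g p v w =
  \tr (lin1_mx (fun u => Rm (gmx g (chart_at p)) (chart_at p p) u v w)).
Proof.
rewrite /ricci; congr (\tr (lin1_mx _)); apply/funext => u.
rewrite RmE /curvature.
rewrite [X in _ - X](_ : _ = 0) ?subr0; last first.
  rewrite {1}/levi_civita lie_bracket_coord; apply: cov_along0; first exact: smooth_map_id.
  by apply: smooth_coord_field; exact: chart_at_dom.
rewrite !levi_civita2_coord.
move: (dchr _ _ _ _ _) (dchr _ _ _ _ _) (chr _ _ _ (chr _ _ _ _)) (chr _ _ _ (chr _ _ _ _)) => a b c d.
vring.
Qed.

Lemma nabla_closed_conformal X psi d q v : closed_conformal g X psi -> atlas d -> chart_dom d q ->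
  nabla (gmx g d) (mrep d d idfun) (frep d d idfun X) (d q) v = psi q *: v.
Proof.
move=> cX ad dq; have [sX _ _] := cX.
rewrite -{1}[v](tcoord_surj v ad dq).
have := cov_along_nabla gm smooth_map_id (v *m trans d (chart_at q) q) ad ad dq dq (smooth_alongP smooth_map_id sX).
by move=> <-; rewrite (closed_conformal_cov _ _ cX) tcoordZ tcoord_surj.
Qed.

Lemma Rm_parallel_field X d q u w : parallel g X -> atlas d -> chart_dom d q ->
  Rm (gmx g d) (d q) u (tcoord d q (X q)) w = 0.
Proof.
move=> pX ad dq; have mG := gram_metric gm ad dq.
have [sX _ _] := pX.
apply: Rm_parallel => // a b.
have s1 : smooth_near (mrep d d idfun) (d q).
  by rewrite mrep_def; exact: (smooth_map_near smooth_map_id).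
have mz : mrep d d idfun (d q) = d q by rewrite mrepE.
have mG' := mG; rewrite -mz in mG'.
have sV := smooth_alongP smooth_map_id sX ad ad dq dq.
have := nabla_curvature a b s1 mG' sV.
rewrite mz !Dv_mrep_id// frepE// => <-.
have z v u' : nabla (gmx g d) (mrep d d idfun)
    (fun y => nabla (gmx g d) (mrep d d idfun) (frep d d idfun X) y v) (d q) u' = 0.
  rewrite (@nabla_near _ _ _ _ _ _ _ _ (fun=> 0)); last first.
    apply: near_chartP => //; apply: filterS (chart_near dq) => q' dq' _.
    by rewrite (nabla_closed_conformal _ pX)// scale0r.
  by rewrite nablaE Dv_cst chr0r// addr0.
by rewrite !z subrr.
Qed.

End CurvatureInCharts.

Section Divergence.
Context {R : realType} {n : nat} {M : manifold R n}.
Variable h : M -> 'M[R]_n.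
Implicit Types (X : M -> 'rV[R]_n) (rho b : M -> R).

(* [rho] is the divergence of [X]: d_k (sqrt |h| X^k) = sqrt |h| rho in every chart. *)
Definition has_div X rho := forall c p, atlas c -> chart_dom c p ->
  smooth_near (frep c c idfun X) (c p) /\
  \sum_k Dv (ebase k) (fun y => Num.sqrt (\det (gmx h c y)) * frep c c idfun X y 0 k) (c p) =
  Num.sqrt (\det (gmx h c (c p))) * rho p.

Definition deriv_along X b p := Dv (X p) (fun y => b (chart_inv (chart_at p) y)) (chart_at p p).

Lemma deriv_alongE c X b p : atlas c -> chart_dom c p -> smooth_fun b ->
  deriv_along X b p = Dv (tcoord c p (X p)) (fun y => b (chart_inv c y)) (c p).
Proof.
move=> ac cp sb; rewrite tcoordE; apply: Dv_chart_change => //.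
- exact: chart_at_atlas.
- exact: chart_at_dom.
- exact/smooth_differentiable/sb.
Qed.

Lemma has_div_scale X rho b : riemannian_metric h -> smooth_fun b -> has_div X rho ->
  has_div (fun p => b p *: X p) (fun p => b p * rho p + deriv_along X b p).
Proof.
move=> hm sb dX c p ac cp; have [sX E] := dX c p ac cp.
have sbc := sb c p ac cp.
have fE y : frep c c idfun (fun p => b p *: X p) y = b (chart_inv c y) *: frep c c idfun X y.
  by rewrite !frep_def tcoordZ.
split; first by apply: (smooth_ext (f := fun y => b (chart_inv c y) *: frep c c idfun X y)) => //; exact: smooth_scale.
rewrite (deriv_alongE _ ac cp sb).
have sd := @smooth_sqrt _ _ (fun y => \det (gmx h c y)) (c p) (posdef_det_gt0 (posdef_gram hm ac cp))
  (smooth_det (smooth_gram hm ac cp)).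
have sk k := smoothM sd (smooth_entry 0 k sX).
have key k : Dv (ebase k) (fun y => Num.sqrt (\det (gmx h c y)) * frep c c idfun (fun p => b p *: X p) y 0 k) (c p)
   = b p * Dv (ebase k) (fun y => Num.sqrt (\det (gmx h c y)) * frep c c idfun X y 0 k) (c p)
   + Num.sqrt (\det (gmx h c (c p))) * (tcoord c p (X p) 0 k *: Dv (ebase k) (fun y => b (chart_inv c y)) (c p)).
  rewrite (_ : (fun y => _) = fun y => b (chart_inv c y) * (Num.sqrt (\det (gmx h c y)) * frep c c idfun X y 0 k)); last first.
    by apply/funext => y; rewrite fE mxE mulrCA.
  rewrite (DvM _ sbc (sk k)) chartK// (frepE _ _ _ cp) -[_ *: _]/(_ * _).
  have rg (r1 r2 r3 r4 r5 : R) : r1 * (r2 * r3) + r4 * r5 = r4 * r5 + r2 * (r3 * r1) by ring.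
  exact: rg.
rewrite (eq_bigr _ (fun k _ => key k)) big_split -!mulr_sumr E.
rewrite (Dv_dir_sum _ (smooth_differentiable sbc)).
by rewrite mulrDr mulrCA.
Qed.

Lemma has_divB X X' rho rho' : riemannian_metric h -> has_div X rho -> has_div X' rho' ->
  has_div (fun p => X p - X' p) (fun p => rho p - rho' p).
Proof.
move=> hm dX dX' c p ac cp; have [sX E] := dX c p ac cp; have [sX' E'] := dX' c p ac cp.
have fE y : frep c c idfun (fun p => X p - X' p) y = frep c c idfun X y - frep c c idfun X' y.
  by rewrite !frep_def tcoordD tcoordN.
split; first by apply: (smooth_ext (f := fun y => frep c c idfun X y - frep c c idfun X' y)) => //; exact: smoothB.
have sd := @smooth_sqrt _ _ (fun y => \det (gmx h c y)) (c p) (posdef_det_gt0 (posdef_gram hm ac cp))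
  (smooth_det (smooth_gram hm ac cp)).
rewrite mulrBr -E -E' -sumrB; apply: eq_bigr => k _.
rewrite -(DvB _ (smoothM sd (smooth_entry 0 k sX)) (smoothM sd (smooth_entry 0 k sX'))).
by congr (Dv _ _ _); apply/funext => y; rewrite fE !mxE mulrBr.
Qed.

Lemma eq_has_div X rho rho' : (forall p, rho p = rho' p) -> has_div X rho -> has_div X rho'.
Proof. by move=> E dX c p ac cp; rewrite -E; exact: dX. Qed.

End Divergence.

(** * Hypersurfaces *)

Section Immersed.
Context {R : realType} {n : nat} {Mt : manifold R n.+1} {M : manifold R n}.
Variables (g : Mt -> 'M[R]_n.+1) (x : M -> Mt).
Hypothesis gm : riemannian_metric g.
Hypothesis xi : immersion x.
Local Notation h := (induced_metric g x).
Implicit Types (c : chart R n M) (d : chart R n.+1 Mt) (p q : M).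

Let sx : smooth_map x := xi.1.

Lemma smooth_mrep c d p : atlas c -> atlas d -> chart_dom c p -> chart_dom d (x p) ->
  smooth_near (mrep c d x) (c p).
Proof. by move=> *; rewrite mrep_def; exact: smooth_map_near. Qed.

Lemma dmap_mrep c d p v : atlas c -> atlas d -> chart_dom c p -> chart_dom d (x p) ->
  tcoord d (x p) (dmap x p v) = Dv (tcoord c p v) (mrep c d x) (c p).
Proof. by move=> *; rewrite mrep_def; exact: dmap_tcoord. Qed.

Lemma immersed_mrep_at c d p : atlas c -> atlas d -> chart_dom c p -> chart_dom d (x p) ->
  immersed_at (gmx g d) (mrep c d x) (c p).
Proof.
move=> ac ad cp dp; split; first exact: smooth_mrep.
  by rewrite mrepE//; exact: gram_metric.
move=> v; rewrite -(tcoord_surj v ac cp) -(dmap_mrep _ ac ad cp dp) => E.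
rewrite (_ : v *m _ = 0) ?tcoord0//; apply: (xi.2 p); rewrite [RHS]/dmap mul0mx.
by apply: (tcoord_inj ad dp); rewrite E tcoord0.
Qed.

Lemma near_mrep c d p (P : 'rV[R]_n -> Prop) : chart_dom c p -> chart_dom d (x p) ->
  (forall q, chart_dom c q -> chart_dom d (x q) -> P (c q)) -> \forall y \near c p, P y.
Proof.
move=> cp dp H; apply: near_chartP => //.
by apply: filterS (map_chart_near sx dp) => q dq cq; exact: H.
Qed.

Lemma immersed_mrep c d p : atlas c -> atlas d -> chart_dom c p -> chart_dom d (x p) ->
  immersed (gmx g d) (mrep c d x) (c p).
Proof.
move=> ac ad cp dp; apply: (near_mrep cp dp) => q cq dq; exact: immersed_mrep_at.
Qed.

Lemma induced_inner p u v : inner h p u v = inner g (x p) (dmap x p u) (dmap x p v).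
Proof. by rewrite !innerE /dmap bil_mulmx. Qed.

Lemma gmx_induced c d p : atlas c -> atlas d -> chart_dom c p -> chart_dom d (x p) ->
  gmx h c (c p) = pullback (gmx g d) (mrep c d x) (c p).
Proof.
move=> ac ad cp dp; apply: bil_ext => u v.
rewrite bil_pullback; last exact: smooth_mrep.
rewrite -(tcoord_surj u ac cp) -(tcoord_surj v ac cp) bil_gram//.
by rewrite -!(dmap_mrep _ ac ad cp dp) (mrepE _ _ cp) bil_gram// induced_inner.
Qed.

Lemma gmx_induced_near c d p : atlas c -> atlas d -> chart_dom c p -> chart_dom d (x p) ->
  \forall y \near c p, gmx h c y = pullback (gmx g d) (mrep c d x) y.
Proof. by move=> ac ad cp dp; apply: (near_mrep cp dp) => q cq dq; exact: gmx_induced. Qed.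

Lemma induced_riemannian : riemannian_metric h.
Proof.
have pd p : posdef (h p).
  have ac := chart_at_atlas p; have cp := chart_at_dom p.
  have ad := chart_at_atlas (x p); have dp := chart_at_dom (x p).
  rewrite -gram_at (gmx_induced ac ad cp dp); apply: posdef_pullback.
  exact: immersed_mrep_at.
split; first by move=> p; have [] := pd p.
  by move=> p v v0; rewrite innerE; exact: posdef_bil_gt0.
move=> c i j ac; apply/CinftyP; first exact: chart_img_open.
move=> _ [p cp <-]; rewrite -gmx_def; apply: smooth_entry.
have ad := chart_at_atlas (x p); have dp := chart_at_dom (x p).
apply: (eq_smooth (f := pullback (gmx g (chart_at (x p))) (mrep c (chart_at (x p)) x))).
  by apply: filterS (gmx_induced_near ac ad cp dp) => y ->.
by apply: smooth_pullback; exact: immersed_mrep_at.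
Qed.

Lemma tangent_part_inner p w u :
  inner h p (tangent_part g x p w) u = inner g (x p) w (dmap x p u).
Proof.
rewrite !innerE !bilE /tangent_part /dmap mulmxKV ?trmx_mul ?mulmxA//.
exact/posdef_unit/posdef_metric/induced_riemannian.
Qed.

Lemma push_tcoord c d p u : atlas c -> atlas d -> chart_dom c p -> chart_dom d (x p) ->
  Dv (tcoord c p u) (mrep c d x) (c p) = tcoord d (x p) (dmap x p u).
Proof. by move=> *; rewrite -dmap_mrep. Qed.

(** The projection formula persists in arbitrary charts; its ingredients are then smooth functions
    of the coordinates, which the definition through preferred charts does not show. *)
Lemma tcoord_tangent_part c d p w : atlas c -> atlas d -> chart_dom c p -> chart_dom d (x p) ->
  tcoord c p (tangent_part g x p w) = tcoord d (x p) w *m gmx g d (d (x p))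
    *m ('J (mrep c d x) (c p))^T *m invmx (gmx h c (c p)).
Proof.
move=> ac ad cp dp; have hm := induced_riemannian.
have uP := posdef_unit (posdef_gram hm ac cp).
apply: (bil_inj uP) => u; rewrite -(tcoord_surj u ac cp) (bil_gram _ _ _ ac cp).
rewrite tangent_part_inner bilE mulmxKV// -mulmxA -trmx_mul.
rewrite (Dv_jacobian _ (smooth_differentiable_mx (smooth_mrep ac ad cp dp))).
by rewrite (push_tcoord _ ac ad cp dp) -bilE bil_gram.
Qed.

Lemma smooth_tangent_part (V : M -> 'rV[R]_n.+1) c p : smooth_along x V ->
  atlas c -> chart_dom c p ->
  smooth_near (frep c c idfun (fun p => tangent_part g x p (V p))) (c p).
Proof.
move=> sV ac cp; have ad := chart_at_atlas (x p); have dp := chart_at_dom (x p).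
set d := chart_at (x p) in ad dp.
apply: (eq_smooth (f := fun y => frep c d x V y *m gmx g d (mrep c d x y) *m ('J (mrep c d x) y)^T
   *m invmx (gmx h c y))).
  apply: (near_mrep cp dp) => q cq dq; rewrite !frepE// mrepE//.
  by rewrite (tcoord_tangent_part _ ac ad cq dq).
have hm := induced_riemannian.
have sz := smooth_mrep ac ad cp dp.
apply: smooth_mulmx; last first.
  by apply: smooth_invmx; [exact: posdef_unit (posdef_gram hm ac cp)|exact: smooth_gram].
apply: smooth_mulmx; last by apply/smooth_trmx/smooth_jacobian.
apply: smooth_mulmx; first exact: smooth_alongP.
by apply: smooth_metric_along => //; rewrite mrepE//; exact: gram_metric.
Qed.

Lemma has_div_tau X rho :
  (forall c p, atlas c -> chart_dom c p -> smooth_near (frep c c idfun X) (c p) /\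
     tau (gmx g (chart_at (x p))) (mrep c (chart_at (x p)) x) (frep c c idfun X) (c p) = rho p) ->
  has_div h X rho.
Proof.
move=> H c p ac cp; have [sX <-] := H c p ac cp; split=> //.
have ad := chart_at_atlas (x p); have dp := chart_at_dom (x p).
set d := chart_at (x p) in ad dp *.
have key k : Dv (ebase k) (fun y => Num.sqrt (\det (gmx h c y)) * frep c c idfun X y 0 k) (c p) =
    Dv (ebase k) (fun y => Num.sqrt (\det (pullback (gmx g d) (mrep c d x) y)) * frep c c idfun X y 0 k) (c p).
  by apply: Dv_near; apply: filterS (gmx_induced_near ac ad cp dp) => y ->.
rewrite (eq_bigr _ (fun k _ => key k)) (gmx_induced ac ad cp dp).
exact: divergence_formula (immersed_mrep ac ad cp dp) sX.
Qed.

Variable N : M -> 'rV[R]_n.+1.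
Hypothesis nN : unit_normal g x N.

Let sN : smooth_along x N. Proof. by case: nN. Qed.

Lemma hyper_mrep c d p : atlas c -> atlas d -> chart_dom c p -> chart_dom d (x p) ->
  hyper (gmx g d) (mrep c d x) (frep c d x N) (c p).
Proof.
move=> ac ad cp dp; split; first exact: immersed_mrep.
apply: (near_mrep cp dp) => q cq dq; have [_ n1 n0] := nN.
split; first exact: smooth_alongP.
  by rewrite mrepE// frepE// bil_gram.
move=> v; rewrite -(tcoord_surj v ac cq) (push_tcoord _ ac ad cq dq) mrepE// frepE//.
by rewrite bil_gram.
Qed.

Lemma dmap_tangent_part p w :
  dmap x p (tangent_part g x p w) = w - inner g (x p) w (N p) *: N p.
Proof.
have ac := chart_at_atlas p; have cp := chart_at_dom p.
have ad := chart_at_atlas (x p); have dp := chart_at_dom (x p).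
set d := chart_at (x p) in ad dp *; set c := chart_at p in ac cp.
apply: (tcoord_inj ad dp); have [_ n1 n0] := nN.
have gT : (g (x p))^T = g (x p) by have [] := posdef_metric gm (x p).
have nC u v : inner g (x p) u v = inner g (x p) v u by rewrite !innerE bilC.
apply: (bil_basis_inj (hyper_mrep ac ad cp dp)) => [j|].
  rewrite -(tcoord_surj (ebase j) ac cp) (push_tcoord _ ac ad cp dp) mrepE// !bil_gram//.
  rewrite -induced_inner tangent_part_inner.
  by rewrite !innerE bilBl bilZl -!innerE n0 mulr0 subr0.
rewrite mrepE// frepE// !bil_gram// nC n0.
by rewrite !innerE bilBl bilZl -!innerE n1 mulr1 subrr.
Qed.

Lemma cov_normal_normal p v : inner g (x p) (cov_along g x N p v) (N p) = 0.
Proof.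
have ac := chart_at_atlas p; have cp := chart_at_dom p.
have ad := chart_at_atlas (x p); have dp := chart_at_dom (x p).
have := nabla_nu_normal (hyper_mrep ac ad cp dp) v.
rewrite (mrepE _ _ cp) (frepE _ _ _ cp).
rewrite -{1}[v](tcoord_at p) -(cov_along_nabla gm sx v ac ad cp dp (smooth_alongP sx sN)).
by rewrite bil_gram.
Qed.

Lemma dmap_shape p v : dmap x p (shape_operator g x N p v) = - cov_along g x N p v.
Proof.
rewrite dmap_tangent_part innerE bilNl -innerE cov_normal_normal oppr0 scale0r.
by rewrite subr0.
Qed.

Local Notation S c d p := (Smx (gmx g d) (mrep c d x) (frep c d x N) (c p)).
Local Notation P c d p := (pullback (gmx g d) (mrep c d x) (c p)).

Lemma tcoord_shape c d p v : atlas c -> atlas d -> chart_dom c p -> chart_dom d (x p) ->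
  tcoord c p (shape_operator g x N p v) = - (tcoord c p v *m S c d p *m invmx (P c d p)).
Proof.
move=> ac ad cp dp; have hm := induced_riemannian.
have uP := posdef_unit (posdef_gram hm ac cp).
have hy := hyper_mrep ac ad cp dp.
rewrite -(gmx_induced ac ad cp dp).
apply: (bil_inj uP) => u; rewrite -(tcoord_surj u ac cp) (bil_gram _ _ _ ac cp).
set u' := u *m _; rewrite tangent_part_inner innerE bilNl bilNl -innerE; congr (- _).
rewrite [RHS]bilE mulmxKV//.
rewrite -(bil_gram _ _ _ ad dp) (cov_along_nabla gm sx v ac ad cp dp (smooth_alongP sx sN)).
rewrite -(push_tcoord _ ac ad cp dp) -(mrepE d x cp).
have sz := smooth_mrep ac ad cp dp.
have mG := gram_metric gm ad dp; rewrite -(mrepE d x cp) in mG.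
have sn := smooth_alongP sx sN ac ad cp dp.
move: (tcoord c p v) (tcoord c p u') => a b.
rewrite (nabla_dir_sum a sz mG sn) (Dv_dir_sum b (smooth_differentiable_mx sz)).
rewrite -mulmxA mxE bil_suml; apply: eq_bigr => i _.
rewrite bilZl bil_sumr mxE; congr (_ * _); apply: eq_bigr => j _.
by rewrite bilZr [S c d p i j]mxE [b^T j 0]mxE mulrC.
Qed.

Lemma trace_conj_trans (A : 'M[R]_n) c p : atlas c -> chart_dom c p ->
  \tr (trans (chart_at p) c p *m A *m trans c (chart_at p) p) = \tr A.
Proof.
move=> ac cp; rewrite mxtrace_mulC mulmxA trans_comp ?trans_id ?mul1mx//.
- exact: chart_at_atlas.
- exact: chart_at_dom.
Qed.

Lemma lin1_shape c d p : atlas c -> atlas d -> chart_dom c p -> chart_dom d (x p) ->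
  lin1_mx (shape_operator g x N p) =
  trans (chart_at p) c p *m (- (S c d p *m invmx (P c d p))) *m trans c (chart_at p) p.
Proof.
move=> ac ad cp dp; have a0 := chart_at_atlas p; have c0 := chart_at_dom p.
have E v : shape_operator g x N p v =
    v *m (trans (chart_at p) c p *m (- (S c d p *m invmx (P c d p))) *m trans c (chart_at p) p).
  apply: (tcoord_inj ac cp); rewrite (tcoord_shape _ ac ad cp dp) [RHS]tcoordE !mulmxA transK//.
  by rewrite [tcoord c p v]tcoordE mulmxN -!mulmxA.
by apply/matrixP => i j; rewrite [LHS]mxE E -rowE mxE.
Qed.

Lemma trace_shape c d p : atlas c -> atlas d -> chart_dom c p -> chart_dom d (x p) ->
  \tr (invmx (P c d p) *m S c d p) = - \tr (lin1_mx (shape_operator g x N p)).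
Proof.
move=> ac ad cp dp; rewrite (lin1_shape ac ad cp dp) trace_conj_trans// raddfN/= opprK.
by rewrite mxtrace_mulC.
Qed.

(** The square of [shape_norm], moved from the preferred chart at [p] to arbitrary charts.
    Self-adjointness, in the form of [Smx_sym], turns the product with the adjoint into a square. *)
Lemma trace_shape2 c d p : atlas c -> atlas d -> chart_dom c p -> chart_dom d (x p) ->
  \tr (invmx (P c d p) *m S c d p *m invmx (P c d p) *m S c d p) =
  \tr (lin1_mx (shape_operator g x N p) *m h p *m (lin1_mx (shape_operator g x N p))^T
     *m invmx (h p)).
Proof.
move=> ac ad cp dp; have a0 := chart_at_atlas p; have c0 := chart_at_dom p.
have hm := induced_riemannian.
have [PT _] := posdef_gram hm ac cp; have uP := posdef_unit (posdef_gram hm ac cp).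
have ST := Smx_sym (hyper_mrep ac ad cp dp).
have hE : h p = trans (chart_at p) c p *m P c d p *m (trans (chart_at p) c p)^T.
  by rewrite -(gram_at h p) (gram_trans h a0 ac c0 cp) (gmx_induced ac ad cp dp).
have uT := trans_unit a0 ac c0 cp.
rewrite (gmx_induced ac ad cp dp) in PT uP.
have uh := posdef_unit (posdef_metric hm p).
have TT := trans_comp ac a0 ac cp c0 cp; rewrite (trans_id cp) in TT.
have TT' := trans_comp a0 ac a0 c0 cp c0; rewrite (trans_id c0) in TT'.
rewrite (lin1_shape ac ad cp dp).
move: PT uP ST hE uT TT TT'; move: (trans c (chart_at p) p) (trans (chart_at p) c p) => T' T.
move: (P c d p) (S c d p) => Q B QT uQ BT hE uT TT TT'.
have hI : invmx (h p) = T'^T *m invmx Q *m T'.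
  have H : h p *m (T'^T *m invmx Q *m T') = 1%:M.
    rewrite hE !mulmxA -[_ *m T^T *m T'^T]mulmxA -trmx_mul TT trmx1 mulmx1.
    by rewrite mulmxK// TT'.
  by rewrite -[RHS](mulKmx uh) H mulmx1.
have E : (T *m - (B *m invmx Q) *m T')^T = - (T'^T *m invmx Q *m B *m T^T).
  by rewrite mulmxN mulNmx linearN/= !trmx_mul trmx_inv QT BT !mulmxA.
rewrite hI hE E; rewrite !(mulmxN, mulNmx) !mulmxA opprK.
rewrite -(mulmxA _ T' T) TT mulmx1 mulmxKV//.
rewrite -(mulmxA _ T^T T'^T) -trmx_mul TT trmx1 mulmx1.
rewrite -(mulmxA _ T^T T'^T) -trmx_mul TT trmx1 mulmx1.
rewrite [RHS]mxtrace_mulC !mulmxA TT mul1mx.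
by rewrite mxtrace_mulC !mulmxA.
Qed.

Section Tangential.
Variables (X : Mt -> 'rV[R]_n.+1) (psi : Mt -> R).
Hypothesis cX : closed_conformal g X psi.

Let sX : smooth_field X. Proof. by case: cX. Qed.

Definition support p := inner g (x p) (X (x p)) (N p).

Definition tangential p := tangent_part g x p (X (x p)).

Lemma nabla_along c d p v : atlas c -> atlas d -> chart_dom c p -> chart_dom d (x p) ->
  nabla (gmx g d) (mrep c d x) (frep c d x (X \o x)) (c p) v =
  psi (x p) *: Dv v (mrep c d x) (c p).
Proof.
move=> ac ad cp dp; rewrite -{1}[v](tcoord_surj v ac cp).
have sXx := smooth_alongP sx (smooth_along_comp sx sX).
rewrite -(cov_along_nabla gm sx _ ac ad cp dp (sXx p)).
rewrite (cov_along_comp gm sx sX) (closed_conformal_cov _ _ cX) tcoordZ.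
by rewrite (dmap_mrep _ ac ad cp dp) tcoord_surj.
Qed.

Lemma support_rep c d p : atlas c -> atlas d -> chart_dom c p -> chart_dom d (x p) ->
  support_fun (gmx g d) (mrep c d x) (frep c d x N) (frep c d x (X \o x)) (c p) = support p.
Proof. by move=> ac ad cp dp; rewrite /support_fun mrepE// !frepE// bil_gram. Qed.

Lemma push_tangential c d p : atlas c -> atlas d -> chart_dom c p -> chart_dom d (x p) ->
  \forall y \near c p, push (mrep c d x) (frep c c idfun tangential) y =
    frep c d x (X \o x) y - support_fun (gmx g d) (mrep c d x) (frep c d x N) (frep c d x (X \o x)) y
       *: frep c d x N y.
Proof.
move=> ac ad cp dp; apply: (near_mrep cp dp) => q cq dq.
rewrite (support_rep ac ad cq dq) !frepE// /push frepE// (push_tcoord _ ac ad cq dq).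
by rewrite dmap_tangent_part tcoordD tcoordN tcoordZ.
Qed.

Lemma smooth_tangential c p : atlas c -> chart_dom c p ->
  smooth_near (frep c c idfun tangential) (c p).
Proof. by move=> ac cp; apply: smooth_tangent_part => //; exact: smooth_along_comp. Qed.

Lemma has_div_tangential : has_div h tangential
  (fun p => psi (x p) * n%:R + support p * \tr (lin1_mx (shape_operator g x N p))).
Proof.
apply: has_div_tau => c p ac cp; split; first exact: smooth_tangential.
have ad := chart_at_atlas (x p); have dp := chart_at_dom (x p).
have sXx := smooth_alongP sx (smooth_along_comp sx sX).
rewrite (tau_tangential (hyper_mrep ac ad cp dp) (sXx p _ _ ac ad cp dp)
  (fun v => nabla_along v ac ad cp dp) (push_tangential ac ad cp dp)).
by rewrite (support_rep ac ad cp dp) (trace_shape ac ad cp dp) mulrN opprK.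
Qed.

Lemma smooth_support : smooth_fun support.
Proof.
move=> c p ac cp; have ad := chart_at_atlas (x p); have dp := chart_at_dom (x p).
set d := chart_at (x p) in ad dp.
have sXx := smooth_alongP sx (smooth_along_comp sx sX).
apply: (eq_smooth (f := support_fun (gmx g d) (mrep c d x) (frep c d x N) (frep c d x (X \o x)))).
  by apply: (near_mrep cp dp) => q cq dq; rewrite (support_rep ac ad cq dq) chartK.
exact: (smooth_support_fun (hyper_mrep ac ad cp dp) (sXx p _ _ ac ad cp dp)).
Qed.

Lemma deriv_support p v : Dv v (fun y => support (chart_inv (chart_at p) y)) (chart_at p p) =
  - inner h p (tangential p) (shape_operator g x N p v).
Proof.
have ac := chart_at_atlas p; have cp := chart_at_dom p.
have ad := chart_at_atlas (x p); have dp := chart_at_dom (x p).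
set c := chart_at p in ac cp *; set d := chart_at (x p) in ad dp.
have sXx := smooth_alongP sx (smooth_along_comp sx sX).
rewrite (@Dv_near _ _ _ _ _ (support_fun (gmx g d) (mrep c d x) (frep c d x N) (frep c d x (X \o x)))); last first.
  by apply: (near_mrep cp dp) => q cq dq; rewrite (support_rep ac ad cq dq) chartK.
rewrite (Dv_support_fun (hyper_mrep ac ad cp dp) (sXx p _ _ ac ad cp dp) (fun v => nabla_along v ac ad cp dp)).
rewrite (mrepE _ _ cp) (frepE _ _ _ cp) -{1}[v](tcoord_at p).
rewrite -(cov_along_nabla gm sx v ac ad cp dp (smooth_alongP sx sN)) bil_gram//.
by rewrite tangent_part_inner dmap_shape !innerE bilNr opprK.
Qed.

End Tangential.

Section Parallel.
Variable X : Mt -> 'rV[R]_n.+1.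
Hypothesis pX : parallel g X.
Hypothesis minimal : forall p, \tr (lin1_mx (shape_operator g x N p)) = 0.

Lemma has_div_shape :
  has_div h (fun p => shape_operator g x N p (tangential X p))
    (fun p => support X p * (\tr (lin1_mx (shape_operator g x N p) *m h p *m
      (lin1_mx (shape_operator g x N p))^T *m invmx (h p)) + ricci g (x p) (N p) (N p))).
Proof.
apply: has_div_tau => c p ac cp.
have ad := chart_at_atlas (x p); have dp := chart_at_dom (x p).
set d := chart_at (x p) in ad dp *.
have sX : smooth_field X by case: pX.
have sXx := smooth_alongP sx (smooth_along_comp sx sX).
have hy := hyper_mrep ac ad cp dp; have hm := induced_riemannian.
have sT := smooth_tangential pX ac cp.
split.
  apply: (eq_smooth (f := fun y => - (frep c c idfun (tangential X) y
      *m Smx (gmx g d) (mrep c d x) (frep c d x N) y *m invmx (gmx h c y)))).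
    apply: (near_mrep cp dp) => q cq dq.
    by rewrite !frepE// (tcoord_shape _ ac ad cq dq) (gmx_induced ac ad cq dq).
  apply: smoothN; apply: smooth_mulmx.
    by apply: smooth_mulmx => //; exact: smooth_Smx.
  by apply: smooth_invmx; [exact: posdef_unit (posdef_gram hm ac cp)|exact: smooth_gram].
have nX v : nabla (gmx g d) (mrep c d x) (frep c d x (X \o x)) (c p) v = 0.
  by rewrite (nabla_along pX _ ac ad cp dp) scale0r.
rewrite (tau_shape hy (sXx p _ _ ac ad cp dp) nX _ sT (push_tangential X ac ad cp dp)).
- rewrite (support_rep X ac ad cp dp) (trace_shape2 ac ad cp dp); congr (_ * (_ + _)).
  rewrite (ricciE gm); congr (\tr (lin1_mx _)); apply/funext => u.
  by rewrite (mrepE _ _ cp) (frepE _ _ _ cp) tcoord_at.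
- move=> u w; rewrite (mrepE _ _ cp) (frepE _ _ _ cp); exact: Rm_parallel_field.
- apply: (near_mrep cp dp) => q cq dq.
  by rewrite (trace_shape ac ad cq dq) minimal oppr0.
apply: (near_mrep cp dp) => q cq dq.
rewrite /push frepE// (push_tcoord _ ac ad cq dq) dmap_shape tcoordN.
by rewrite (cov_along_nabla gm sx _ ac ad cq dq (smooth_alongP sx sN)) (frepE _ _ _ cq).
Qed.

End Parallel.

End Immersed.

(** * Integration on row vectors *)

Section Borel.
Context {R : realType}.

Lemma borel_open (T : ptopologicalType) (U : set T) : open U -> measurable (U : set (borel T)).
Proof. exact: sub_sigma_algebra. Qed.

Lemma open_preimageI (T U : topologicalType) (D : set T) (f : T -> U) (A : set U) : open D ->
  (forall x, D x -> {for x, continuous f}) -> open A -> open (D `&` f @^-1` A).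
Proof.
move=> oD cf oA; rewrite openE => x [Dx Afx]; rewrite /interior.
apply: filterI; first exact: open_nbhs_nbhs.
by apply: (cf x Dx); exact: open_nbhs_nbhs.
Qed.

Lemma borel_continuous (T U : ptopologicalType) (D : set T) (f : T -> U) : open D ->
  (forall x, D x -> {for x, continuous f}) ->
  measurable_fun (D : set (borel T)) (f : borel T -> borel U).
Proof.
move=> oD cf; apply: (@measurability _ _ (borel T) (borel U) D f (@open U)) => //.
by move=> _ [A oA <-]; apply: borel_open; exact: open_preimageI.
Qed.

Lemma borel_continuousR (T : ptopologicalType) (D : set T) (f : T -> R) : open D ->
  (forall x, D x -> {for x, continuous f}) ->
  measurable_fun (D : set (borel T)) (f : borel T -> measurableTypeR R).
Proof.
move=> oD cf; apply: (measurability _ (RGenOInfty.measurableE R)).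
by move=> _ [_ [a -> <-]]; apply: borel_open; apply: open_preimageI.
Qed.

End Borel.

Section Density.
Import HBNNSimple.
Local Open Scope ereal_scope.
Context d1 d2 (X : measurableType d1) (Y : measurableType d2) (R : realType).
Variables (mu : {measure set Y -> \bar R}) (nu : {measure set X -> \bar R}).
Variables (iota : X -> Y) (w : X -> R) (D : set Y).
Hypotheses (miota : measurable_fun setT iota) (mw : measurable_fun setT w).
Hypothesis w0 : forall x, (0 <= w x)%R.
Hypothesis muE : forall B, measurable B -> B `<=` D ->
  mu B = \int[nu]_x (w x * \1_B (iota x))%:E.

(** On subsets of [D], [mu] is the image under [iota] of a weighted measure. The simple functions
    below [f] vanish off [D], so their level sets at nonzero values lie in [D], and the value 0
    contributes nothing on either side. Monotone convergence passes to [f]. *)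
Lemma ge0_integral_density (f : Y -> \bar R) : measurable_fun setT f ->
  (forall y, 0 <= f y) -> (forall y, ~ D y -> f y = 0) ->
  \int[mu]_y f y = \int[nu]_x ((w x)%:E * f (iota x)).
Proof.
move=> mf f0 fD; pose f_ := nnsfun_approx measurableT mf.
have mB n r : measurable (f_ n @^-1` [set r]) by [].
have subD n r : r != 0%R -> f_ n @^-1` [set r] `<=` D.
  move=> r0 y /= fr; apply: contrapT => nD.
  have fny : (f_ n y)%:E <= 0.
    have nd : nondecreasing_seq (fun k => (f_ k y)%:E).
      by move=> a b ab; rewrite lee_fin; exact/lefP/nd_nnsfun_approx.
    have cv := cvg_nnsfun_approx measurableT mf (fun x _ => f0 x) (I : setT y).
    rewrite -(fD _ nD) (cvg_unique (@ereal_hausdorff R) cv (ereal_nondecreasing_cvgn nd)).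
    by apply: ereal_sup_ubound; exists n.
  move: r0; rewrite -fr eq_le fun_ge0 andbT.
  by move: fny; rewrite lee_fin => ->.
have mi n r : measurable_fun setT (fun x => w x * \1_(f_ n @^-1` [set r]) (iota x))%R.
  by apply: measurable_funM => //; exact: (measurableT_comp (measurable_indic (mB n r))).
have key n : \int[mu]_y (f_ n y)%:E = \int[nu]_x (w x * f_ n (iota x))%:E.
  transitivity (\sum_(r \in range (f_ n)) \int[mu]_y (r * \1_(f_ n @^-1` [set r]) y)%:E).
    rewrite -ge0_integral_fsum//; last 2 first.
    - by move=> r; exact/measurable_EFinP/measurable_funM.
    - by move=> r y _; rewrite nnfun_muleindic_ge0.
    by apply: eq_integral => y _; rewrite {1}fimfunE -fsumEFin.
  transitivity (\sum_(r \in range (f_ n)) \int[nu]_x (r * (w x * \1_(f_ n @^-1` [set r]) (iota x)))%:E).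
    apply: eq_fsbigr => r; rewrite inE => -[y0 _ <-]; set r' := f_ n y0.
    have r0 : (0 <= r')%R by exact: fun_ge0.
    under eq_integral do rewrite EFinM.
    under [RHS]eq_integral do rewrite EFinM.
    rewrite ge0_integralZl//; last by apply/measurable_EFinP.
    rewrite ge0_integralZl//; last 2 first.
    - by apply/measurable_EFinP; exact: mi.
    - by move=> x _; rewrite lee_fin mulr_ge0.
    have [-> |rn0] := eqVneq r' 0%R; first by rewrite !mul0e.
    congr (_ * _); rewrite integral_indic// setIT; apply: muE => //; exact: subD.
  rewrite -ge0_integral_fsum//; last 2 first.
  - by move=> r; apply/measurable_EFinP/measurable_funM => //; exact: mi.
  - move=> r x _; rewrite mulrCA EFinM mule_ge0 ?lee_fin// -lee_fin EFinM.
    exact: nnfun_muleindic_ge0.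
  apply: eq_integral => x _; rewrite [X in (w x * X)%R]fimfunE fsumEFin//; congr EFin.
  by rewrite mulr_fsumr; apply: eq_fsbigr => r _; rewrite mulrCA.
transitivity (limn (fun n => \int[mu]_y (f_ n y)%:E)).
  rewrite -monotone_convergence//.
  - apply: eq_integral => y _; apply/esym/cvg_lim => //.
    by apply: cvg_nnsfun_approx => // *; exact: f0.
  - by move=> n; exact/measurable_EFinP/measurable_funP.
  - by move=> n y _; rewrite lee_fin.
  - by move=> y _ m n mn; rewrite lee_fin; exact/lefP/nd_nnsfun_approx.
under eq_fun do rewrite key.
rewrite -monotone_convergence//.
- apply: eq_integral => x _; apply/cvg_lim => //.
  under eq_fun do rewrite EFinM.
  apply: cvgeZl => //.
  by apply: cvg_nnsfun_approx => // *; exact: f0.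
- move=> n; apply/measurable_EFinP/measurable_funM => //.
  by apply: measurableT_comp => //; exact: measurable_funP.
- by move=> n x _; rewrite lee_fin mulr_ge0.
- move=> x _ m n mn; rewrite lee_fin ler_wpM2l//; exact/lefP/nd_nnsfun_approx.
Qed.

End Density.

Section RationalBoxes.
Context {R : realType}.

Lemma rat_between (a b : R) : a < b -> exists q : rat, a < ratr q < b.
Proof. by move=> /rat_in_itvoo[q]; rewrite in_itv/=; exists q. Qed.

Lemma rational_approx k (y : 'rV[R]_k) (e : R) : 0 < e ->
  exists q : 'rV[rat]_k, `|y - map_mx ratr q| < e.
Proof.
move=> e0.
have e2 : 0 < e / 2 by rewrite divr_gt0.
have /(@choice _ _ (fun i q => `|y 0 i - ratr q| <= e / 2))[f Hf] : forall i : 'I_k, exists q : rat, `|y 0 i - ratr q| <= e / 2.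
  move=> i; have [|q /andP[q1 q2]] := @rat_between (y 0 i - e / 2) (y 0 i + e / 2).
    by rewrite ltrBlDr -addrA ltrDl addr_gt0.
  by exists q; rewrite ler_norml; apply/andP; split; lra.
exists (\row_i f i).
apply: (@le_lt_trans _ _ (e / 2)); last by rewrite ltr_pdivrMr// ltr_pMr// ltr1n.
by apply: mx_norm_le => [|i j]; [exact: ltW|rewrite ord1 !mxE].
Qed.

Definition glue k (p : R * 'rV[R]_k) : 'rV[R]_k.+1 := row_mx (p.1%:M : 'rV_1) p.2.

Lemma glue0 k (p : R * 'rV[R]_k) : glue p 0 ord0 = p.1.
Proof. by rewrite /glue mxE; case: splitP => // j _; rewrite ord1 mxE eqxx. Qed.

Lemma glueS k (p : R * 'rV[R]_k) i : glue p 0 (rshift 1 i) = p.2 0 i.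
Proof. exact: row_mxEr. Qed.

Lemma glue_split k (j : 'I_k.+1) : j = ord0 \/ exists i, j = rshift 1 i.
Proof.
case: (@split_ordP 1 k j) => j' ->; [left|by right; exists j'].
by apply/val_inj; rewrite ord1.
Qed.

Lemma glueD k (p q : R * 'rV[R]_k) : glue p + glue q = glue (p.1 + q.1, p.2 + q.2).
Proof.
by apply/rowP => j; case: (glue_split j) => [|[i]] ->; rewrite mxE ?glue0 ?glueS ?mxE.
Qed.

Lemma glueB k (p q : R * 'rV[R]_k) : glue p - glue q = glue (p.1 - q.1, p.2 - q.2).
Proof.
by apply/rowP => j; case: (glue_split j) => [|[i]] ->; rewrite mxE [(- glue q) _ _]mxE ?glue0 ?glueS ?mxE.
Qed.

Lemma norm_glue k (p : R * 'rV[R]_k) (e : R) : `|p.1| <= e -> `|p.2| <= e -> `|glue p| <= e.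
Proof.
move=> h1 h2; apply: mx_norm_le => [|i j]; first exact: le_trans h1.
rewrite ord1; case: (glue_split j) => [|[l]] ->; first by rewrite glue0.
rewrite glueS; apply: le_trans h2; exact: mx_norm_entry.
Qed.

Lemma norm_glue_fst k (p : R * 'rV[R]_k) : `|p.1| <= `|glue p|.
Proof. by rewrite -glue0; exact: mx_norm_entry. Qed.

Lemma norm_glue_snd k (p : R * 'rV[R]_k) : `|p.2| <= `|glue p|.
Proof.
apply: mx_norm_le => // i j; rewrite ord1 -glueS; exact: mx_norm_entry.
Qed.

Lemma glue_surj k (y : 'rV[R]_k.+1) : exists p, y = glue p.
Proof.
exists (y 0 ord0, \row_i y 0 (rshift 1 i)); apply/rowP => j.
by case: (glue_split j) => [|[l]] ->; rewrite ?glue0// glueS mxE.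
Qed.

(** The source carries the product sigma-algebra, so the preimage of an open set is exhausted by
    countably many rational boxes, each a product of measurable sets. *)
Lemma measurable_glue k :
  measurable_fun setT (@glue k : measurableTypeR R * borel 'rV[R]_k -> borel 'rV[R]_k.+1).
Proof.
apply: (@measurability _ _ _ (borel 'rV[R]_k.+1) setT _ (@open 'rV[R]_k.+1)) => //.
move=> _ [U oU <-]; rewrite setTI.
pose I := (rat * 'rV[rat]_k * rat)%type.
pose B (i : I) : set (measurableTypeR R * borel 'rV[R]_k) :=
  [set t | `|t - ratr i.1.1| < ratr i.2] `*` [set y | `|y - map_mx ratr i.1.2| < ratr i.2].
pose F (i : I) := if `[< B i `<=` @glue k @^-1` U >] then B i else set0.
have mB i : measurable (B i).
  apply: measurableX.
    rewrite (_ : [set t | _] = `](ratr i.1.1 - ratr i.2), (ratr i.1.1 + ratr i.2)[%classic).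
      exact: measurable_itv.
    by apply/seteqP; split => t /=; rewrite in_itv/= ltr_distl.
  apply: borel_open.
  rewrite (_ : [set y | _] = (fun y : 'rV[R]_k => `|y - map_mx ratr i.1.2|) @^-1` [set t | t < ratr i.2])//.
  apply: open_comp; last exact: open_lt.
  by move=> z _; apply: (@cvg_norm _ _ _ _ (nbhs_filter z)); apply: cvgB; [exact: cvg_id|exact: cvg_cst].
rewrite (_ : _ @^-1` U = \bigcup_i F i).
  apply: (@countable_bigcupT_measurable _ _ I); first exact: countableP.
  by move=> i; rewrite /F; case: asboolP => // _; exact: mB.
apply/seteqP; split => [p Up|p [i _]]; last by rewrite /F; case: asboolP => // sB /sB.
have /nbhs_ballP[e /= e0 eU] : nbhs (glue p) U by exact: open_nbhs_nbhs.
have [|r /andP[r0 re]] := @rat_between 0 (e / 2); first by rewrite divr_gt0.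
have [q1 Hq1] : exists q : rat, `|p.1 - ratr q| < ratr r.
  have [|q /andP[q1 q2]] := @rat_between (p.1 - ratr r) (p.1 + ratr r); first by lra.
  by exists q; rewrite ltr_distl; apply/andP; split; lra.
have [q2 Hq2] := rational_approx p.2 r0.
exists (q1, q2, r) => //; rewrite /F; case: asboolP => [_|[]]; first by split.
move=> p' [/= h1 h2]; apply: eU; rewrite -ball_normE /= glueB.
apply: (@le_lt_trans _ _ (2 * ratr r)); last by lra.
apply: norm_glue => /=.
  rewrite -(subrKA (ratr q1)) (le_trans (ler_normD _ _))//.
  rewrite mulr2n mulrDl mul1r lerD//; first exact: ltW.
  by rewrite distrC ltW.
rewrite -(subrKA (map_mx ratr q2)) (le_trans (ler_normD _ _))//.
rewrite mulr2n mulrDl mul1r lerD//; first exact: ltW.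
by rewrite distrC ltW.
Qed.

End RationalBoxes.

Section SigmaFinitePacking.
Context d (T : measurableType d) (R : realType) (m : {measure set T -> \bar R}).

(** A copy of [m] carrying the proof of sigma-finiteness, to which the structure expected by product
    measures can be attached. *)
Definition sfmeasure (sf : sigma_finite setT m) : set T -> \bar R := m.

Variable sf : sigma_finite setT m.

HB.instance Definition _ := Measure.on (sfmeasure sf).
HB.instance Definition _ := Measure_isSigmaFinite.Build _ _ _ (sfmeasure sf) sf.

End SigmaFinitePacking.

(** * Lebesgue measure on row vectors and its translation invariance *)

Section LebesgueMeasure.
Context {R : realType}.
Local Open Scope ereal_scope.

(** [lebesgue_int] is an iterated integral; a measure behind it gives access to integrability and
    dominated convergence. Finiteness on boxes provides the sigma-finiteness that Tonelli's theorem
    asks for. *)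
Definition represents k (leb : {measure set (borel 'rV[R]_k) -> \bar R}) :=
  (forall e : R, leb [set y | (`|y| <= e)%R] < +oo) /\
  forall f : borel 'rV[R]_k -> \bar R, (forall y, 0 <= f y) -> measurable_fun setT f ->
    lebesgue_int f = \int[leb]_y f y.

Lemma measurable_box k (e : R) : measurable ([set y | (`|y| <= e)%R] : set (borel 'rV[R]_k)).
Proof.
rewrite -[X in measurable X]setCK; apply: measurableC; apply: borel_open.
rewrite (_ : ~` _ = (fun y : 'rV[R]_k => `|y|%R) @^-1` [set t | (e < t)%R]); last first.
  by apply/seteqP; split => y /=; [move/negP; rewrite -ltNge|rewrite ltNge => /negP].
apply: open_comp; last exact: open_gt.
by move=> z _; exact: norm_continuous.
Qed.

Lemma represents_sigma_finite k leb : @represents k leb -> sigma_finite setT leb.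
Proof.
move=> [fin _]; exists (fun n => [set y : 'rV[R]_k | (`|y| <= n%:R)%R]).
  apply/esym/seteqP; split => // y _; have [n _ /(_ n (leqnn _)) yn] := nbhs_infty_ger `|y|%R.
  by exists n.
move=> n; split; [exact: measurable_box|exact: fin].
Qed.

(** In dimension [k.+1] the measure is the image under [glue] of the product of the line and
    dimension [k]; Tonelli's theorem reproduces the nesting of the iterated integral. *)
Lemma exists_lebesgue k : exists leb : {measure set (borel 'rV[R]_k) -> \bar R}, represents leb.
Proof.
elim: k => [|k [leb rl]].
  exists (@dirac _ (borel 'rV[R]_0) 0%R R); split => [e|f f0 mf /=].
    exact: ltry.
  by rewrite integral_dirac// diracT mul1e.
have sf := represents_sigma_finite rl; have [fin lE] := rl.
pose leb' : {sigma_finite_measure set (borel 'rV[R]_k) -> \bar R} :=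
  sfmeasure sf.
have mg := @measurable_glue R k.
pose m : {measure set (measurableTypeR R * borel 'rV[R]_k) -> \bar R} := (@lebesgue_measure R \x leb').
exists (measure_function_pushforward__canonical__measure_function_Measure m mg); split => [e|f f0 mf].
  set A : set (measurableTypeR R * borel 'rV[R]_k) := glue (k:=k) @^-1` [set y | (`|y| <= e)%R].
  have mA : measurable A by rewrite -[X in measurable X]setTI; apply: mg => //; exact: measurable_box.
  set B : set (measurableTypeR R * borel 'rV[R]_k) := `[(- e)%R, e]%classic `*` [set y | (`|y| <= e)%R].
  have mB : measurable B by apply: measurableX; [exact: measurable_itv|exact: measurable_box].
  have AB : m A <= m B.
    apply: le_measure; rewrite ?inE// => p /= pe; split => /=.
      by rewrite in_itv/= -ler_norml (le_trans (norm_glue_fst p)).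
    by rewrite (le_trans (norm_glue_snd p)).
  suff : m B < +oo by exact: le_lt_trans.
  have -> : m B = lebesgue_measure `[(- e)%R, e]%classic * leb' [set y | (`|y| <= e)%R].
    by apply: product_measure1E; [exact: measurable_itv|exact: measurable_box].
  apply: lte_mul_pinfty => //; last exact: fin.
  by rewrite lebesgue_measure_itv/=; case: ifP => // _; rewrite -EFinB.
have f1 : measurable_fun setT (f \o (@glue R k : measurableTypeR R * borel 'rV[R]_k -> borel 'rV[R]_k.+1)).
  exact: measurableT_comp.
rewrite (ge0_integral_pushforward mg m measurableT mf (fun y _ => f0 y)) preimage_setT.
have F := @fubini_tonelli1 _ _ _ _ _ (@lebesgue_measure R) leb' _ f1 (fun p => f0 (glue p)).
apply: etrans (esym F).
apply: eq_integral => t _; rewrite /fubini_F /=.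
apply: lE => [y|]; first exact: f0.
have mp : measurable_fun setT (fun y : borel 'rV[R]_k => ((t : measurableTypeR R), y)) by exact: measurable_pair1.
exact: (measurableT_comp f1 mp).
Qed.

Lemma measurable_lebesgue_glue k (f : borel 'rV[R]_k.+1 -> \bar R) : (forall y, 0 <= f y) ->
  measurable_fun setT f ->
  measurable_fun setT (fun t : measurableTypeR R => lebesgue_int (fun y => f (glue (t, y)))).
Proof.
move=> f0 mf; have [leb rl] := exists_lebesgue k.
have sf := represents_sigma_finite rl; have [fin lE] := rl.
pose leb' : {sigma_finite_measure set (borel 'rV[R]_k) -> \bar R} :=
  sfmeasure sf.
have f1 : measurable_fun setT (f \o (@glue R k : measurableTypeR R * borel 'rV[R]_k -> borel 'rV[R]_k.+1)).
  by apply: measurableT_comp => //; exact: measurable_glue.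
have := @measurable_fun_fubini_tonelli_F _ _ _ _ _ leb' _ f1 (fun p => f0 (glue p)).
apply: eq_measurable_fun => t _; rewrite /fubini_F /=; apply/esym/lE => [y|]; first exact: f0.
by apply: (measurableT_comp f1); exact: measurable_pair1.
Qed.

Lemma lebesgue_measure_shift (s : R) (A : set R) : measurable A ->
  pushforward lebesgue_measure (fun t : measurableTypeR R => (t + s)%R : measurableTypeR R) A
  = lebesgue_measure A.
Proof.
have ms : measurable_fun setT (fun t : measurableTypeR R => (t + s)%R : measurableTypeR R).
  by apply: measurable_funD.
pose nu := measure_function_pushforward__canonical__measure_function_Measure (@lebesgue_measure R) ms.
move=> mA; apply/esym/(@lebesgue_measure_unique _ nu) => //= _ [[a b]] _ <-.
rewrite /pushforward (_ : _ @^-1` _ = `](a - s)%R, (b - s)%R]%classic); last first.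
  by apply/seteqP; split => t /=; rewrite !in_itv/= ltrBlDr lerBrDr.
rewrite !lebesgue_measure_itv/= !lte_fin ltrD2r; case: ifP => // _.
by rewrite -!EFinB; congr EFin; ring.
Qed.

(** A translation splits along [glue]: the tail is treated by induction, the first coordinate by the
    invariance of Lebesgue measure on the line, which follows from its uniqueness. *)
Lemma lebesgue_int_shift k (f : borel 'rV[R]_k -> \bar R) (v : 'rV[R]_k) :
  (forall y, 0 <= f y) -> measurable_fun setT f ->
  lebesgue_int (fun y => f (y + v)%R) = lebesgue_int f.
Proof.
elim: k f v => [f v _ _|k IH f v f0 mf /=].
  by rewrite /=; congr f; apply/rowP => -[].
have [[s w] ->] := glue_surj v.
have mt t : measurable_fun setT (fun y : borel 'rV[R]_k => f (glue (t, y))).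
  apply: (measurableT_comp mf); apply: (measurableT_comp (@measurable_glue R k)).
  exact: measurable_pair1.
under eq_integral => t _.
  rewrite (_ : (fun y => _) = fun y => f (glue ((t + s)%R, (y + w)%R))); last first.
    by apply/funext => y; exact: (congr1 f (glueD (t, y) (s, w))).
  rewrite (IH (fun y => f (glue ((t + s)%R, y))) w)//.
  over.
have mG := measurable_lebesgue_glue f0 mf.
have ms : measurable_fun setT (fun t : measurableTypeR R => (t + s)%R : measurableTypeR R).
  by apply: measurable_funD.
pose G (t : measurableTypeR R) := lebesgue_int (fun y => f (glue (t, y))).
have G0 t : 0 <= G t.
  have [leb [_ lE]] := exists_lebesgue k; rewrite /G lE//; exact: integral_ge0.
transitivity (\int[pushforward lebesgue_measure (fun t : measurableTypeR R => (t + s)%R : measurableTypeR R)]_t G t).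
  by rewrite (ge0_integral_pushforward ms lebesgue_measure measurableT mG (fun y _ => G0 y)) preimage_setT.
by apply: eq_measure_integral => A mA _; exact: lebesgue_measure_shift.
Qed.

End LebesgueMeasure.

(** * Bounded balls are relatively compact *)

Section Speed.
Context {R : realType} {n : nat} {M : manifold R n}.
Variables (h : M -> 'M[R]_n) (hm : riemannian_metric h).
Implicit Types (c : R -> M) (e : chart R n M).

Definition speed c t : R := riem_norm h (c t) (derive1 (chart_at (c t) \o c : R -> 'rV[R]_n) t).

Lemma speed_ge0 c t : 0 <= speed c t. Proof. exact: sqrtr_ge0. Qed.

Lemma smooth_curve_near c e t : smooth_curve c -> atlas e -> chart_dom e (c t) ->
  smooth_near (fun s => e (c s)) t.
Proof.
move=> [cc sc] ae ct; apply: Cinfty_near (sc e ae) => //.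
by apply: open_comp; [move=> s _; exact: cc|exact: chart_dom_open].
Qed.

Lemma curve_chart_near c e t : smooth_curve c -> chart_dom e (c t) ->
  \forall s \near t, chart_dom e (c s).
Proof. by move=> [cc _] ct; apply: (cc t); exact: chart_near. Qed.

Lemma Dv_curve_chart c e e' t : smooth_curve c -> atlas e -> atlas e' ->
  chart_dom e (c t) -> chart_dom e' (c t) ->
  Dv (1 : R) (fun s : R => e' (c s)) t = Dv (1 : R) (fun s : R => e (c s)) t *m trans e e' (c t).
Proof.
move=> sc ae ae' et e't; rewrite -(Dv_trans _ ae ae' et e't).
rewrite -(@Dv_comp _ _ _ _ (fun s => e (c s)) (fun y => e' (chart_inv e y)) t 1).
- by apply: Dv_near; apply: filterS (curve_chart_near sc et) => s es; rewrite chartK.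
- exact: smooth_curve_near.
- exact/smooth_differentiable_mx/smooth_transition.
Qed.

Lemma speedE c e t : smooth_curve c -> atlas e -> chart_dom e (c t) ->
  speed c t = Num.sqrt (bil (gmx h e (e (c t))) (Dv (1 : R) (fun s : R => e (c s)) t) (Dv (1 : R) (fun s : R => e (c s)) t)).
Proof.
move=> sc ae et; rewrite /speed /riem_norm derive1E -DvE; congr Num.sqrt.
rewrite -(bil_gram h _ _ ae et) tcoordE -(Dv_curve_chart sc (chart_at_atlas _) ae)//.
exact: chart_at_dom.
Qed.

Lemma continuous_speed c : smooth_curve c -> continuous (speed c).
Proof.
move=> sc t; set e := chart_at (c t).
have ae : atlas e := chart_at_atlas _; have et : chart_dom e (c t) := chart_at_dom _.
have s1 := smooth_curve_near sc ae et.
pose F s := bil (gmx h e (e (c s))) (Dv (1 : R) (fun s : R => e (c s)) s) (Dv (1 : R) (fun s : R => e (c s)) s).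
have sF : smooth_near F t.
  apply: smooth_bil; [|exact: smooth_Dv|exact: smooth_Dv].
  by apply: (smooth_comp s1); exact: smooth_gram.
have E : \forall s \near t, Num.sqrt (F s) = speed c s.
  by apply: filterS (curve_chart_near sc et) => s es; rewrite (speedE sc ae es).
apply: (@cvg_trans _ (Num.sqrt (F s) @[s --> t])); first exact: near_eq_cvg.
rewrite (nbhs_singleton E : speed c t = _) || rewrite -(nbhs_singleton E).
apply: continuous_comp; first exact: smooth_continuous.
exact: sqrt_continuous.
Qed.

(** The interval exceeds [[0, 1]] on both sides, so that the derivatives at 0 and 1 are
    two-sided. *)
Definition arclength c (V : R -> R) := forall t : R, (- 1 < t < 2) -> is_derive t 1 V (speed c t).

Lemma exists_arclength c : smooth_curve c -> exists V, arclength c V.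
Proof.
move=> sc; have cs := continuous_speed sc.
pose V x := (\int[@lebesgue_measure R]_(t in [set` `[(-1 : R), x]]) (speed c t))%R.
exists V => t /andP[t1 t2].
have int : (@lebesgue_measure R).-integrable `[(-1 : R), 2] (EFin \o speed c).
  apply: continuous_compact_integrable; first exact: segment_compact.
  exact: continuous_subspaceT.
have [dV V'] := continuous_FTC1_closed t2 int t1 (cs t).
by apply: DeriveDef; [exact: dV|rewrite -derive1E; exact: V'].
Qed.

Lemma arclength_continuous c V t : arclength c V -> (- 1 < t < 2) -> {for t, continuous V}.
Proof.
move=> aV tt; have dV := aV t tt.
by apply: differentiable_continuous; apply/derivable1_diffP; exact: ex_derive.
Qed.

(** Affine changes of parameter cut a curve into arcs when [b] is positive and reverse it when [b]
    is negative, and keep it defined on the whole line. *)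
Definition affine_curve c (a b : R) : R -> M := fun t => c (a + b * t).

Lemma is_derive_affine (a b t : R) : is_derive t 1 (fun s => a + b * s) b.
Proof.
have h1 : is_derive t 1 (fun s => b * s) b.
  have := @is_deriveZ _ _ _ id b t 1 1 (is_derive_id t 1).
  by rewrite /GRing.scale/= mulr1.
by have := @is_deriveD _ _ _ (cst a) _ t 1 0 b (is_derive_cst a t 1) h1; rewrite add0r.
Qed.

Lemma is_derive_comp_affine (W : normedModType R) (f : R -> W) (a b t : R) (d : W) :
  is_derive (a + b * t) 1 f d -> is_derive t 1 (fun s => f (a + b * s)) (b *: d).
Proof.
move=> df; have d1 := derivable_diff1 (@ex_derive _ _ _ _ _ _ _ df).
have [d2 E2] := is_derive_affine a b t.
have L (z u : R) : 'd f z u = u *: 'd f z 1.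
  by rewrite -{1}[u]mulr1 -[u * 1]/(u *: (1 : R)) linearZ.
have := is_derive_comp d2 d1; rewrite E2 L -deriveE// (@derive_val _ _ _ _ _ _ _ df).
exact.
Qed.

Lemma smooth_affine (a b t : R) : smooth_near (fun s : R => a + b * s) t.
Proof.
apply: smoothD; first exact: smooth_cst.
apply: smoothM; first exact: smooth_cst.
apply: (@smooth_lin _ R^o R^o (idfun : {linear R^o -> R^o})); exact: id_continuous || (move=> ?; exact: cvg_id).
Qed.

Lemma smooth_compR1 (W : normedModType R) (f : R -> W) (a b t : R) : smooth_near f (a + b * t) ->
  smooth_near (fun s => f (a + b * s)) t.
Proof.
have key k U (f' : R -> W) : Ck k U f' -> Ck k ((fun s => a + b * s) @^-1` U) (fun s => f' (a + b * s)).
  have cphi (s : R) : {for s, continuous (fun s : R => a + b * s)} := smooth_continuous (smooth_affine a b s).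
  have line (g : R -> W) (y v s : R) : g (a + b * (s *: v + y)) = g (s *: (b * v) + (a + b * y)).
    by congr g; rewrite -![_ *: _]/(_ * _); ring.
  elim: k f' => [|k IH] f' Cf.
    by split=> // y Uy; apply: continuous_comp (cphi y) _; exact: Ck_continuous Cf Uy.
  have [cf df Df] := (CkSP _ _ _).1 Cf.
  apply/CkSP; split.
  - by move=> y Uy; apply: continuous_comp (cphi y) _; exact: cf.
  - move=> y v Uy; have dy := derivableP (df _ (b * v) Uy).
    move/is_derive_lineP: dy => dy.
    apply: (@ex_derive _ _ _ _ _ _ ('D_(b * v) f' (a + b * y))); apply/is_derive_lineP.
    by apply: is_derive_ext dy => s; rewrite line.
  move=> v; rewrite (_ : 'D_v _ = fun s => 'D_(b * v) f' (a + b * s)); first exact: (IH _ (Df (b * v))).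
  apply/funext => y; rewrite /derive (_ : (fun s => _) = (fun s : R => s^-1 *: ((f' \o shift (a + b * y)) (s *: (b * v)) - f' (a + b * y))))//.
  by apply/funext => s /=; rewrite line.
move=> [U [oU Ut] Cf]; exists ((fun s => a + b * s) @^-1` U); last by move=> k; exact: key.
split=> //; apply: open_comp => // s _; exact: smooth_continuous (smooth_affine a b s).
Qed.

Lemma smooth_affine_curve c a b : smooth_curve c -> smooth_curve (affine_curve c a b).
Proof.
move=> sc; split.
  move=> t; apply: (@continuous_comp _ _ _ (fun s => a + b * s) c).
    exact: smooth_continuous (smooth_affine a b t).
  by case: sc => + _; apply.
move=> d ad; apply/CinftyP.
  apply: open_comp; last exact: chart_dom_open.
  move=> t _; apply: (@continuous_comp _ _ _ (fun s => a + b * s) c).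
    exact: smooth_continuous (smooth_affine a b t).
  by case: sc => + _; apply.
by move=> t dt; apply: (@smooth_compR1 _ (d \o c)); exact: smooth_curve_near.
Qed.

Lemma speed_affine c a b t : smooth_curve c ->
  speed (affine_curve c a b) t = `|b| * speed c (a + b * t).
Proof.
move=> sc; set e := chart_at (c (a + b * t)).
have ae : atlas e := chart_at_atlas _; have et : chart_dom e (c (a + b * t)) := chart_at_dom _.
rewrite (speedE (smooth_affine_curve a b sc) ae et) (speedE sc ae et) /affine_curve.
have -> : Dv (1 : R) (fun s : R => e (c (a + b * s))) t = b *: Dv (1 : R) (fun s : R => e (c s)) (a + b * t).
  have s1 := smooth_curve_near sc ae et.
  by apply: Dv_val; apply: (@is_derive_comp_affine _ (fun s => e (c s))); exact: Dv_is_derive.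
by rewrite bilZl bilZr mulrA -expr2 sqrtrM ?sqr_ge0// sqrtr_sqr.
Qed.

Lemma affine_length c V a b : smooth_curve c -> arclength c V ->
  0 <= a <= 1 -> 0 <= a + b <= 1 ->
  curve_length h (affine_curve c a b) = (`|V (a + b) - V a|)%:E.
Proof.
move=> sc aV a01 ab01.
have rng (t : R) : 0 <= t <= 1 -> -1 < a + b * t < 2.
  move=> /andP[t0 t1]; move: a01 ab01 => /andP[a0 a1] /andP[ab0 ab1].
  have : 0 <= (1 - t) * a + t * (a + b) by rewrite addr_ge0// mulr_ge0// subr_ge0.
  have : (1 - t) * a + t * (a + b) <= 1.
    have : (1 - t) * a <= (1 - t) * 1 by rewrite ler_wpM2l// subr_ge0.
    have : t * (a + b) <= t * 1 by rewrite ler_wpM2l.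
    lra.
  have -> : (1 - t) * a + t * (a + b) = a + b * t by ring.
  by move=> h1 h2; apply/andP; split; lra.
(* The sign of [b]: with it [F] is a primitive of the speed even when the curve is run backwards. *)
pose s : R := if 0 <= b then 1 else -1.
have sb : s * b = `|b|.
  by rewrite /s; case: ifPn => [b0|]; [rewrite mul1r ger0_norm|rewrite -ltNge => b0; rewrite mulN1r ltr0_norm].
pose F (t : R) := s * V (a + b * t).
have dF (t : R) : 0 <= t <= 1 -> is_derive t 1 F (speed (affine_curve c a b) t).
  move=> t01; have dV := aV _ (rng t t01).
  have := @is_deriveZ _ _ _ _ s t 1 _ (is_derive_comp_affine dV).
  by rewrite scalerA sb speed_affine.
have cF (t : R) : 0 <= t <= 1 -> {for t, continuous F}.
  move=> /dF dt; apply: differentiable_continuous; apply/derivable1_diffP; exact: ex_derive.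
have := @continuous_FTC2 _ (speed (affine_curve c a b)) F 0 1 ltr01.
rewrite /curve_length => ->.
- rewrite -EFinB; congr EFin; rewrite /F mulr0 mulr1 addr0 -mulrBr.
  have ge : 0 <= s * (V (a + b) - V a).
    suff : F 0 <= F 1 by rewrite /F mulr0 mulr1 addr0 mulrBr subr_ge0.
    have [||t t01 E] := @MVT_segment _ F (speed (affine_curve c a b)) 0 1 ler01.
    - by move=> t; rewrite in_itv/= => /andP[t0 t1]; apply: dF; rewrite !ltW.
    - by apply: continuous_in_subspaceT => t; rewrite inE/= in_itv/=; exact: cF.
    by rewrite -subr_ge0 E subr0 mulr1 speed_ge0.
  rewrite -(ger0_norm ge) normrM (_ : `|s| = 1) ?mul1r//.
  by rewrite /s; case: ifP; rewrite ?normrN normr1.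
- apply: continuous_subspaceT; apply: continuous_speed; exact: smooth_affine_curve.
- split.
  + by move=> t; rewrite in_itv/= => /andP[t0 t1]; have [] := dF t; rewrite ?(ltW t0) ?(ltW t1).
  + apply: cvg_at_right_filter; apply: cF; rewrite lexx ler01//.
  + apply: cvg_at_left_filter; apply: cF; rewrite lexx ler01//.
- move=> t; rewrite in_itv/= => /andP[t0 t1]; rewrite derive1E.
  have t01 : 0 <= t <= 1 by rewrite (ltW t0) (ltW t1).
  by have [_ ->] := dF t t01.
Qed.

Lemma arclength_length c V : smooth_curve c -> arclength c V ->
  curve_length h c = (V 1 - V 0)%:E /\ V 0 <= V 1.
Proof.
move=> sc aV; have := @affine_length c V 0 1 sc aV; rewrite lexx ler01 add0r lexx ler01.
move=> /(_ erefl erefl); rewrite (_ : affine_curve c 0 1 = c); last first.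
  by apply/funext => t; rewrite /affine_curve add0r mul1r.
have ge : V 0 <= V 1.
  have dV (t : R) : 0 <= t <= 1 -> is_derive t 1 V (speed c t).
    by move=> /andP[t0 t1]; apply: aV; apply/andP; split; lra.
  have [||t t01 E] := @MVT_segment _ V (speed c) 0 1 ler01.
  - by move=> t; rewrite in_itv/= => /andP[t0 t1]; apply: dV; rewrite !ltW.
  - apply: continuous_in_subspaceT => t; rewrite inE/= in_itv/= => /andP[t0 t1].
    by apply: (arclength_continuous aV); apply/andP; split; lra.
  by rewrite -subr_ge0 E subr0 mulr1 speed_ge0.
by move=> ->; rewrite ger0_norm ?subr_ge0.
Qed.

End Speed.

(** * The distance: concatenating, reversing and cutting paths *)

Section Joined.
Context {R : realType} {n : nat} {M : manifold R n}.
Variables (h : M -> 'M[R]_n) (hm : riemannian_metric h).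
Implicit Types (p q z : M) (r s t : R) (l : \bar R).

Lemma joined_fin p q l : joined h p q l -> exists2 r, 0 <= r & l = r%:E.
Proof.
elim => {p q l} [p|c q l sc _ [r r0 ->]]; first by exists 0.
have [V aV] := exists_arclength hm sc; have [-> V01] := arclength_length hm sc aV.
by exists (V 1 - V 0 + r); rewrite ?EFinD// addr_ge0// subr_ge0.
Qed.

Lemma joined_trans p q z l l' : joined h p q l -> joined h q z l' -> joined h p z (l + l')%E.
Proof.
elim => {p q l} [p|c q l sc _ IH] jqz; first by rewrite add0e.
by rewrite -addeA; apply: joined_cons => //; exact: IH.
Qed.

Lemma joined1 c : smooth_curve c -> joined h (c 0) (c 1) (curve_length h c).
Proof. by move=> sc; rewrite -[curve_length h c]adde0; apply: joined_cons => //; exact: joined_refl. Qed.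

Lemma joined_sym p q l : joined h p q l -> joined h q p l.
Proof.
elim => {p q l} [p|c q l sc _ IH]; first exact: joined_refl.
rewrite addeC; apply: joined_trans IH _.
have [V aV] := exists_arclength hm sc; have [-> V01] := arclength_length hm sc aV.
have sc' := smooth_affine_curve 1 (-1) sc.
have := joined1 sc'; rewrite (affine_length hm sc aV) ?ler01 ?lexx// ?subrr ?lexx ?ler01//.
by rewrite /affine_curve mulr0 addr0 mulr1 subrr distrC ger0_norm ?subr_ge0.
Qed.

(** Whole arcs are removed until the one on which the length [s] is reached; that arc is cut at a
    time supplied by the intermediate value theorem for its arclength. *)
Lemma joined_cut p q (l : R) s : joined h p q l%:E -> 0 <= s <= l ->
  exists2 z, joined h p z s%:E & joined h z q (l - s)%:E.
Proof.
move Ee : l%:E => e j; move: l s Ee; elim: j => {p q e} [p|c q l' sc j IH] l s Ee /andP[s0 sl].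
  move: Ee => [l0]; have -> : s = 0 by apply: le_anti; rewrite s0 -l0 sl.
  by exists p; rewrite ?l0 ?subrr; exact: joined_refl.
have [V aV] := exists_arclength hm sc; have [cE V01] := arclength_length hm sc aV.
have [r r0 rE] := joined_fin j; move: Ee; rewrite cE rE -EFinD => -[lE].
have [sV|Vs] := leP (V 1 - V 0) s.
  have [||z j1 j2] := IH r (s - (V 1 - V 0)); [by rewrite rE|by apply/andP; split; lra|].
  exists z; last by rewrite (_ : l - s = r - (s - (V 1 - V 0)))//; lra.
  have := joined_cons sc j1; rewrite cE -EFinD (_ : V 1 - V 0 + (s - (V 1 - V 0)) = s)//; lra.
have [t t01 Vt] : exists2 t, t \in `[0, 1] & V t = V 0 + s.
  apply: IVT => //; first by apply: continuous_in_subspaceT => t; rewrite inE/= in_itv/= => /andP[t0 t1];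
    apply: (arclength_continuous aV); apply/andP; split; lra.
  by rewrite min_l// max_r//; apply/andP; split; lra.
move: t01; rewrite in_itv/= => /andP[t0 t1]; exists (c t).
  have := joined1 (smooth_affine_curve 0 t sc).
  rewrite (affine_length hm sc aV) ?lexx ?ler01 ?add0r ?t0 ?t1// Vt addrC addKr ger0_norm//.
  by rewrite /affine_curve mulr0 mulr1 !add0r.
have := joined_trans (joined1 (smooth_affine_curve t (1 - t) sc)) (_ : joined h _ q r%:E).
have tt : t + (1 - t) = 1 by ring.
rewrite (affine_length hm sc aV) ?t0 ?t1// tt ?lexx ?ler01// Vt -EFinD.
rewrite /affine_curve mulr0 mulr1 addr0 tt ger0_norm; last by lra.
rewrite -rE => /(_ j); rewrite (_ : V 1 - (V 0 + s) + r = l - s)//; lra.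
Qed.

(** Metric arguments are phrased with strict upper bounds only: each is witnessed by a single path
    ([dltP]), and extended reals stay out of sight. *)
Definition dlt p q r := (rdist h p q < r%:E)%E.

Lemma dltP p q r : dlt p q r <-> exists2 l : R, joined h p q l%:E & 0 <= l < r.
Proof.
split=> [/ereal_inf_lt[l /= j lr]|[l j /andP[l0 lr]]].
  have [t t0 lt] := joined_fin j; exists t; first by rewrite -lt.
  by rewrite t0/=; move: lr; rewrite lt lte_fin.
by apply: (@le_lt_trans _ _ l%:E); [exact: ereal_inf_lbound|rewrite lte_fin].
Qed.

Lemma dlt_sym p q r : dlt p q r -> dlt q p r.
Proof. by move=> /dltP[l j lr]; apply/dltP; exists l => //; exact: joined_sym. Qed.

Lemma dlt_trans q p z r s : dlt p q r -> dlt q z s -> dlt p z (r + s).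
Proof.
move=> /dltP[l j /andP[l0 lr]] /dltP[l' j' /andP[l0' lr']]; apply/dltP.
exists (l + l'); first by rewrite EFinD; exact: joined_trans j j'.
by rewrite addr_ge0//= ltrD.
Qed.

Lemma dltW p q r s : r <= s -> dlt p q r -> dlt p q s.
Proof. by move=> rs; rewrite /dlt => /lt_le_trans; apply; rewrite lee_fin. Qed.

Lemma dlt_gt0 p q r : dlt p q r -> 0 < r.
Proof. by move=> /dltP[l _ /andP[l0 lr]]; exact: le_lt_trans lr. Qed.

Lemma dlt_refl p r : 0 < r -> dlt p p r.
Proof. by move=> r0; apply/dltP; exists 0; [exact: joined_refl|rewrite lexx]. Qed.

Lemma dlt_cut p q s t : 0 < s -> 0 < t -> dlt p q (s + t) -> exists2 z, dlt p z s & dlt z q t.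
Proof.
move=> s0 t0 /dltP[l j /andP[l0 lst]]; have st0 : 0 < s + t by exact: addr_gt0.
(* Cutting in the proportion of [s] to [t] makes both pieces strictly shorter than their bounds. *)
pose u := l * s / (s + t).
have us : u < s by rewrite /u ltr_pdivrMr// mulrC ltr_pM2l.
have u0 : 0 <= u by rewrite /u divr_ge0// ?mulr_ge0// ltW.
have lu : l - u = l * t / (s + t) by rewrite /u; field; rewrite gt_eqF.
have ut : l - u < t by rewrite lu ltr_pdivrMr// mulrC ltr_pM2l.
have lu0 : 0 <= l - u by rewrite lu divr_ge0// ?mulr_ge0// ltW.
have [|z j1 j2] := joined_cut j (s := u); first by rewrite u0 -subr_ge0.
by exists z; apply/dltP; [exists u|exists (l - u)] => //; rewrite ?u0 ?lu0.
Qed.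

End Joined.

Section TameBoxes.
Context {R : realType} {n : nat} {M : manifold R n}.
Variables (h : M -> 'M[R]_n) (hm : riemannian_metric h).
Implicit Types (p q z : M) (c : chart R n M).

Definition sqn (u : 'rV[R]_n) : R := \sum_i u 0 i ^+ 2.

(* Coordinates in which the metric is within a factor 4 of the Euclidean one. *)
Definition tame c y0 (B : 'M[R]_n) e := [/\ 0 < e, boxed c y0 e, B \in unitmx &
  forall y u, box y0 e y -> sqn u / 4 <= bil (gmx h c y) (u *m B) (u *m B) <= 4 * sqn u].

Lemma sqn_ge0 u : 0 <= sqn u. Proof. by apply: sumr_ge0 => i _; exact: sqr_ge0. Qed.

(** As [2 |a b|] is at most the sum of the squares, an entrywise error of [1 / (2 (n + 1))] changes
    the quadratic form by at most [n / (2 (n + 1))], hence 1/2, times [sqn u]. The factors obtained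
    are 1/2 and 3/2; the coarser 1/4 and 4 have simple square roots. *)
Lemma sqn_perturb (A : 'M[R]_n) u : (forall i j, `|A i j - (i == j)%:R| <= (2 * n.+1%:R)^-1) ->
  sqn u / 4 <= bil A u u <= 4 * sqn u.
Proof.
move=> HA; have bE : bil A u u = \sum_i \sum_j u 0 i * u 0 j * A i j.
  rewrite bilE -mulmxA mxE; apply: eq_bigr => i _; rewrite mxE mulr_sumr; apply: eq_bigr => j _.
  by rewrite mxE; ring.
have sE : sqn u = \sum_i \sum_j u 0 i * u 0 j * (i == j)%:R.
  apply: eq_bigr => i _; rewrite (bigD1 i)//= eqxx mulr1 big1 ?addr0// => j ji.
  by rewrite eq_sym (negPf ji) mulr0.
have dE : `|bil A u u - sqn u| <= sqn u / 2.
  rewrite bE sE -sumrB (le_trans (ler_norm_sum _ _ _))//.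
  apply: (@le_trans _ _ (\sum_i \sum_j (u 0 i ^+ 2 + u 0 j ^+ 2) / 2 * (2 * n.+1%:R)^-1)).
    apply: ler_sum => i _; rewrite -sumrB (le_trans (ler_norm_sum _ _ _))//.
    apply: ler_sum => j _; rewrite -mulrBr normrM; apply: ler_pM => //.
    rewrite normrM -(real_normK (num_real (u 0 i))) -(real_normK (num_real (u 0 j))).
    by have := sqr_ge0 (`|u 0 i| - `|u 0 j|); rewrite sqrrB; lra.
  have -> : \sum_i \sum_j (u 0 i ^+ 2 + u 0 j ^+ 2) / 2 * (2 * n.+1%:R)^-1 = n%:R * sqn u * (2 * n.+1%:R)^-1.
    set k := (2 * _)^-1; under eq_bigr do rewrite -!mulr_suml big_split/= sumr_const card_ord.
    rewrite -!mulr_suml big_split/= sumr_const card_ord sumrMnl -/(sqn u) -[sqn u *+ n]mulr_natl.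
    by move: (sqn u) k => a k; lra.
  rewrite -sE mulrAC.
  have : (n%:R : R) / (2 * n.+1%:R) <= 2^-1.
    by rewrite invfM mulrCA -[leRHS]mulr1 ler_pM2l ?invr_gt0// ler_pdivrMr ?ltr0n// mul1r ler_nat.
  by move=> Hk; rewrite [leRHS]mulrC; apply: ler_wpM2r => //; exact: sqn_ge0.
have := sqn_ge0 u; move: dE; rewrite ler_norml => /andP[]; move=> *; apply/andP; split; lra.
Qed.

(** [B] is an orthonormal basis at the centre; by continuity the matrix of the metric in this basis
    stays close to the identity on a small box. *)
Lemma exists_tame c p e0 : atlas c -> chart_dom c p -> 0 < e0 ->
  exists B e, tame c (c p) B e /\ e <= e0.
Proof.
move=> ac cp e00; have [B BE] := posdef_orthonormal (posdef_gram hm ac cp).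
have uB : B \in unitmx by have := BE; rewrite -mulmxA => /mulmx1_unit[].
pose A y := B *m gmx h c y *m B^T.
have sA : smooth_near A (c p).
  apply: smooth_mulmx; last exact: smooth_cst.
  by apply: smooth_mulmx; [exact: smooth_cst|exact: smooth_gram].
have eta0 : 0 < (2 * n.+1%:R : R)^-1 by rewrite invr_gt0 mulr_gt0// ltr0n.
have nA : \forall y \near c p, forall i j, `|A y i j - (i == j)%:R| <= (2 * n.+1%:R)^-1.
  apply: near_forall => i; apply: near_forall => j.
  have cA := smooth_continuous (smooth_entry i j sA).
  have : \forall t \near A (c p) i j, `|t - (i == j)%:R| <= (2 * n.+1%:R)^-1.
    rewrite /A BE mxE; apply: filterS (nbhsx_ballx _ _ eta0) => t.
    by rewrite -ball_normE /= distrC => /ltW.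
  by move/cA.
have [e1 e10 b1] := near_box (filterI (chart_invK_near cp) nA).
exists B, (Num.min e1 e0); split; last by rewrite ge_min lexx orbT.
have sub : box (c p) (Num.min e1 e0) `<=` box (c p) e1.
  by move=> y /= /le_trans; apply; rewrite ge_min lexx.
split => //; first by rewrite lt_min e10.
  by move=> y /sub/b1[].
by move=> y u /sub/b1[_ Ay]; rewrite bil_mulmx; exact: sqn_perturb.
Qed.

End TameBoxes.


Section LocalDistance.
Context {R : realType} {n : nat} {M : manifold R n}.
Variables (h : M -> 'M[R]_n) (hm : riemannian_metric h).
Implicit Types (p q z : M) (c : chart R n M).

Lemma step_speed_bound : exists2 C : R, 0 < C & forall t : R, 0 <= t <= 1 -> `|Dv (1 : R) step t| <= C.
Proof.
have ss (t : R) : smooth_near (step : R -> R) t.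
  apply: (@smooth_step _ R^o (fun s : R => s) t).
  by apply: (@smooth_lin _ R^o R^o (idfun : {linear R^o -> R^o})); move=> ?; exact: cvg_id.
have cD : continuous (fun t : R => `|Dv (1 : R) step t|).
  move=> t; apply: (@cvg_norm _ _ _ _ (nbhs_filter t)).
  exact: smooth_continuous (smooth_Dv _ (ss t)).
have [t t01 Ht] := @EVT_max _ (fun t : R => `|Dv (1 : R) step t|) 0 1 ler01 (continuous_subspaceT cD).
exists (`|Dv (1 : R) step t| + 1); first by rewrite ltr_wpDl.
by move=> s s01; apply: (le_trans (Ht s _)); rewrite ?lerDl// in_itv.
Qed.

Lemma box_convex (y0 y w : 'rV[R]_n) e (s : R) : 0 <= s <= 1 -> box y0 e y -> box y0 e (y + w) ->
  box y0 e (y + s *: w).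
Proof.
rewrite /box /= => /andP[s0 s1] h1 h2.
rewrite (_ : _ - y0 = (1 - s) *: (y - y0) + s *: (y + w - y0)); last first.
  by apply/rowP => i; rewrite !mxE; ring.
rewrite (le_trans (ler_normD _ _))// !normrZ (ger0_norm s0) (@ger0_norm _ (1 - s)) ?subr_ge0//.
have : (1 - s) * `|y - y0| <= (1 - s) * e by rewrite ler_wpM2l// subr_ge0.
have : s * `|y + w - y0| <= s * e by rewrite ler_wpM2l.
lra.
Qed.

(* Proved with straight segments of the chart, reparametrized so as to stay in
   it for all times: a [smooth_curve] is defined on the whole line. *)
Lemma segment_dlt : exists2 C : R, 0 < C & forall c y0 B e, atlas c -> tame h c y0 B e ->
  forall y u r, box y0 e y -> box y0 e (y + u *m B) -> C * Num.sqrt (sqn u) < r ->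
  dlt h (chart_inv c y) (chart_inv c (y + u *m B)) r.
Proof.
(* [C] bounds the speed of the reparametrization, and 2 is the square root of the distortion allowed
   by [tame]. *)
have [C C0 HC] := step_speed_bound; exists (2 * C); first by rewrite mulr_gt0.
move=> c y0 B e ac [e0 bx uB tm] y u r by0 byu Cr.
pose line (t : R) := y + step t *: (u *m B).
have bline (t : R) : box y0 e (line t).
  by apply: box_convex => //; rewrite step_ge0 step_le1.
have dline t : chart_dom c (chart_inv c (line t)) by have [] := bx _ (bline t).
have cline t : c (chart_inv c (line t)) = line t by have [] := bx _ (bline t).
have ss (t : R) : smooth_near (step : R -> R) t.
  apply: (@smooth_step _ R^o (fun s : R => s) t).
  by apply: (@smooth_lin _ R^o R^o (idfun : {linear R^o -> R^o})); move=> ?; exact: cvg_id.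
have sl t : smooth_near line t.
  apply: smoothD; first exact: smooth_cst.
  by apply: smooth_scale => //; exact: smooth_cst.
pose gam (t : R) := chart_inv c (line t).
have sg : smooth_curve gam.
  have cg : continuous gam.
    move=> t; apply: (@continuous_comp _ _ _ line (chart_inv c)); first exact: smooth_continuous.
    by rewrite -cline; apply: chart_inv_continuous.
  split=> // d ad; apply/CinftyP; first by apply: open_comp => //; exact: chart_dom_open.
  move=> t dt; suff : smooth_near ((fun w => d (chart_inv c w)) \o line) t by [].
  apply: smooth_comp (sl t) _.
  by rewrite -cline; apply: smooth_transition.
apply/dltP => //; have [V aV] := exists_arclength hm sg.
have [E V01] := arclength_length hm sg aV.
exists (V 1 - V 0).
  have := joined1 h sg; rewrite E /gam /line step_le0// step_ge1// scale0r scale1r addr0.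
  exact.
rewrite subr_ge0 V01/=; apply: le_lt_trans Cr.
rewrite -lee_fin -E /curve_length.
apply: (@le_trans _ _ (\int[@lebesgue_measure R]_(t in `[0%R, 1%R]) (2 * C * Num.sqrt (sqn u))%:E)%E); last first.
  by rewrite integral_cst//= lebesgue_measure_itv/= lte_fin ltr01 oppr0 adde0 mule1.
apply: ge0_le_integral => //.
- by move=> t _; rewrite lee_fin sqrtr_ge0.
- apply/measurable_EFinP; apply: measurable_funTS.
  exact: continuous_measurable_fun (continuous_speed hm sg).
move=> t; rewrite /= in_itv/= => t01; rewrite lee_fin -/(speed h gam t).
rewrite (speedE h sg ac (dline t)) cline.
have -> : Dv (1 : R) (fun s : R => c (gam s)) t = Dv (1 : R) step t *: (u *m B).
  rewrite (_ : (fun s => _) = line); last by apply/funext => s; rewrite cline.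
  rewrite /line DvD; [|exact: smooth_cst|by apply: smooth_scale => //; exact: smooth_cst].
  by rewrite Dv_cst add0r (Dv_scale _ (ss t) (smooth_cst _ _)) Dv_cst scaler0 addr0.
rewrite bilZl bilZr mulrA -expr2 sqrtrM ?sqr_ge0// sqrtr_sqr.
have /andP[_ ub] := tm _ u (bline t).
have s2 : Num.sqrt (bil (gmx h c (line t)) (u *m B) (u *m B)) <= 2 * Num.sqrt (sqn u).
  rewrite (_ : 2 * Num.sqrt (sqn u) = Num.sqrt (4 * sqn u)); first exact: ler_wsqrtr.
  rewrite sqrtrM// (_ : (4 : R) = 2 ^+ 2) ?sqrtr_sqr ?ger0_norm//.
  by rewrite -natrX.
apply: (@le_trans _ _ (C * (2 * Num.sqrt (sqn u)))); first by apply: ler_pM => //; exact: HC.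
by rewrite mulrCA mulrA.
Qed.

Lemma near_dlt p r : 0 < r -> \forall q \near p, dlt h p q r.
Proof.
move=> r0; have [C C0 seg] := segment_dlt.
have ac := chart_at_atlas p; have cp := chart_at_dom p; set c := chart_at p in ac cp.
have [B [e [tm _]]] := exists_tame hm ac cp (ltr01 : (0 : R) < 1).
have [e0 bx uB _] := tm.
pose F (y : 'rV[R]_n) : R := Num.sqrt (sqn ((y - c p) *m invmx B)).
have cF : {for c p, continuous F}.
  apply: (@continuous_comp _ _ _ (fun y : 'rV[R]_n => sqn ((y - c p) *m invmx B)) Num.sqrt); last exact: sqrt_continuous.
  apply: smooth_continuous; apply: smooth_sum => i _.
  have s1 : smooth_near (fun y => ((y - c p) *m invmx B) 0 i) (c p).
    apply: smooth_entry; apply: smooth_mulmx; last exact: smooth_cst.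
    by apply: smoothB; [exact: smooth_id|exact: smooth_cst].
  exact: smoothM.
have F0 : F (c p) = 0.
  rewrite /F subrr mul0mx /sqn big1 ?sqrtr0// => i _.
  by rewrite mxE expr0n.
have nF : \forall y \near c p, F y < r / C.
  have : \forall t \near F (c p), t < r / C by apply: lt_nbhsl; rewrite F0 divr_gt0.
  by move/cF.
apply: (near_chart_inv cp); apply: filterS2 nF (box_near (c p) e0) => y Fy bxy.
have := seg c (c p) B e ac tm (c p) ((y - c p) *m invmx B) r.
rewrite mulmxKV// addrC subrK chartK//; apply => //; last by rewrite mulrC -ltr_pdivlMr.
by rewrite /box /= subrr normr0 ltW.
Qed.

Lemma near_dlt_sym p r : 0 < r -> \forall q \near p, dlt h q p r.
Proof. by move=> /(near_dlt p); apply: filterS => q; exact: dlt_sym. Qed.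

(** The points at finite distance from [p] form an open and closed set, both by [near_dlt]. *)
Lemma connected_dlt p q : connected [set: M] -> exists r, dlt h p q r.
Proof.
move=> cM; pose A := [set z | exists r, dlt h p z r].
have oA : open A.
  rewrite openE => z [r pz]; rewrite /interior; apply: filterS (near_dlt z ltr01) => w zw.
  by exists (r + 1); exact: dlt_trans pz zw.
have cA : closed A.
  move=> z Az; have [w [[r pw] zw]] := Az _ (near_dlt_sym z ltr01).
  by exists (r + 1); exact: dlt_trans pw zw.
have AT : A = setT.
  apply: cM; last 2 first.
  - by exists A => //; rewrite setTI.
  - by exists A => //; rewrite setTI.
  by exists p; exists 1; exact: dlt_refl.
by have : A q by rewrite AT.
Qed.

(* A bump function at [p] is Lipschitz for the distance, so small balls cannot
   leave its support. *)
Lemma small_ball_compact p : exists2 r, 0 < r &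
  exists2 K, compact K & forall q, dlt h p q r -> K q.
Proof.
have ac := chart_at_atlas p; have cp := chart_at_dom p; set c := chart_at p in ac cp.
have [B [e [tm _]]] := exists_tame hm ac cp (ltr01 : (0 : R) < 1).
have [e0 bx uB tame_b] := tm.
pose b := extend0 c (bump (c p) e).
have b0 y : ~ box (c p) e y -> bump (c p) e y = 0.
  by move=> /negP; rewrite -ltNge => /ltW; exact: bump_eq0.
have sb : smooth_fun b by apply: smooth_extend0 b0 => //; exact: smooth_bump.
pose D y := \sum_i `|Dv (row i B) (bump (c p) e) y|.
(* Unlike [D], this sum of squares is smooth, hence bounded on the compact box; it controls [D]
   because [|a|] is at most [1 + a ^+ 2]. *)
pose D2 y := \sum_i Dv (row i B) (bump (c p) e) y * Dv (row i B) (bump (c p) e) y.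
have cD2 : continuous D2.
  move=> y; apply: smooth_continuous; apply: smooth_sum => i _.
  by apply: smoothM; apply: smooth_Dv; exact: smooth_bump.
have [L L0 HL] : exists2 L, 0 < L & forall y, box (c p) e y -> D y <= L.
  have : bounded_set (D2 @` box (c p) e).
    apply: compact_bounded; apply: continuous_compact; last exact: compact_box.
    exact: continuous_subspaceT.
  move=> [L [_ HL]]; exists (n%:R + (`|L| + 1)); first by rewrite ltr_wpDl// ltr_wpDl.
  move=> y by0; apply: (@le_trans _ _ (n%:R + D2 y)).
    rewrite /D /D2 (_ : n%:R = \sum_(i < n) 1); last by rewrite sumr_const card_ord.
    rewrite -big_split; apply: ler_sum => i _ /=; set a := Dv _ _ _.
    by rewrite -expr2 -(real_normK (num_real a)); have := sqr_ge0 (`|a| - 1); have := normr_ge0 a; rewrite sqrrB; lra.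
  rewrite lerD2l; apply: le_trans (ler_norm _) _; apply: (HL (`|L| + 1)); last by exists y.
  by rewrite (le_lt_trans (ler_norm _))// ltrDl.
(* The lower bound in [tame] controls each coordinate of [v] in the basis [B] by twice the
   Riemannian norm of [v]. *)
have Db v y : box (c p) e y -> `|Dv v (bump (c p) e) y| <= 2 * L * Num.sqrt (bil (gmx h c y) v v).
  move=> by0; have -> : v = (v *m invmx B) *m B by rewrite mulmxKV.
  set u := v *m invmx B; have /andP[lb _] := tame_b y u by0.
  have Eu : Dv (u *m B) (bump (c p) e) y = \sum_i u 0 i * Dv (row i B) (bump (c p) e) y.
    have dfb := smooth_differentiable (smooth_bump (c p) e y).
    rewrite (_ : u *m B = \sum_i u 0 i *: row i B); last first.
      by apply/rowP => j; rewrite !mxE summxE; apply: eq_bigr => i _; rewrite !mxE.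
    elim: (index_enum _) => [|i s IH]; first by rewrite !big_nil Dv0dir.
    by rewrite !big_cons DvDdir// DvZdir// IH.
  rewrite Eu (le_trans (ler_norm_sum _ _ _))//.
  have ui i : `|u 0 i| <= 2 * Num.sqrt (bil (gmx h c y) (u *m B) (u *m B)).
    rewrite -sqrtr_sqr (_ : 2 * Num.sqrt _ = Num.sqrt (4 * bil (gmx h c y) (u *m B) (u *m B))); last first.
      by rewrite sqrtrM// (_ : (4 : R) = 2 ^+ 2) ?sqrtr_sqr ?ger0_norm// -natrX.
    apply: ler_wsqrtr; have : u 0 i ^+ 2 <= sqn u.
      by rewrite /sqn (bigD1 i)//= lerDl; apply: sumr_ge0 => j _; exact: sqr_ge0.
    by move: lb; lra.
  apply: (@le_trans _ _ (2 * Num.sqrt (bil (gmx h c y) (u *m B) (u *m B)) * D y)).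
    by rewrite /D mulr_sumr; apply: ler_sum => i _; rewrite normrM ler_wpM2r.
  rewrite [leRHS]mulrAC; apply: ler_wpM2l; [by rewrite mulr_ge0 ?sqrtr_ge0|exact: HL].
exists (2 * L)^-1; first by rewrite invr_gt0 mulr_gt0.
exists (chart_box c (c p) e); first exact: compact_chart_box.
suff lip q l : joined h p q l -> ((b p - b q)%:E <= (2 * L)%:E * l)%E.
  move=> q /dltP[//|l /lip + /andP[l0 lr]]; rewrite -EFinM lee_fin => bpq.
  apply: contrapT => nq; move: bpq.
  rewrite {2}/b (extend0_out bx b0 nq) subr0 /b extend0_in// bump_center.
  move: lr; rewrite -[(2 * L)^-1]mul1r ltr_pdivlMr ?mulr_gt0// mulrC => lr.
  by move=> /le_lt_trans/(_ lr); rewrite ltxx.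
elim => {q l} [q|gam q l sg jl IH]; first by rewrite subrr mule0.
have [r r0 rE] := joined_fin hm jl; move: IH; rewrite {}rE -EFinM lee_fin => IH.
have [V aV] := exists_arclength hm sg; have [E V01] := arclength_length hm sg aV.
rewrite E.
have step1 : b (gam 0) - b (gam 1) <= 2 * L * (V 1 - V 0).
  (* [F] has a nonnegative derivative: inside the box [b] decreases along [gam] at a rate at most
     [2 * L] times the speed, and outside it [b] is locally 0. *)
  pose F (t : R) := 2 * L * V t + b (gam t).
  have dF (t : R) : 0 <= t <= 1 -> exists2 d, is_derive t 1 F d & 0 <= d.
    move=> /andP[t0 t1]; have dV : is_derive t 1 V (speed h gam t) by apply: aV; apply/andP; split; lra.
    have [cg|ncg] := pselect (chart_dom c (gam t)); last first.
      have nb : \forall s \near t, b (gam s) = 0.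
        have : \forall q' \near gam t, b q' = 0.
          by apply: extend0_near0 b0 _ => // -[z /bx[dz _] zq]; apply: ncg; rewrite -zq.
        by case: sg => cg _ /(cg t).
      have db : is_derive t 1 (fun s => b (gam s)) 0.
        have sbg : smooth_near (fun s => b (gam s)) t.
          by apply: (eq_smooth (f := fun=> 0)) (smooth_cst _ _); apply: filterS nb => s ->.
        by have := Dv_is_derive (1 : R) sbg; rewrite (Dv_near _ nb) Dv_cst.
      exists (2 * L * speed h gam t + 0); last by rewrite addr0 mulr_ge0 ?speed_ge0// ltW// mulr_gt0.
      exact: (is_deriveD (is_deriveZ (2 * L) dV) db).
    have nb : \forall s \near t, b (gam s) = bump (c p) e (c (gam s)).
      by apply: filterS (curve_chart_near sg cg) => s cs; rewrite /b extend0_in.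
    have sgc := smooth_curve_near sg ac cg.
    have sbg : smooth_near (fun s => b (gam s)) t.
      apply: (eq_smooth (f := bump (c p) e \o (fun s => c (gam s)))).
        by apply: filterS nb => s ->.
      by apply: smooth_comp1 => //; exact: smooth_bump.
    exists (2 * L * speed h gam t + Dv (1 : R) (fun s => b (gam s)) t).
      exact: (is_deriveD (is_deriveZ (2 * L) dV) (Dv_is_derive (1 : R) sbg)).
    rewrite (Dv_near _ nb).
    rewrite (Dv_comp _ sgc (smooth_differentiable (smooth_bump _ _ _))).
    set w := Dv _ (fun s => c (gam s)) t.
    have [bg|nbg] := pselect (box (c p) e (c (gam t))).
      have := Db w _ bg; rewrite (speedE h sg ac cg) ler_norml => /andP[+ _]; rewrite -/w.
      by move: (Dv _ _ _) => a; lra.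
    rewrite (@Dv_near _ _ _ _ _ (fun=> 0)); last first.
      have oc : open (~` box (c p) e) by exact/closed_openC/closed_box.
      have : \forall y \near c (gam t), (~` box (c p) e) y by apply: open_nbhs_nbhs.
      by apply: filterS => y; exact: b0.
    by rewrite Dv_cst addr0 mulr_ge0 ?speed_ge0// ltW// mulr_gt0.
  have ndF : F 0 <= F 1.
    have /(@choice R R (fun t d => 0 <= t <= 1 -> is_derive t 1 F d /\ 0 <= d))[df Hdf] :
        forall t : R, exists d : R, 0 <= t <= 1 -> is_derive t 1 F d /\ 0 <= d.
      move=> t; have [t01|nt] := boolP (0 <= t <= 1); last by exists 0.
      by have [d d1 d2] := dF t t01; exists d.
    have [||t t01 E'] := @MVT_segment _ F df 0 1 ler01.
    - by move=> t; rewrite in_itv/= => /andP[t0 t1]; apply: (Hdf t _).1; rewrite !ltW.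
    - apply: continuous_in_subspaceT => t; rewrite inE/= in_itv/= => t01.
      have [dt _] := Hdf t t01.
      by apply: differentiable_continuous; apply/derivable1_diffP; exact: ex_derive.
    rewrite -subr_ge0 E' subr0 mulr1; apply: (Hdf t _).2.
    by move: t01; rewrite in_itv.
  by move: ndF; rewrite /F; lra.
rewrite -EFinD -EFinM lee_fin mulrDr.
by move: (2 * L * _) (2 * L * r) step1 IH => a1 a2; lra.
Qed.

End LocalDistance.

Section HopfRinow.
Context {R : realType} {n : nat} {M : manifold R n}.
Variables (h : M -> 'M[R]_n) (hm : riemannian_metric h).
Implicit Types (p q z : M) (r e : R).
Local Notation dlt := (dlt h).

Definition bounded_ball p r := exists2 K, compact K & forall q, dlt p q r -> K q.

Lemma bounded_ballW p q r s : dlt p q s -> bounded_ball p (s + r) -> bounded_ball q r.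
Proof.
move=> pq [K cK HK]; exists K => // z qz; apply: HK.
exact: dlt_trans pq qz.
Qed.

(* If every ball of radius 3 e centered in B(p, r) is bounded, then so is
   B(p, r + e): cover B(p, r) by finitely many e-balls. *)
Lemma bounded_ball_extend p r e : 0 < r -> 0 < e -> bounded_ball p r ->
  (forall q, dlt p q r -> bounded_ball q (3 * e)) -> bounded_ball p (r + e).
Proof.
move=> r0 e0 [K cK HK] Hq.
pose V z : set M := [set w | dlt z w e]^°.
move: cK; rewrite compact_cover => /(_ M setT V) [z _||D _ KD].
- exact: open_interior.
- by move=> z Kz; exists z => //; exact: near_dlt.
pose bad z := forall w, dlt p w r -> ~ V z w.
have HB z : exists2 B, compact B & forall w, dlt p w r -> V z w -> forall y, dlt w y e -> B y.
  have [bz|] := pselect (bad z).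
    by exists set0; [exact: compact0|move=> w pw /(bz w pw)].
  move=> /existsNP[w /not_implyP[pw /contrapT Vw]].
  have [B cB HB] := Hq w pw; exists B => // w' pw' Vw' y w'y; apply: HB.
  have w1 := dlt_sym hm (interior_subset Vw); have w2 := interior_subset Vw'.
  rewrite (_ : 3 * e = e + e + e); last by ring.
  exact: (dlt_trans hm (dlt_trans hm w1 w2) w'y).
have [B /all_and2[cB HBB]] := @choice _ _ (fun z B => compact B /\ forall w, dlt p w r -> V z w -> forall y, dlt w y e -> B y)
  (fun z => let: ex_intro2 B a b := HB z in ex_intro _ B (conj a b)).
exists (\bigcup_(z in [set` D]) B z).
  rewrite bigcup_fset; apply: big_ind => //; first exact: compact0.
  by move=> A A'; exact: compactU.
move=> y py; have [w pw wy] := dlt_cut hm r0 e0 py.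
have [z Dz Vzw] := KD w (HK _ pw).
by exists z => //; exact: HBB pw Vzw y wy.
Qed.

(** Otherwise every ball of radius [3 * e] centred in the larger ball lies in a compact set;
    starting from radius [e], [bounded_ball_extend] then applies again and again until the radius
    exceeds [r]. *)
Lemma unbounded_ball_near p r e : 0 < r -> 0 < e -> ~ bounded_ball p r ->
  exists2 q, dlt p q (r + e) & ~ bounded_ball q (3 * e).
Proof.
move=> r0 e0 ub; apply: contrapT => Hn.
have Hq q : dlt p q (r + e) -> bounded_ball q (3 * e).
  by move=> pq; apply: contrapT => nb; apply: Hn; exists q.
have HN k : e + k%:R * e <= r + e -> bounded_ball p (e + k%:R * e).
  elim: k => [|k IH] ke.
    rewrite mul0r addr0; have [K cK HK] := Hq p (dlt_refl hm p (addr_gt0 r0 e0)).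
    by exists K => // q pq; apply: HK; apply: dltW pq; lra.
  have k0 : 0 <= k%:R * e by rewrite mulr_ge0// ltW.
  move: ke; rewrite -natr1 mulrDl mul1r => ke.
  rewrite addrA; apply: bounded_ball_extend => //; [lra|by apply: IH; lra|].
  by move=> q pq; apply: Hq; apply: dltW pq; lra.
pose k := Num.truncn (r / e).
have /andP[k1 k2] := truncn_itv (ltW (divr_gt0 r0 e0)); rewrite -/k in k1 k2.
have kr : k%:R * e <= r by rewrite -ler_pdivlMr.
have rk : r < e + k%:R * e.
  by move: k2; rewrite ltr_pdivrMr// -natr1 mulrDl mul1r addrC.
apply: ub; have [|K cK HK] := HN k; first by lra.
by exists K => // q pq; apply: HK; apply: dltW pq; exact: ltW.
Qed.

Hypothesis complete : complete_metric h.

(** A ball contained in no compact set produces another such ball of half the radius with a centre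
    not far away. The centres form a Cauchy sequence, and around its limit small balls are
    relatively compact, which catches the late balls of the sequence. *)
Lemma ball_bounded p r : bounded_ball p r.
Proof.
apply: contrapT => ub.
have r0 : 0 < r.
  rewrite ltNge; apply/negP => r0; apply: ub; exists set0; first exact: compact0.
  by move=> q /(dlt_gt0 hm); rewrite ltNge r0.
pose e k := (2^-1 : R) ^+ k * r.
have ee k : e k = 2 * e k.+1 by rewrite /e exprS; field.
have e0 k : 0 < e k by rewrite /e mulr_gt0// exprn_gt0// invr_gt0.
pose T := {qk : M * nat | ~ bounded_ball qk.1 (e qk.2)}.
have nxt (x : T) : exists y : T, dlt (sval x).1 (sval y).1 (e (sval x).2 + e (sval x).2) /\ (sval y).2 = (sval x).2.+1.
  case: x => -[q k] /= ub'.
  (* A third of the next radius, as the ball found has three times the radius of the tolerance. *)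
  have [|q' qq' ub2] := @unbounded_ball_near q (e k) (e k.+1 / 3) (e0 k) _ ub'; first by rewrite divr_gt0.
  have ub3 : ~ bounded_ball q' (e k.+1) by rewrite (_ : e k.+1 = 3 * (e k.+1 / 3)) => //; field.
  exists (exist _ (q', k.+1) ub3); split => //=.
  by apply: dltW qq'; have := ee k; have := e0 k.+1; lra.
have ub0 : ~ bounded_ball (p, 0%N).1 (e (p, 0%N).2) by rewrite /= /e expr0 mul1r.
have [f [f0 Hf]] := @dependent_choice T (fun x y => dlt (sval x).1 (sval y).1 (e (sval x).2 + e (sval x).2) /\ (sval y).2 = (sval x).2.+1) (fun x => cid (nxt x)) (exist _ (p, 0%N) ub0).
pose u k := (sval (f k)).1.
have fk k : (sval (f k)).2 = k by elim: k => [|k IH]; [rewrite f0|rewrite (Hf k).2 IH].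
have uu k : dlt (u k) (u k.+1) (2 * e k).
  by have [+ _] := Hf k; rewrite fk mulr2n mulrDl mul1r.
have nu k : ~ bounded_ball (u k) (e k) by have := svalP (f k); rewrite fk.
have uN k l : dlt (u k) (u (k + l)%N) (5 * e k).
  (* The jumps [2 * e j], equal to [4 * e j - 4 * e j.+1], telescope; the remaining [e k] makes the
     bound strict already for [l = 0]. *)
  have : dlt (u k) (u (k + l)%N) (5 * e k - 4 * e (k + l)%N).
    elim: l => [|l IH]; first by rewrite addn0; apply: (dlt_refl hm); have := e0 k; lra.
    rewrite addnS; apply: dltW (dlt_trans hm IH (uu (k + l)%N)).
    by have := ee (k + l)%N; lra.
  by apply: dltW; have := e0 (k + l)%N; lra.
have e_cvg (d : R) : 0 < d -> exists K, forall k, (K <= k)%N -> e k < d.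
  move=> d0; have : (fun k => e k) @ \oo --> (0 : R).
    rewrite -[0](mul0r r); apply: cvgM; last exact: cvg_cst.
    by apply: cvg_expr; rewrite ger0_norm ?invr_ge0// invf_lt1// ltr1n.
  move=> /cvgrPdist_lt/(_ d d0)[K _ HK]; exists K => k Kk.
  by have := HK k Kk; rewrite /= sub0r normrN gtr0_norm.
have [z uz] : exists z, u @ \oo --> z.
  apply: complete => d d0; have [|K HK] := e_cvg (d / 16); first by rewrite divr_gt0.
  exists K => i j Ki Kj; apply: (dltW (r := 5 * e K + 5 * e K)).
    by have := HK K (leqnn _); lra.
  have uK i' : (K <= i')%N -> dlt (u K) (u i') (5 * e K) by move=> /subnKC <-.
  exact: (dlt_trans hm (dlt_sym hm (uK _ Ki)) (uK _ Kj)).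
have [d d0 bz] := small_ball_compact hm z.
have d2 : 0 < d / 2 by rewrite divr_gt0.
have [K HK] := e_cvg (d / 2) d2.
have /= := uz _ (near_dlt hm z d2).
move=> [K' _ HK']; pose k := maxn K K'.
apply: (nu k); apply: (@bounded_ballW z _ _ (d / 2)).
  by apply: HK'; rewrite /= leq_maxr.
have [C cC HC] := bz; exists C => // q zq; apply: HC; apply: dltW zq.
by have := HK k (leq_maxl _ _); lra.
Qed.

End HopfRinow.

(** * Lipschitz cutoff functions *)

Section Cutoff.
Context {R : realType} {n : nat} {M : manifold R n}.
Variables (h : M -> 'M[R]_n) (hm : riemannian_metric h).
Hypotheses (complete : complete_metric h) (Mconn : connected [set: M]).
Variable p0 : M.
Local Notation dlt := (dlt h).

Definition radius q : R := inf [set r | dlt p0 q r].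

Lemma radius_has_inf q : has_inf [set r | dlt p0 q r].
Proof.
split; first by have [r] := connected_dlt hm p0 q Mconn; exists r.
by exists 0 => r /(dlt_gt0 hm)/ltW.
Qed.

Lemma radius_ltP q r : radius q < r -> dlt p0 q r.
Proof.
move=> qr; have e0 : 0 < r - radius q by rewrite subr_gt0.
have [s ps] := inf_adherent e0 (radius_has_inf q).
by rewrite -/(radius q) addrC subrK => /ltW sr; exact: dltW ps.
Qed.

Lemma radius_lip q z s : dlt q z s -> radius z <= radius q + s.
Proof.
move=> qz; apply/ler_addgt0Pr => e e0.
have /radius_ltP pq : radius q < radius q + e by rewrite ltrDl.
apply: ge_inf; first by case: (radius_has_inf z).
rewrite /= (_ : radius q + s + e = radius q + e + s); last by ring.
exact: dlt_trans pq qz.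
Qed.

Lemma radius_ge0 q : 0 <= radius q.
Proof. by apply: lb_le_inf; [case: (radius_has_inf q)|move=> r /(dlt_gt0 hm)/ltW]. Qed.

(** The radius of the support and the inverse of the slope are both [k.+1]: the support exhausts the
    manifold while the slope, which multiplies the final estimate, tends to 0. *)
Definition cutoff (k : nat) q : R := Num.max 0 (1 - radius q / k.+1%:R).

Lemma cutoff_ge0 k q : 0 <= cutoff k q.
Proof. by rewrite /cutoff le_max lexx. Qed.

Lemma cutoff_le1 k q : cutoff k q <= 1.
Proof. by rewrite /cutoff ge_max ler01/= gerBl divr_ge0// radius_ge0. Qed.

Lemma cutoff_lip k q z s : dlt q z s -> `|cutoff k z - cutoff k q| <= s / k.+1%:R.
Proof.
move=> qz; have h1 := radius_lip qz; have h2 := radius_lip (dlt_sym hm qz).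
have k0 : 0 < k.+1%:R :> R by rewrite ltr0n.
have m1 : radius z / k.+1%:R <= radius q / k.+1%:R + s / k.+1%:R.
  by rewrite -mulrDl ler_pM2r ?invr_gt0.
have m2 : radius q / k.+1%:R <= radius z / k.+1%:R + s / k.+1%:R.
  by rewrite -mulrDl ler_pM2r ?invr_gt0.
have s0 : 0 <= s / k.+1%:R by rewrite divr_ge0// ltW// (dlt_gt0 hm qz).
rewrite /cutoff; move: m1 m2 s0; move: (radius z / _) (radius q / _) (s / _) => a b c m1 m2 s0.
by rewrite /Order.max; case: ltP => ?; case: ltP => ?; rewrite ler_norml; apply/andP; split; lra.
Qed.

Lemma continuous_cutoff k : continuous (cutoff k).
Proof.
move=> q; apply/cvgrPdist_le => e e0.
have d0 : 0 < e * k.+1%:R by rewrite mulr_gt0// ltr0n.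
apply: filterS (near_dlt hm q d0) => z /(cutoff_lip k).
by rewrite distrC mulfK// pnatr_eq0.
Qed.

Lemma cutoff_compact k : exists2 K, compact K & forall q, cutoff k q != 0 -> K q.
Proof.
have [K cK HK] := ball_bounded hm complete p0 k.+1%:R; exists K => // q.
rewrite /cutoff /Num.max; case: ltP => [|_]; last by rewrite eqxx.
rewrite subr_gt0 ltr_pdivrMr ?ltr0n// mul1r => /radius_ltP qk _; exact: HK.
Qed.

Lemma cutoff_cvg q : (fun k => cutoff k q) @ \oo --> (1 : R).
Proof.
have h1 : (fun k : nat => 1 - radius q / k.+1%:R) @ \oo --> (1 : R).
  rewrite -[X in _ --> X]subr0 -[X in _ - X](mulr0 (radius q)).
  apply: cvgB; first exact: cvg_cst.
  apply: cvgM; [exact: cvg_cst|exact: cvg_harmonic].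
apply: (squeeze_cvgr _ h1 (cvg_cst (1 : R))).
by near=> k; rewrite cutoff_le1 andbT /cutoff le_max lexx orbT.
Unshelve. all: by end_near.
Qed.

Lemma cutoff_nd k l q : (k <= l)%N -> cutoff k q <= cutoff l q.
Proof.
move=> kl; rewrite /cutoff ge_max cutoff_ge0/= le_max lerD2l lerN2.
by rewrite ler_wpM2l ?radius_ge0// ?orbT// lef_pV2 ?posrE ?ltr0n// ler_nat.
Qed.

End Cutoff.

(** * Stokes' theorem on complete manifolds *)

Section EuclideanIntegrals.
Context {R : realType} {k : nat}.
Variables (leb : {measure set (borel 'rV[R]_k) -> \bar R}) (rl : represents leb).
Local Notation mR := (measurableTypeR R).
Local Notation bV := (borel 'rV[R]_k).
Implicit Types (y z : 'rV[R]_k) (f F phi : bV -> mR).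

Lemma measurable_continuous (f : 'rV[R]_k -> R) : continuous f ->
  measurable_fun setT (f : bV -> mR).
Proof. by move=> cf; apply: borel_continuousR => [|y _]; [exact: openT|exact: cf]. Qed.

Lemma measurable_translation (v : 'rV[R]_k) :
  measurable_fun setT (fun y : bV => ((y : 'rV[R]_k) + v : bV)).
Proof.
have c : continuous (fun y : 'rV[R]_k => y + v).
  by move=> y; exact: smooth_continuous (smoothD (smooth_id y) (smooth_cst v y)).
by apply: borel_continuous => [|y _]; [exact: openT|exact: c].
Qed.

Lemma ge0_integral_translate (v : 'rV[R]_k) (f : bV -> \bar R) : (forall y, 0 <= f y)%E ->
  measurable_fun setT f -> (\int[leb]_y f ((y : 'rV[R]_k) + v)%R = \int[leb]_y f y)%E.
Proof.
move=> f0 mf; have [_ lE] := rl.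
rewrite -(lE (fun y : bV => f ((y : 'rV[R]_k) + v)))// -?lE//; first exact: lebesgue_int_shift.
exact: (measurableT_comp mf (measurable_translation v)).
Qed.

Lemma Rintegral_translate (v : 'rV[R]_k) (f : bV -> R) : measurable_fun setT (f : bV -> mR) ->
  (\int[leb]_y f ((y : 'rV[R]_k) + v) = \int[leb]_y f y)%R.
Proof.
move=> mf; rewrite /Rintegral; congr fine; rewrite integralE [RHS]integralE.
have mF : measurable_fun setT (EFin \o f) by apply/measurable_EFinP.
congr (_ - _)%E.
- rewrite -(ge0_integral_translate v (funepos_ge0 (EFin \o f)) (measurable_funepos mF)).
  by apply: eq_integral => y _; rewrite !funeposE.
- rewrite -(ge0_integral_translate v (funeneg_ge0 (EFin \o f)) (measurable_funeneg mF)).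
  by apply: eq_integral => y _; rewrite !funenegE.
Qed.

Lemma integrable_bounded_support (f : bV -> R) (K r : R) : measurable_fun setT (f : bV -> mR) ->
  (forall y, `|f y| <= K) -> (forall y, r < `|(y : 'rV[R]_k)| -> f y = 0) ->
  leb.-integrable setT (EFin \o f).
Proof.
move=> mf fK fr.
have mA := @measurable_box R k r; pose A : set bV := [set y | `|y| <= r].
apply: (@le_integrable _ _ _ _ setT measurableT _ (fun y : bV => (K%:E * (\1_A y)%:E)%E)) => //.
- exact/measurable_EFinP.
- move=> y _; change (`|f y|%:E <= `|K * \1_A y|%:E)%E; rewrite lee_fin indicE.
  case: (ltP r `|y : 'rV[R]_k|) => ry; first by rewrite fr// normr0 normr_ge0.
  by rewrite mem_set// mulr1 (le_trans (fK y))// ler_norm.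
- apply: integrableZl => //; apply/integrableP; split; first exact/measurable_EFinP/measurable_indic.
  under eq_integral => y _ do rewrite gee0_abs ?lee_fin//.
  by rewrite integral_indic// setIT; exact: rl.1.
Qed.

Lemma continuous_bounded_support (f : 'rV[R]_k -> R) (r : R) : continuous f ->
  (forall y, r < `|y| -> f y = 0) -> exists2 K, 0 < K & forall y, `|f y| <= K.
Proof.
move=> cf fr.
have cn : {within box 0 r, continuous (fun y : 'rV[R]_k => `|f y|)}.
  apply: continuous_subspaceT => y; apply: (@cvg_norm _ _ _ _ (nbhs_filter y)); exact: cf.
have [[y0 by0]|ne] := pselect (box (0 : 'rV[R]_k) r !=set0); last first.
  exists 1 => // y; rewrite fr ?normr0// ltNge; apply/negP => yr; apply: ne.
  by exists y; rewrite /box /= subr0.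
have [y1 _ Hy] := compact_EVT_max (ex_intro _ y0 by0) (@compact_box R k 0 r) cn.
exists (`|f y1| + 1); first by rewrite ltr_wpDl.
move=> y; case: (ltP r `|y|) => yr; first by rewrite fr// normr0 addr_ge0.
by apply: (le_trans (Hy y _)); rewrite ?lerDl// inE /box /= subr0.
Qed.

Lemma Dv_bounded_support (F : 'rV[R]_k -> R) (w : 'rV[R]_k) (r : R) :
  (forall y, r < `|y| -> F y = 0) -> forall y, r < `|y| -> Dv w F y = 0.
Proof.
move=> Fr y ry; rewrite (@Dv_near _ _ _ w F (fun=> 0)) ?Dv_cst//.
have : \forall z \near y, r < `|z|.
  have c : continuous (fun z : 'rV[R]_k => `|z|) by exact: norm_continuous.
  exact: (c y _ (lt_nbhsr ry)).
by apply: filterS => z; exact: Fr.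
Qed.

(* Integration by parts against [phi], which need only be Lipschitz: [Dv w F] is
   a limit of difference quotients, and translation invariance shifts them to
   [phi]. *)
Lemma integral_difference_bound (phi F : 'rV[R]_k -> R) (w : 'rV[R]_k) (A : set 'rV[R]_k) (kappa tau r : R) :
  measurable_fun setT (phi : bV -> mR) -> (forall y, `|phi y| <= 1) -> 0 < tau ->
  (forall y t, A y -> `|t| < tau -> `|phi (y + t *: w) - phi y| <= kappa * `|t|) ->
  (forall y, smooth_near F y) -> (forall y, ~ A y -> F y = 0) ->
  (forall y, r < `|y| -> F y = 0) ->
  leb.-integrable setT (EFin \o (fun y : bV => phi y * Dv w F y)) /\
  `|\int[leb]_y (phi y * Dv w F y)%R|%R <= kappa * (\int[leb]_y `|F y|)%R.
Proof.
move=> mphi phi1 tau0 Hphi sF FA Fr.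
have cF : continuous F by move=> y; exact: smooth_continuous (sF y).
have cD : continuous (Dv w F) by move=> y; exact: smooth_continuous (smooth_Dv w (sF y)).
have mF := measurable_continuous cF; have mD := measurable_continuous cD.
have [K1 K10 HK1] := continuous_bounded_support cF Fr.
have [K2 K20 HK2] := continuous_bounded_support cD (Dv_bounded_support w Fr).
have iD : leb.-integrable setT (EFin \o (fun y : bV => phi y * Dv w F y)).
  apply: (@integrable_bounded_support _ K2 r).
  - exact: measurable_funM.
  - by move=> y; rewrite normrM -[K2]mul1r ler_pM.
  - by move=> y ry; rewrite (Dv_bounded_support w Fr ry) mulr0.
split=> //.
(* Steps below [tau] for the Lipschitz estimate, and below 1 to keep all translated supports in one
   ball; [m.+2] makes these inequalities strict from [m = 0] on. *)
pose t (m : nat) : R := Num.min tau 1 / m.+2%:R.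
have m0 : 0 < Num.min tau 1 by rewrite lt_min tau0 ltr01.
have t0 m : 0 < t m by rewrite /t divr_gt0.
have tm m : t m < Num.min tau 1 by rewrite /t ltr_pdivrMr// ltr_pMr// ltr1n.
have ttau m : `|t m| < tau by rewrite gtr0_norm//; apply: (lt_le_trans (tm m)); rewrite ge_min lexx.
have t1 m : `|t m| <= 1 by rewrite gtr0_norm//; apply: (le_trans (ltW (tm m))); rewrite ge_min lexx orbT.
have tneq m : t m != 0 by rewrite gt_eqF.
have cvt : t @ \oo --> (0 : R).
  rewrite -(mulr0 (Num.min tau 1)); apply: cvgM; first exact: cvg_cst.
  by have := @cvg_harmonic R; rewrite -cvg_shiftS; apply.
pose Q m y := (phi y * ((F (y + t m *: w) - F y) / t m))%R.
have mT v (f : bV -> mR) : measurable_fun setT f -> measurable_fun setT (fun y : bV => f ((y : 'rV[R]_k) + v)).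
  by move=> mf; exact: (measurableT_comp mf (measurable_translation v)).
have mQ m : measurable_fun setT (Q m : bV -> mR).
  by apply: measurable_funM => //; apply: measurable_funM => //; apply: measurable_funB => //; exact: mT.
have bw y (s : R) : r + `|w| < `|y| -> `|s| <= 1 -> r < `|y + s *: w|.
  move=> ry s1; rewrite -(ltrD2r `|w|) (lt_le_trans ry)//.
  rewrite -{1}[y](addrK (s *: w)) (le_trans (ler_normB _ _))// lerD2l normrZ ler_piMl//.
have r' y : r + `|w| < `|y| -> r < `|y| by apply: le_lt_trans; rewrite lerDl.
have QK m y : `|Q m y| <= K2.
  rewrite /Q normrM -[K2]mul1r ler_pM//.
  have [|s s1] := @MVT_line _ _ F y w (t m); first by move=> s _; exact: smooth_derivable (sF _).
  rewrite [t m *: w + y]addrC => ->; rewrite mulrC mulKf// -DvE; exact: HK2.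
have Q0 m y : r + `|w| < `|y| -> Q m y = 0.
  by move=> ry; rewrite /Q (Fr y) ?r'// (Fr (y + _)) ?bw// subrr mul0r mulr0.
have iQ m : leb.-integrable setT (EFin \o (Q m : bV -> R)).
  exact: (@integrable_bounded_support _ K2 (r + `|w|) (mQ m) (QK m) (Q0 m)).
have cvQ y : (Q m y @[m --> \oo] --> phi y * Dv w F y)%R.
  rewrite /Q; apply: cvgM; first exact: cvg_cst.
  rewrite DvE; have dF := smooth_derivable (v := w) (sF y).
  have cd : (fun h => h^-1 *: (F (h *: w + y) - F y)) @ 0^' --> 'D_w F y by [].
  have tt : t @ \oo --> 0^'.
    move=> P HP; have H : \forall m \near \oo, t m != 0 -> P (t m) := cvt (fun s : R => s != 0 -> P s) HP.
    change (\forall m \near \oo, P (t m)).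
    by apply: filterS H => m /(_ (tneq m)).
  have := cvg_comp _ _ tt cd; apply: cvg_trans; apply: near_eq_cvg; apply: nearW => m /=.
  by rewrite [_ / t m]mulrC [t m *: w + y]addrC.
have iF : leb.-integrable setT (EFin \o (F : bV -> R)) by exact: (@integrable_bounded_support _ K1 r mF HK1 Fr).
have iaF : leb.-integrable setT (EFin \o (fun y : bV => `|F y|)) by exact: (integrable_abse iF).
have QE m : (\int[leb]_y Q m y = \int[leb]_y ((phi ((y : 'rV[R]_k) - t m *: w) - phi y) / t m * F y))%R.
  pose P1 (y : bV) : R := phi ((y : 'rV[R]_k) - t m *: w) * F y.
  pose P2 (y : bV) : R := phi y * F y.
  have mP1 : measurable_fun setT (P1 : bV -> mR) by apply: measurable_funM => //; exact: mT.
  have iP1 : leb.-integrable setT (EFin \o P1).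
    apply: (@integrable_bounded_support _ K1 r) => // [y|y ry]; rewrite /P1.
      by rewrite normrM -[K1]mul1r ler_pM.
    by rewrite Fr// mulr0.
  have mP2 : measurable_fun setT (P2 : bV -> mR) by apply: measurable_funM.
  have iP2 : leb.-integrable setT (EFin \o P2).
    apply: (@integrable_bounded_support _ K1 r) => // [y|y ry]; rewrite /P2.
      by rewrite normrM -[K1]mul1r ler_pM.
    by rewrite Fr// mulr0.
  have iP1' : leb.-integrable setT (EFin \o (fun y : bV => P1 ((y : 'rV[R]_k) + t m *: w))).
    apply: (@integrable_bounded_support _ K1 (r + `|w|)) => [|y|y ry].
    - exact: mT.
    - by rewrite /P1 normrM -[K1]mul1r ler_pM.
    - by rewrite /P1 Fr ?mulr0// bw.
  transitivity ((t m)^-1 * (\int[leb]_y P1 ((y : 'rV[R]_k) + t m *: w) - \int[leb]_y P2 y))%R.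
    rewrite -RintegralB// -RintegralZl//; last exact: (integrableB _ iP1' iP2).
    apply: eq_Rintegral => y _; rewrite /Q /P1 /P2 addrK; ring.
  rewrite (Rintegral_translate _ mP1) -RintegralB// -RintegralZl//; last exact: (integrableB _ iP1 iP2).
  apply: eq_Rintegral => y _; rewrite /P1 /P2; ring.
have Qb m : `|\int[leb]_y Q m y|%R <= kappa * (\int[leb]_y `|F y|)%R.
  rewrite QE.
  have mP : measurable_fun setT ((fun y : bV => (phi ((y : 'rV[R]_k) - t m *: w) - phi y) / t m * F y) : bV -> mR).
    by apply: measurable_funM => //; apply: measurable_funM => //; apply: measurable_funB => //; exact: mT.
  have bP (y : 'rV[R]_k) : `|(phi (y - t m *: w) - phi y) / t m * F y| <= kappa * `|F y|.
    have [Ay|/FA ->] := pselect (A y); last by rewrite mulr0 !normr0 mulr0.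
    rewrite normrM ler_wpM2r// normrM normfV ler_pdivrMr ?normr_gt0//.
    by have := Hphi y (- t m) Ay; rewrite normrN scaleNr; apply.
  have iP : leb.-integrable setT (EFin \o (fun y : bV => (phi ((y : 'rV[R]_k) - t m *: w) - phi y) / t m * F y)).
    apply: (@le_integrable _ _ _ _ setT _ _ (fun y : bV => (kappa%:E * (`|F y|)%:E)%E)) => //.
    - exact/measurable_EFinP.
    - by move=> y _ /=; rewrite lee_fin (le_trans (bP y))// ler_norm.
    - exact: integrableZl.
  apply: (le_trans (le_normr_Rintegral _ iP)) => //.
  rewrite -RintegralZl//; apply: le_Rintegral => //; first exact: (integrable_abse iP).
  exact: (@integrableZl _ _ _ _ setT _ kappa _ iaF).
have iK : leb.-integrable setT (fun y : bV => (K2%:E * (\1_[set y : bV | (`|y : 'rV[R]_k| <= r + `|w|)%R] y)%:E)%E).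
  apply: integrableZl => //.
  apply: (@integrable_bounded_support _ 1 (r + `|w|)).
  - by apply: measurable_indic; exact: measurable_box.
  - by move=> y; rewrite indicE ger0_norm// lern1 leq_b1.
  - by move=> y ry; rewrite indicE memNset//= => /le_lt_trans/(_ ry); rewrite ltxx.
have mQE m : measurable_fun setT (fun y : bV => (Q m y)%:E) by apply/measurable_EFinP; exact: (mQ m).
have mDE : measurable_fun setT (fun y : bV => (phi y * Dv w F y)%:E).
  by apply/measurable_EFinP; exact: measurable_funM.
have aecv : \forall y \ae leb, setT y -> (Q m y)%:E @[m --> \oo] --> (phi y * Dv w F y)%:E.
  by apply: aeW => y _; apply/fine_cvgP; split; [exact: nearW|exact: cvQ].
have aeb : \forall y \ae leb, forall m, setT y ->
    (`|(Q m y)%:E| <= K2%:E * (\1_[set y : bV | (`|y : 'rV[R]_k| <= r + `|w|)%R] y)%:E)%E.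
  apply: aeW => y m _; rewrite -EFinM lee_fin indicE.
  case: (ltP (r + `|w|) `|y : 'rV[R]_k|) => ry; first by rewrite Q0// normr0 mulr_ge0// ltW.
  by rewrite mem_set// mulr1.
have [_ _ cvI] := dominated_convergence measurableT mQE mDE aecv iK aeb.
have fI : (\int[leb]_y (phi y * Dv w F y)%:E)%E \is a fin_num by exact: integrable_fin_num iD.
rewrite -(fineK fI) in cvI; have /fine_cvgP[_ cvR] := cvI.
have cvN := @cvg_norm _ _ _ _ eventually_filter _ _ cvR.
rewrite leNgt; apply/negP => kI.
have [m Hm] := @filter_ex _ _ eventually_filter _ (cvN _ (lt_nbhsr kI)).
by have := le_lt_trans (Qb m) Hm; rewrite ltxx.
Qed.

End EuclideanIntegrals.

Section BoxPositive.
Context {R : realType}.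
Local Open Scope ereal_scope.

Lemma lebesgue_box_gt0 k (y0 : 'rV[R]_k) (e : R) : (0 < e)%R ->
  0 < lebesgue_int (fun y => (\1_(box y0 e) y)%:E).
Proof.
move=> e0; elim: k y0 => [y0|k IH y0] /=.
  by rewrite indicE mem_set//= /box /= (_ : 0 - y0 = 0)%R ?normr0 ?ltW//; apply/rowP => -[].
have [[t0 z0] ->] := glue_surj y0.
pose I : set (measurableTypeR R) := `[(t0 - e)%R, (t0 + e)%R]%classic.
have IE t : I t = (`|t - t0|%R <= e)%R by rewrite /I /= in_itv /= ler_distl.
have E (t : R) y : \1_(box (glue (t0, z0)) e) (glue (t, y)) = (\1_I t * \1_(box z0 e) y)%R :> R.
  rewrite !indicE -natrM mulnb; congr (_%:R); congr nat_of_bool.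
  apply/idP/andP; rewrite !inE IE /box /= glueB /=.
    by move=> h; split; [exact: le_trans (norm_glue_fst _) h|exact: le_trans (norm_glue_snd _) h].
  by case=> h1 h2; exact: norm_glue.
pose v := lebesgue_int (fun y => (\1_(box z0 e) y)%:E : \bar R).
have F (t : R) : lebesgue_int (fun y => (\1_(box (glue (t0, z0)) e) (row_mx (t%:M : 'rV[R]_1) y))%:E) =
    (cst v \_ I) t.
  under eq_fun => y do rewrite (E t y).
  rewrite patchE indicE; case: (t \in _); first by under eq_fun => y do rewrite mul1r.
  have [leb [_ lE]] := exists_lebesgue (R := R) k.
  under eq_fun => y do rewrite mul0r.
  by rewrite lE//; exact: integral0.
under eq_integral do rewrite F.
have mI : measurable I by exact: measurable_itv.
rewrite -integral_mkcond integral_cst// mule_gt0//; first exact: IH.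
suff : 0 < lebesgue_measure [set` `[(t0 - e)%R, (t0 + e)%R]%R] by [].
by rewrite lebesgue_measure_itv/= lte_fin ifT -?EFinB ?lte_fin; lra.
Qed.

End BoxPositive.

(** * The Riemannian volume in one chart *)

Section ChartVolume.
Context {R : realType} {n : nat} {M : manifold R n}.
Variables (h : M -> 'M[R]_n) (hm : riemannian_metric h).
Variables (mu : {measure set (borel M) -> \bar R}) (vol : riemannian_volume h mu).
Variables (leb : {measure set (borel 'rV[R]_n) -> \bar R}) (rl : represents leb).
Variables (c : chart R n M) (ac : atlas c).
Local Notation mR := (measurableTypeR R).
Local Notation bV := (borel 'rV[R]_n).

Definition img : set 'rV[R]_n := c @` chart_dom c.

(** With [density] it describes the chart by total functions: off the image of the chart the point
    is arbitrary and the density is 0, so that integrals run over the whole coordinate space. *)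
Definition inv_pt (y : 'rV[R]_n) : M := if `[< img y >] then chart_inv c y else point.

Definition density (y : 'rV[R]_n) : R := if `[< img y >] then Num.sqrt (\det (gmx h c y)) else 0.

Lemma imgP y : img y -> chart_dom c (chart_inv c y) /\ c (chart_inv c y) = y.
Proof. by move=> [p cp <-]; rewrite chartK. Qed.

Lemma inv_ptE y : img y -> inv_pt y = chart_inv c y.
Proof. by rewrite /inv_pt; case: asboolP. Qed.

Lemma densityE y : img y -> density y = Num.sqrt (\det (gmx h c y)).
Proof. by rewrite /density; case: asboolP. Qed.

Lemma density_out y : ~ img y -> density y = 0.
Proof. by rewrite /density; case: asboolP. Qed.

Lemma density_ge0 y : 0 <= density y.
Proof. by rewrite /density; case: asboolP => // _; exact: sqrtr_ge0. Qed.

Lemma open_img : open img. Proof. exact: chart_img_open. Qed.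

Lemma measurable_img : measurable (img : set bV).
Proof. exact: (borel_open open_img). Qed.

Lemma measurable_on_img d (T : measurableType d) (f : bV -> T) (a : T) :
  measurable_fun (img : set bV) f -> (forall y, ~ img y -> f y = a) -> measurable_fun setT f.
Proof.
move=> mf fa; rewrite -(setUv (img : set bV)); apply/(measurable_funU f measurable_img (measurableC measurable_img)).
split=> //; apply: (@eq_measurable_fun _ _ _ _ _ (cst a)); last exact: measurable_cst.
by move=> y; rewrite inE => /fa ->.
Qed.

Lemma measurable_inv_pt : measurable_fun setT (inv_pt : bV -> borel M).
Proof.
apply: (measurable_on_img (a := point)); last by move=> y; rewrite /inv_pt; case: asboolP.
apply: (@eq_measurable_fun _ _ _ _ _ (chart_inv c : bV -> borel M)).
  by move=> y; rewrite inE => /inv_ptE ->.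
by apply: borel_continuous; [exact: open_img|move=> _ [p cp <-]; exact: chart_inv_continuous].
Qed.

Lemma smooth_sqrt_gram p : chart_dom c p -> smooth_near (fun y => Num.sqrt (\det (gmx h c y))) (c p).
Proof.
move=> cp; apply: smooth_sqrt; last exact: smooth_det (smooth_gram hm ac cp).
exact: posdef_det_gt0 (posdef_gram hm ac cp).
Qed.

Lemma sqrt_gram_gt0 p : chart_dom c p -> 0 < Num.sqrt (\det (gmx h c (c p))).
Proof. by move=> cp; rewrite sqrtr_gt0; exact: posdef_det_gt0 (posdef_gram hm ac cp). Qed.

Lemma measurable_density : measurable_fun setT (density : bV -> mR).
Proof.
apply: (measurable_on_img (a := 0 : mR)); last by move=> y; exact: density_out.
apply: (@eq_measurable_fun _ _ _ _ _ ((fun y => Num.sqrt (\det (gmx h c y))) : bV -> mR)).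
  by move=> y; rewrite inE => /densityE ->.
apply: borel_continuousR; first exact: open_img.
by move=> _ [p cp <-]; exact: smooth_continuous (smooth_sqrt_gram cp).
Qed.

Lemma volume_density (B : set (borel M)) : measurable B -> B `<=` chart_dom c ->
  (mu B = \int[leb]_y (density y * \1_B (inv_pt y))%:E)%E.
Proof.
move=> mB Bc; rewrite (vol ac mB Bc) -(rl.2 (fun y => (density y * \1_B (inv_pt y))%:E)).
- congr lebesgue_int; apply/funext => y; congr EFin; rewrite -gmx_def.
  have [Uy|nU] := pselect (img y); last first.
    rewrite density_out// mul0r indicE memNset ?mul0r// => -[p Bp py].
    by apply: nU; exists p => //; exact: Bc.
  rewrite (densityE Uy) mulrC; congr (_ * _); rewrite !indicE; congr (_%:R); congr nat_of_bool.
  have [cy cyK] := imgP Uy; rewrite inv_ptE//.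
  apply/idP/idP; rewrite !inE; last by exists (chart_inv c y).
  by move=> [p Bp <-]; rewrite chartK//; exact: Bc.
- by move=> y; rewrite lee_fin mulr_ge0// density_ge0.
- apply/measurable_EFinP; apply: measurable_funM; first exact: measurable_density.
  exact: (measurableT_comp (measurable_indic mB) measurable_inv_pt).
Qed.

Lemma ge0_volume_chart (f : borel M -> \bar R) : measurable_fun setT f ->
  (forall p, 0 <= f p)%E -> (forall p, ~ chart_dom c p -> f p = 0)%E ->
  (\int[mu]_p f p = \int[leb]_y ((density y)%:E * f (inv_pt y)))%E.
Proof.
move=> mf f0 fD.
exact: (ge0_integral_density measurable_inv_pt measurable_density density_ge0 volume_density mf f0 fD).
Qed.

Lemma volume_chart (f : borel M -> R) : measurable_fun setT (f : borel M -> mR) ->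
  (forall p, ~ chart_dom c p -> f p = 0) ->
  (\int[mu]_p f p = \int[leb]_y (density y * f (inv_pt y)))%R /\
  (mu.-integrable setT (EFin \o f) <-> leb.-integrable setT (EFin \o (fun y : bV => density y * f (inv_pt y)))).
Proof.
move=> mf f0; have mF : measurable_fun setT (EFin \o f) by apply/measurable_EFinP.
split.
  rewrite /Rintegral integralE [in RHS]integralE; congr (fine (_ - _)%E).
  - rewrite (ge0_volume_chart (measurable_funepos mF) (funepos_ge0 _)).
      apply: eq_integral => y _; rewrite !funeposE /= maxe_pMr ?lee_fin ?density_ge0//.
      by rewrite mule0 EFinM.
    by move=> p cp; rewrite funeposE /= f0// maxxx.
  - rewrite (ge0_volume_chart (measurable_funeneg mF) (funeneg_ge0 _)).
      apply: eq_integral => y _; rewrite !funenegE /= maxe_pMr ?lee_fin ?density_ge0//.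
      by rewrite mule0 -EFinM mulrN.
    by move=> p cp; rewrite funenegE /= f0// oppr0 maxxx.
have mG : measurable_fun setT ((fun y : bV => density y * f (inv_pt y)) : bV -> mR).
  by apply: measurable_funM; [exact: measurable_density|exact: (measurableT_comp mf measurable_inv_pt)].
have mA : measurable_fun setT (fun p : borel M => `|f p|%:E).
  by apply/measurable_EFinP; exact: measurableT_comp.
have E : (\int[mu]_p `|f p|%:E = \int[leb]_y `|density y * f (inv_pt y)|%:E)%E.
  rewrite (ge0_volume_chart mA).
  - by apply: eq_integral => y _; rewrite normrM (ger0_norm (density_ge0 y)) EFinM.
  - by move=> p; rewrite lee_fin.
  - by move=> p cp; rewrite f0// normr0.
split=> /integrableP[_ fin]; apply/integrableP; split => //.
- by apply/measurable_EFinP.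
- by move: fin; rewrite -[X in (X < _)%E -> _]/(\int[mu]_p `|f p|%:E)%E E.
- by move: fin; rewrite -[X in (X < _)%E -> _]/(\int[leb]_y `|density y * f (inv_pt y)|%:E)%E -E.
Qed.

End ChartVolume.

Lemma closed_near (T : topologicalType) (A : set T) (q : T) : closed A -> ~ A q -> \forall z \near q, ~ A z.
Proof.
move=> cA nA; apply: contrapT => H; apply: nA; apply: cA => B qB.
by apply: contrapT => AB; apply: H; apply: filterS qB => z Bz Az; apply: AB; exists z.
Qed.

Section DivergenceRegularity.
Context {R : realType} {n : nat} {M : manifold R n}.
Variables (h : M -> 'M[R]_n) (hm : riemannian_metric h).
Implicit Types (X : M -> 'rV[R]_n) (rho b : M -> R).

Lemma smooth_fun_continuous b : smooth_fun b -> continuous b.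
Proof.
move=> sb q; have cq := chart_at_dom q.
have cb := smooth_continuous (sb _ q (chart_at_atlas q) cq).
move=> P; rewrite -[b q](congr1 b (chartK cq)) => /cb bP.
have := chart_near_inv cq bP; apply: filterS2 (chart_near cq) => z cz /=.
by rewrite chartK.
Qed.

Lemma smooth_div X rho : has_div h X rho -> smooth_fun rho.
Proof.
move=> hX c p ac cp.
pose f (k : 'I_n) := (fun y => Num.sqrt (\det (gmx h c y)) * frep c c idfun X y 0 k).
have sf k : smooth_near (f k) (c p).
  by apply: smoothM; [exact: smooth_sqrt_gram|exact: smooth_entry (hX c p ac cp).1].
apply: (@eq_smooth _ _ _ (fun y => (\sum_k Dv (ebase k) (f k) y) * (Num.sqrt (\det (gmx h c y)))^-1)).
  apply: filterS (chart_invK_near cp) => y [cy cyK].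
  have [_] := hX c _ ac cy; rewrite cyK => ->.
  by rewrite mulrAC mulfV ?mul1r// -{1}cyK gt_eqF// sqrt_gram_gt0.
apply: smoothM; first by apply: smooth_sum => k _; exact: smooth_Dv.
by apply: smoothV; [rewrite gt_eqF// sqrt_gram_gt0|exact: smooth_sqrt_gram].
Qed.

Lemma div_near0 X rho q : has_div h X rho -> (\forall z \near q, X z = 0) -> rho q = 0.
Proof.
move=> hX X0; pose c := chart_at q; have ac : atlas c := chart_at_atlas q.
have cq : chart_dom c q := chart_at_dom q.
have [_ E] := hX c q ac cq.
have : Num.sqrt (\det (gmx h c (c q))) * rho q = 0.
  rewrite -E big1// => k _; rewrite (@Dv_near _ _ _ _ _ (fun=> 0)) ?Dv_cst//.
  apply: filterS (near_chart cq X0) => y Xy.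
  by rewrite frep_def Xy tcoord0 mxE mulr0.
by move/eqP; rewrite mulf_eq0 gt_eqF ?sqrt_gram_gt0// => /eqP.
Qed.

Lemma riem_normZ p (a : R) v : riem_norm h p (a *: v) = `|a| * riem_norm h p v.
Proof. by rewrite /riem_norm !innerE bilZl bilZr mulrA -expr2 sqrtrM ?sqr_ge0// sqrtr_sqr. Qed.

Lemma riem_norm_ge0 p v : 0 <= riem_norm h p v. Proof. exact: sqrtr_ge0. Qed.

Lemma riem_norm0 p : riem_norm h p 0 = 0.
Proof. by rewrite /riem_norm innerE bil0l sqrtr0. Qed.

Lemma continuous_riem_norm X : (forall c p, atlas c -> chart_dom c p -> smooth_near (frep c c idfun X) (c p)) ->
  continuous (fun p => riem_norm h p (X p)).
Proof.
move=> sX; have sI : smooth_fun (fun p => inner h p (X p) (X p)).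
  move=> c p ac cp.
  apply: (@eq_smooth _ _ _ (fun y => bil (gmx h c y) (frep c c idfun X y) (frep c c idfun X y))).
    apply: filterS (chart_invK_near cp) => y [cy cyK].
    by rewrite -{1}cyK -(bil_gram h _ _ ac cy) frep_def cyK.
  by apply: smooth_bil; [exact: smooth_gram|exact: sX|exact: sX].
move=> p; rewrite /riem_norm.
by apply: (continuous_comp (smooth_fun_continuous sI (x := p)) (@sqrt_continuous R _)).
Qed.

End DivergenceRegularity.

(** * Integration by parts on one tame box *)

Section Patch.
Context {R : realType} {n : nat} {M : manifold R n}.
Variables (h : M -> 'M[R]_n) (hm : riemannian_metric h).
Variables (mu : {measure set (borel M) -> \bar R}) (vol : riemannian_volume h mu).
Local Notation mR := (measurableTypeR R).
Local Notation bV := (borel 'rV[R]_n).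

Lemma ler_dense (a b k : R) : 0 <= k -> (forall r, b < r -> a <= k * r) -> a <= k * b.
Proof.
move=> k0 H; apply/ler_addgt0Pr => e e0.
apply: (le_trans (H (b + e / (k + 1)) _)).
  by rewrite ltrDl divr_gt0// ltr_wpDl.
rewrite mulrDr lerD2l mulrCA -[leRHS]mulr1 ler_pM2l// ler_pdivrMr ?mul1r ?lerDl// ltr_wpDl//.
Qed.

Lemma sqn_entry (u : 'rV[R]_n) i : u 0 i ^+ 2 <= sqn u.
Proof. by rewrite /sqn (bigD1 i)//= lerDl sumr_ge0// => j _; exact: sqr_ge0. Qed.

Lemma sqn_ebase (t : R) i : sqn (t *: ebase i : 'rV[R]_n) = t ^+ 2.
Proof.
rewrite /sqn (bigD1 i)//= !mxE !eqxx mulr1 big1 ?addr0// => j ji.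
by rewrite !mxE (negPf ji) mulr0 expr0n.
Qed.

Section Local.
Variables (C : R) (C0 : 0 < C).
Hypothesis HC : forall c y0 B e, atlas c -> tame h c y0 B e ->
  forall y u r, box y0 e y -> box y0 e (y + u *m B) -> C * Num.sqrt (sqn u) < r ->
  dlt h (chart_inv c y) (chart_inv c (y + u *m B)) r.
Variables (c : chart R n M) (y0 : 'rV[R]_n) (B : 'M[R]_n) (e : R).
Hypotheses (ac : atlas c) (tm : tame h c y0 B e).
Variables (Z : M -> 'rV[R]_n) (rho phi : M -> R) (kappa : R).
Hypotheses (hZ : has_div h Z rho) (Z0 : forall q, ~ chart_box c y0 (e / 2) q -> Z q = 0).
Hypotheses (k0 : 0 <= kappa) (cphi : continuous phi) (phi1 : forall q, `|phi q| <= 1).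
Hypothesis lphi : forall p q s, dlt h p q s -> `|phi q - phi p| <= kappa * s.
Hypothesis iZ : mu.-integrable setT (fun p : borel M => (riem_norm h p (Z p))%:E).

Let e0 : 0 < e. Proof. by case: tm. Qed.
Let bx : boxed c y0 e. Proof. by case: tm. Qed.
Let uB : B \in unitmx. Proof. by case: tm. Qed.
Let e20 : 0 < e / 2. Proof. by rewrite divr_gt0. Qed.

Let box2 y : box y0 (e / 2) y -> box y0 e y.
Proof. by move=> /= /le_trans; apply; rewrite ler_pdivrMr// ler_pMr// ler1n. Qed.

Let bx2 : boxed c y0 (e / 2).
Proof. by move=> y /box2/bx. Qed.

Let box_img y : box y0 e y -> img c y.
Proof. by move=> /bx[cy cyK]; exists (chart_inv c y). Qed.

(** The components of the density times [Z] in the basis given by the rows of [B]. In this nearly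
    orthonormal basis they are bounded by twice the norm, and translating by [t] along a row moves
    points by no more than about [C * t]. In the coordinate basis these constants would depend on
    the chart. *)
Let comp a (y : 'rV[R]_n) : R :=
  if `[< box y0 e y >] then Num.sqrt (\det (gmx h c y)) * (frep c c idfun Z y *m invmx B) 0 a else 0.

Let smooth_zeta p : chart_dom c p -> smooth_near (frep c c idfun Z) (c p).
Proof. by move=> cp; have [] := hZ ac cp. Qed.

Let zeta0 y : box y0 e y -> ~ box y0 (e / 2) y -> frep c c idfun Z y = 0.
Proof.
move=> by0 ny; rewrite frep_def Z0 ?tcoord0// => -[z bz zy].
apply: ny; have [_ <-] := bx by0; rewrite -zy.
by have [_ ->] := bx2 bz.
Qed.

Let comp0 a y : ~ box y0 (e / 2) y -> comp a y = 0.
Proof.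
move=> ny; rewrite /comp; case: asboolP => // by0.
by rewrite zeta0// mul0mx mxE mulr0.
Qed.

Let near_in y : box y0 (e / 2) y -> \forall z \near y, box y0 e z.
Proof.
move=> byy; have := box_near y e20; apply: filterS => z zy.
rewrite /box /= -(subrKA y) (le_trans (ler_normD _ _))// (splitr e) lerD//.
Qed.

Let near_out y : ~ box y0 (e / 2) y -> \forall z \near y, ~ box y0 (e / 2) z.
Proof. by apply: closed_near; exact: closed_box. Qed.

Let comp_near a y : box y0 (e / 2) y -> \forall z \near y, comp a z =
  \sum_l Num.sqrt (\det (gmx h c z)) * frep c c idfun Z z 0 l * invmx B l a.
Proof.
move=> /near_in; apply: filterS => z bz; rewrite /comp; case: asboolP => // _.
by rewrite mxE mulr_sumr; apply: eq_bigr => l _; rewrite mulrA.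
Qed.

Let flux l z : R := Num.sqrt (\det (gmx h c z)) * frep c c idfun Z z 0 l.

Let smooth_flux l p : chart_dom c p -> smooth_near (flux l) (c p).
Proof. by move=> cp; apply: smoothM; [exact: smooth_sqrt_gram|exact/smooth_entry/smooth_zeta]. Qed.

Let smooth_comp_ a y : smooth_near (comp a) y.
Proof.
have [byy|ny] := pselect (box y0 (e / 2) y); last first.
  apply: (@eq_smooth _ _ _ (fun=> 0)); last exact: smooth_cst.
  by apply: filterS (near_out ny) => z nz; rewrite comp0.
apply: (@eq_smooth _ _ _ (fun z => \sum_l flux l z * invmx B l a)).
  by apply: filterS (comp_near a byy) => z ->.
have [cy cyK] := bx (box2 byy); rewrite -cyK.
by apply: smooth_sum => l _; apply: smoothM; [exact: smooth_flux|exact: smooth_cst].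
Qed.

(** A divergence may be computed in any constant basis: [B] and its inverse cancel. *)
Let Dv_comp_sum y : \sum_a Dv (row a B) (comp a) y = density h c y * rho (inv_pt c y).
Proof.
have [byy|ny] := pselect (box y0 (e / 2) y); last first.
  rewrite big1 => [|a _]; last first.
    rewrite (@Dv_near _ _ _ _ _ (fun=> 0)) ?Dv_cst//.
    by apply: filterS (near_out ny) => z nz; rewrite comp0.
  have [Uy|nU] := pselect (img c y); last by rewrite density_out// mul0r.
  rewrite (@div_near0 _ _ _ h hm Z rho) ?mulr0// inv_ptE//.
  have cl : ~ chart_box c y0 (e / 2) (chart_inv c y).
    move=> [z bz zy]; apply: ny; have [_ <-] := imgP Uy; rewrite -zy.
    by have [_ ->] := bx2 bz.
  by apply: filterS (closed_near (closed_chart_box bx2) cl) => q; exact: Z0.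
have Uy := box_img (box2 byy); have [cy cyK] := imgP Uy.
rewrite (densityE h Uy) (inv_ptE Uy).
have [_] := hZ ac cy; rewrite cyK => <-.
have sf l : smooth_near (flux l) y by rewrite -cyK; exact: smooth_flux.
have df l : differentiable (flux l) y by exact: smooth_differentiable (sf l).
transitivity (\sum_a \sum_l invmx B l a * Dv (row a B) (flux l) y).
  apply: eq_bigr => a _; rewrite (Dv_near _ (comp_near a byy)).
  rewrite Dv_sum => [|l]; last by apply: smoothM; [exact: sf|exact: smooth_cst].
  by apply: eq_bigr => l _; rewrite (DvM _ (sf l) (smooth_cst _ _)) Dv_cst mulr0 addr0 mulrC.
rewrite exchange_big /=; apply: eq_bigr => l _.
rewrite -/(flux l); transitivity (\sum_a \sum_k invmx B l a * B a k * Dv (ebase k) (flux l) y).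
  apply: eq_bigr => a _; rewrite (Dv_dir_sum _ (df l)) mulr_sumr; apply: eq_bigr => k _.
  by rewrite mxE mulrA.
rewrite exchange_big /=; under eq_bigr => k _ do rewrite -mulr_suml.
have E k : \sum_a invmx B l a * B a k = (l == k)%:R.
  by have := congr1 (fun A : 'M[R]_n => A l k) (mulVmx uB); rewrite !mxE.
rewrite (bigD1 l)//= E eqxx mul1r big1 ?addr0// => k kl.
by rewrite E eq_sym (negPf kl) mul0r.
Qed.

Let comp_bound a y : `|comp a y| <= 2 * (density h c y * riem_norm h (inv_pt c y) (Z (inv_pt c y))).
Proof.
have [byy|ny] := pselect (box y0 e y); last first.
  rewrite /comp; case: asboolP => // _.
  by rewrite normr0 mulr_ge0// mulr_ge0 ?density_ge0// riem_norm_ge0.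
have Uy := box_img byy; have [cy cyK] := imgP Uy.
rewrite /comp; case: asboolP => // _; rewrite (densityE h Uy) (inv_ptE Uy).
rewrite normrM ger0_norm ?sqrtr_ge0// mulrCA ler_wpM2l ?sqrtr_ge0//.
set u := frep c c idfun Z y *m invmx B.
have [_ _ _ /(_ y u byy)/andP[H _]] := tm.
have E : bil (gmx h c y) (u *m B) (u *m B) = inner h (chart_inv c y) (Z (chart_inv c y)) (Z (chart_inv c y)).
  by rewrite /u mulmxKV// -(bil_gram h _ _ ac cy) cyK frep_def.
rewrite -(sqrtr_sqr (u 0 a)) /riem_norm -E.
have -> : 2 = Num.sqrt (4 : R).
  by rewrite (_ : 4 = 2 ^+ 2 :> R) ?sqrtr_sqr ?ger0_norm//; ring.
rewrite -sqrtrM// ler_wsqrtr//; apply: (le_trans (sqn_entry u a)).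
by rewrite mulrC -ler_pdivrMr.
Qed.

(** The constant collects [C] from the length of segments, 2 from the comparison of norms in [tame],
    and one summand for each of the [n] directions. It depends neither on the box nor on [Z]. *)
Lemma patch_bound :
  mu.-integrable setT (fun p : borel M => (phi p * rho p)%:E) /\
  `|\int[mu]_p (phi p * rho p)%R|%R <= (C * 2 * n%:R) * kappa * (\int[mu]_p riem_norm h p (Z p))%R.
Proof.
have [leb rl] := exists_lebesgue (R := R) n.
have crho : continuous rho := smooth_fun_continuous (smooth_div hm hZ).
have mphi : measurable_fun setT (phi : borel M -> mR).
  by apply: borel_continuousR => [|q _]; [exact: openT|exact: cphi].
have mrho : measurable_fun setT (rho : borel M -> mR).
  by apply: borel_continuousR => [|q _]; [exact: openT|exact: crho].
have mZ : measurable_fun setT ((fun p => riem_norm h p (Z p)) : borel M -> mR).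
  apply: borel_continuousR => [|q _]; first exact: openT.
  by apply: (continuous_riem_norm hm) => d p ad dp; have [] := hZ ad dp.
have Zc p : ~ chart_dom c p -> Z p = 0.
  move=> cp; apply: Z0 => -[z bz zp]; apply: cp; rewrite -zp.
  by have [] := bx2 bz.
have rhoc p : ~ chart_dom c p -> rho p = 0.
  move=> cp; have cl : ~ chart_box c y0 (e / 2) p.
    by move=> -[z bz zp]; apply: cp; rewrite -zp; have [] := bx2 bz.
  apply: (div_near0 hm hZ).
  by apply: filterS (closed_near (closed_chart_box bx2) cl) => q; exact: Z0.
pose psi (y : bV) : mR := phi (inv_pt c y).
have mpsi : measurable_fun setT psi := measurableT_comp mphi (measurable_inv_pt c).
have iZ' : leb.-integrable setT (EFin \o (fun y : bV => density h c y * riem_norm h (inv_pt c y) (Z (inv_pt c y)))).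
  have [_ [H _]] := volume_chart hm vol rl ac mZ (fun p cp => etrans (congr1 (riem_norm h p) (Zc p cp)) (riem_norm0 h p)).
  exact: H.
have IZ : (\int[mu]_p riem_norm h p (Z p) = \int[leb]_y (density h c y * riem_norm h (inv_pt c y) (Z (inv_pt c y))))%R.
  by have [] := volume_chart hm vol rl ac mZ (fun p cp => etrans (congr1 (riem_norm h p) (Zc p cp)) (riem_norm0 h p)).
(* The bound on the translation parameter keeps the translates of the half box, where [Z] is
   supported, inside the box of size [e], on which lengths are under control. *)
have key a := @integral_difference_bound R n leb rl psi (comp a) (row a B) (box y0 (e / 2)) (C * kappa)
  (e / 2 / (`|row a B| + 1)) (`|y0| + e) mpsi (fun y => phi1 _).
have {}key a : leb.-integrable setT (EFin \o (fun y : bV => psi y * Dv (row a B) (comp a) y)) /\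
  `|\int[leb]_y (psi y * Dv (row a B) (comp a) y)%R|%R <= C * kappa * (\int[leb]_y `|comp a y|)%R.
  apply: key.
  - by rewrite divr_gt0// ltr_wpDl.
  - move=> y t byy tt.
    have bty : box y0 e (y + t *: row a B).
      rewrite /box /= addrAC (le_trans (ler_normD _ _))// (splitr e) lerD// normrZ.
      apply: (@le_trans _ _ (`|t| * (`|row a B| + 1))); first by rewrite ler_wpM2l// lerDl.
      by rewrite -ler_pdivlMr ?ltr_wpDl// ltW.
    rewrite /psi (inv_ptE (box_img bty)) (inv_ptE (box_img (box2 byy))).
    rewrite -[C * kappa * _]mulrA mulrCA; apply: ler_dense => // r Cr; apply: lphi.
    have E : t *: row a B = (t *: ebase a) *m B by rewrite -scalemxAl -rowE.
    rewrite E; apply: HC ac tm _ _ _ (box2 byy) _ _; first by rewrite -E.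
    by rewrite sqn_ebase sqrtr_sqr.
  - exact: smooth_comp_.
  - by move=> y; exact: comp0.
  - move=> y yr; apply: comp0 => /box2; rewrite /box /= => yb.
    have : `|y| <= `|y0| + e by rewrite -[y](subrK y0) addrC (le_trans (ler_normD _ _))// lerD2l.
    by move=> /(lt_le_trans yr); rewrite ltxx.
have PE y : density h c y * (phi (inv_pt c y) * rho (inv_pt c y)) = \sum_a psi y * Dv (row a B) (comp a) y.
  by rewrite -mulr_sumr Dv_comp_sum mulrCA.
have mP : measurable_fun setT ((fun p => phi p * rho p) : borel M -> mR) by exact: measurable_funM.
have P0 p : ~ chart_dom c p -> phi p * rho p = 0 by move=> /rhoc ->; rewrite mulr0.
have [IP [_ iP]] := volume_chart hm vol rl ac mP P0.
have iS : leb.-integrable setT (fun y : bV => \sum_a (psi y * Dv (row a B) (comp a) y)%:E)%E.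
  by apply: integrable_sum => // a _; have [] := key a.
split.
  apply: iP; apply: (eq_integrable measurableT _ _ _ iS) => y _ /=.
  by rewrite PE sumEFin.
rewrite IP; have -> : (\int[leb]_y (density h c y * (phi (inv_pt c y) * rho (inv_pt c y))) =
    \sum_a \int[leb]_y (psi y * Dv (row a B) (comp a) y))%R.
  rewrite /Rintegral sum_fine => [|a _]; last by have [ia _] := key a; exact: integrable_fin_num ia.
  rewrite -integral_sum// => [|a]; last by have [] := key a.
  by congr fine; apply: eq_integral => y _; rewrite PE sumEFin.
apply: (le_trans (ler_norm_sum _ _ _)).
have -> : C * 2 * n%:R * kappa * (\int[mu]_p riem_norm h p (Z p))%R =
   \sum_(a < n) C * kappa * (2 * (\int[mu]_p riem_norm h p (Z p))%R).
  by rewrite sumr_const card_ord -mulr_natl; ring.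
apply: ler_sum => a _; apply: (le_trans (key a).2).
apply: ler_wpM2l; first by rewrite mulr_ge0// ltW.
rewrite IZ -RintegralZl//; apply: le_Rintegral => //.
  have mc : measurable_fun setT (comp a : bV -> mR).
    by apply: measurable_continuous => y; exact: smooth_continuous (smooth_comp_ a y).
  apply: (@le_integrable _ _ _ _ setT measurableT _ (fun y : bV => (2%:E * (density h c y * riem_norm h (inv_pt c y) (Z (inv_pt c y)))%:E)%E)).
  - by apply/measurable_EFinP; exact: measurableT_comp.
  - by move=> y _; rewrite -EFinM !abse_EFin lee_fin normr_id (le_trans (comp_bound a y))// ler_norm.
  - exact: integrableZl.
exact: (@integrableZl _ _ _ _ setT measurableT 2 _ iZ').
Qed.

End Local.
End Patch.

(** * Globalization, and fields whose divergence has a sign *)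

Section Stokes.
Context {R : realType} {n : nat} {M : manifold R n}.
Variables (h : M -> 'M[R]_n) (hm : riemannian_metric h).
Variables (mu : {measure set (borel M) -> \bar R}) (vol : riemannian_volume h mu).
Local Notation mR := (measurableTypeR R).
Implicit Types (X : M -> 'rV[R]_n) (b rho phi : M -> R).

Definition localizer b := [/\ smooth_fun b, forall q, 0 <= b q <= 1 &
  exists c y0 B e, [/\ atlas c, tame h c y0 B e & forall q, ~ chart_box c y0 (e / 2) q -> b q = 0]].

Lemma exists_localizer (p : M) : exists2 b, localizer b & \forall q \near p, b q = 1.
Proof.
pose c := chart_at p; have ac : atlas c := chart_at_atlas p; have cp : chart_dom c p := chart_at_dom p.
have [B [e [tm _]]] := exists_tame hm ac cp ltr01.
have [e0 bx _ _] := tm; have e20 : 0 < e / 2 by rewrite divr_gt0.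
have bx2 : boxed c (c p) (e / 2).
  by move=> y yb; apply: bx; apply: (le_trans yb); rewrite ler_pdivrMr// ler_pMr// ler1n.
have b0 z : ~ box (c p) (e / 2) z -> bump (c p) (e / 2) z = 0.
  by move=> /negP; rewrite -ltNge => /ltW; exact: bump_eq0.
exists (extend0 c (bump (c p) (e / 2))).
  split.
  - by apply: smooth_extend0 b0 => // z; exact: smooth_bump.
  - move=> q; rewrite /extend0; case: asboolP => _; last by rewrite lexx ler01.
    by rewrite bump_ge0 bump_le1.
  - by exists c, (c p), B, e; split=> // q; exact: extend0_out.
have := chart_near_inv cp (bump_near1 (c p) e20).
by apply: filterS2 (chart_near cp) => q cq; rewrite extend0_in.
Qed.

(** The localizers are peeled off one by one. [X] splits into [b *: X], living on one tame box, and
    the remainder, which vanishes where [b] is locally 1 and is left to the rest of the list. As [b]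
    takes values between 0 and 1, the two norms add up exactly to that of [X], so the bound does not
    grow with the list. *)
Lemma stokes_finite (C : R) : 0 < C ->
  (forall c y0 B e, atlas c -> tame h c y0 B e ->
    forall y u r, box y0 e y -> box y0 e (y + u *m B) -> C * Num.sqrt (sqn u) < r ->
    dlt h (chart_inv c y) (chart_inv c (y + u *m B)) r) ->
  forall phi kappa, 0 <= kappa -> continuous phi -> (forall q, `|phi q| <= 1) ->
  (forall p q s, dlt h p q s -> `|phi q - phi p| <= kappa * s) ->
  forall (b_ : M -> M -> R), (forall p, localizer (b_ p)) ->
  forall (L : seq M) X rho, has_div h X rho ->
  mu.-integrable setT (fun p : borel M => (riem_norm h p (X p))%:E) ->
  (forall q, phi q != 0 -> (exists2 p, p \in L & \forall z \near q, b_ p z = 1) \/ \forall z \near q, X z = 0) ->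
  mu.-integrable setT (fun p : borel M => (phi p * rho p)%:E) /\
  `|\int[mu]_p (phi p * rho p)%R|%R <= (C * 2 * n%:R) * kappa * (\int[mu]_p riem_norm h p (X p))%R.
Proof.
move=> C0 HC phi kappa k0 cphi phi1 lphi b_ Hb; elim=> [|p L IH] X rho hX iX HL.
  have E q : phi q * rho q = 0.
    have [->|/HL[[//]|X0]] := eqVneq (phi q) 0; first by rewrite mul0r.
    by rewrite (div_near0 hm hX X0) mulr0.
  split.
    have -> : (fun p : borel M => (phi p * rho p)%:E) = (fun=> 0%E) by apply/funext => q; rewrite E.
    exact: integrable0.
  have -> : (\int[mu]_p (phi p * rho p) = \int[mu]_(p in setT) 0)%R by apply: eq_Rintegral => q _; rewrite E.
  rewrite Rintegral_cst// mul0r normr0; apply: mulr_ge0; first by rewrite !mulr_ge0// ltW.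
  by apply: Rintegral_ge0 => q _; exact: riem_norm_ge0.
have [sb b01 [c [y0 [B [e [ac tm b0]]]]]] := Hb p.
set b := b_ p in sb b01 b0.
have hZ := has_div_scale hm sb hX; have hX' := has_divB hm hX hZ.
set Z := (fun p => b p *: X p) in hZ hX'; set rZ := (fun p => b p * rho p + deriv_along X b p) in hZ hX'.
have nZ q : riem_norm h q (Z q) = b q * riem_norm h q (X q).
  by rewrite riem_normZ ger0_norm//; case/andP: (b01 q).
have nX' q : riem_norm h q (X q - Z q) = (1 - b q) * riem_norm h q (X q).
  have -> : X q - Z q = (1 - b q) *: X q by rewrite scalerBl scale1r.
  by rewrite riem_normZ ger0_norm// subr_ge0; case/andP: (b01 q).
have mnorm X1 rho1 : has_div h X1 rho1 -> measurable_fun setT ((fun p => riem_norm h p (X1 p)) : borel M -> mR).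
  move=> hX1; apply: borel_continuousR => [|q _]; first exact: openT.
  by apply: (continuous_riem_norm hm) => d q' ad dq'; have [] := hX1 d q' ad dq'.
have le_int (f : borel M -> R) : measurable_fun setT (f : borel M -> mR) -> (forall q, 0 <= f q <= riem_norm h q (X q)) ->
    mu.-integrable setT (fun p : borel M => (f p)%:E).
  move=> mf Hf; apply: (le_integrable measurableT _ _ iX); first by apply/measurable_EFinP.
  move=> q _; rewrite !abse_EFin lee_fin; case/andP: (Hf q) => f0 fX.
  by rewrite ger0_norm// (le_trans fX)// ler_norm.
have iZ : mu.-integrable setT (fun p : borel M => (riem_norm h p (Z p))%:E).
  apply: le_int => [|q]; first exact: mnorm hZ.
  by rewrite riem_norm_ge0 nZ ler_piMl ?riem_norm_ge0//; case/andP: (b01 q).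
have iX' : mu.-integrable setT (fun p : borel M => (riem_norm h p (X p - Z p))%:E).
  apply: le_int => [|q]; first exact: mnorm hX'.
  rewrite riem_norm_ge0 nX' ler_piMl ?riem_norm_ge0// lerBlDr lerDl.
  by case/andP: (b01 q).
have Z0 q : ~ chart_box c y0 (e / 2) q -> Z q = 0 by move=> /b0 bq; rewrite /Z bq scale0r.
have [i1 B1] := patch_bound hm vol C0 HC ac tm hZ Z0 k0 cphi phi1 lphi iZ.
have [|i2 B2] := IH _ _ hX' iX'.
  move=> q /HL[[p' ]|X0]; last by right; apply: filterS X0 => z X0; rewrite /Z X0 scaler0 subr0.
  rewrite inE => /orP[/eqP -> b1|p'L b1]; last by left; exists p'.
  by right; apply: filterS b1 => z; rewrite /Z /b => ->; rewrite scale1r subrr.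
have E q : phi q * rho q = phi q * rZ q + phi q * (rho q - rZ q) by ring.
have EZ q : riem_norm h q (X q) = riem_norm h q (Z q) + riem_norm h q (X q - Z q).
  by rewrite nZ nX' -mulrDl addrC subrK mul1r.
split.
  have -> : (fun p : borel M => (phi p * rho p)%:E) =
    ((fun p : borel M => (phi p * rZ p)%:E) \+ (fun p : borel M => (phi p * (rho p - rZ p))%:E))%E.
    by apply/funext => q; rewrite -EFinD -E.
  exact: integrableD.
have -> : (\int[mu]_p (phi p * rho p) = \int[mu]_p (phi p * rZ p) + \int[mu]_p (phi p * (rho p - rZ p)))%R.
  by rewrite -RintegralD//; apply: eq_Rintegral => q _; rewrite E.
have -> : (\int[mu]_p (riem_norm h p (X p)) = \int[mu]_p riem_norm h p (Z p) + \int[mu]_p riem_norm h p (X p - Z p))%R.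
  by rewrite -RintegralD//; apply: eq_Rintegral => q _; rewrite EZ.
rewrite mulrDr; apply: (le_trans (ler_normD _ _)); exact: lerD.
Qed.

Hypotheses (complete : complete_metric h) (Mconn : connected [set: M]).

(** Near [q] both [f] and the volume density exceed half of their values there, and a coordinate box
    has positive Lebesgue measure. *)
Lemma continuous_integral_gt0 (f : M -> R) q : continuous f -> (forall p, 0 <= f p) -> 0 < f q ->
  (0 < \int[mu]_p (f p)%:E)%E.
Proof.
move=> cf f0 fq; pose c := chart_at q.
have ac : atlas c := chart_at_atlas q; have cq : chart_dom c q := chart_at_dom q.
have [leb rl] := exists_lebesgue (R := R) n.
have n1 : \forall z \near q, f q / 2 < f z.
  have fq2 : f q / 2 < f q by rewrite ltr_pdivrMr// ltr_pMr// ltr1n.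
  exact: (cf q _ (lt_nbhsr fq2)).
pose G y := Num.sqrt (\det (gmx h c y)).
have G0 : 0 < G (c q) by exact: sqrt_gram_gt0.
have n2 : \forall y \near c q, G (c q) / 2 < G y.
  have G2 : G (c q) / 2 < G (c q) by rewrite ltr_pdivrMr// ltr_pMr// ltr1n.
  exact: (smooth_continuous (smooth_sqrt_gram hm ac cq) (lt_nbhsr G2)).
have [e e0 He] := near_box (filterI (chart_invK_near cq) (filterI n2 (near_chart cq n1))).
pose V : set (borel M) := chart_box c (c q) e.
have bx : boxed c (c q) e by move=> y /He[].
have mV : measurable V.
  rewrite -[V]setCK; apply: measurableC; apply: borel_open; apply: closed_openC.
  exact: closed_chart_box.
have Vc : V `<=` chart_dom c by move=> _ [z /bx[? _] <-].
have mf : measurable_fun setT (f : borel M -> mR).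
  by apply: borel_continuousR => [|p _]; [exact: openT|exact: cf].
have muV : (0 < mu V)%E.
  rewrite (vol ac mV Vc) -gmx_def.
  have mB : measurable (box (c q) e : set (borel 'rV[R]_n)).
    rewrite -[X in measurable X]setCK; apply: measurableC; apply: borel_open; apply: closed_openC.
    exact: closed_box.
  have E : (fun y => (\1_(c @` V) y * Num.sqrt (\det (gmx h c y)))%:E) =
      (fun y => (density h c y * \1_(box (c q) e) y)%:E).
    apply/funext => y; congr EFin; rewrite mulrC.
    have -> : c @` V = box (c q) e.
      apply/seteqP; split => [_ [_ [z bz <-] <-]|z bz]; first by have [_ ->] := bx _ bz.
      by exists (chart_inv c z); [exists z|have [] := bx _ bz].
    rewrite indicE; case: (boolP (y \in _)) => [|_]; last by rewrite !mulr0.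
    rewrite inE => /bx[cy cyK]; rewrite densityE//.
    by exists (chart_inv c y).
  rewrite E rl.2.
  2: by move=> y; rewrite lee_fin mulr_ge0 ?density_ge0.
  2: by apply/measurable_EFinP; apply: measurable_funM; [exact: measurable_density|exact: measurable_indic].
  apply: (@lt_le_trans _ _ (\int[leb]_y ((G (c q) / 2)%:E * (\1_(box (c q) e) y)%:E))%E).
    rewrite ge0_integralZl//; last by rewrite lee_fin ltW// divr_gt0.
      rewrite mule_gt0 ?lte_fin ?divr_gt0// -rl.2//; first exact: lebesgue_box_gt0.
      by apply/measurable_EFinP; exact: measurable_indic.
    by apply/measurable_EFinP; exact: measurable_indic.
  apply: ge0_le_integral => //.
  - by move=> y _; rewrite -EFinM lee_fin mulr_ge0// ltW// divr_gt0.
  - apply/measurable_EFinP; apply: measurable_funM => //; exact: measurable_indic.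
  - by apply/measurable_EFinP; apply: measurable_funM; [exact: measurable_density|exact: measurable_indic].
  move=> y _; rewrite -EFinM lee_fin indicE; case: (boolP (y \in _)) => [|_]; last by rewrite !mulr0.
  rewrite inE => by0; have [[cy cyK] [Gy _]] := He _ by0; rewrite !mulr1 densityE; first exact: ltW.
  by exists (chart_inv c y).
apply: (@lt_le_trans _ _ (\int[mu]_p ((f q / 2)%:E * (\1_V p)%:E))%E).
  rewrite ge0_integralZl//; last 2 first.
  - by apply/measurable_EFinP; exact: measurable_indic.
  - by rewrite lee_fin ltW// divr_gt0.
  by rewrite mule_gt0 ?lte_fin ?divr_gt0// integral_indic// setIT.
apply: ge0_le_integral => //.
- by move=> y _; rewrite -EFinM lee_fin mulr_ge0// ltW// divr_gt0.
- by apply/measurable_EFinP; apply: measurable_funM => //; exact: measurable_indic.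
- exact/measurable_EFinP.
move=> y _; rewrite -EFinM lee_fin indicE; case: (boolP (y \in _)) => [|_]; last by rewrite mulr0.
by rewrite inE mulr1 => -[z bz <-]; have [_ [_ /ltW]] := He _ bz.
Qed.

(** If [rho] were positive at [p], the integrals of the cutoffs times [rho] would be positive from
    some index on and nondecreasing, whereas [stokes_finite] bounds them by a fixed number divided
    by [l.+1]. *)
Theorem stokes_nonneg X rho : has_div h X rho ->
  mu.-integrable setT (fun p : borel M => (riem_norm h p (X p))%:E) ->
  (forall p, 0 <= rho p) -> forall p, rho p = 0.
Proof.
move=> hX iX rho0 p; apply/eqP/negPn/negP => rp.
have {rp} rp : 0 < rho p by rewrite lt_def rp rho0.
have crho : continuous rho := smooth_fun_continuous (smooth_div hm hX).
have [C C0 HC] := segment_dlt hm.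
pose phi k : M -> R := cutoff h p k.
have cphi k : continuous (phi k) by apply: continuous_cutoff.
have phi1 k q : `|phi k q| <= 1 by rewrite ger0_norm ?cutoff_ge0 ?cutoff_le1.
have lphi k q q' s : dlt h q q' s -> `|phi k q' - phi k q| <= k.+1%:R^-1 * s.
  by move=> qq; rewrite mulrC; by apply: cutoff_lip.
have [b_ /all_and2[Hb Hb1]] := @choice _ _ (fun (q : M) b => localizer b /\ \forall z \near q, b z = 1)
  (fun q => let: ex_intro2 b u v := exists_localizer q in ex_intro _ b (conj u v)).
have bound k : mu.-integrable setT (fun q : borel M => (phi k q * rho q)%:E) /\
    `|\int[mu]_q (phi k q * rho q)%R|%R <= (C * 2 * n%:R) * k.+1%:R^-1 * (\int[mu]_q riem_norm h q (X q))%R.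
  have [K cK HK] : exists2 K, compact K & forall q, phi k q != 0 -> K q by apply: cutoff_compact.
  (* Finitely many of the open sets on which a localizer is locally 1 cover the compact set
     containing the support of the cutoff; they give the list for [stokes_finite]. *)
  pose V q : set M := [set z | b_ q z = 1]^°.
  move: cK; rewrite compact_cover => /(_ M setT V)[z _||D _ KD].
  - exact: open_interior.
  - by move=> q _; exists q => //; exact: Hb1.
  apply: (@stokes_finite C C0 HC (phi k) k.+1%:R^-1 _ (cphi k) (phi1 k) (lphi k) b_ Hb (finmap.enum_fset D)) => //.
  move=> q /HK /KD[d dD Vd]; left; exists d => //.
have f0 k q : 0 <= phi k q * rho q by rewrite mulr_ge0 ?cutoff_ge0.
have [k kp] : exists k, 0 < phi k p.
  have cv : (fun k => phi k p) @ \oo --> (1 : R) by apply: cutoff_cvg.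
  have := cv _ (lt_nbhsr ltr01).
  move=> /(@filter_ex _ _ eventually_filter)[k kp]; exists k; exact: kp.
have I0 : 0 < (\int[mu]_q (phi k q * rho q))%R.
  have [ik _] := bound k.
  have : (0 < \int[mu]_q (phi k q * rho q)%:E)%E.
    apply: (@continuous_integral_gt0 _ p) => //; last by rewrite mulr_gt0.
    by move=> q; apply: cvgM; [exact: cphi|exact: crho].
  have fk : (\int[mu]_q (phi k q * rho q)%:E)%E \is a fin_num by exact: integrable_fin_num ik.
  by rewrite -(fineK fk) lte_fin.
set I := (\int[mu]_q (phi k q * rho q))%R in I0.
set A := C * 2 * n%:R * (\int[mu]_q riem_norm h q (X q))%R.
have IA l : (k <= l)%N -> I <= A / l.+1%:R.
  move=> kl; have [il bl] := bound l; have [ik _] := bound k.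
  apply: (@le_trans _ _ (\int[mu]_q (phi l q * rho q))%R).
    apply: le_Rintegral => // q _; rewrite ler_wpM2r//; by apply: cutoff_nd.
  by apply: (le_trans (ler_norm _)); apply: (le_trans bl); rewrite /A mulrAC.
have [l /andP[kl lA]] : exists l, (k <= l)%N && (A / I < l.+1%:R).
  have [m _ /(_ m (leqnn m)) /= Hm] := nbhs_infty_ger (A / I).
  by exists (maxn k m); rewrite leq_maxl /= (le_lt_trans Hm)// ltr_nat ltnS leq_maxr.
have := IA l kl; rewrite ler_pdivlMr ?ltr0n//.
by move: lA; rewrite ltr_pdivrMr// mulrC => /lt_le_trans h1 /h1; rewrite ltxx.
Qed.

End Stokes.

(** * Total geodesy *)

Lemma trace_mul_tr {R : realType} m k (Y : 'M[R]_(m, k)) : \tr (Y *m Y^T) = \sum_i \sum_j Y i j ^+ 2.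
Proof.
by rewrite /mxtrace; apply: eq_bigr => i _; rewrite mxE; apply: eq_bigr => j _; rewrite mxE.
Qed.

(** Cauchy-Schwarz for each column of [Y]: a sum of squares is a nonnegative quadratic polynomial in
    [t], evaluated at its minimum [a / q]. *)
Lemma trace_mul_tr_bound {R : realType} m k (Y : 'M[R]_(m, k)) (u : 'rV[R]_m) :
  sqn (u *m Y) <= \tr (Y *m Y^T) * sqn u.
Proof.
rewrite trace_mul_tr exchange_big /= mulr_suml; apply: ler_sum => j _.
have -> : (u *m Y) 0 j = \sum_i u 0 i * Y i j by rewrite mxE.
pose a := \sum_i u 0 i * Y i j; pose q := \sum_i Y i j ^+ 2; pose s := sqn u.
have E (t : R) : 0 <= s - 2 * t * a + t ^+ 2 * q.
  have -> : s - 2 * t * a + t ^+ 2 * q = \sum_i (u 0 i - t * Y i j) ^+ 2.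
    rewrite /s /a /q /sqn !mulr_sumr -sumrN -!big_split/=; apply: eq_bigr => i _; ring.
  by apply: sumr_ge0 => i _; exact: sqr_ge0.
have q0 : 0 <= q by apply: sumr_ge0 => i _; exact: sqr_ge0.
rewrite -/a -/q -/s; have [q00|qn0] := eqVneq q 0.
  have a0 : a = 0.
    rewrite /a big1// => i _; have /eqP := q00; rewrite /q psumr_eq0 => [/allP/(_ i)|l _]; last exact: sqr_ge0.
    by rewrite mem_index_enum sqrf_eq0 => /(_ isT)/eqP ->; rewrite mulr0.
  by rewrite a0 q00 expr0n mul0r.
have {q0} q0 : 0 < q by rewrite lt_def qn0.
have := E (a / q); have -> : s - 2 * (a / q) * a + (a / q) ^+ 2 * q = s - a ^+ 2 / q by field.
by rewrite subr_ge0 ler_pdivrMr// mulrC.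
Qed.

Section TraceNorm.
Context {R : realType} {n : nat}.
Variables (h S : 'M[R]_n) (ph : posdef h).

(** In a basis orthonormal for [h] the operator becomes [Y] and its adjoint the transpose. The trace
    is then the sum of the squares of the entries of [Y]: nonnegative, zero only for the zero
    operator, and an upper bound for the square of the operator norm. *)
Lemma adjoint_trace : exists B Y : 'M[R]_n, [/\ B \in unitmx, h = invmx B *m (invmx B)^T,
  \tr (S *m h *m S^T *m invmx h) = \tr (Y *m Y^T) & Y = B *m S *m invmx B].
Proof.
have [B BhB] := posdef_orthonormal ph.
have uB : B \in unitmx.
  by have [] := @mulmx1_unit _ _ B (h *m B^T) => //; rewrite mulmxA.
have hE : h = invmx B *m (invmx B)^T.
  apply: (can_inj (mulKmx uB)); apply: (can_inj (@mulmxK _ _ _ B^T _)); first by rewrite unitmx_tr.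
  by rewrite BhB mulKVmx// trmx_inv mulVmx ?unitmx_tr.
exists B, (B *m S *m invmx B); split => //.
have ih : invmx h = B^T *m B.
  apply: (can_inj (mulKmx (posdef_unit ph))); rewrite mulmxV ?posdef_unit//.
  by rewrite hE -!mulmxA [_^T *m _]mulmxA -trmx_mul mulmxV// trmx1 mul1mx mulVmx.
rewrite ih hE; transitivity (\tr (B *m (S *m (invmx B *m (invmx B)^T) *m S^T *m B^T))).
  by rewrite mulmxA mxtrace_mulC.
by congr (\tr _); rewrite !trmx_mul !mulmxA.
Qed.

Lemma adjoint_trace_ge0 : 0 <= \tr (S *m h *m S^T *m invmx h).
Proof.
have [B [Y [_ _ -> _]]] := adjoint_trace; rewrite trace_mul_tr.
by do 2![apply: sumr_ge0 => ? _]; exact: sqr_ge0.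
Qed.

Lemma adjoint_trace_eq0 : \tr (S *m h *m S^T *m invmx h) = 0 -> S = 0.
Proof.
have [B [Y [uB _ -> YE]]] := adjoint_trace; rewrite trace_mul_tr => /eqP.
rewrite psumr_eq0 => [/allP H|i _]; last by apply: sumr_ge0 => j _; exact: sqr_ge0.
have Y0 : Y = 0.
  apply/matrixP => i j; have := H i (mem_index_enum _); rewrite psumr_eq0 => [/allP H'|l _]; last exact: sqr_ge0.
  by have := H' j (mem_index_enum _); rewrite /= sqrf_eq0 mxE => /eqP.
have -> : S = invmx B *m Y *m B by rewrite YE !mulmxA mulVmx// mul1mx mulmxKV.
by rewrite Y0 mulmx0 mul0mx.
Qed.

Lemma adjoint_trace_bound v : bil h (v *m S) (v *m S) <= \tr (S *m h *m S^T *m invmx h) * bil h v v.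
Proof.
have [B [Y [uB hE -> YE]]] := adjoint_trace.
have bE w : bil h w w = sqn (w *m invmx B).
  rewrite bilE hE (mulmxA w) -(mulmxA (w *m _)) -trmx_mul mxE; apply: eq_bigr => i _.
  by rewrite [X in _ * X]mxE expr2.
rewrite !bE (_ : v *m S *m invmx B = v *m invmx B *m Y); first exact: trace_mul_tr_bound.
by rewrite YE !mulmxA mulmxKV.
Qed.

End TraceNorm.

Section SignedStokes.
Context {R : realType} {n : nat} {M : manifold R n}.
Variables (h : M -> 'M[R]_n) (hm : riemannian_metric h).
Variables (mu : {measure set (borel M) -> \bar R}) (vol : riemannian_volume h mu).
Hypotheses (complete : complete_metric h) (Mconn : connected [set: M]).

Lemma has_divN X rho : has_div h X rho -> has_div h (fun p => - X p) (fun p => - rho p).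
Proof.
move=> hX; have s1 : smooth_fun (fun _ : M => -1 : R) by move=> *; exact: smooth_cst.
have := has_div_scale hm s1 hX.
have -> : (fun p : M => -1 *: X p) = (fun p => - X p) by apply/funext => p; rewrite scaleN1r.
by apply: eq_has_div => p; rewrite /deriv_along Dv_cst addr0 mulN1r.
Qed.

Lemma stokes_sign X rho : has_div h X rho ->
  mu.-integrable setT (fun p : borel M => (riem_norm h p (X p))%:E) ->
  (forall p, 0 <= rho p) \/ (forall p, rho p <= 0) -> forall p, rho p = 0.
Proof.
move=> hX iX [rho0|rho0] p; first exact: (stokes_nonneg hm vol complete Mconn hX iX rho0).
apply/eqP; rewrite -oppr_eq0; apply/eqP.
apply: (stokes_nonneg hm vol complete Mconn (has_divN hX)) => [|q]; last by rewrite oppr_ge0.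
have -> // : (fun p : borel M => (riem_norm h p (- X p))%:E) = (fun p => (riem_norm h p (X p))%:E).
by apply/funext => q; rewrite -scaleN1r riem_normZ normrN1 mul1r.
Qed.

Lemma constant_sign (f : M -> R) : continuous f -> (forall p, f p != 0) ->
  (forall p, 0 < f p) \/ (forall p, f p < 0).
Proof.
move=> cf f0.
have oP : open [set p | 0 < f p] by exact: (@open_comp M R f [set t | 0 < t] (fun p _ => cf p) (@open_gt R 0)).
have oN : open [set p | f p < 0] by exact: (@open_comp M R f [set t | t < 0] (fun p _ => cf p) (@open_lt R 0)).
have [H|H] := pselect (forall p, f p < 0); first by right.
move: H => /existsNP[p0 /negP]; rewrite -leNgt le_eqVlt eq_sym (negPf (f0 p0)) /= => p00.
left=> p; suff : [set q | 0 < f q] p by [].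
have -> // : [set p | 0 < f p] = [set: M].
apply: Mconn; first by exists p0.
- by exists [set p | 0 < f p] => //; rewrite setTI.
- exists (~` [set p | f p < 0]); first exact: open_closedC.
  rewrite setTI; apply/seteqP; split => q /=; first by move=> h1 h2; have := lt_trans h1 h2; rewrite ltxx.
  by move/negP; rewrite -leNgt le_eqVlt eq_sym (negPf (f0 q)).
Qed.

End SignedStokes.

Section TotallyGeodesic.
Context {R : realType} {n : nat} {Mt : manifold R n.+1} {M : manifold R n}.
Variables (g : Mt -> 'M[R]_n.+1) (x : M -> Mt) (N : M -> 'rV[R]_n.+1) (xi : Mt -> 'rV[R]_n.+1).
Variables (mu : {measure set (borel M) -> \bar R}).
Local Notation h := (induced_metric g x).
Hypotheses (n0 : (0 < n)%N) (gm : riemannian_metric g) (xim : immersion x) (nN : unit_normal g x N).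
Hypotheses (pxi : parallel g xi) (trans : transversal_to x xi).
Hypotheses (vol : riemannian_volume h mu).
Hypotheses (complete : complete_metric h) (Mconn : connected [set: M]).
Hypothesis xi_integrable : mu.-integrable setT (fun p : borel M =>
       (riem_norm h p (tangent_part g x p (xi (x p))))%:E).
Let hm : riemannian_metric h := induced_riemannian gm xim.

Lemma shape_lin p v : shape_operator g x N p v = v *m lin1_mx (shape_operator g x N p).
Proof.
have ad := chart_at_atlas (x p); have dp := chart_at_dom (x p).
have ac := chart_at_atlas p; have cp := chart_at_dom p.
rewrite (lin1_shape gm xim nN ac ad cp dp) trans_id// mul1mx mulmx1.
by rewrite -[LHS](@tcoord_at _ _ M p) (tcoord_shape gm xim nN _ ac ad cp dp) tcoord_at mulmxN mulmxA.
Qed.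

(** At a zero of the support function the field would be tangent, namely the image of its own
    tangential part. *)
Lemma support_neq0 p : support g x N xi p != 0.
Proof.
apply/eqP => f0; have /eqP := trans p (tangent_part g x p (xi (x p))); apply.
rewrite (dmap_tangent_part gm xim nN) -[inner g _ _ _]/(support g x N xi p) f0 scale0r subr0.
by [].
Qed.

Lemma support_sign : (forall p, 0 < support g x N xi p) \/ (forall p, support g x N xi p < 0).
Proof.
apply: (@constant_sign _ _ _ Mconn (support g x N xi)) => [|p]; last exact: support_neq0.
exact: smooth_fun_continuous (smooth_support gm xim nN pxi).
Qed.

Lemma support_prod_sign (r : M -> R) : (forall p, 0 <= r p) \/ (forall p, r p <= 0) ->
  (forall p, 0 <= support g x N xi p * r p) \/ (forall p, support g x N xi p * r p <= 0).
Proof.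
case: support_sign => Hf [Hr|Hr]; [left|right|right|left] => p.
- by rewrite mulr_ge0// ltW.
- by rewrite mulr_ge0_le0// ltW.
- by rewrite mulr_le0_ge0// ltW.
- by rewrite mulr_le0// ltW.
Qed.

Lemma minimal_of_sign :
  (forall p, 0 <= mean_curvature g x N p) \/ (forall p, mean_curvature g x N p <= 0) ->
  forall p, \tr (lin1_mx (shape_operator g x N p)) = 0.
Proof.
move=> Hs p; have trE q : \tr (lin1_mx (shape_operator g x N q)) = n%:R * mean_curvature g x N q.
  by rewrite /mean_curvature mulrC divfK// pnatr_eq0 -lt0n.
have hX := has_div_tangential gm xim nN pxi.
have H : (forall q, 0 <= 0 * n%:R + support g x N xi q * \tr (lin1_mx (shape_operator g x N q))) \/
    (forall q, 0 * n%:R + support g x N xi q * \tr (lin1_mx (shape_operator g x N q)) <= 0).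
  have [|H|H] := @support_prod_sign (fun q => \tr (lin1_mx (shape_operator g x N q))).
  - case: Hs => H; [left|right] => q; rewrite trE; first exact: mulr_ge0 (ler0n _ _) (H q).
    exact: mulr_ge0_le0 (ler0n _ _) (H q).
  - by left=> q; rewrite mul0r add0r.
  - by right=> q; rewrite mul0r add0r.
have /eqP := stokes_sign hm vol complete Mconn hX xi_integrable H p.
by rewrite mul0r add0r mulf_eq0 (negPf (support_neq0 p)) => /eqP.
Qed.

Hypothesis minimal : forall p, \tr (lin1_mx (shape_operator g x N p)) = 0.
Hypothesis A_bounded : exists C : R, forall p, shape_norm g x N p <= C.
Hypothesis ricci0 : ricci_nonneg g.

Theorem geodesic_of_minimal :
  totally_geodesic g x N /\ forall p, ricci g (x p) (N p) (N p) = 0.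
Proof.
pose S p := lin1_mx (shape_operator g x N p).
pose T p := \tr (S p *m h p *m (S p)^T *m invmx (h p)).
have hX := has_div_shape gm xim nN pxi minimal.
have T0 p : 0 <= T p by apply: adjoint_trace_ge0; exact: posdef_metric.
have [C HC] := A_bounded.
have X2E p : shape_operator g x N p (tangential g x xi p) = tangential g x xi p *m S p by exact: shape_lin.
(* [shape_norm], a Hilbert-Schmidt norm, dominates the operator norm, so the field is bounded by [C]
   times the integrable tangential part. *)
have iX : mu.-integrable setT (fun p : borel M =>
    (riem_norm h p (shape_operator g x N p (tangential g x xi p)))%:E).
  apply: (@le_integrable _ _ _ _ setT measurableT _ (fun p : borel M => (C%:E * (riem_norm h p (tangent_part g x p (xi (x p))))%:E)%E)).
  - apply/measurable_EFinP; apply: borel_continuousR => [|q _]; first exact: openT.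
    by apply: (continuous_riem_norm hm) => c p ac cp; have [] := hX c p ac cp.
  - move=> p _; rewrite -EFinM !abse_EFin lee_fin ger0_norm ?riem_norm_ge0//.
    apply: (@le_trans _ _ (C * riem_norm h p (tangential g x xi p))); last exact: ler_norm.
    apply: (@le_trans _ _ (shape_norm g x N p * riem_norm h p (tangential g x xi p))); last first.
      by rewrite ler_wpM2r ?riem_norm_ge0.
    rewrite /shape_norm /riem_norm -sqrtrM ?T0// ler_wsqrtr// !innerE X2E.
    exact: adjoint_trace_bound (posdef_metric hm p) _.
  - exact: integrableZl.
have rho0 p : support g x N xi p * (T p + ricci g (x p) (N p) (N p)) = 0.
  apply: (stokes_sign hm vol complete Mconn hX iX).
  by apply: support_prod_sign; left=> q; rewrite addr_ge0// T0.
have E p : T p + ricci g (x p) (N p) (N p) = 0.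
  by have /eqP := rho0 p; rewrite mulf_eq0 (negPf (support_neq0 p)) => /eqP.
have Tz p : T p = 0 by have := E p; have := T0 p; have := ricci0 (x p) (N p); lra.
split=> p; last by have := E p; rewrite Tz add0r.
move=> v; rewrite shape_lin (_ : lin1_mx _ = 0) ?mulmx0//.
exact: adjoint_trace_eq0 (posdef_metric hm p) (Tz p).
Qed.

End TotallyGeodesic.

(** * Vanishing of the tangential part *)

Section LocallyConstant.
Context {R : realType} {n : nat} {M : manifold R n}.

Lemma const_of_deriv0 (s : M -> R) : connected [set: M] -> smooth_fun s ->
  (forall p v, Dv v (fun y => s (chart_inv (chart_at p) y)) (chart_at p p) = 0) ->
  forall p q, s p = s q.
Proof.
move=> Mconn ss D0 p q; have cs := smooth_fun_continuous ss.
suff : [set z | s z = s q] p by [].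
have cl : closed [set z | s z = s q].
  have := @closed_comp M R s [set t | t = s q] (fun z _ => cs z); apply; exact: closed_eq.
have op : open [set z | s z = s q].
  rewrite openE => z zq; pose c := chart_at z.
  have ac : atlas c := chart_at_atlas z; have cz : chart_dom c z := chart_at_dom z.
  have [e e0 be] := boxed_chart cz.
  have Hb y : box (c z) e y -> s (chart_inv c y) = s q.
    move=> yb; pose f y := s (chart_inv c y).
    have fl (t : R) : `|t| <= `|1 : R| -> box (c z) e (t *: (y - c z) + c z).
      move=> t1; rewrite /box /= addrK normrZ (le_trans _ yb)// ler_piMl//.
      by rewrite (le_trans t1)// normr1.
    have sf t : `|t| <= `|1 : R| -> smooth_near f (t *: (y - c z) + c z).
      by move=> /fl/be[cy <-]; exact: ss.
    have [t t1] := @MVT_line _ _ f (c z) (y - c z) 1 (fun t t1 => smooth_derivable (sf t t1)).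
    rewrite scale1r subrK mul1r; have [cy cyK] := be _ (fl t t1).
    set w := t *: _ + _ in cy cyK *; rewrite -DvE -cyK.
    set p' := chart_inv c w in cy *.
    rewrite (Dv_chart_change _ ac (chart_at_atlas p') cy (chart_at_dom p')); last first.
      by apply: smooth_differentiable; exact: ss (chart_at_atlas p') (chart_at_dom p').
    by rewrite D0 => /eqP; rewrite subr_eq0 /f chartK// => /eqP ->.
  have := chart_near_inv cz (box_near (c z) e0); rewrite /interior.
  by apply: filterS2 (chart_near cz) => z' cz' /Hb; rewrite chartK.
have -> // : [set z | s z = s q] = [set: M].
apply: Mconn; first by exists q.
- by exists [set z | s z = s q] => //; rewrite setTI.
- by exists [set z | s z = s q] => //; rewrite setTI.
Qed.

End LocallyConstant.

Lemma integrable_dominated d (T : measurableType d) (R : realType) (mu : {measure set T -> \bar R})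
  (f u : T -> R) (K : R) : measurable_fun setT f -> (forall p, 0 <= f p <= K * u p) ->
  mu.-integrable setT (EFin \o u) -> mu.-integrable setT (EFin \o f).
Proof.
move=> mf fK iu; apply: (@le_integrable _ _ _ _ setT measurableT _ (fun p => (K%:E * (u p)%:E)%E)).
- exact/measurable_EFinP.
- move=> p _; case/andP: (fK p) => f0 fu.
  by change (`|f p|%:E <= `|K * u p|%:E)%E; rewrite lee_fin ger0_norm// (le_trans fu)// ler_norm.
- exact: integrableZl.
Qed.

Section TangentialNorm.
Context {R : realType} {n : nat} {Mt : manifold R n.+1} {M : manifold R n}.
Variables (g : Mt -> 'M[R]_n.+1) (x : M -> Mt) (N : M -> 'rV[R]_n.+1).
Local Notation h := (induced_metric g x).
Hypotheses (gm : riemannian_metric g) (xim : immersion x) (nN : unit_normal g x N).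
Hypothesis geodesic : totally_geodesic g x N.
Let hm : riemannian_metric h := induced_riemannian gm xim.
Let sx : smooth_map x := xim.1.

Section Field.
Variables (X : Mt -> 'rV[R]_n.+1) (a : R).
Hypothesis cX : closed_conformal g X (fun=> a).
Let sX : smooth_field X. Proof. by case: cX. Qed.

Definition tangential_sq p := inner h p (tangential g x X p) (tangential g x X p).

Lemma tangential_sqE p : tangential_sq p =
  inner g (x p) (X (x p)) (X (x p)) - support g x N X p ^+ 2.
Proof.
rewrite /tangential_sq {1}/tangential (tangent_part_inner gm xim) (dmap_tangent_part gm xim nN).
by rewrite innerE bilBr bilZr -!innerE -/(support g x N X p) expr2.
Qed.

Lemma tangential_sq_ge0 p : 0 <= tangential_sq p.
Proof. by rewrite /tangential_sq innerE; exact: posdef_bil_ge0 (posdef_metric hm p). Qed.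

Let ambient c d y := bil (gmx g d (mrep c d x y)) (frep c d x (X \o x) y) (frep c d x (X \o x) y).

Let ambientE c d p : atlas c -> atlas d -> chart_dom c p -> chart_dom d (x p) ->
  \forall y \near c p, inner g (x (chart_inv c y)) (X (x (chart_inv c y))) (X (x (chart_inv c y))) = ambient c d y.
Proof.
move=> ac ad cp dp; apply: (near_mrep xim cp dp) => q cq dq.
by rewrite /ambient (mrepE _ _ cq) (frepE _ _ _ cq) (bil_gram g _ _ ad dq) chartK.
Qed.

Lemma smooth_tangential_sq : smooth_fun tangential_sq.
Proof.
move=> c p ac cp; have ad := chart_at_atlas (x p); have dp := chart_at_dom (x p).
have sXx := smooth_alongP sx (smooth_along_comp sx sX).
have sf := smooth_support gm xim nN cX ac cp.
apply: (@eq_smooth _ _ _ (fun y => ambient c (chart_at (x p)) y - support g x N X (chart_inv c y) * support g x N X (chart_inv c y))).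
  by apply: filterS (ambientE ac ad cp dp) => y E; rewrite tangential_sqE E expr2.
apply: smoothB; last exact: smoothM.
have sG : smooth_near (fun y => gmx g (chart_at (x p)) (mrep c (chart_at (x p)) x y)) (c p).
  apply: smooth_comp; first exact: smooth_mrep.
  by rewrite mrepE//; exact: smooth_gram.
by apply: smooth_bil => //; exact: sXx.
Qed.

(** The squared norm of the tangential part is that of [X] minus the square of the support function.
    The latter has derivative 0, being differentiated through the shape operator; the former is
    differentiated by metric compatibility, with [nabla X] equal to [a] times the identity. *)
Lemma deriv_tangential_sq p v :
  Dv v (fun y => tangential_sq (chart_inv (chart_at p) y)) (chart_at p p) =
  2 * a * inner h p (tangential g x X p) v.
Proof.
have ac := chart_at_atlas p; have cp := chart_at_dom p.
have ad := chart_at_atlas (x p); have dp := chart_at_dom (x p).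
set c := chart_at p in ac cp *; set d := chart_at (x p) in ad dp.
have sXx := smooth_alongP sx (smooth_along_comp sx sX) ac ad cp dp.
have sf : smooth_near (fun y => support g x N X (chart_inv c y)) (c p) := smooth_support gm xim nN cX ac cp.
have sm := smooth_mrep xim ac ad cp dp.
have mG : metric_near (gmx g d) (mrep c d x (c p)) by rewrite mrepE//; exact: gram_metric.
have sG : smooth_near (fun y => gmx g d (mrep c d x y)) (c p).
  by apply: smooth_comp => //; rewrite mrepE//; exact: smooth_gram.
have sA : smooth_near (ambient c d) (c p) by apply: smooth_bil.
rewrite (@Dv_near _ _ _ _ _ (fun y => ambient c d y - support g x N X (chart_inv c y) * support g x N X (chart_inv c y))); last first.
  by apply: filterS (ambientE ac ad cp dp) => y E; rewrite tangential_sqE E expr2.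
rewrite (DvB _ sA (smoothM sf sf)) (DvM _ sf sf) (deriv_support gm xim nN cX) geodesic innerE bil0r oppr0.
rewrite mulr0 mul0r addr0 subr0 /ambient (nabla_compat v sm mG sXx sXx).
rewrite (nabla_along gm xim cX v ac ad cp dp) bilZl bilZr mrepE// frepE//.
rewrite -{1 2}[v](@tcoord_at _ _ M p) -/c (push_tcoord xim v ac ad cp dp) !(bil_gram g _ _ ad dp).
rewrite (tangent_part_inner gm xim) [inner g (x p) (dmap x p v) _]innerE.
have [gT _] := posdef_metric gm (x p); rewrite (bilC _ _ gT) -innerE /=; ring.
Qed.

Lemma riem_norm_tangential p : riem_norm h p (tangential g x X p) = Num.sqrt (tangential_sq p).
Proof. by []. Qed.

Let b p := (1 + tangential_sq p)^-1.

Let s1 p : 0 < 1 + tangential_sq p. Proof. by rewrite ltr_wpDr ?tangential_sq_ge0. Qed.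

Lemma has_div_normalized : has_div h (fun p => (1 + tangential_sq p)^-1 *: tangential g x X p)
  (fun p => a * (n%:R + (n%:R - 2) * tangential_sq p) / (1 + tangential_sq p) ^+ 2).
Proof.
have sb : smooth_fun b.
  move=> c p ac cp; apply: smoothV; first by rewrite gt_eqF// s1.
  by apply: smoothD; [exact: smooth_cst|exact: smooth_tangential_sq].
have hX := has_div_tangential gm xim nN cX.
apply: eq_has_div (has_div_scale hm sb hX) => p.
have tr0 : \tr (lin1_mx (shape_operator g x N p)) = 0.
  by rewrite (_ : lin1_mx _ = 0) ?mxtrace0//; apply/matrixP => i j; rewrite mxE geodesic !mxE.
have ss : smooth_near (fun y => tangential_sq (chart_inv (chart_at p) y)) (chart_at p p).
  exact: smooth_tangential_sq (chart_at_atlas p) (chart_at_dom p).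
have F : tangential_sq (chart_inv (chart_at p) (chart_at p p)) = tangential_sq p := congr1 tangential_sq (chartK (chart_at_dom p)).
rewrite tr0 mulr0 addr0 /deriv_along /b.
have s1' : 1 + tangential_sq (chart_inv (chart_at p) (chart_at p p)) != 0 by rewrite F gt_eqF// s1.
pose f y := 1 + tangential_sq (chart_inv (chart_at p) y).
have sf : smooth_near f (chart_at p p) := smoothD (smooth_cst _ _) ss.
rewrite (@DvV _ _ _ f _ s1' sf) /f (DvD _ (smooth_cst _ _) ss) Dv_cst add0r.
rewrite deriv_tangential_sq F -/(tangential_sq p).
have := lt0r_neq0 (s1 p); move: (tangential_sq p) => s s0; field.
by [].
Qed.

Lemma normalized_norm p : riem_norm h p ((1 + tangential_sq p)^-1 *: tangential g x X p) <= 2^-1.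
Proof.
rewrite riem_normZ riem_norm_tangential gtr0_norm ?invr_gt0// mulrC ler_pdivrMr//.
have := sqr_sqrtr (tangential_sq_ge0 p); move: (Num.sqrt _) => t <-.
have := sqr_ge0 (t - 1); rewrite sqrrB; lra.
Qed.

End Field.

Lemma parallel_tangential_const xi : parallel g xi -> connected [set: M] ->
  forall p q, tangential_sq xi p = tangential_sq xi q.
Proof.
move=> pxi Mconn; apply: (const_of_deriv0 Mconn); first exact: smooth_tangential_sq pxi.
by move=> p v; rewrite (deriv_tangential_sq pxi) mulr0 mul0r.
Qed.

Variables (mu : {measure set (borel M) -> \bar R}).
Hypotheses (vol : riemannian_volume h mu).
Hypotheses (complete : complete_metric h) (Mconn : connected [set: M]).
Variables (xi eta : Mt -> 'rV[R]_n.+1).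
Hypotheses (n2 : (2 <= n)%N) (pxi : parallel g xi) (heta : homothetic g eta) (neta : ~ parallel g eta).
Hypothesis xi_integrable : mu.-integrable setT (fun p : borel M =>
       (riem_norm h p (tangent_part g x p (xi (x p))))%:E).

Theorem tangential_eq0 p : tangential g x xi p = 0.
Proof.
apply/eqP/negP => /negP t0.
have s0 q : tangential_sq xi q = tangential_sq xi p by exact: parallel_tangential_const.
have k0 : 0 < Num.sqrt (tangential_sq xi p).
  by rewrite sqrtr_gt0 /tangential_sq innerE; exact: posdef_bil_gt0 (posdef_metric hm p) t0.
set k := Num.sqrt _ in k0.
have [a ca] := heta.
have a0 : a != 0 by apply/eqP => a0; apply: neta; rewrite /parallel -a0.
have hZ := has_div_normalized ca.
have iZ : mu.-integrable setT (fun q : borel M =>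
    (riem_norm h q ((1 + tangential_sq eta q)^-1 *: tangential g x eta q))%:E).
  (* The tangential part of [xi] has constant norm [k], so the bound 1/2 equals [(2 * k)^-1] times
     an integrable function. *)
  apply: (integrable_dominated (K := (2 * k)^-1) _ _ xi_integrable) => [|q].
    apply: borel_continuousR => [|q _]; first exact: openT.
    by apply: (continuous_riem_norm hm) => c q' ac cq'; have [] := hZ c q' ac cq'.
  rewrite riem_norm_ge0; apply: (le_trans (normalized_norm eta q)).
  have E : riem_norm h q (tangential g x xi q) = k by rewrite riem_norm_tangential s0.
  change (2^-1 <= (2 * k)^-1 * riem_norm h q (tangential g x xi q)).
  by rewrite E invfM (mulfVK (lt0r_neq0 k0)).
(* Dimension at least 2 makes the coefficient [n%:R - 2] nonnegative. *)
have pos q : 0 < (n%:R + (n%:R - 2) * tangential_sq eta q) / (1 + tangential_sq eta q) ^+ 2.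
  have := tangential_sq_ge0 eta q; move: (tangential_sq eta q) => s hs.
  have nR : 2 <= n%:R :> R by rewrite ler_nat.
  apply: divr_gt0; last by apply: exprn_gt0; lra.
  have : 0 <= (n%:R - 2) * s by apply: mulr_ge0; lra.
  lra.
have sgn : (forall q, 0 <= a * (n%:R + (n%:R - 2) * tangential_sq eta q) / (1 + tangential_sq eta q) ^+ 2) \/
   (forall q, a * (n%:R + (n%:R - 2) * tangential_sq eta q) / (1 + tangential_sq eta q) ^+ 2 <= 0).
  case: (ltP 0 a) => ha; [left|right] => q; rewrite -mulrA.
    exact: mulr_ge0 (ltW ha) (ltW (pos q)).
  exact: mulr_le0_ge0 ha (ltW (pos q)).
have /eqP := stokes_sign hm vol complete Mconn hZ iZ sgn p.
rewrite -mulrA mulf_eq0 (negPf a0) orFb => /eqP rp.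
by have := pos p; rewrite rp ltxx.
Qed.

End TangentialNorm.

(** * The inverse function theorem and local uniqueness of integral hypersurfaces *)

Section InverseFunction.
Context {R : realType} {n : nat}.
Implicit Types (u v y z : 'rV[R]_n).

(** The map sending [y] to [y - f y] has derivative 0 at [u0], so its partial derivatives are small
    nearby. [P] stands for any further property wanted on the same box. *)
Lemma near_contraction (f : 'rV[R]_n -> 'rV[R]_n) (P : set 'rV[R]_n) u0 : smooth_near f u0 ->
  (forall v, Dv v f u0 = v) -> (\forall y \near u0, P y) ->
  exists2 r, 0 < r & (forall y, box u0 r y -> smooth_near f y /\ P y) /\
    forall y z, box u0 r y -> box u0 r z -> `|(y - f y) - (z - f z)| <= `|y - z| / 2.
Proof.
move=> sf Df nP; pose k : R := 2^-1 / n.+1%:R.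
have k0 : 0 < k by rewrite divr_gt0// invr_gt0.
pose D (i j : 'I_n) y : R := (ebase i : 'rV[R]_n) 0 j - Dv (ebase i) (fun z => f z 0 j) y.
have nD : \forall y \near u0, forall i j, `|D i j y| < k.
  apply: near_forall => i; apply: near_forall => j.
  have sD : smooth_near (D i j) u0.
    by apply: smoothB; [exact: smooth_cst|apply: smooth_Dv; exact: smooth_entry].
  have cD := smooth_continuous sD.
  have D0 : D i j u0 = 0 by rewrite /D -Dv_entry// Df subrr.
  have : \forall t \near D i j u0, `|t| < k.
    rewrite D0; apply: filterS (nbhsx_ballx _ _ k0) => t.
    by rewrite -ball_normE /= sub0r normrN.
  by move/cD.
have [r r0 Hr] := near_box (filterI (near_smooth sf) (filterI nD nP)).
(* [MVT_line] ranges over parameters down to -1 and thus leaves the segment from [z] to [y]; a box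
   three times as large still contains these points. *)
have r30 : 0 < r / 3 by rewrite divr_gt0.
have r3 y : box u0 (r / 3) y -> box u0 r y.
  by rewrite /box /= => /le_trans; apply; rewrite ler_pdivrMr// ler_pMr// ler1n.
exists (r / 3) => //; split=> [y /r3/Hr[? []]//|y z by_ bz].
pose w := y - z.
have bline (t : R) : `|t| <= 1 -> box u0 r (t *: w + z).
  move=> t1; rewrite /box /=.
  have -> : t *: w + z - u0 = t *: (y - u0) - t *: (z - u0) + (z - u0).
    by rewrite /w; apply/rowP => i; rewrite !mxE; ring.
  rewrite (le_trans (ler_normD _ _))// (le_trans (lerD (ler_normB _ _) (lexx _)))// !normrZ.
  have h1 : `|t| * `|y - u0| <= r / 3 by rewrite (le_trans _ by_)// ler_piMl.
  have h2 : `|t| * `|z - u0| <= r / 3 by rewrite (le_trans _ bz)// ler_piMl.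
  have h3 : `|z - u0| <= r / 3 := bz.
  by apply: (le_trans (lerD (lerD h1 h2) h3)); lra.
apply: mx_norm_le => [|i j]; first by rewrite mulr_ge0// invr_ge0.
rewrite ord1 {i}.
pose q (w' : 'rV[R]_n) : R := w' 0 j - f w' 0 j.
have sfj w' : box u0 r w' -> smooth_near (fun z => f z 0 j) w'.
  by move=> /Hr[sw _]; exact: smooth_entry.
have sq w' : box u0 r w' -> smooth_near q w'.
  by move=> bw; apply: smoothB; [exact: smooth_coord|exact: sfj].
have dq t : `|t| <= `|1 : R| -> derivable q (t *: w + z) w.
  by rewrite normr1 => /bline/sq; exact: smooth_derivable.
have [t t1] := MVT_line dq; rewrite normr1 in t1; have bt := bline t t1.
rewrite scale1r subrK mul1r -DvE => E.
have -> : (y - f y - (z - f z)) 0 j = Dv w q (t *: w + z).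
  by rewrite -E /q !mxE.
rewrite (Dv_dir_sum _ (smooth_differentiable (sq _ bt))).
apply: (le_trans (ler_norm_sum _ _ _)).
apply: (@le_trans _ _ (\sum_(i < n) `|w| * k)).
  apply: ler_sum => i _; rewrite normrM ler_pM//; first exact: mx_norm_entry.
  have [_ [/(_ i j) Hij _]] := Hr _ bt.
  have -> : Dv (ebase i) q (t *: w + z) = D i j (t *: w + z).
    rewrite /q (DvB _ (smooth_coord _ j) (sfj _ bt)) /D; congr (_ - _).
    by rewrite -Dv_entry ?Dv_id//; exact: smooth_id.
  exact: ltW.
rewrite sumr_const card_ord -[leLHS]mulr_natl /k.
have : n%:R / n.+1%:R <= 1 :> R by rewrite ler_pdivrMr ?ltr0n// mul1r ler_nat.
have -> : n%:R * (`|w| * (2^-1 / n.+1%:R)) = (n%:R / n.+1%:R) * (`|w| / 2) :> R by ring.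
by move=> H; rewrite ler_piMl// divr_ge0.
Qed.

(** The Lipschitz bound makes the increment [hh t] of [g] of order [t]. Differentiability of [f]
    then gives [hh t *m J] up to an error negligible against [t], and multiplication by the inverse
    of [J] concludes. *)
Lemma is_derive_inverse_map (f g : 'rV[R]_n -> 'rV[R]_n) z v : smooth_near f (g z) ->
  'J f (g z) \in unitmx -> (\forall z' \near z, f (g z') = z') ->
  (\forall z' \near z, `|g z' - g z| <= 2 * `|z' - z|) ->
  is_derive z v g (v *m invmx ('J f (g z))).
Proof.
move=> sf uJ fg lg; set J := 'J f (g z) in uJ *.
pose hh (t : R) := g (t *: v + z) - g z.
have cline : (fun t : R => t *: v + z) @ 0^' --> z.
  have c : {for 0, continuous (fun t : R => t *: v + z)}.
    apply: smooth_continuous; apply: smoothD; last exact: smooth_cst.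
    apply: smooth_scale; last exact: smooth_cst.
    by apply: (@smooth_lin _ R^o R^o (idfun : {linear R^o -> R^o})); move=> ?; exact: cvg_id.
  have c0 : (0 : R) *: v + z = z by rewrite scale0r add0r.
  by rewrite -{2}c0; apply: cvg_trans c; apply: cvg_app; exact: nbhs_dnbhs.
have lh : \forall t \near 0^', `|hh t| <= 2 * (`|t| * `|v|).
  have H : \forall t \near 0^', `|g (t *: v + z) - g z| <= 2 * `|t *: v + z - z| := cline _ lg.
  by apply: filterS H => t; rewrite addrK normrZ.
have fh : \forall t \near 0^', f (hh t + g z) - f (g z) = t *: v.
  have H : \forall t \near 0^', f (g (t *: v + z)) = t *: v + z := cline _ fg.
  apply: filterS H => t E; rewrite /hh subrK E.
  by rewrite (nbhs_singleton fg) addrK.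
have t0 : \forall t \near 0^', t != 0 :> R by exact: nbhs_dnbhs_neq.
have ch : hh @ 0^' --> (0 : 'rV[R]_n).
  apply/cvgr0Pnorm_le => e e0.
  have : \forall t \near (0 : R)^', `|t| <= e / (2 * (`|v| + 1)).
    apply: nbhs_dnbhs; apply: filterS (nbhsx_ballx (0 : R) (e / (2 * (`|v| + 1))) _).
      by move=> t; rewrite -ball_normE /= sub0r normrN => /ltW.
    by rewrite divr_gt0// mulr_gt0// ltr_wpDl.
  apply: filterS2 lh => t ht; rewrite ler_pdivlMr ?mulr_gt0 ?ltr_wpDl// => he.
  apply: (le_trans ht); apply: le_trans he.
  have : 0 <= `|t| by []. have : 0 <= `|v| by [].
  by move: `|t| `|v| => a b; nra.
pose ee (t : R) : 'rV[R]_n := v - t^-1 *: (hh t *m J).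
have ce : ee @ 0^' --> (0 : 'rV[R]_n).
  apply/cvg_mxP => i j; rewrite ord1 mxE {i}.
  have sfj : smooth_near (fun y => f y 0 j) (g z) by exact: smooth_entry.
  apply/cvgr0Pnorm_le => e e0.
  have e1 : 0 < e / (2 * (`|v| + 1)) by rewrite divr_gt0// mulr_gt0// ltr_wpDl.
  have pinc : \forall h \near (0 : 'rV[R]_n), `|f (h + g z) 0 j - f (g z) 0 j - \sum_i h 0 i * 'D_(ebase i) (fun y => f y 0 j) (g z)| <= e / (2 * (`|v| + 1)) * `|h|.
    apply: (@partial_increment R n (fun y => f y 0 j)) => //.
      by apply: filterS (near_smooth sfj) => y sy i; exact: smooth_derivable.
    by move=> i; apply: smooth_continuous; exact: smooth_derive.
  have pt : \forall t \near 0^', `|f (hh t + g z) 0 j - f (g z) 0 j - \sum_i hh t 0 i * 'D_(ebase i) (fun y => f y 0 j) (g z)| <= e / (2 * (`|v| + 1)) * `|hh t| := ch _ pinc.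
  apply: filterS2 (filterI lh fh) (filterI t0 pt) => t [lt ft] [tn0 pt'].
  have Es : \sum_i hh t 0 i * 'D_(ebase i) (fun y => f y 0 j) (g z) = (hh t *m J) 0 j.
    rewrite (Dv_jacobian _ (smooth_differentiable_mx sf)) (Dv_dir_sum _ (smooth_differentiable_mx sf)) summxE.
    by apply: eq_bigr => i _; rewrite [RHS]mxE (Dv_entry _ 0 j sf) DvE.
  have Ef : f (hh t + g z) 0 j - f (g z) 0 j = t * v 0 j.
    by have := congr1 (fun A : 'rV[R]_n => A 0 j) ft; rewrite !mxE.
  rewrite Es Ef in pt'.
  have -> : ee t 0 j = t^-1 * (t * v 0 j - (hh t *m J) 0 j).
    by rewrite /ee !mxE mulrBr mulKf.
  rewrite normrM normfV mulrC ler_pdivrMr ?normr_gt0//.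
  apply: (le_trans pt'); apply: (@le_trans _ _ (e / (2 * (`|v| + 1)) * (2 * (`|t| * `|v|)))).
    by rewrite ler_wpM2l// ltW.
  have v0 : 0 <= `|v| by []. have at0 : 0 <= `|t| by [].
  rewrite mulrAC ler_pdivrMr ?mulr_gt0 ?ltr_wpDl//.
  by have := mulr_ge0 (ltW e0) at0; move: `|t| `|v| v0 => a b b0; nra.
have key : (fun t : R => t^-1 *: hh t) @ 0^' --> v *m invmx J.
  have c1 : (fun t => (v - ee t) *m invmx J) @ 0^' --> (v - 0) *m invmx J.
    have cl := @rV_linear_continuous R n _ (mulmxr (invmx J)) (v - 0).
    have cB : (fun t => v - ee t) @ 0^' --> v - 0 by exact: (cvgB (cvg_cst v) ce).
    exact: (cvg_comp _ _ cB cl).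
  rewrite subr0 in c1; apply: cvg_trans c1; apply: near_eq_cvg.
  apply: nearW => t /=.
  by rewrite /ee opprB addrC subrK -scalemxAl mulmxK.
have dg : derivable g z v by apply/cvg_ex; exists (v *m invmx J).
apply: DeriveDef => //; exact: cvg_lim key.
Qed.

(** The contraction estimate gives injectivity and a Lipschitz bound for the inverse; surjectivity
    onto a small ball comes from minimizing [|z - f y|] over a compact box. *)
Lemma inverse_function_id (f : 'rV[R]_n -> 'rV[R]_n) u0 : smooth_near f u0 ->
  (forall v, Dv v f u0 = v) -> exists g, [/\ smooth_near g (f u0), g (f u0) = u0,
    \forall z \near f u0, f (g z) = z & \forall u \near u0, g (f u) = u].
Proof.
move=> sf Df.
have nJ : \forall y \near u0, 'J f y \in unitmx.
  have J1 : 'J f u0 = 1%:M.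
    by apply/row_matrixP => i; rewrite !rowE (Dv_jacobian _ (smooth_differentiable_mx sf)) Df mulmx1.
  have cd := smooth_continuous (smooth_det (smooth_jacobian sf)).
  have d0 : 0 < \det ('J f u0) by rewrite J1 det1.
  have H : \forall y \near u0, 0 < \det ('J f y) := cd _ (lt_nbhsr d0); apply: filterS H => y H.
  by rewrite unitmxE unitfE; exact: lt0r_neq0.
have [r r0 [Hr contr]] := near_contraction sf Df nJ.
have expand y z : box u0 r y -> box u0 r z -> `|y - z| <= 2 * `|f y - f z|.
  move=> by_ bz; have := contr y z by_ bz.
  have := ler_normD (y - f y - (z - f z)) (f y - f z).
  have -> : y - f y - (z - f z) + (f y - f z) = y - z by apply/rowP => i; rewrite !mxE; ring.
  by move: `|_ - _ - _| `|y - z| `|f y - f z| => a b c; lra.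
have bu0 : box u0 r u0 by rewrite /box /= subrr normr0 ltW.
(* The quarter keeps the minimizer off the boundary of the box: [|y - u0|] is at most twice
   [|f y - f u0|], hence at most four times [|z - f u0|]. *)
have surj z : `|z - f u0| < r / 4 -> exists2 y, box u0 r y & f y = z.
  move=> zr.
  have cfz : {within box u0 r, continuous (fun y => `|z - f y|)}.
    apply: continuous_in_subspaceT => y; rewrite inE => /Hr[sy _].
    apply: (@cvg_norm _ _ _ _ (nbhs_filter y)).
    exact: smooth_continuous (smoothB (smooth_cst z y) sy).
  have [y ] := compact_EVT_min (ex_intro _ u0 bu0) (@compact_box R n u0 r) cfz.
  rewrite inE => by_ Hmin; exists y => //; apply/eqP; rewrite eq_sym -subr_eq0.
  apply: contraT => rho0; set rho := z - f y in rho0.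
  have nr0 : 0 < `|rho| by rewrite normr_gt0.
  have rz : `|rho| <= `|z - f u0| by apply: Hmin; rewrite inE.
  have yr : `|y - u0| < r.
    have := expand y u0 by_ bu0; have := ler_normB (z - f u0) rho.
    have -> : z - f u0 - rho = f y - f u0 by apply/rowP => i; rewrite !mxE; ring.
    by move: rz zr; move: `|z - _| `|rho| `|y - _| `|f y - _| => a b c d; lra.
  (* Moving [y] by [t] times the residual [rho] turns the residual into [(1 - t) *: rho] plus an
     error of norm at most half of [t * |rho|], contradicting minimality. *)
  pose t := Num.min 1 ((r - `|y - u0|) / `|rho|).
  have t0 : 0 < t by rewrite lt_min ltr01 divr_gt0// subr_gt0.
  have t1 : t <= 1 by rewrite ge_min lexx.
  have tr : t * `|rho| <= r - `|y - u0| by rewrite -ler_pdivlMr// ge_min lexx orbT.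
  have by' : box u0 r (y + t *: rho).
    rewrite /box /= addrAC (le_trans (ler_normD _ _))// normrZ (gtr0_norm t0).
    by move: tr; move: (t * _) `|y - _| => a b; lra.
  have := contr _ _ by' by_; have := Hmin (y + t *: rho); rewrite inE => /(_ by').
  have -> : y + t *: rho - y = t *: rho by rewrite addrAC subrr add0r.
  set c := _ - (y - f y); rewrite normrZ (gtr0_norm t0).
  have -> : z - f (y + t *: rho) = (1 - t) *: rho + c.
    by rewrite /c /rho; apply/rowP => i; rewrite !mxE; ring.
  move=> h1 h2; have := le_trans h1 (ler_normD _ _).
  rewrite normrZ ger0_norm ?subr_ge0// -/rho => h3.
  have : 0 < t * `|rho| by rewrite mulr_gt0.
  rewrite mulrBl mul1r in h3; move: h2 h3; move: (t * `|rho|) => A.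
  by move: `|c| `|rho| => b d ? ? ?; exfalso; lra.
pose g z := xget u0 [set y | box u0 r y /\ f y = z].
have Hg z : `|z - f u0| < r / 4 -> box u0 r (g z) /\ f (g z) = z.
  by move=> /surj[y by_ fy]; rewrite /g; case: xgetP => [_ -> //|/(_ y)]; case; split.
pose B : set 'rV[R]_n := [set z | `|z - f u0| < r / 4].
have oB : open B.
  rewrite openE => z Bz; rewrite /interior; have c : continuous (fun z : 'rV[R]_n => `|z - f u0|).
    move=> w; apply: (@cvg_norm _ _ _ _ (nbhs_filter w)).
    exact: smooth_continuous (smoothB (smooth_id w) (smooth_cst _ w)).
  exact: (c z _ (lt_nbhsl Bz)).
have r4 : 0 < r / 4 by rewrite divr_gt0.
have Bu : B (f u0) by rewrite /B /= subrr normr0.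
have lip z z' : B z -> B z' -> `|g z - g z'| <= 2 * `|z - z'|.
  move=> /Hg[b1 f1] /Hg[b2 f2]; have := expand _ _ b1 b2; by rewrite f1 f2.
have nB z : B z -> \forall z' \near z, B z' by move=> Bz; exact: open_nbhs_nbhs.
have gu0 : g (f u0) = u0.
  have [b1 f1] := Hg _ Bu; have := expand _ _ b1 bu0.
  by rewrite f1 subrr normr0 mulr0 normr_le0 subr_eq0 => /eqP.
have gint z : B z -> `|g z - u0| < r.
  move=> Bz; rewrite -gu0; apply: (le_lt_trans (lip _ _ Bz Bu)).
  by move: Bz; rewrite /B /=; move: `|_| => b; lra.
have dg z v : B z -> is_derive z v g (v *m invmx ('J f (g z))).
  move=> Bz; have [bz fz] := Hg z Bz; have [sz uz] := Hr _ bz.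
  apply: (@is_derive_inverse_map f g z v sz uz).
    by apply: filterS (nB z Bz) => z' /Hg[].
  by apply: filterS (nB z Bz) => z' Bz'; exact: lip.
have cg z : B z -> {for z, continuous g}.
  move=> Bz; apply/(@cvgrPdist_le _ _ _ _ (nbhs_filter z)) => e e0.
  have : \forall z' \near z, `|z' - z| <= e / 2.
    apply: filterS (nbhsx_ballx z (e / 2) _); last by rewrite divr_gt0.
    by move=> z'; rewrite -ball_normE /= distrC => /ltW.
  apply: filterS2 (nB z Bz) => z' Bz' h; apply: (le_trans (lip _ _ Bz Bz')).
  by rewrite mulrC -ler_pdivlMr// distrC.
pose U' : set 'rV[R]_n := [set y | `|y - u0| < r].
have oU' : open U'.
  rewrite openE => z Bz; rewrite /interior; have c : continuous (fun z : 'rV[R]_n => `|z - u0|).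
    move=> w; apply: (@cvg_norm _ _ _ _ (nbhs_filter w)).
    exact: smooth_continuous (smoothB (smooth_id w) (smooth_cst _ w)).
  exact: (c z _ (lt_nbhsl Bz)).
(* Bootstrap: the derivative of [g] is a smooth function of [g] itself, so each order gives the
   next. *)
have Ckg k : Ck k B g.
  elim: k => [|k IH]; first by split.
  apply/CkSP; split => // [y v /(dg _ v)[]//|v].
  apply: (@eq_Ck _ _ _ _ _ (fun z => v *m invmx ('J f (g z)))) => //.
    by move=> y /(dg _ v)[_ ->].
  apply/Ck_mxP => // i j.
  apply: (@Ck_comp_rV _ _ k n B U' g (fun y => (v *m invmx ('J f y)) i j)) => //.
  apply/CinftyP => // y /ltW/Hr[sy uy].
  apply: smooth_entry; apply: smooth_mulmx; first exact: smooth_cst.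
  by apply: smooth_invmx => //; exact: smooth_jacobian.
exists g; split => //.
- by exists B => //; split.
- by apply: filterS (nB _ Bu) => z /Hg[].
- have H : \forall u \near u0, B (f u) := smooth_continuous sf (nB _ Bu).
  apply: filterS2 (box_near u0 r0) H => u bu Bfu.
  have [b1 f1] := Hg _ Bfu; have := expand _ _ b1 bu.
  by rewrite f1 subrr normr0 mulr0 normr_le0 subr_eq0 => /eqP.
Qed.

Theorem inverse_function (f : 'rV[R]_n -> 'rV[R]_n) u0 : smooth_near f u0 ->
  (forall v, Dv v f u0 = 0 -> v = 0) -> exists g, [/\ smooth_near g (f u0), g (f u0) = u0,
    \forall z \near f u0, f (g z) = z & \forall u \near u0, g (f u) = u].
Proof.
move=> sf Df; set A := 'J f u0.
have JA v : v *m A = Dv v f u0 := Dv_jacobian v (smooth_differentiable_mx sf).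
have uA : A \in unitmx.
  rewrite -row_free_unit -kermx_eq0; apply/eqP/row_matrixP => i; rewrite row0.
  apply: Df; rewrite -JA; apply/sub_kermxP; exact: row_sub.
pose F y := f y *m invmx A.
have sm z : smooth_near (fun z : 'rV[R]_n => z *m invmx A) z.
  by apply: smooth_mulmx; [exact: smooth_id|exact: smooth_cst].
have sm' z : smooth_near (fun z : 'rV[R]_n => z *m A) z.
  by apply: smooth_mulmx; [exact: smooth_id|exact: smooth_cst].
have sF : smooth_near F u0 by apply: smooth_mulmx => //; exact: smooth_cst.
have [|g [sg gu fg gf]] := inverse_function_id sF.
  move=> v; rewrite /F (Dv_mulmx _ sf (smooth_cst _ _)) Dv_cst mulmx0 addr0 -JA mulmxK//.
exists (fun z => g (z *m invmx A)); split => //.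
- exact: (smooth_comp (f := g) (sm _) sg).
- have H : \forall z \near f u0, F (g (z *m invmx A)) = z *m invmx A := smooth_continuous (sm (f u0)) fg.
  apply: filterS H => z E.
  by rewrite -[LHS](mulmxKV uA) -/(F _) E mulmxKV.
Qed.

End InverseFunction.

(** * Local uniqueness in coordinates *)

Section LocalUniqueness.
Context {R : realType} {n : nat}.

(** Pairs a covector with a vector: in the uniqueness theorem the first argument is a conormal form,
    so no metric intervenes. *)
Definition dot {m} (a b : 'rV[R]_m) : R := \sum_i a 0 i * b 0 i.

Lemma dotDr m (a b c : 'rV[R]_m) : dot a (b + c) = dot a b + dot a c.
Proof. by rewrite /dot -big_split; apply: eq_bigr => i _; rewrite mxE mulrDr. Qed.

Lemma dotBl m (a b c : 'rV[R]_m) : dot (a - b) c = dot a c - dot b c.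
Proof. by rewrite /dot -sumrB; apply: eq_bigr => i _; rewrite !mxE mulrBl. Qed.

Lemma dotZr m k (a b : 'rV[R]_m) : dot a (k *: b) = k * dot a b.
Proof. by rewrite /dot mulr_sumr; apply: eq_bigr => i _; rewrite mxE mulrCA. Qed.

Lemma dot0r m (a : 'rV[R]_m) : dot a 0 = 0.
Proof. by rewrite /dot big1// => i _; rewrite mxE mulr0. Qed.

Lemma dot_gt0 m (a : 'rV[R]_m) : a != 0 -> 0 < dot a a.
Proof.
move=> a0; have d0 : 0 <= dot a a by apply: sumr_ge0 => i _; rewrite -expr2 sqr_ge0.
rewrite lt_def d0 andbT; apply: contraNN a0 => /eqP/psumr_eq0P H.
apply/eqP/rowP => i; rewrite mxE.
have H' j : true -> 0 <= a 0 j * a 0 j by rewrite -expr2 sqr_ge0.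
by have /eqP := H H' i isT; rewrite mulf_eq0 orbb => /eqP.
Qed.

Lemma smooth_dot (V : normedModType R) m (a b : V -> 'rV[R]_m) y : smooth_near a y -> smooth_near b y ->
  smooth_near (fun y => dot (a y) (b y)) y.
Proof. by move=> sa sb; apply: smooth_sum => i _; apply: smoothM; exact: smooth_entry. Qed.

(* At a maximum of [`|s|] on a box of radius [e <= 1 / (2 K)], the mean value
   theorem gives [`|s| <= K e `|s|]. *)
Lemma vanish_of_growth (s : 'rV[R]_n -> R) y1 K : smooth_near s y1 -> s y1 = 0 ->
  (\forall y \near y1, forall v, `|Dv v s y| <= K * `|s y| * `|v|) -> \forall y \near y1, s y = 0.
Proof.
move=> ss s0 Hs; have [e1 e10 He1] := near_box (filterI (near_smooth ss) Hs).
pose e := Num.min e1 (2 * (`|K| + 1))^-1.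
have e0 : 0 < e by rewrite lt_min e10 invr_gt0 mulr_gt0// ltr_wpDl.
have sub : box y1 e `<=` box y1 e1 by move=> y /= /le_trans; apply; rewrite ge_min lexx.
have eK : `|K| * e <= 2^-1.
  apply: (@le_trans _ _ (`|K| * (2 * (`|K| + 1))^-1)); first by rewrite ler_wpM2l// ge_min lexx orbT.
  rewrite ler_pdivrMr ?mulr_gt0 ?ltr_wpDl//; have : 0 <= `|K| by []. by move: `|K| => k ?; lra.
have cs : {within box y1 e, continuous (fun y => `|s y|)}.
  apply: continuous_in_subspaceT => y; rewrite inE => /sub/He1[sy _].
  by apply: (@cvg_norm _ _ _ _ (nbhs_filter y)); exact: smooth_continuous sy.
have by1 : box y1 e y1 by rewrite /box /= subrr normr0 ltW.
have [y] := compact_EVT_max (ex_intro _ y1 by1) (@compact_box R n y1 e) cs.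
rewrite inE => by_ Hmax.
have bl (t : R) : `|t| <= `|1 : R| -> box y1 e (t *: (y - y1) + y1).
  rewrite normr1 => t1; rewrite /box /= addrK normrZ (le_trans _ by_)// ler_piMl//.
have dl (t : R) : `|t| <= `|1 : R| -> derivable s (t *: (y - y1) + y1) (y - y1).
  by move=> /bl/sub/He1[sy _]; exact: smooth_derivable.
have [t /bl bt] := MVT_line dl; rewrite scale1r subrK mul1r s0 subr0 -DvE => E.
have sy0 : `|s y| <= `|s y| / 2.
  rewrite {1}E; have [_ /(_ (y - y1)) H] := He1 _ (sub _ bt).
  have st : `|s (t *: (y - y1) + y1)| <= `|s y| by apply: Hmax; rewrite inE.
  apply: (le_trans H); apply: (@le_trans _ _ (`|K| * `|s y| * e)).
    rewrite -!mulrA; apply: (@le_trans _ _ (`|K| * (`|s (t *: (y - y1) + y1)| * `|y - y1|))).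
      by rewrite ler_wpM2r// ler_norm.
    by rewrite ler_wpM2l// ler_pM.
  by rewrite mulrAC mulrC ler_wpM2l.
have sy : `|s y| <= 0 by move: sy0; move: `|s y| => b; lra.
apply: filterS (box_near y1 e0) => z bz; apply/eqP; rewrite -normr_le0.
by apply: le_trans sy; apply: Hmax; rewrite inE.
Qed.

Definition tail (u : 'rV[R]_n.+1) : 'rV[R]_n := \row_i u 0 (rshift 1 i).

Lemma smooth_tail u : smooth_near tail u.
Proof.
apply: smooth_mx => i j; apply: (smooth_ext (f := fun u : 'rV[R]_n.+1 => u 0 (rshift 1 j))).
  by move=> z; rewrite mxE.
exact: smooth_coord.
Qed.

Lemma Dv_tail v u : Dv v tail u = tail v.
Proof.
apply/rowP => i; rewrite Dv_entry; last exact: smooth_tail.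
rewrite mxE (_ : (fun z => tail z 0 i) = (fun z : 'rV[R]_n.+1 => z 0 (rshift 1 i))).
  by rewrite -Dv_entry ?Dv_id//; exact: smooth_id.
by apply/funext => z; rewrite mxE.
Qed.

Lemma near_bounded (f : 'rV[R]_n -> R) y : {for y, continuous f} -> \forall z \near y, `|f z| <= `|f y| + 1.
Proof.
move=> cf; have H : \forall t \near f y, `|t| <= `|f y| + 1.
  apply: filterS (nbhsx_ballx (f y) 1 ltr01) => t; rewrite -ball_normE /= distrC => /ltW h.
  by rewrite -[t](subrK (f y)) addrC (le_trans (ler_normD _ _))// lerD2l.
exact: cf _ H.
Qed.

(** Adding multiples of [e = w (j2 y2)] to [j2] gives a local diffeomorphism [G], in whose
    coordinates [j1] has a tail [a] and a first coordinate [s]; the claim is that [s] vanishes.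
    Tangency of both maps expresses the derivative of [s] through [w (j2 (a y)) - w (j1 y)]. As the
    two base points differ by [s y *: e], this is bounded by a multiple of [|s y|], and
    [vanish_of_growth] applies. *)
Theorem integral_uniqueness (w : 'rV[R]_n.+1 -> 'rV[R]_n.+1) (j1 j2 : 'rV[R]_n -> 'rV[R]_n.+1) y1 y2 :
  smooth_near w (j2 y2) -> w (j2 y2) != 0 -> j1 y1 = j2 y2 ->
  smooth_near j1 y1 -> smooth_near j2 y2 -> (forall v, Dv v j2 y2 = 0 -> v = 0) ->
  (\forall y \near y1, forall v, dot (w (j1 y)) (Dv v j1 y) = 0) ->
  (\forall y \near y2, forall v, dot (w (j2 y)) (Dv v j2 y) = 0) ->
  exists s, [/\ smooth_near s y1, s y1 = y2 & \forall y \near y1, j2 (s y) = j1 y].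
Proof.
set z0 := j2 y2; move=> sw w0 j12 sj1 sj2 ij2 t1 t2.
set e := w z0 in w0; have k0 := dot_gt0 w0; set k := dot e e in k0.
pose G (u : 'rV[R]_n.+1) := j2 (tail u) + u 0 0 *: e.
pose u0 : 'rV[R]_n.+1 := glue (0, y2).
have tu0 : tail u0 = y2 by apply/rowP => i; rewrite mxE /u0 glueS.
have u00 : u0 0 0 = 0 by rewrite /u0 glue0.
have sj2t : smooth_near (fun u => j2 (tail u)) u0.
  by apply: (smooth_comp (f := j2)); [exact: smooth_tail|rewrite tu0].
have sce u : smooth_near (fun u : 'rV[R]_n.+1 => u 0 0 *: e) u.
  by apply: smooth_scale; [exact: smooth_coord|exact: smooth_cst].
have sG : smooth_near G u0 by apply: smoothD.
have Gu0 : G u0 = z0 by rewrite /G tu0 u00 scale0r addr0.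
have DG v : Dv v G u0 = Dv (tail v) j2 y2 + v 0 0 *: e.
  rewrite (DvD _ sj2t (sce _)); congr (_ + _).
    rewrite (Dv_comp _ (smooth_tail _)) ?tu0 ?Dv_tail//.
    exact: smooth_differentiable_mx.
  rewrite (Dv_scale _ (smooth_coord _ _) (smooth_cst _ _)) Dv_cst scaler0 addr0.
  by rewrite -Dv_entry ?Dv_id//; exact: smooth_id.
have iG v : Dv v G u0 = 0 -> v = 0.
  rewrite DG => H; have v00 : v 0 0 = 0.
    have := congr1 (dot e) H; rewrite dotDr dotZr dot0r (nbhs_singleton t2) add0r => /eqP.
    by rewrite mulf_eq0 (gt_eqF k0) orbF => /eqP.
  move: H; rewrite v00 scale0r addr0 => /ij2 tv.
  apply/rowP => i; rewrite [RHS]mxE.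
  case: (glue_split i) => [|[l]] ->; first exact: v00.
  by have := congr1 (fun A : 'rV[R]_n => A 0 l) tv; rewrite !mxE.
have [psi [spsi psi0 Gpsi _]] := inverse_function sG iG.
rewrite Gu0 in spsi psi0 Gpsi.
pose S y := psi (j1 y).
have sS : smooth_near S y1 by apply: (smooth_comp (f := psi)) => //; rewrite j12.
pose a y := tail (S y); pose s y := S y 0 0.
have sa : smooth_near a y1 by apply: (smooth_comp (f := tail)) => //; exact: smooth_tail.
have ss : smooth_near s y1 by exact: smooth_entry.
have S1 : S y1 = u0 by rewrite /S j12.
have a1 : a y1 = y2 by rewrite /a S1.
have s1 : s y1 = 0 by rewrite /s S1.
have H1 : \forall y \near y1, j1 y = j2 (a y) + s y *: e.
  have H : \forall z \near j1 y1, G (psi z) = z by rewrite j12.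
  have {}H : \forall y \near y1, G (psi (j1 y)) = j1 y := smooth_continuous sj1 H.
  by apply: filterS H => y <-.
suff sz : \forall y \near y1, s y = 0.
  exists a; split => //; apply: filterS2 H1 sz => y -> ->; by rewrite scale0r addr0.
have sj2' : smooth_near j2 (a y1) by rewrite a1.
have sj2a : smooth_near (fun y => j2 (a y)) y1 by apply: (smooth_comp (f := j2)).
have T2 : \forall y \near y1, smooth_near j2 (a y) /\ forall v, dot (w (j2 (a y))) (Dv v j2 (a y)) = 0.
  have H : \forall z \near a y1, smooth_near j2 z /\ forall v, dot (w (j2 z)) (Dv v j2 z) = 0.
    by rewrite a1; apply: filterS2 (near_smooth sj2) t2.
  exact: (smooth_continuous sa H).
have H1' : \forall y \near y1, \forall z \near y, j1 z = j2 (a z) + s z *: e.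
  exact: nbhs_interior H1.
have D1 : \forall y \near y1, forall v,
    Dv v s y * dot (w (j2 (a y))) e = dot (w (j2 (a y)) - w (j1 y)) (Dv v j1 y).
  apply: filterS2 (filterI (filterI H1' T2) (filterI t1 (near_smooth sj2a)))
    (filterI (near_smooth sa) (near_smooth ss)) => y [[E [sj ty2]] [ty1 sja]] [say ssy] v.
  rewrite dotBl ty1 subr0.
  rewrite (Dv_near v E) (DvD _ sja (smooth_scale ssy (smooth_cst _ _))).
  rewrite (Dv_scale _ ssy (smooth_cst _ _)) Dv_cst scaler0 addr0.
  by rewrite (Dv_comp _ say (smooth_differentiable_mx sj)) dotDr ty2 add0r dotZr.
have B1 : \forall y \near y1, k / 2 < dot (w (j2 (a y))) e.
  have sd : smooth_near (fun y => dot (w (j2 (a y))) e) y1.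
    apply: smooth_dot; last exact: smooth_cst.
    by apply: (smooth_comp (f := w) sj2a); rewrite a1.
  have kk : k / 2 < dot (w (j2 (a y1))) e.
    by rewrite a1 -/z0 -/e -/k ltr_pdivrMr// ltr_pMr// ltr1n.
  exact: (smooth_continuous sd (lt_nbhsr kk)).
(* [K1] bounds the derivatives of [w] along [e], the only direction in which [j1 y] and [j2 (a y)]
   differ. *)
have [K1 K10 [r r0 HK1]] : exists2 K1, 0 <= K1 & exists2 r, 0 < r &
    forall z, box z0 r z -> forall i, smooth_near (fun z => w z 0 i) z /\ `|Dv e (fun z => w z 0 i) z| <= K1.
  pose K1 := \sum_i (`|Dv e (fun z => w z 0 i) z0| + 1).
  have K1i i : `|Dv e (fun z => w z 0 i) z0| + 1 <= K1.
    by rewrite /K1 (bigD1 i)//= lerDl sumr_ge0// => l _; rewrite addr_ge0.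
  exists K1; first by apply: sumr_ge0 => i _; rewrite addr_ge0.
  have swi i : smooth_near (fun z => w z 0 i) z0 by exact: smooth_entry.
  have H : \forall z \near z0, forall i, smooth_near (fun z => w z 0 i) z /\ `|Dv e (fun z => w z 0 i) z| <= K1.
    apply: near_forall => i.
    have c := smooth_continuous (smooth_Dv e (swi i)).
    have H : \forall t \near Dv e (fun z => w z 0 i) z0, `|t| <= K1.
      apply: filterS (nbhsx_ballx _ 1 ltr01) => t; rewrite -ball_normE /= distrC => /ltW h.
      apply: le_trans (K1i i); rewrite -[t](subrK (Dv e (fun z => w z 0 i) z0)) addrC.
      by rewrite (le_trans (ler_normD _ _))// lerD2l.
    have H' : \forall z \near z0, `|Dv e (fun z => w z 0 i) z| <= K1 := c _ H.
    by apply: filterS2 (near_smooth (swi i)) H'.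
  by have [r r0 Hr] := near_box H; exists r => // z /Hr.
have B2 : \forall y \near y1, forall i, `|(w (j2 (a y)) - w (j1 y)) 0 i| <= K1 * `|s y|.
  have n1 : \forall y \near y1, `|j2 (a y) - z0| <= r / 2.
    have r2 : 0 < r / 2 by rewrite divr_gt0.
    have H : \forall z \near j2 (a y1), box z0 (r / 2) z by rewrite a1; exact: box_near.
    exact: (smooth_continuous sj2a H).
  have n2 : \forall y \near y1, `|s y| <= r / 2 / (`|e| + 1).
    have r2 : 0 < r / 2 / (`|e| + 1) by rewrite !divr_gt0// ltr_wpDl.
    have H : \forall t \near s y1, `|t| <= r / 2 / (`|e| + 1).
      rewrite s1; apply: filterS (nbhsx_ballx _ _ r2) => t.
      by rewrite -ball_normE /= sub0r normrN => /ltW.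
    exact: (smooth_continuous ss H).
  apply: filterS2 H1 (filterI n1 n2) => y E [b1 b2] i.
  have bl (t : R) : `|t| <= `|s y| -> box z0 r (t *: e + j2 (a y)).
    move=> ts; rewrite /box /= -addrA (le_trans (ler_normD _ _))// (splitr r) lerD// normrZ.
    apply: (@le_trans _ _ (`|s y| * (`|e| + 1))); last by rewrite -ler_pdivlMr// ltr_wpDl.
    by rewrite ler_pM// lerDl.
  have dl (t : R) : `|t| <= `|s y| -> derivable (fun z => w z 0 i) (t *: e + j2 (a y)) e.
    by move=> /bl/HK1/(_ i)[sy _]; exact: smooth_derivable.
  have [t /bl/HK1/(_ i)[_ Kt]] := MVT_line dl.
  rewrite -DvE E [s y *: e + _]addrC => Ed; rewrite mxE [(- w _) 0 i]mxE distrC Ed normrM mulrC.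
  by rewrite ler_wpM2r.
(* A crude common bound for the partial derivatives of [j1] near [y1]; each summand 1 absorbs their
   variation around [y1]. *)
pose K2 := \sum_l \sum_i (`|(Dv (ebase l) j1 y1) 0 i| + 1).
have K2i l i : `|(Dv (ebase l) j1 y1) 0 i| + 1 <= K2.
  have p0 l' : 0 <= \sum_i (`|(Dv (ebase l') j1 y1) 0 i| + 1) by apply: sumr_ge0 => ? _; rewrite addr_ge0.
  apply: (@le_trans _ _ (\sum_i (`|(Dv (ebase l) j1 y1) 0 i| + 1))).
    by rewrite (bigD1 i)//= lerDl sumr_ge0// => l' _; rewrite addr_ge0.
  by rewrite /K2 (bigD1 l)//= lerDl sumr_ge0// => l' _.
have K20 : 0 <= K2 by apply: sumr_ge0 => l _; apply: sumr_ge0 => i _; rewrite addr_ge0.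
have B3 : \forall y \near y1, forall v i, `|(Dv v j1 y) 0 i| <= K2 * n%:R * `|v|.
  have H : \forall y \near y1, forall l i, `|(Dv (ebase l) j1 y) 0 i| <= K2.
    apply: near_forall => l; apply: near_forall => i.
    have c := smooth_continuous (smooth_entry 0 i (smooth_Dv (ebase l) sj1)).
    by apply: filterS (near_bounded c) => y /le_trans; apply.
  apply: filterS2 H (near_smooth sj1) => y Hy sy v i.
  rewrite (Dv_dir_sum _ (smooth_differentiable_mx sy)) summxE (le_trans (ler_norm_sum _ _ _))//.
  apply: (@le_trans _ _ (\sum_(l < n) K2 * `|v|)).
    apply: ler_sum => l _; rewrite mxE normrM mulrC ler_pM//; exact: mx_norm_entry.
  by rewrite sumr_const card_ord -[leLHS]mulr_natr mulrAC.
apply: (@vanish_of_growth s y1 (n.+1%:R * K1 * (K2 * n%:R) * (2 / k))) => //.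
apply: filterS2 (filterI D1 B1) (filterI B2 B3) => y [Dy By1] [By2 By3] v.
have kn : 0 < dot (w (j2 (a y))) e by apply: lt_trans By1; rewrite divr_gt0.
have M : `|Dv v s y| * (k / 2) <= n.+1%:R * (K1 * `|s y| * (K2 * n%:R * `|v|)).
  apply: (@le_trans _ _ (`|Dv v s y * dot (w (j2 (a y))) e|)).
    by rewrite normrM ler_wpM2l// gtr0_norm// ltW.
  rewrite Dy /dot (le_trans (ler_norm_sum _ _ _))//.
  apply: (@le_trans _ _ (\sum_(i < n.+1) K1 * `|s y| * (K2 * n%:R * `|v|))).
    by apply: ler_sum => i _; rewrite normrM ler_pM.
  by rewrite sumr_const card_ord -[leLHS]mulr_natl.
rewrite -ler_pdivlMr ?divr_gt0// in M; apply: (le_trans M).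
rewrite invf_div le_eqVlt; apply/orP; left; apply/eqP; ring.
Qed.

End LocalUniqueness.

(** * The image of an integral immersion *)

Section IntegralImmersions.
Context {R : realType} {n : nat} {Mt : manifold R n.+1}.
Variables (g : Mt -> 'M[R]_n.+1) (gm : riemannian_metric g).
Variables (xi : Mt -> 'rV[R]_n.+1) (sxi : smooth_field xi).

Definition integral_immersion {M : manifold R n} (x : M -> Mt) := immersion x /\
  forall p, xi (x p) != 0 /\ forall v, inner g (x p) (xi (x p)) (dmap x p v) = 0.

(** The one-form dual to [xi] in the chart [d]: tangency to its orthogonal distribution becomes the
    vanishing of a [dot]. *)
Let conormal (d : chart R n.+1 Mt) (z : 'rV[R]_n.+1) := frep d d idfun xi z *m gmx g d z.

Let dot_conormal d q u : atlas d -> chart_dom d q ->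
  dot (conormal d (d q)) u = bil (gmx g d (d q)) (tcoord d q (xi q)) u.
Proof.
move=> ad dq; rewrite /conormal frepE// /dot bilE mxE.
by apply: eq_bigr => i _; rewrite [X in _ = _ * X]mxE.
Qed.

Lemma near_tangency (M : manifold R n) (x : M -> Mt) c d p : integral_immersion x ->
  atlas c -> atlas d -> chart_dom c p -> chart_dom d (x p) ->
  \forall y \near c p, forall v, dot (conormal d (mrep c d x y)) (Dv v (mrep c d x) y) = 0.
Proof.
move=> [xim tx] ac ad cp dp; apply: (near_mrep xim cp dp) => q cq dq v.
rewrite mrepE// -(tcoord_surj v ac cq) -(dmap_mrep xim _ ac ad cq dq) dot_conormal//.
by rewrite (bil_gram g _ _ ad dq); have [_] := tx q; apply.
Qed.

Theorem local_uniqueness (M1 M2 : manifold R n) (x1 : M1 -> Mt) (x2 : M2 -> Mt) c1 c2 p1 p2 :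
  integral_immersion x1 -> integral_immersion x2 -> atlas c1 -> atlas c2 ->
  chart_dom c1 p1 -> chart_dom c2 p2 -> x1 p1 = x2 p2 ->
  exists s, [/\ smooth_near s (c1 p1), s (c1 p1) = c2 p2 & \forall y \near c1 p1,
    (chart_dom c2 (chart_inv c2 (s y)) /\ c2 (chart_inv c2 (s y)) = s y) /\
    x2 (chart_inv c2 (s y)) = x1 (chart_inv c1 y)].
Proof.
move=> i1 i2 ac1 ac2 cp1 cp2 x12.
pose d := chart_at (x2 p2); have ad : atlas d := chart_at_atlas (x2 p2).
have dp2 : chart_dom d (x2 p2) := chart_at_dom (x2 p2).
have dp1 : chart_dom d (x1 p1) by rewrite x12.
have sw : smooth_near (conormal d) (d (x2 p2)).
  apply: smooth_mulmx; last exact: smooth_gram.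
  exact: (smooth_alongP (@smooth_map_id _ _ _) sxi (p := x2 p2) ad ad dp2 dp2).
have w0 : conormal d (d (x2 p2)) != 0.
  apply/eqP => w0; have := dot_conormal (tcoord d (x2 p2) (xi (x2 p2))) ad dp2.
  rewrite w0 /dot big1 => [/esym/eqP|i _]; last by rewrite mxE mul0r.
  rewrite gt_eqF// (posdef_bil_gt0 (posdef_gram gm ad dp2))//.
  have [xi0 _] := i2.2 p2; apply: contraNN xi0 => /eqP E.
  by apply/eqP/(tcoord_inj ad dp2); rewrite E tcoord0.
have E2 := mrepE d x2 cp2; have E1 := mrepE d x1 cp1.
have [||||||||s [ss s1 Hs]] := @integral_uniqueness R n (conormal d) (mrep c1 d x1) (mrep c2 d x2) (c1 p1) (c2 p2).
- by rewrite E2.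
- by rewrite E2.
- by rewrite E1 E2 x12.
- exact: (smooth_mrep i1.1 ac1 ad cp1 dp1).
- exact: (smooth_mrep i2.1 ac2 ad cp2 dp2).
- by have [] := immersed_mrep_at gm i2.1 ac2 ad cp2 dp2.
- exact: near_tangency.
- exact: near_tangency.
exists s; split=> //.
have n1 : \forall y \near c1 p1, chart_dom d (x1 (chart_inv c1 y)).
  exact: near_chart cp1 (map_chart_near i1.1.1 dp1).
have n2 : \forall y \near c1 p1, (chart_dom c2 (chart_inv c2 (s y)) /\ c2 (chart_inv c2 (s y)) = s y) /\
    chart_dom d (x2 (chart_inv c2 (s y))).
  have H : \forall z \near s (c1 p1), (chart_dom c2 (chart_inv c2 z) /\ c2 (chart_inv c2 z) = z) /\
      chart_dom d (x2 (chart_inv c2 z)).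
    rewrite s1; apply: filterS2 (chart_invK_near cp2) (near_chart cp2 (map_chart_near i2.1.1 dp2)).
    by move=> z.
  exact: (smooth_continuous ss H).
apply: filterS2 Hs (filterI n1 n2) => y; rewrite !mrep_def => E [d1 [c2s d2]]; split => //.
by rewrite -(chartK d2) E chartK.
Qed.

(** Followed by a pseudo-inverse of its Jacobian at [p], the immersion becomes a map between spaces
    of equal dimension with the identity as derivative; a local inverse of this map separates
    points. *)
Lemma immersion_locally_injective (M : manifold R n) (x : M -> Mt) c p : immersion x ->
  atlas c -> chart_dom c p -> exists U, [/\ open U, U p, U `<=` chart_dom c &
    forall q q', U q -> U q' -> x q = x q' -> q = q'].
Proof.
move=> xim ac cp; have ad := chart_at_atlas (x p); have dp := chart_at_dom (x p).
set d := chart_at (x p) in ad dp.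
have [sj _ ij] := immersed_mrep_at gm xim ac ad cp dp.
set j := mrep c d x in sj ij; set y0 := c p in sj ij *.
have fJ : row_free ('J j y0).
  apply: inj_row_free => v; rewrite (Dv_jacobian _ (smooth_differentiable_mx sj)); exact: ij.
pose f y := j y *m pinvmx ('J j y0).
have sf : smooth_near f y0 by apply: smooth_mulmx => //; exact: smooth_cst.
have [|h [_ _ _ hf]] := inverse_function sf.
  move=> v; rewrite /f (Dv_mulmx _ sj (smooth_cst _ _)) Dv_cst mulmx0 addr0.
  by rewrite -(Dv_jacobian _ (smooth_differentiable_mx sj)) -mulmxA mulmxVp// mulmx1.
have H : \forall q \near p, chart_dom c q /\ h (f (c q)) = c q.
  by apply: filterS2 (chart_near cp) (chart_near_inv cp hf) => q.
have [U [oU Up HU]] := near_openP H; exists U; split => // [q /HU[]//|q q' /HU[cq hq] /HU[cq' hq'] xq].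
by rewrite -(chartK cq) -(chartK cq') -hq -hq' /f /j !mrepE// xq.
Qed.

End IntegralImmersions.

(* The image of [f] with the quotient topology of [T]; a point is coded by a
   preferred preimage. *)
Section ImageSpace.
Context {T : ptopologicalType} {S : Type} (f : T -> S).

Definition preferred p : T := xget point [set q | f q = f p].

Lemma preferredE p : f (preferred p) = f p.
Proof. by rewrite /preferred; case: xgetP => [_ -> //|/(_ p)]; case. Qed.

Lemma eq_preferred p q : f p = f q -> preferred p = preferred q.
Proof. by rewrite /preferred => ->. Qed.

Definition image_space := {p : T | preferred p == p}.

Fact preferred_idem p : preferred (preferred p) == preferred p.
Proof. by apply/eqP/eq_preferred/preferredE. Qed.

Definition proj p : image_space := exist _ (preferred p) (preferred_idem p).

HB.instance Definition _ := Choice.on image_space.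
HB.instance Definition _ := isPointed.Build image_space (proj point).

Definition image_open (U : set image_space) := open (proj @^-1` U).

Fact image_openT : image_open setT. Proof. exact: openT. Qed.

Fact image_openI U V : image_open U -> image_open V -> image_open (U `&` V).
Proof. exact: openI. Qed.

Fact image_open_bigU (I : Type) (F : I -> set image_space) :
  (forall i, image_open (F i)) -> image_open (\bigcup_i F i).
Proof. by move=> oF; rewrite /image_open preimage_bigcup; apply: bigcup_open => i _; exact: oF. Qed.

HB.instance Definition _ := isOpenTopological.Build image_space image_openT image_openI image_open_bigU.

Lemma open_image_space (U : set image_space) : open U = open (proj @^-1` U).
Proof. by []. Qed.

Lemma continuous_proj : continuous proj.
Proof. by apply/continuousP => U; rewrite open_image_space. Qed.

Definition image_val (l : image_space) : S := f (sval l).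

Lemma image_valE p : image_val (proj p) = f p. Proof. exact: preferredE. Qed.

Lemma projK l : proj (sval l) = l.
Proof. by apply/val_inj/eqP; exact: (svalP l). Qed.

Lemma image_val_inj : injective image_val.
Proof.
move=> l l' E; apply/val_inj.
by have := eq_preferred E; rewrite (eqP (svalP l)) (eqP (svalP l')).
Qed.

Lemma eq_proj p q : f p = f q -> proj p = proj q.
Proof. by move=> E; apply/val_inj; exact: eq_preferred. Qed.

Lemma range_image_val : range image_val = range f.
Proof.
apply/seteqP; split => [_ [l _ <-]|_ [p _ <-]]; first by exists (sval l).
by exists (proj p) => //; exact: image_valE.
Qed.

End ImageSpace.

(** * The manifold structure on the image of an integral immersion *)

Section LeafManifold.
Context {R : realType} {n : nat} {Mt : manifold R n.+1} {M : manifold R n}.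
Variables (g : Mt -> 'M[R]_n.+1) (gm : riemannian_metric g).
Variables (xi : Mt -> 'rV[R]_n.+1) (sxi : smooth_field xi).
Variables (x : M -> Mt) (ix : integral_immersion g xi x).
Local Notation L := (image_space x).
Local Notation pi := (proj x).

(** Around two points with the same image, [x] parametrizes the same piece of hypersurface. [s]
    matches the parameters and is invisible in the quotient. *)
Lemma slide c1 c2 p1 p2 : atlas c1 -> atlas c2 -> chart_dom c1 p1 -> chart_dom c2 p2 -> x p1 = x p2 ->
  exists s, [/\ smooth_near s (c1 p1), s (c1 p1) = c2 p2 & \forall y \near c1 p1,
    (chart_dom c2 (chart_inv c2 (s y)) /\ c2 (chart_inv c2 (s y)) = s y) /\
    pi (chart_inv c2 (s y)) = pi (chart_inv c1 y)].
Proof.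
move=> ac1 ac2 cp1 cp2 xp; have [s [ss s1 Hs]] := local_uniqueness gm sxi ix ix ac1 ac2 cp1 cp2 xp.
by exists s; split => //; apply: filterS Hs => y [? /eq_proj].
Qed.

(** A point identified with some point of [U] has a neighbourhood that slides into [U], so the
    saturation of [U] is open. *)
Lemma open_proj (U : set M) : open U -> open (pi @` U).
Proof.
move=> oU; rewrite open_image_space openE => q [p Up pq]; rewrite /interior.
have xpq : x q = x p by rewrite -(image_valE x q) -pq image_valE.
have cq := chart_at_dom q; have cp := chart_at_dom p.
have [s [ss s1 Hs]] := slide (chart_at_atlas q) (chart_at_atlas p) cq cp xpq.
apply: (near_chart_inv cq).
have nU : \forall z \near s (chart_at q q), U (chart_inv (chart_at p) z).
  by rewrite s1; apply: (near_chart cp); exact: open_nbhs_nbhs.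
have H : \forall y \near chart_at q q, U (chart_inv (chart_at p) (s y)) := smooth_continuous ss nU.
by apply: filterS2 Hs H => y [_ E] Uy; exists (chart_inv (chart_at p) (s y)).
Qed.

(** Charts of the quotient are charts of [M] restricted to open sets on which [x] is injective; as a
    relation, it keeps [c] and [U] available for comparing two of them. *)
Definition leaf_chart (e : chart R n L) (c : chart R n M) (U : set M) :=
  [/\ atlas c /\ open U, U `<=` chart_dom c, forall q q', U q -> U q' -> x q = x q' -> q = q',
      chart_dom e = pi @` U & forall p, U p -> e (pi p) = c p /\ chart_inv e (c p) = pi p].

Lemma exists_leaf_chart c p : atlas c -> chart_dom c p -> exists e U, leaf_chart e c U /\ U p.
Proof.
move=> ac cp; have [U [oU Up Uc Uinj]] := immersion_locally_injective gm ix.1 ac cp.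
pose sel (l : L) : M := xget point [set p | U p /\ pi p = l].
have selE q : U q -> sel (pi q) = q.
  move=> Uq; rewrite /sel; case: xgetP => [q' _ [Uq' E]|/(_ q)]; last by case.
  by apply: Uinj => //; rewrite -(image_valE x q') E image_valE.
pose emap (l : L) := c (sel l); pose einv y := pi (chart_inv c y).
have odom : open (pi @` U) by exact: open_proj.
have imgE : emap @` (pi @` U) = c @` U.
  apply/seteqP; split => [_ [_ [q Uq <-] <-]|_ [q Uq <-]]; first by exists q; rewrite // /emap selE.
  by exists (pi q); [exists q|rewrite /emap selE].
have oimg : open (emap @` (pi @` U)) by rewrite imgE; exact: open_chart_image.
have eK l : (pi @` U) l -> einv (emap l) = l.
  by move=> [q Uq <-]; rewrite /einv /emap selE// chartK//; exact: Uc.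
have ec l : (pi @` U) l -> {for l, continuous emap}.
  move=> [q Uq <-] W; rewrite {1}/emap selE// => cW.
  have nW : \forall q' \near q, U q' /\ W (c q').
    apply: filterI; first exact: open_nbhs_nbhs.
    exact: (chart_continuous (Uc _ Uq)) cW.
  have [V [oV Vq HV]] := near_openP nW.
  have oV' := open_proj oV.
  have : nbhs (pi q) (pi @` V) by apply: open_nbhs_nbhs; split => //; exists q.
  apply: filterS => _ [q' /HV[Uq' Wq'] <-]; rewrite /= /emap selE//.
have eic l : (pi @` U) l -> {for emap l, continuous einv}.
  move=> [q Uq <-]; rewrite /emap selE//.
  apply: (@continuous_comp _ _ _ (chart_inv c) pi); first exact: chart_inv_continuous (Uc _ Uq).
  exact: continuous_proj.
exists (Chart odom oimg eK ec eic), U; split => //; split => // q Uq.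
by split; rewrite /= ?/emap ?selE// /einv chartK//; exact: Uc.
Qed.

Lemma leaf_chart_near e c U p : leaf_chart e c U -> U p ->
  \forall y \near c p, [/\ U (chart_inv c y), c (chart_inv c y) = y & chart_inv e y = pi (chart_inv c y)].
Proof.
move=> [[ac oU] Uc _ _ HU] Up; have cp := Uc _ Up.
have nU : \forall y \near c p, U (chart_inv c y) by apply: (near_chart cp); exact: open_nbhs_nbhs.
apply: filterS2 nU (chart_invK_near cp) => y Uy [cy cyK]; split => //.
by have [_] := HU _ Uy; rewrite cyK.
Qed.

(** In the coordinates of [c] and [c'] the change of charts is the sliding map, which is smooth. *)
Lemma leaf_transition e c U e' c' U' l : leaf_chart e c U -> leaf_chart e' c' U' ->
  chart_dom e l -> chart_dom e' l -> smooth_near (e' \o chart_inv e) (e l).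
Proof.
move=> he he'; have [[ac oU] Uc _ dE HU] := he; have [[ac' oU'] Uc' _ dE' HU'] := he'.
rewrite dE dE' => -[p Up <-] [p' Up' pp'].
have xp : x p = x p' by rewrite -(image_valE x p) -pp' image_valE.
have [s [ss s1 Hs]] := slide ac ac' (Uc _ Up) (Uc' _ Up') xp.
have [-> _] := HU _ Up.
have n1 : \forall z \near s (c p), U' (chart_inv c' z).
  by rewrite s1; apply: (near_chart (Uc' _ Up')); exact: open_nbhs_nbhs.
have n1' : \forall y \near c p, U' (chart_inv c' (s y)) := smooth_continuous ss n1.
apply: (eq_smooth _ ss).
apply: filterS2 (leaf_chart_near he Up) (filterI Hs n1') => y [Uy cyK ey] [[[_ cs] E] Us].
by rewrite /= ey -E; have [-> _] := HU' _ Us.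
Qed.

Definition leaf_atlas : set (chart R n L) := [set e | exists c U, leaf_chart e c U].

Lemma leaf_atlas_at l : exists e, leaf_atlas e /\ chart_dom e l.
Proof.
have [e [U [he Up]]] := exists_leaf_chart (chart_at_atlas (sval l)) (chart_at_dom (sval l)).
exists e; split; first by exists (chart_at (sval l)), U.
by have [_ _ _ -> _] := he; exists (sval l) => //; exact: projK.
Qed.

(** Separating open sets are pulled back from the ambient manifold, into which the quotient injects
    continuously. *)
Lemma leaf_hausdorff : hausdorff_space L.
Proof.
rewrite open_hausdorff => l l' /eqP ll'.
have := @manifold_hausdorff _ _ Mt; rewrite open_hausdorff => /(_ (image_val l) (image_val l')).
case=> [|[A B] /= [Al Bl'] [oA oB AB]]; first by apply/eqP => /image_val_inj.
have cx : continuous x := ix.1.1.1.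
exists ([set l | A (image_val l)], [set l | B (image_val l)]).
  by split; rewrite /= inE; [move: Al|move: Bl']; rewrite inE.
have E (C : set Mt) : pi @^-1` [set l | C (image_val l)] = x @^-1` C.
  by apply/seteqP; split => p /=; rewrite image_valE.
split.
- by rewrite open_image_space E; apply: open_comp => // p _; exact: cx.
- by rewrite open_image_space E; apply: open_comp => // p _; exact: cx.
- apply/eqP/seteqP; split => // k [/= Ak Bk].
  by have /eqP/seteqP[/(_ (image_val k)) + _] := AB; apply.
Qed.

Lemma leaf_second_countable : @second_countable L.
Proof.
have [B cB [oB bB]] := @manifold_second_countable _ _ M.
exists [set pi @` V | V in B]; first exact: card_le_trans (card_image_le _ _) cB.
split=> [_ [V BV <-]|l]; first by apply: open_proj; exact: oB.
move=> W lW; have nW : nbhs (sval l) (pi @^-1` W).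
  by apply: continuous_proj; rewrite projK.
have [V [BV Vl] VW] := bB (sval l) _ nW.
exists (pi @` V); last by move=> _ [q /VW Wq <-].
by split; [exists V|exists (sval l) => //; exact: projK].
Qed.

Lemma leaf_compatible e e' : leaf_atlas e -> leaf_atlas e' ->
  Cinfty (e @` (chart_dom e `&` chart_dom e')) (e' \o chart_inv e).
Proof.
move=> [c [U he]] [c' [U' he']].
apply/CinftyP => [|_ [l [el e'l] <-]]; last exact: leaf_transition he he' el e'l.
apply: open_chart_image; last exact: subIsetl.
by apply: openI; exact: chart_dom_open.
Qed.

Theorem exists_leaf_manifold : connected [set: M] -> integral_hypersurface g xi (range x).
Proof.
move=> Mconn.
have [ca Hca] := @choice _ _ (fun (l : L) e => leaf_atlas e /\ chart_dom e l) leaf_atlas_at.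
pose LM : manifold R n := @Manifold R n L leaf_hausdorff leaf_second_countable leaf_atlas ca
  (fun l => (Hca l).1) (fun l => (Hca l).2) leaf_compatible.
pose i : LM -> Mt := @image_val M Mt x.
have sx : smooth_map x := ix.1.1.
have ci : continuous i.
  apply/continuousP => V oV; rewrite [open _]open_image_space.
  rewrite (_ : _ @^-1` _ = x @^-1` V); last by apply/seteqP; split => p /=; rewrite /i image_valE.
  by apply: open_comp => // p _; exact: sx.1.
have near_i e c U (d : chart R n.+1 Mt) p : leaf_chart e c U -> U p ->
    \forall y \near c p, @mrep R n n.+1 LM Mt e d i y = mrep c d x y.
  move=> he Up; apply: filterS (leaf_chart_near he Up) => y [_ _ ey].
  by rewrite !mrep_def ey /i image_valE.
have si : smooth_map i.
  split=> // e d [c [U he]] ad; have [[ac oU] Uc _ dE HU] := he.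
  apply/CinftyP => [|_ [l [el dl] <-]].
    apply: open_chart_image; last exact: subIsetl.
    apply: openI; first exact: chart_dom_open.
    by apply: open_comp => [l' _|]; [exact: ci|exact: chart_dom_open].
  move: el dl; rewrite dE => -[p Up <-]; rewrite /= /i image_valE => dp.
  have [-> _] := HU _ Up; apply: (@eq_smooth _ _ _ (mrep c d x)); last first.
    exact: (smooth_mrep ix.1 ac ad (Uc _ Up) dp).
  by apply: filterS (near_i e c U d p he Up) => y <-; rewrite mrep_def.
(* Read in a chart, tangent vectors of the quotient are tangent vectors of [M] with the same image,
   so injectivity of the differential and tangency are inherited from [x]. *)
have lift (l : LM) v : exists p v', [/\ x p = i l, dmap i l v = dmap x p v' :> 'rV[R]_n.+1 & v' = 0 -> v = 0].
  have [ae el] := Hca l; have [c [U he]] := ae; have [[ac oU] Uc _ dE HU] := he.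
  move: (el); rewrite dE => -[p Up pl]; have cp := Uc _ Up.
  have xp : x p = i l by rewrite -pl /i image_valE.
  pose d := chart_at (x p); have ad : atlas d := chart_at_atlas (x p).
  have dp : chart_dom d (x p) := chart_at_dom (x p).
  have dl : chart_dom d (i l) by rewrite -xp.
  have [v' Ev'] : exists v', tcoord c p v' = @tcoord R n LM (ca l) l v.
    by exists (@tcoord R n LM (ca l) l v *m trans c (chart_at p) p); exact: tcoord_surj.
  exists p, v'; split; first exact: xp; last first.
    by move=> v0; apply: (@tcoord_inj _ _ LM (ca l) l ae el); rewrite -Ev' v0 !tcoord0.
  have cl : ca l l = c p by have [<- _] := HU _ Up; rewrite pl.
  have H1 := dmap_tcoord si v ae ad el dl.
  have H2 := dmap_tcoord sx v' ac ad cp dp.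
  set u := @tcoord R n LM (ca l) l v in Ev' H1 *.
  have H2' : tcoord d (i l) (dmap x p v') = Dv u (fun y => d (x (chart_inv c y))) (c p).
    by rewrite -Ev' -H2 xp.
  have H3 : Dv u (fun y => d (i (chart_inv (ca l) y))) (c p) = Dv u (fun y => d (x (chart_inv c y))) (c p).
    apply: Dv_near; apply: filterS (near_i (ca l) c U d p he Up) => y.
    by rewrite !mrep_def.
  have H4 := congr1 (Dv u (fun y => d (i (chart_inv (ca l) y)))) cl.
  exact: (tcoord_inj ad dl (etrans H1 (etrans H4 (etrans H3 (esym H2'))))).
exists LM, i; split.
- have -> : [set: LM] = pi @` [set: M].
    by apply/seteqP; split => // l _; exists (sval l) => //; exact: projK.
  apply: connected_continuous_connected => //; apply: continuous_subspaceT; exact: continuous_proj.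
- split=> // l v v' E; apply/eqP; rewrite -subr_eq0; apply/eqP.
  have [p [w [_ Ew w0]]] := lift l (v - v'); apply: w0; apply: (ix.1.2 p).
  by rewrite -Ew /dmap mulmxBl mul0mx -[_ *m _]/(dmap i l v) E subrr.
- exact: image_val_inj.
- exact: range_image_val.
- move=> l; split=> [|v].
    by have [p [w [<- _ _]]] := lift l 0; have [] := ix.2 p.
  by have [p [w [<- -> _]]] := lift l v; have [_] := ix.2 p; apply.
Qed.

End LeafManifold.

(** * Maximality *)

Section SegmentLifting.
Context {R : realType} {n : nat} {Mt : manifold R n.+1}.
Variables (g : Mt -> 'M[R]_n.+1) (gm : riemannian_metric g).
Variables (xi : Mt -> 'rV[R]_n.+1) (sxi : smooth_field xi).
Variables (M L : manifold R n) (x : M -> Mt) (i : L -> Mt).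
Hypotheses (ix : integral_immersion g xi x) (ii : integral_immersion g xi i).
Local Notation h := (induced_metric g x).
Local Notation h' := (induced_metric g i).
Let hm : riemannian_metric h := induced_riemannian gm ix.1.
Variables (C0 : R) (C00 : 0 < C0).
Hypothesis HC0 : forall c y0 B e, atlas c -> tame h c y0 B e ->
  forall y u r, box y0 e y -> box y0 e (y + u *m B) -> C0 * Num.sqrt (sqn u) < r ->
  dlt h (chart_inv c y) (chart_inv c (y + u *m B)) r.

Lemma sqnZ (k : R) (u : 'rV[R]_n) : sqn (k *: u) = k ^+ 2 * sqn u.
Proof. by rewrite /sqn mulr_sumr; apply: eq_bigr => j _; rewrite mxE exprMn. Qed.

Lemma smooth_sqn (u : 'rV[R]_n) : smooth_near (@sqn R n) u.
Proof.
apply: smooth_sum => j _; apply: (smooth_ext (f := fun u : 'rV[R]_n => u 0 j * u 0 j)).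
  by move=> z; rewrite expr2.
by apply: smoothM; exact: smooth_coord.
Qed.

(* [x] and [i] are isometric onto overlapping pieces of the same leaf, so a lift
   to [M] of a curve of [L] moves at the same speed. *)
Lemma lift_step c' l w p V : atlas c' -> chart_dom c' l -> x p = i l ->
  bil (gmx h' c' (c' l)) w w <= V ->
  \forall t \near (0 : R)^', exists p', x p' = i (chart_inv c' (t *: w + c' l)) /\
    forall r, C0 * (Num.sqrt (4 * V) + 1) * `|t| < r -> dlt h p p' r.
Proof.
move=> ac' cl' xp VV.
pose c := chart_at p; have ac : atlas c := chart_at_atlas p; have cp : chart_dom c p := chart_at_dom p.
pose d := chart_at (x p); have ad : atlas d := chart_at_atlas (x p).
have dp : chart_dom d (x p) := chart_at_dom (x p).
have dl : chart_dom d (i l) by rewrite -xp.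
have [s [ss s1 Hs]] := local_uniqueness gm sxi ii ix ac' ac cl' cp (esym xp).
have [B [e [tm _]]] := exists_tame hm ac cp ltr01; have [e0 bx uB tmB] := tm.
(* The velocity of the lifted curve, of the same Riemannian norm as [w] since both are sent to the
   same ambient vector. *)
pose sg := Dv w s (c' l).
have V0 : 0 <= V.
  by apply: le_trans VV; exact: posdef_bil_ge0 (posdef_gram (induced_riemannian gm ii.1) ac' cl').
have sgV : bil (gmx h c (c p)) sg sg <= V.
  have sj := smooth_mrep ix.1 ac ad cp dp.
  rewrite (gmx_induced _ ix.1 ac ad cp dp) bil_pullback//.
  have E : Dv sg (mrep c d x) (c p) = Dv w (mrep c' d i) (c' l).
    have sj' : smooth_near (mrep c d x) (s (c' l)) by rewrite s1.
    rewrite -s1 -(Dv_comp w ss (smooth_differentiable_mx sj')); apply: Dv_near.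
    by apply: filterS Hs => y [_ E]; rewrite !mrep_def E.
  rewrite E mrepE// xp; apply: le_trans VV.
  rewrite (gmx_induced _ ii.1 ac' ad cl' dl) bil_pullback ?mrepE//; exact: (smooth_mrep ii.1 ac' ad cl' dl).
(* In tame coordinates the velocity has Euclidean length at most [Num.sqrt (4 * V)]; the summand 1
   makes the bound strict, so that it holds for difference quotients close to the derivative. *)
pose k := Num.sqrt (4 * V) + 1.
have k0 : 0 < k by rewrite ltr_wpDl.
have sgk : sqn (sg *m invmx B) < k ^+ 2.
  have /andP[H _] := tmB (c p) (sg *m invmx B) (nbhs_singleton (box_near (c p) e0)).
  rewrite mulmxKV// in H.
  have : sqn (sg *m invmx B) <= 4 * V.
    by move: H; rewrite ler_pdivrMr// => H; apply: (le_trans H); rewrite mulrC ler_wpM2l.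
  move=> H'; apply: (le_lt_trans H'); rewrite -{1}(sqr_sqrtr (_ : 0 <= 4 * V)) ?mulr_ge0//.
  by rewrite ltr_pXn2r ?nnegrE ?sqrtr_ge0// ?ltrDl// ltW.
have cq : {for sg, continuous (fun z : 'rV[R]_n => sqn (z *m invmx B))}.
  apply: smooth_continuous; apply: (smooth_comp1 (f := @sqn R n)); last exact: smooth_sqn.
  by apply: smooth_mulmx; [exact: smooth_id|exact: smooth_cst].
have ds : (fun t : R => t^-1 *: (s (t *: w + c' l) - s (c' l))) @ 0^' --> sg.
  by rewrite /sg DvE; exact: smooth_derivable ss.
have n1 : \forall t \near (0 : R)^', sqn ((t^-1 *: (s (t *: w + c' l) - s (c' l))) *m invmx B) < k ^+ 2.
  have H : \forall z \near sg, sqn (z *m invmx B) < k ^+ 2 := cq _ (lt_nbhsl sgk).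
  exact: ds _ H.
have cline : {for 0, continuous (fun t : R => t *: w + c' l)}.
  apply: smooth_continuous; apply: smoothD; last exact: smooth_cst.
  apply: smooth_scale; last exact: smooth_cst.
  by apply: (@smooth_lin _ R^o R^o (idfun : {linear R^o -> R^o})); move=> ?; exact: cvg_id.
have l0 : (0 : R) *: w + c' l = c' l by rewrite scale0r add0r.
have n2 : \forall t \near (0 : R)^', box (c p) e (s (t *: w + c' l)) /\
    x (chart_inv c (s (t *: w + c' l))) = i (chart_inv c' (t *: w + c' l)).
  apply: nbhs_dnbhs.
  have H : \forall y \near c' l, box (c p) e (s y) /\ x (chart_inv c (s y)) = i (chart_inv c' y).
    have Hb : \forall y \near c' l, box (c p) e (s y).
      have Hb' : \forall z \near s (c' l), box (c p) e z by rewrite s1; exact: box_near.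
      exact: (smooth_continuous ss Hb').
    by apply: filterS2 Hb Hs => y by_ [_ E].
  by rewrite -l0 in H; exact: (cline _ H).
have n3 : \forall t \near (0 : R)^', t != 0 by exact: nbhs_dnbhs_neq.
apply: filterS2 n1 (filterI n2 n3) => t Ht [[bt Et] tn0].
exists (chart_inv c (s (t *: w + c' l))); split => // r Hr.
set u := (s (t *: w + c' l) - s (c' l)) *m invmx B.
have uE : s (t *: w + c' l) = c p + u *m B by rewrite /u mulmxKV// s1 [RHS]addrC subrK.
rewrite uE -{1}(chartK cp); apply: (HC0 ac tm).
- exact: nbhs_singleton (box_near _ e0).
- by rewrite -uE.
apply: le_lt_trans Hr; rewrite -mulrA ler_wpM2l ?(ltW C00)//.
have t20 : 0 < t ^+ 2 by rewrite exprn_even_gt0.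
have : sqn u <= (k * `|t|) ^+ 2.
  move: Ht; rewrite -scalemxAl sqnZ -/u exprVn mulrC ltr_pdivrMr// => /ltW.
  by rewrite exprMn real_normK ?num_real.
have kt : 0 <= k * `|t| by apply: mulr_ge0; [exact: ltW|exact: normr_ge0].
by move=> /ler_wsqrtr; rewrite sqrtr_sqr (ger0_norm kt).
Qed.

Hypothesis complete : complete_metric h.

(** Continuation along the segment from [l1] to [l0]. Consider the supremum of the parameters [t]
    whose point has a preimage under [x] at distance at most [K * t] from [p1]. It is attained
    because balls of the complete manifold are relatively compact, and it is 1 because [lift_step]
    goes beyond any smaller value. *)
Lemma lift_segment c' l1 l0 p1 B e : atlas c' -> tame h' c' (c' l0) B e ->
  box (c' l0) e (c' l1) -> chart_dom c' l1 -> chart_dom c' l0 -> x p1 = i l1 -> exists p, x p = i l0.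
Proof.
move=> ac' tm bl1 cl1 cl0 xp1; have [e0 bx uB tmB] := tm.
pose w := c' l0 - c' l1; pose line (t : R) := t *: w + c' l1; pose gam t := chart_inv c' (line t).
have line1 : line 1 = c' l0 by rewrite /line scale1r subrK.
have bline (t : R) : 0 <= t <= 1 -> box (c' l0) e (line t).
  move=> t01; rewrite /line addrC; apply: box_convex => //.
  by rewrite /w addrC subrK; exact: nbhs_singleton (box_near _ e0).
have gamP (t : R) : 0 <= t <= 1 -> chart_dom c' (gam t) /\ c' (gam t) = line t.
  by move=> /bline/bx.
pose V := 4 * sqn (w *m invmx B).
have VB (t : R) : 0 <= t <= 1 -> bil (gmx h' c' (c' (gam t))) w w <= V.
  move=> t01; have [_ ->] := gamP t t01.
  by have /andP[_] := tmB _ (w *m invmx B) (bline t t01); rewrite mulmxKV.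
pose K := C0 * (Num.sqrt (4 * V) + 1).
have K0 : 0 < K by rewrite mulr_gt0// ltr_wpDl.
pose good (t : R) := exists p, x p = i (gam t) /\ forall r, K * t < r -> dlt h p1 p r.
pose E : set R := [set t | 0 <= t <= 1 /\ good t].
have E0 : E 0.
  split; first by rewrite lexx ler01.
  exists p1; split; first by rewrite /gam /line scale0r add0r chartK.
  by move=> r; rewrite mulr0 => r0; exact: dlt_refl.
have ubE : ubound E 1 by move=> t [/andP[]].
have hsE : has_sup E by split; [exists 0|exists 1].
pose tau := sup E.
have tau01 : 0 <= tau <= 1.
  by rewrite (ub_le_sup hsE.2 E0) ge_sup//; exists 0.
have Etau : E tau.
  split=> //.
  have Hk (k : nat) : exists tp : R * M, [/\ E tp.1, tau - k.+1%:R^-1 < tp.1, x tp.2 = i (gam tp.1) &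
      forall r, K * tp.1 < r -> dlt h p1 tp.2 r].
    have k0 : 0 < k.+1%:R^-1 :> R by rewrite invr_gt0 ltr0n.
    have [t Et tt] := sup_adherent k0 hsE; have [_ [p [xp dp]]] := Et.
    by exists (t, p).
  have [tp Htp] := @choice _ _ (fun (k : nat) (tp : R * M) => [/\ E tp.1, tau - k.+1%:R^-1 < tp.1, x tp.2 = i (gam tp.1) &
      forall r, K * tp.1 < r -> dlt h p1 tp.2 r]) Hk.
  have tpt k : (tp k).1 <= tau by have [Ek _ _ _] := Htp k; exact: (ub_le_sup hsE.2 Ek).
  have [Kc cK HK] := ball_bounded hm complete p1 (K * tau + 1).
  have inK k : Kc (tp k).2.
    apply: HK; have [_ _ _] := Htp k; apply.
    by apply: (@le_lt_trans _ _ (K * tau)); [rewrite ler_wpM2l// ltW|rewrite ltrDl].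
  have PF : ProperFilter ((fun k => (tp k).2) @ \oo) by exact: fmap_proper_filter.
  (* A cluster point of nearly optimal lifts. Its image is the point of the segment at parameter
     [tau], since the ambient manifold is Hausdorff. *)
  have [p [_ clp]] := cK _ PF (nearW _ inK : \forall k \near \oo, Kc (tp k).2).
  have freq (B' : set M) (k0 : nat) : nbhs p B' -> exists2 k, (k0 <= k)%N & B' (tp k).2.
    move=> nB; have [_ [[k k0k ->] Bk]] : [set q | exists2 k, (k0 <= k)%N & q = (tp k).2] `&` B' !=set0.
      by apply: clp => //; exists k0 => // k k0k; exists k.
    by exists k.
  exists p; split.
    apply: contrapT => /eqP xn.
    have := @manifold_hausdorff _ _ Mt; rewrite open_hausdorff => /(_ _ _ xn)[[A1 B1]] /= [].
    rewrite !inE => Ap Bp [oA oB AB].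
    have nA : \forall q \near p, A1 (x q) by apply: ix.1.1.1; exact: open_nbhs_nbhs.
    have [clt cltE] := gamP tau tau01.
    have cg : {for tau, continuous (fun t => i (gam t))}.
      apply: (@continuous_comp _ _ _ gam i); last exact: ii.1.1.1.
      apply: (@continuous_comp _ _ _ line (chart_inv c')); last by rewrite -cltE; exact: chart_inv_continuous.
      apply: smooth_continuous; apply: smoothD; last exact: smooth_cst.
      apply: smooth_scale; last exact: smooth_cst.
      by apply: (@smooth_lin _ R^o R^o (idfun : {linear R^o -> R^o})); move=> ?; exact: cvg_id.
    have nB : \forall t \near tau, B1 (i (gam t)) by apply: cg; exact: open_nbhs_nbhs.
    have /nbhs_ballP[eps /= eps0 Heps] := nB.
    have [k0 _ Hk0] := nbhs_infty_ger eps^-1.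
    have [k k0k Ak] := freq _ k0 nA; have [_ tk xk _] := Htp k.
    have Bk : B1 (i (gam (tp k).1)).
      apply: Heps; rewrite /ball /= ger0_norm ?subr_ge0 ?tpt//.
      have : k.+1%:R^-1 < eps.
        rewrite -[eps]invrK ltf_pV2 ?posrE ?invr_gt0 ?ltr0n//.
        by apply: (le_lt_trans (Hk0 k k0k)); rewrite ltr_nat.
      by move: tk; move: (k.+1%:R^-1) (tp k).1 => a b; lra.
    suff : (A1 `&` B1) (x (tp k).2) by rewrite AB.
    by split => //; rewrite xk.
  move=> r Kr; pose eps := (r - K * tau) / 2.
  have eps0 : 0 < eps by rewrite divr_gt0// subr_gt0.
  have [k _ dk] := freq _ 0%N (near_dlt_sym hm p eps0).
  have [_ _ _ Hd] := Htp k.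
  have d1 : dlt h p1 (tp k).2 (K * tau + eps).
    apply: Hd; apply: (@le_lt_trans _ _ (K * tau)); last by rewrite ltrDl.
    by rewrite ler_wpM2l ?tpt// ltW.
  have -> : r = (K * tau + eps) + eps by rewrite /eps; field.
  exact: (dlt_trans hm d1 dk).
have tau1 : tau = 1.
  apply/eqP; rewrite eq_le; case/andP: (tau01) => t0 -> /=; rewrite leNgt; apply/negP => t1.
  have [_ [p [xp dp]]] := Etau.
  have [clt cltE] := gamP tau tau01.
  have := lift_step ac' clt xp (VB tau tau01); rewrite -/K => /nbhs_ballP[dl /= dl0 Hdl].
  pose s := Num.min (dl / 2) (1 - tau).
  have s0 : 0 < s by rewrite lt_min divr_gt0// subr_gt0.
  have [||p' [xp' dp']] := Hdl s.
  - rewrite /ball /= sub0r normrN gtr0_norm//.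
    apply: (@le_lt_trans _ _ (dl / 2)); first by rewrite ge_min lexx.
    by rewrite ltr_pdivrMr// ltr_pMr// ltr1n.
  - by rewrite gt_eqF.
  have s1 : s <= 1 - tau by rewrite ge_min lexx orbT.
  have : E (tau + s).
    split; first by apply/andP; split; move: t0 s0 s1; lra.
    exists p'; split.
      by rewrite xp' cltE /gam /line scalerDl addrA [s *: w + _]addrC.
    move=> r Hr; pose eps := (r - K * (tau + s)) / 2.
    have eps0 : 0 < eps by rewrite divr_gt0// subr_gt0.
    have -> : r = (K * tau + eps) + (K * s + eps) by rewrite /eps; field.
    apply: (dlt_trans hm (q := p)); first by apply: dp; rewrite ltrDl.
    by apply: dp'; rewrite gtr0_norm// ltrDl.
  by move=> /(ub_le_sup hsE.2); rewrite -/tau gerDl leNgt s0.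
have [_ [p [xp _]]] := Etau; exists p.
by rewrite xp tau1 /gam line1 chartK.
Qed.

End SegmentLifting.

Section Maximality.
Context {R : realType} {n : nat} {Mt : manifold R n.+1}.
Variables (g : Mt -> 'M[R]_n.+1) (gm : riemannian_metric g).
Variables (xi : Mt -> 'rV[R]_n.+1) (sxi : smooth_field xi).
Variables (M : manifold R n) (x : M -> Mt) (ix : integral_immersion g xi x).
Hypotheses (complete : complete_metric (induced_metric g x)) (Mconn : connected [set: M]).

(** The part of [L] covered by [x] is open by local uniqueness and closed by lifting short segments;
    it is nonempty and [L] is connected. *)
Lemma complete_range_max (L : manifold R n) (i : L -> Mt) : integral_immersion g xi i ->
  connected [set: L] -> range x `<=` range i -> range i `<=` range x.
Proof.
move=> ii Lconn sub.
have hm := induced_riemannian gm ix.1; have hm' := induced_riemannian gm ii.1.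
have [C0 C00 HC0] := segment_dlt hm.
pose A : set L := [set l | exists p, x p = i l].
have oA : open A.
  rewrite openE => l [p xp]; rewrite /interior.
  have cl := chart_at_dom l; have cp := chart_at_dom p.
  have [s [_ _ Hs]] := local_uniqueness gm sxi ii ix (chart_at_atlas l) (chart_at_atlas p) cl cp (esym xp).
  apply: (near_chart_inv cl); apply: filterS Hs => y [_ E].
  by exists (chart_inv (chart_at p) (s y)).
have cA : closed A.
  move=> l0 clA; pose c := chart_at l0.
  have ac : atlas c := chart_at_atlas l0; have cl0 : chart_dom c l0 := chart_at_dom l0.
  have [B [e [tm _]]] := exists_tame hm' ac cl0 ltr01; have [e0 _ _ _] := tm.
  have nb : \forall l \near l0, chart_dom c l /\ box (c l0) e (c l).
    by apply: filterS2 (chart_near cl0) (chart_near_inv cl0 (box_near (c l0) e0)) => l.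
  have [l1 [[p1 xp1] [cl1 bl1]]] := clA _ nb.
  exact: (lift_segment gm sxi ix ii C00 HC0 complete ac tm bl1 cl1 cl0 xp1).
have AT : A = [set: L].
  apply: Lconn; last 2 first.
  - by exists A => //; rewrite setTI.
  - by exists A => //; rewrite setTI.
  have [l _ il] := sub (x point) (ex_intro2 _ _ point I erefl).
  by exists l, point.
move=> _ [l _ <-]; have [p xp] : A l by rewrite AT.
by exists p.
Qed.

Theorem complete_range_leaf : leaf_orth g xi (range x).
Proof.
split; first exact: (exists_leaf_manifold gm sxi ix Mconn).
move=> S' [L [i [Lconn iim _ iS ti]]] sub; apply/seteqP; split => //.
rewrite -iS in sub *; exact: (complete_range_max (conj iim ti) Lconn sub).
Qed.

End Maximality.

Theorem theorem5p2 (R : realType) (n : nat) (n_ge2 : (2 <= n)%N)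
    (Mt : manifold R n.+1) (g : Mt -> 'M[R]_n.+1) (oMt : Mt -> bool)
    (xi eta : Mt -> 'rV[R]_n.+1)
    (M : manifold R n) (oM : M -> bool) (x : M -> Mt) (N : M -> 'rV[R]_n.+1)
    (mu : {measure set (borel M) -> \bar R})
    (g_metric : riemannian_metric g)
    (Mt_oriented : orientation oMt)
    (Mt_ricci : ricci_nonneg g)
    (xi_parallel : parallel g xi)
    (eta_homothetic : homothetic g eta)
    (eta_nonparallel : ~ parallel g eta)
    (M_connected : connected [set: M])
    (x_immersion : immersion x)
    (M_complete : complete_metric (induced_metric g x))
    (M_oriented : orientation oM)
    (x_transversal : transversal_to x xi)
    (N_normal : unit_normal g x N)
    (mu_volume : riemannian_volume (induced_metric g x) mu)
    (A_bounded : exists C : R, forall p, shape_norm g x N p <= C)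
    (xi_integrable : mu.-integrable setT (fun p : borel M =>
       (riem_norm (induced_metric g x) p (tangent_part g x p (xi (x p))))%:E))
    (H_sign : (forall p, 0 <= mean_curvature g x N p) \/
              (forall p, mean_curvature g x N p <= 0)) :
  (totally_geodesic g x N /\ forall p, ricci g (x p) (N p) (N p) = 0) /\
  (~ compact [set: M] -> ricci_nonneg (induced_metric g x) ->
     exists2 S : set Mt, leaf_orth g xi S & range x `<=` S).
Proof.
have n0 : (0 < n)%N by exact: ltnW.
have tr0 := minimal_of_sign n0 g_metric x_immersion N_normal xi_parallel x_transversal mu_volume
  M_complete M_connected xi_integrable H_sign.
have [geo ric] := geodesic_of_minimal g_metric x_immersion N_normal xi_parallel x_transversal mu_volume
  M_complete M_connected xi_integrable tr0 A_bounded Mt_ricci.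
split; first exact: conj geo ric.
have xiT0 := tangential_eq0 g_metric x_immersion N_normal geo mu_volume M_complete M_connected n_ge2
  xi_parallel eta_homothetic eta_nonparallel xi_integrable.
have ix : integral_immersion g xi x.
  split; first exact: x_immersion.
  (* Transversality tested on the zero vector says that [xi] does not vanish along [x]. *)
  move=> p; split; first by have := x_transversal p 0; rewrite /dmap mul0mx eq_sym.
  move=> v; rewrite -(tangent_part_inner g_metric x_immersion) -[tangent_part _ _ _ _]/(tangential g x xi p).
  by rewrite xiT0 /inner !mul0mx mxE.
have [sxi _ _] := xi_parallel.
have leaf := complete_range_leaf g_metric sxi ix M_complete M_connected.
by move=> _ _; exists (range x).
Qed.
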